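(* Let $d \ge 2$, $B_1 = (-b_1,b_1)^{2d}$, $B_0 = [-b_0,b_0]^{2d} \subset B_1$, let $\Phi,\rho : B_1 \to \mathbb{R}$ be smooth, let $a$ be smooth with compact support in $B_0$, let $\lambda\in\mathbb{R}$, and assume the bounds $$\max_{|\alpha|\le 2d+3}\sup_{B_1}|\partial^\alpha\rho|\le C_\rho,\quad \max_{|\alpha|\le 2d+2}\sup_{B_1}|\partial^\alpha\Phi|\le C_\Phi,\quad \max_{|\alpha|\le 2d+2}\sup_{B_0}|\partial^\alpha a|\le C_a,$$ $$(C_\rho')^{-1}\le \min_{i=1,\ldots,2d}\inf_{B_1}|\partial_i\rho|,\qquad |\lambda|^{-1/2}\le\min\{b_1-b_0,1\}.$$ Suppose that there is a positive constant $c$ such that for every $x \in B_1$ and every $(\tilde\tau,\tau)\in\mathbb{R}^2$ with $\tilde\tau^2+\tau^2=1$, the indices $\{1,\ldots,2d\}$ may be partitioned into two sets $\{i_1,\ldots,i_d\}$ and $\{j_1,\ldots,j_d\}$ (the partition may depend on $x$ and $(\tilde\tau,\tau)$) such that $$\left|\det\begin{bmatrix} \partial_{i_1}\rho(x) & \partial^2_{i_1j_1}(\tilde\tau\Phi(x)+\tau\rho(x)) & \cdots & \partial^2_{i_1j_d}(\tilde\tau\Phi(x)+\tau\rho(x))\\ \vdots&\vdots&\ddots&\vdots\\ \partial_{i_d}\rho(x) & \partial^2_{i_dj_1}(\tilde\tau\Phi(x)+\tau\rho(x)) & \cdots & \partial^2_{i_dj_d}(\tilde\tau\Phi(x)+\tau\rho(x))\\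 0 & \partial_{j_1}\rho(x) & \cdots & \partial_{j_d}\rho(x) \end{bmatrix}\right|\ge c.$$ Then there is a constant $C$ depending only on $d, C_\rho, C_\rho', C_\Phi, C_a$ and $c$ such that for all $f_1,\ldots,f_{2d}\in L^2(\mathbb{R})$, $$|I_\lambda(f_1,\ldots,f_{2d})|\le C\,|\lambda|^{-\frac{d-1}{2}}\prod_{j=1}^{2d}\|f_j\|_{L^2(\mathbb{R})}.$$
   Context: $M := \{x\in B_1 : \rho(x)=0\}$, a smooth hypersurface since $\nabla\rho$ is nonvanishing, and $d\sigma$ is Lebesgue (surface) measure on $M$. The multilinear functional is $$I_\lambda(f_1,\ldots,f_{2d}) = \int_M e^{i\lambda\Phi(x)}\Big[\prod_{j=1}^{2d} f_j(x_j)\Big]a(x)\,d\sigma(x).$$ $\partial_i$ and $\partial^2_{ij}$ denote the first and second partial derivatives with respect to the standard coordinates $x_1,\ldots,x_{2d}$ on $\mathbb{R}^{2d}$. The parameters $b_0, b_1$ are positive with $b_0<b_1$, and $C_\rho, C'_\rho, C_\Phi, C_a$ are finite positive constants. *)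

(* Defs.v *)
From HB Require Import structures.
From mathcomp Require Import all_boot all_order all_algebra.
From mathcomp Require Import all_classical all_reals all_analysis.
From mathcomp Require Export complex.

Set Implicit Arguments.
Unset Strict Implicit.
Unset Printing Implicit Defensive.
Import Order.TTheory GRing.Theory Num.Theory.
Import numFieldNormedType.Exports.

Local Open Scope classical_set_scope.
Local Open Scope ring_scope.
Local Open Scope complex_scope.

(* R^n is 'rV[R]_n with the sigma-algebra generated by the coordinates, that
   is, the Borel sigma-algebra. *)
Section measurable_rV.
Variables (R : realType) (n : nat).

Let coords (i : 'I_n) (x : 'rV[R]_n) : measurableTypeR R := x 0 i.

Let rV_set0 : g_sigma_preimage coords set0.
Proof. exact: sigma_algebra0. Qed.

Let rV_setC A : g_sigma_preimage coords A -> g_sigma_preimage coords (~` A).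
Proof. exact: sigma_algebraC. Qed.

Let rV_bigcup (F : (set 'rV[R]_n)^nat) :
  (forall i, g_sigma_preimage coords (F i)) ->
  g_sigma_preimage coords (\bigcup_i F i).
Proof. exact: sigma_algebra_bigcup. Qed.

HB.instance Definition _ :=
  @isMeasurable.Build default_measure_display
    'rV[R]_n (g_sigma_preimage coords) rV_set0 rV_setC rV_bigcup.

Lemma measurable_coord (i : 'I_n) :
  measurable_fun [set: 'rV[R]_n] (fun x => x 0 i : measurableTypeR R).
Proof.
move=> _ Y mY; rewrite setTI; apply: sub_sigma_algebra => /=.
rewrite -bigcup_seq/=; exists i => /=; first by rewrite mem_index_enum.
by exists Y => //; rewrite setTI.
Qed.

Lemma measurable_fun_coordP d (T : measurableType d) (f : T -> 'rV[R]_n) :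
  (forall i, measurable_fun [set: T] (fun t => f t 0 i : measurableTypeR R)) ->
  measurable_fun [set: T] f.
Proof.
move=> mf _ A mA; rewrite setTI; move: A mA.
suff : @measurable _ 'rV[R]_n `<=` [set A | measurable (f @^-1` A)] by [].
apply: smallest_sub.
  split => /=; first by rewrite preimage_set0.
  - by move=> A mA; rewrite setTD preimage_setC; exact: measurableC.
  - by move=> F mF; rewrite preimage_bigcup; exact: bigcup_measurable.
rewrite -bigcup_seq/=; apply: bigcup_sub => i _ A [B mB <-] /=.
by rewrite setTI -comp_preimage -[X in measurable X]setTI; exact: mf.
Qed.

End measurable_rV.

Section lebesgue_rV.
Variable R : realType.

Definition rV_cons n (p : measurableTypeR R * 'rV[R]_n) : 'rV[R]_n.+1 :=
  row_mx (p.1%:M : 'rV[R]_1) p.2.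

Lemma rV_consE n (p : measurableTypeR R * 'rV[R]_n) (i : 'I_n.+1) :
  rV_cons p 0 i = if unlift ord0 i is Some j then p.2 0 j else p.1.
Proof.
rewrite /rV_cons mxE; case: splitP => [j ij|j ij].
  rewrite ord1 mxE eqxx mulr1n; case: unliftP => // k ik.
  by move: ij; rewrite ik ord1.
have -> : i = lift ord0 j by apply: val_inj.
by rewrite liftK.
Qed.

Lemma measurable_rV_cons n : measurable_fun setT (@rV_cons n).
Proof.
apply: measurable_fun_coordP => i.
case: (unliftP ord0 i) => [j|] ->.
- rewrite [X in measurable_fun _ X](_ : _ =
    (fun x : 'rV[R]_n => x 0 j : measurableTypeR R) \o snd).
    exact: (measurableT_comp (measurable_coord j)).
  by apply/funext => p /=; rewrite rV_consE liftK.
- rewrite [X in measurable_fun _ X](_ : _ = fst); first exact: measurable_fst.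
  by apply/funext => p /=; rewrite rV_consE unlift_none.
Qed.

Definition rV_uncons n (x : 'rV[R]_n.+1) : measurableTypeR R * 'rV[R]_n :=
  (x 0 ord0, \row_j x 0 (lift ord0 j)).

Lemma rV_consK n : cancel (@rV_cons n) (@rV_uncons n).
Proof.
move=> [t y]; rewrite /rV_uncons rV_consE unlift_none/=; congr pair.
by apply/rowP => j; rewrite mxE rV_consE liftK.
Qed.

Lemma measurable_rV_uncons n : measurable_fun setT (@rV_uncons n).
Proof.
apply/measurable_fun_pairP; split; first exact: (measurable_coord ord0).
apply: measurable_fun_coordP => j.
rewrite [X in measurable_fun _ X](_ : _ = fun x : 'rV[R]_n.+1 =>
  x 0 (lift ord0 j) : measurableTypeR R); first exact: measurable_coord.
by apply/funext => x; rewrite /= mxE.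
Qed.

Section step.
Variables (n : nat) (mu : {sigma_finite_measure set 'rV[R]_n -> \bar R}).

Definition lebesgue_rV_step : set 'rV[R]_n.+1 -> \bar R :=
  pushforward (lebesgue_measure \x mu)%E (@rV_cons n).

Let step0 : lebesgue_rV_step set0 = 0%E.
Proof. by rewrite /lebesgue_rV_step /pushforward preimage_set0 measure0. Qed.

Let step_ge0 A : (0 <= lebesgue_rV_step A)%E.
Proof. by rewrite /lebesgue_rV_step /pushforward; exact: measure_ge0. Qed.

Let step_sigma_additive : semi_sigma_additive lebesgue_rV_step.
Proof.
have mc := @measurable_rV_cons n.
move=> F mF tF mUF; rewrite /lebesgue_rV_step /pushforward preimage_bigcup.
apply: measure_semi_sigma_additive.
- by move=> k; rewrite -[X in measurable X]setTI; exact: mc.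
- apply/trivIsetP => /= i j _ _ ij; rewrite -preimage_setI.
  by move/trivIsetP : tF => /(_ _ _ _ _ ij) ->//; rewrite preimage_set0.
- by rewrite -preimage_bigcup -[X in measurable X]setTI; exact: mc.
Qed.

HB.instance Definition _ := isMeasure.Build _ _ _
  lebesgue_rV_step step0 step_ge0 step_sigma_additive.

Let step_sigma_finite : sigma_finite setT lebesgue_rV_step.
Proof.
have /sigma_finiteP[F [TF ndF Foo]] := sigma_finiteT (@lebesgue_measure R).
have /sigma_finiteP[G [TG ndG Goo]] := sigma_finiteT mu.
exists (fun k => @rV_uncons n @^-1` (F k `*` G k)).
  rewrite -preimage_bigcup -[LHS](@preimage_setT _ _ (@rV_uncons n)).
  congr (_ @^-1` _); rewrite -setXTT TF TG predeqE => -[x y]; split.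
    move=> [/= [j _ Fjx] [k _ Gky]]; exists (maxn j k) => //; split.
    - by move: x Fjx; exact/subsetPset/ndF/leq_maxl.
    - by move: y Gky; exact/subsetPset/ndG/leq_maxr.
  by move=> [k _ []/= ? ?]; split; exists k.
move=> k; have [? ?] := Foo k; have [? ?] := Goo k; split.
  rewrite -[X in measurable X]setTI; apply: measurable_rV_uncons => //.
  exact: measurableX.
rewrite /lebesgue_rV_step /pushforward -comp_preimage.
rewrite (_ : _ \o _ = id); last by apply/funext; exact: rV_consK.
by rewrite preimage_id product_measure1E// lte_mul_pinfty// ge0_fin_numE.
Qed.

HB.instance Definition _ := @Measure_isSigmaFinite.Build _ _ _
  lebesgue_rV_step step_sigma_finite.

End step.

(* n-dimensional Lebesgue measure, as an iterated product measure. *)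
Fixpoint lebesgue_rV n : {sigma_finite_measure set 'rV[R]_n -> \bar R} :=
  if n is m.+1 then lebesgue_rV_step (lebesgue_rV m) else dirac (0 : 'rV[R]_0).

End lebesgue_rV.

Section calculus.
Variables (R : realType) (n : nat).
Implicit Types (U : set 'rV[R]_n) (f : 'rV[R]_n -> R) (x : 'rV[R]_n).

Definition partial (i : 'I_n) f : 'rV[R]_n -> R :=
  fun x => 'D_(delta_mx 0 i) f x.

Definition partials (s : seq 'I_n) f := foldr partial f s.

(* For open U: on U all iterated partial derivatives of f of order at most k
   exist and are continuous. Values of f outside U are irrelevant. *)
Definition Ck_on (k : nat) U f := forall s x, (size s <= k)%N -> U x ->
  {for x, continuous (partials s f)} /\
  ((size s < k)%N -> forall i, derivable (partials s f) x (delta_mx 0 i)).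

Definition smooth_on U f := forall k, Ck_on k U f.

Definition mpartial (alpha : 'I_n -> nat) f :=
  foldr (fun i g => iter (alpha i) (partial i) g) f (enum 'I_n).

Definition morder (alpha : 'I_n -> nat) := (\sum_(i < n) alpha i)%N.

Definition derivs_bounded_on (k : nat) U f (C : R) :=
  forall (alpha : 'I_n -> nat) x, (morder alpha <= k)%N -> U x ->
    `|mpartial alpha f x| <= C.

Definition open_cube (b : R) : set 'rV[R]_n :=
  [set x | forall i, `|x 0 i| < b].

Definition closed_cube (b : R) : set 'rV[R]_n :=
  [set x | forall i, `|x 0 i| <= b].

Definition smooth_onC U (f : 'rV[R]_n -> R[i]) :=
  smooth_on U (fun x => complex.Re (f x)) /\
  smooth_on U (fun x => complex.Im (f x)).

Definition derivs_bounded_onC (k : nat) U (f : 'rV[R]_n -> R[i]) (C : R) :=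
  forall (alpha : 'I_n -> nat) x, (morder alpha <= k)%N -> U x ->
    Normc.normc (mpartial alpha (fun y => complex.Re (f y)) x +i*
                 mpartial alpha (fun y => complex.Im (f y)) x) <= C.

Definition supp (f : 'rV[R]_n -> R[i]) : set 'rV[R]_n :=
  closure [set x | f x != 0].

End calculus.

Section surface.
Variables (R : realType) (n : nat).

(* The graph over E of g, giving the coordinate x_i as a function of the
   remaining n - 1 coordinates. *)
Definition graph_over (i : 'I_n) (E : set 'rV[R]_n.-1) (g : 'rV[R]_n.-1 -> R) :
    set 'rV[R]_n :=
  [set x | E (col' i x) /\ x 0 i = g (col' i x)].

(* sigma is the Lebesgue (surface) measure of the embedded hypersurface M: it is
   carried by M and, on every piece of M that is the graph of a C^1 function g
   over an open set of one of the coordinate hyperplanes, it is given by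
   d(sigma) = (1 + |grad g|^2)^(1/2) dy. As M is covered by countably many
   such pieces, this determines sigma. *)
Definition is_surface_measure (M : set 'rV[R]_n)
    (sigma : {measure set 'rV[R]_n -> \bar R}) :=
  sigma (~` M) = 0%E /\
  forall (i : 'I_n) (U : set 'rV[R]_n.-1) (g : 'rV[R]_n.-1 -> R),
    open U -> Ck_on 1 U g -> graph_over i U g `<=` M ->
  forall E : set 'rV[R]_n.-1, measurable E -> E `<=` U ->
    sigma (graph_over i E g) =
    (\int[lebesgue_rV R n.-1]_(y in E)
       (Num.sqrt (1 + \sum_(k < n.-1) partial k g y ^+ 2))%:E)%E.

Definition Cintegral (sigma : {measure set 'rV[R]_n -> \bar R})
    (D : set 'rV[R]_n) (F : 'rV[R]_n -> R[i]) : R[i] :=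
  (\int[sigma]_(x in D) complex.Re (F x)) +i*
  (\int[sigma]_(x in D) complex.Im (F x)).

Definition expi (t : R) : R[i] := cos t +i* sin t.

Definition zero_locus (U : set 'rV[R]_n) (rho : 'rV[R]_n -> R) :
  set 'rV[R]_n := [set x | U x /\ rho x = 0].

Definition multilinear_form (sigma : {measure set 'rV[R]_n -> \bar R})
    (M : set 'rV[R]_n) (lambda : R) (Phi : 'rV[R]_n -> R) (a : 'rV[R]_n -> R[i])
    (f : 'I_n -> R -> R[i]) : R[i] :=
  Cintegral sigma M (fun x =>
    expi (lambda * Phi x) * (\prod_(j < n) f j (x 0 j)) * a x).

End surface.

Section L2.
Variable R : realType.

Definition L2norm (f : R -> R[i]) : \bar R :=
  Lnorm (@lebesgue_measure R) 2%:E (fun t => (Normc.normc (f t))%:E).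

Definition in_L2 (f : R -> R[i]) :=
  [/\ measurable_fun [set: R] (fun t => complex.Re (f t)),
      measurable_fun [set: R] (fun t => complex.Im (f t)) &
      (L2norm f < +oo)%E].

End L2.

Section determinant.
Variables (R : realType) (d n : nat).

Definition is_bipartition (i j : 'I_d -> 'I_n) :=
  [/\ injective i, injective j &
      [set k | k \in codom i] = ~: [set k | k \in codom j]]%SET.

(* Rows 0, ..., d-1 carry the indices i and the last row is the border; the
   border column is column 0 and columns 1, ..., d carry the indices j. *)
Definition bordered_hessian (rho psi : 'rV[R]_n -> R) (i j : 'I_d -> 'I_n)
    (x : 'rV[R]_n) : 'M[R]_d.+1 :=
  \matrix_(r, s)
    match unlift ord_max r, unlift ord0 s with
    | Some k, Some l => partial (i k) (partial (j l) psi) x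
    | Some k, None => partial (i k) rho x
    | None, Some l => partial (j l) rho x
    | None, None => 0
    end.

End determinant.

(* Main.v *)
(* The surface measure, weighted by |grad rho|, is the limit as M tends to
   infinity of (1/2 pi) 2M/(1 + (M rho)^2) dx, and 2M/(1 + (M rho)^2) is the
   integral over t of exp(-|t|/M) cos(t rho). The form thereby becomes an
   integral over x and t with the phase lambda Phi + t rho. Cut the t-axis into
   pieces of length comparable to a small multiple of mu = |lambda| + |t0| about
   t0; their scales grow geometrically. On one piece, after localizing x, a
   single partition of the coordinates into x' and x'' has a determinant bounded
   below. Squaring out the form over x'' (TT* ) leaves a kernel in two copies
   x', y' and two copies of t; the determinant says that the gradient in
   (x'', t) of the difference of the two phases is at least comparable to
   mu |x' - y'| + |s|, where s is the difference of the t's. Integrating by parts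
   and applying Schur's test gives mu^(-(d-1)/2) for the piece, and these bounds
   sum to |lambda|^(-(d-1)/2). *)
From HB Require Import structures.
From mathcomp Require Import all_boot all_order all_algebra.
From mathcomp Require Import all_classical all_reals all_analysis.
From mathcomp Require Import measurable_realfun complex perm ring lra.
Require Import Defs.

Set Implicit Arguments.
Unset Strict Implicit.
Unset Printing Implicit Defensive.
Import Order.TTheory GRing.Theory Num.Theory.
Import numFieldNormedType.Exports.
Local Open Scope classical_set_scope.
Local Open Scope ring_scope.

(** The determinant condition is homogeneous in (lambda, t). A partition good at (lambda, t0) stays
    good, with a smaller bound, when t moves by a small multiple of mu and x by a fixed amount; this
    fixes the sizes of pieces and boxes. The kernel of a piece is at most a multiple of mu (1 +
    W)^(-2d), with W = mu |x' - y'| + |s| and mu the length of the piece; integration over s and the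
    d coordinates of x' leaves mu^(1-d) for the square of the norm. The order 2d is taken because (1
    + W)^(-2d) is at most a product of d + 1 factors with the integrable exponent 4/3, which
    requires d >= 2.

    Some bounds depend on the f_j, but only in errors of order 1/M that vanish in the limit; one
    comes from the kink of exp(-|t|/M) at 0, because of which the central piece is taken without
    this factor. The f_j are only in L^2: they are cut to bounded functions, for which Fubini is
    free, and the limit in M is taken on coordinate lines with one f_j continuous; an L^1
    approximation then removes the continuity. The size of the cube does not enter the constant,
    since the bounds on rho and its first derivatives bound b1. *)

(** * Functions of one variable with derivative bounds at a given scale *)

Section one_variable.
Variable R : realType.
Implicit Types (l K c t : R) (D : set R) (F G A p : R -> R).
Local Notation leb := (@lebesgue_measure R).

(* [Cb l k K D F]: F is C^k on D with |F^(m)| <= K / l^m for m <= k. *)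
Fixpoint Cb l k K D F : Prop :=
  (forall t, D t -> `|F t| <= K) /\
  if k is k'.+1 then
    exists2 F', (forall t, D t -> is_derive t 1 F (F' t)) & Cb l k' (K / l) D F'
  else forall t, D t -> {for t, continuous F}.

Lemma Cb_bound l k K D F : Cb l k K D F -> forall t, D t -> `|F t| <= K.
Proof. by case: k => [|k] []. Qed.

Lemma is_derive_cont F t (dF : R) : is_derive t 1 F dF -> {for t, continuous F}.
Proof. by case=> dF1 _; apply/differentiable_continuous/derivable1_diffP. Qed.

Lemma Cb_cont l k K D F : Cb l k K D F -> forall t, D t -> {for t, continuous F}.
Proof.
case: k => [|k] []; first by [].
by move=> _ [F' dF _] t Dt; exact: is_derive_cont (dF t Dt).
Qed.

Lemma Cb_le l k K K' D F : 0 < l -> K <= K' -> Cb l k K D F -> Cb l k K' D F.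
Proof.
move=> l0; elim: k K K' F => [|k IH] K K' F KK' [bF cF]; split.
- by move=> t Dt; exact: le_trans (bF _ Dt) KK'.
- by [].
- by move=> t Dt; exact: le_trans (bF _ Dt) KK'.
- by case: cF => F' dF cF; exists F' => //; apply: IH cF; rewrite ler_pM2r ?invr_gt0.
Qed.

Lemma Cb_sub l k K D D' F : D' `<=` D -> Cb l k K D F -> Cb l k K D' F.
Proof.
move=> DD; elim: k K F => [|k IH] K F [bF cF]; split; try by move=> t /DD; auto.
by case: cF => F' dF cF; exists F' => [t /DD|]; [exact: dF|exact: IH].
Qed.

Lemma Cb_pred l k K D F : Cb l k.+1 K D F -> Cb l k K D F.
Proof.
elim: k K F => [|k IH] K F [bF [F' dF cF]]; split => //.
  by move=> t Dt; exact: is_derive_cont (dF t Dt).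
by exists F' => //; exact: IH.
Qed.

Lemma is_derive_ext F G t (dF : R) :
  (\near t, F t = G t) -> is_derive t 1 F dF -> is_derive t 1 G dF.
Proof. by move=> FG; apply: near_eq_is_derive; near=> x; rewrite (near FG x). Unshelve. all: end_near. Qed.

Lemma Cb_ext l k K D F G : open D -> (forall t, D t -> F t = G t) ->
  Cb l k K D F -> Cb l k K D G.
Proof.
move=> oD FG; have nFG t : D t -> \forall x \near t, F x = G x.
  by move=> Dt; near=> x; apply: FG; near: x; exact: open_nbhs_nbhs.
elim: k K => [|k IH] K [bF cF]; (split; first by move=> t Dt; rewrite -FG// bF).
- move=> t Dt; rewrite /prop_for /continuous_at -FG//.
  by apply: cvg_trans (cF _ Dt); apply: near_eq_cvg; near=> x; rewrite (near (nFG _ Dt) x).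
- case: cF => F' dF cF; exists F' => // t Dt.
  exact: is_derive_ext (nFG _ Dt) (dF t Dt).
Unshelve. all: end_near. Qed.

Lemma Cb_cst l k K D (x : R) : 0 < l -> `|x| <= K -> Cb l k K D (fun=> x).
Proof.
move=> l0; elim: k K x => [|k IH] K x xK; (split; first by []).
  by move=> t _; exact: cst_continuous.
exists (fun=> 0) => [t _|]; first exact: is_derive_cst.
by apply: IH; rewrite normr0 divr_ge0// ?(ltW l0)// (le_trans _ xK).
Qed.

Lemma CbD l k K K' D F G : Cb l k K D F -> Cb l k K' D G ->
  Cb l k (K + K') D (fun t => F t + G t).
Proof.
elim: k K K' F G => [|k IH] K K' F G [bF cF] [bG cG]; split.
1,3: by move=> t Dt; rewrite (le_trans (ler_normD _ _))// lerD ?bF ?bG.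
  by move=> t Dt; apply: continuousD; [exact: cF|exact: cG].
case: cF => F' dF cF; case: cG => G' dG cG.
exists (fun t => F' t + G' t); first by move=> t Dt; apply: is_deriveD; auto.
by rewrite mulrDl; exact: IH.
Qed.

(** Each order of Leibniz's rule splits a product into two terms, whence the factor [2 ^+ k], which
    does not depend on the scale [l]. *)
Lemma CbM l k K K' D F G : 0 < l -> Cb l k K D F -> Cb l k K' D G ->
  Cb l k (2 ^+ k * K * K') D (fun t => F t * G t).
Proof.
move=> l0; elim: k K K' F G => [|k IH] K K' F G [bF cF] [bG cG]; split.
- by move=> t Dt; rewrite normrM expr0 mul1r ler_pM ?bF ?bG.
- by move=> t Dt; apply: continuousM; [exact: cF|exact: cG].
- move=> t Dt; rewrite normrM -mulrA.
  have FG : `|F t| * `|G t| <= K * K' by rewrite ler_pM ?bF ?bG.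
  by rewrite (le_trans FG)// ler_peMl ?exprn_ege1 ?ler1n// (le_trans _ FG)// mulr_ge0.
case: cF => F' dF cF; case: cG => G' dG cG.
exists (fun t => F t * G' t + F' t * G t).
  move=> t Dt; have := is_deriveM (dF t Dt) (dG t Dt).
  by rewrite /GRing.scale/= (mulrC (G t)).
have -> : 2 ^+ k.+1 * K * K' / l = 2 ^+ k * K * (K' / l) + 2 ^+ k * (K / l) * K'.
  by rewrite exprS; field; exact: lt0r_neq0.
apply: CbD; apply: IH => //; apply: Cb_pred; split=> //.
  by exists F'.
by exists G'.
Qed.

Lemma CbZ l k K D (x : R) F : 0 < l -> Cb l k K D F -> Cb l k (`|x| * K) D (fun t => x * F t).
Proof.
move=> l0; elim: k K F => [|k IH] K F [bF cF]; split.
1,3: by move=> t Dt; rewrite normrM ler_wpM2l ?bF.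
  by move=> t Dt; apply: continuousM; [exact: cst_continuous|exact: cF].
case: cF => F' dF cF; exists (fun t => x * F' t).
  by move=> t Dt; have := dF t Dt => ?; exact: is_deriveZ.
by rewrite -mulrA; exact: IH.
Qed.

Lemma CbX l k K D F m : 0 < l -> Cb l k K D F ->
  Cb l k ((2 ^+ k * K) ^+ m) D (fun t => F t ^+ m).
Proof.
move=> l0 cF; elim: m => [|m IH]; first by under eq_fun do rewrite expr0; apply: Cb_cst; rewrite ?normr1.
by under eq_fun do rewrite exprS; rewrite exprS; exact: CbM.
Qed.

(* Regularity of solutions of G' = a F' G^m, used for G = 1/F and G = F^(-1/2). *)
Lemma Cb_ode (a : R) (m k : nat) (K B : R) : exists K', forall l D F G, 0 < l ->
  Cb l k K D F -> (forall t, D t -> `|G t| <= B) ->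
  (forall t, D t -> {for t, continuous F} -> {for t, continuous G}) ->
  (forall t (dF : R), D t -> is_derive t 1 F dF ->
     is_derive t 1 G (a * (dF * G t ^+ m))) ->
  Cb l k K' D G.
Proof.
elim: k => [|k [K' IH]].
  by exists B => l D F G l0 cF bG cG dG; split=> // t Dt; apply: cG => //; exact: Cb_cont cF _ Dt.
exists (Num.max B (`|a| * (2 ^+ k * K * ((2 ^+ k * K') ^+ m)))).
move=> l D F G l0 cF bG cG dG.
(* The derivative of [G], wanted at order [k], involves [G] only at order [k], so the induction
   closes. The factor [l^-1] is supplied by the derivative of [F]; hence [K'] does not depend on
   [l]. *)
have {}IH := IH l D F G l0 (Cb_pred cF) bG cG dG.
split; first by move=> t Dt; rewrite le_max bG.
case: cF => _ [F' dF cF].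
exists (fun t => a * (F' t * G t ^+ m)); first by move=> t Dt; exact: dG (dF t Dt).
apply: (@Cb_le _ _ (`|a| * (2 ^+ k * (K / l) * ((2 ^+ k * K') ^+ m)))) => //.
  rewrite ler_pdivlMr// le_max; apply/orP; right.
  rewrite le_eqVlt; apply/orP; left; apply/eqP; field; exact: lt0r_neq0.
by apply: CbZ => //; apply: CbM => //; exact: CbX.
Qed.

Lemma CbV (k : nat) (K c : R) : 0 < c -> exists K', forall l D F, 0 < l ->
  Cb l k K D F -> (forall t, D t -> c <= `|F t|) -> Cb l k K' D (fun t => (F t)^-1).
Proof.
move=> c0; have [K' HK] := Cb_ode (-1) 2 k K c^-1; exists K' => l D F l0 cF bF.
have F0 t : D t -> F t != 0 by move=> Dt; rewrite -normr_gt0 (lt_le_trans c0 (bF t Dt)).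
apply: HK cF _ _ _ => //.
- by move=> t Dt; rewrite normfV lef_pV2 ?posrE ?bF// (lt_le_trans c0 (bF t Dt)).
- by move=> t Dt; apply: continuousV; exact: F0.
- move=> t dF Dt dF1; have := is_deriveV (F0 t Dt) dF1.
  by rewrite /GRing.scale/= exprVn mulN1r mulNr mulrC.
Qed.

End one_variable.

(** * Integration by parts and non-stationary phase on an interval *)

Section one_variable_integrals.
Variable R : realType.
Implicit Types (l K c t : R) (D : set R) (F G A p f g : R -> R).
Local Notation leb := (@lebesgue_measure R).

Lemma within_itv_continuous F a b :
  (forall t, a <= t <= b -> {for t, continuous F}) -> {within `[a, b], continuous F}.
Proof. by move=> cF; apply: continuous_in_subspaceT => t; rewrite inE/= in_itv/= => /cF. Qed.

Lemma itv_integrable F a b : (forall t, a <= t <= b -> {for t, continuous F}) ->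
  leb.-integrable `[a, b] (EFin \o F).
Proof.
by move=> cF; apply: continuous_compact_integrable;
  [exact: segment_compact|exact: within_itv_continuous].
Qed.

Lemma le_itv_Rintegral F a b K : a <= b ->
  (forall t, a <= t <= b -> {for t, continuous F}) ->
  (forall t, a <= t <= b -> `|F t| <= K) ->
  `|\int[leb]_(t in `[a, b]) F t| <= K * (b - a).
Proof.
move=> ab cF bF; have iF := itv_integrable cF.
apply: le_trans (le_normr_Rintegral _ iF) _ => //.
have -> : K * (b - a) = \int[leb]_(t in `[a, b]) K.
  rewrite Rintegral_cst//= lebesgue_measure_itv/= lte_fin.
  by move: ab; rewrite le_eqVlt => /predU1P[->|->]; rewrite ?ltxx ?subrr.
apply: le_Rintegral => //.
- by apply: itv_integrable => t /cF cFt; exact: (continuous_comp cFt (@norm_continuous _ _ _)).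
- by apply: itv_integrable => t _; exact: cst_continuous.
Qed.

Lemma ibp F G f g a b : a < b ->
  (forall t, a <= t <= b -> is_derive t 1 F (f t)) ->
  (forall t, a <= t <= b -> is_derive t 1 G (g t)) ->
  (forall t, a <= t <= b -> {for t, continuous f}) ->
  (forall t, a <= t <= b -> {for t, continuous g}) ->
  \int[leb]_(t in `[a, b]) (F t * g t) =
    F b * G b - F a * G a - \int[leb]_(t in `[a, b]) (f t * G t).
Proof.
move=> ab dF dG cf cg.
have LR (H h : R -> R) : (forall t, a <= t <= b -> is_derive t 1 H (h t)) -> derivable_oo_LRcontinuous H a b.
  move=> dH; split.
  - by move=> t; rewrite in_itv/= => /andP[at_ tb]; have [] := dH t; rewrite ?(ltW at_) ?(ltW tb).
  - have d : is_derive a 1 H (h a) by apply: dH; rewrite lexx ltW.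
    apply: cvg_at_right_filter; exact: (is_derive_cont d).
  - have d : is_derive b 1 H (h b) by apply: dH; rewrite lexx ltW.
    apply: cvg_at_left_filter; exact: (is_derive_cont d).
have dE (H h : R -> R) : (forall t, a <= t <= b -> is_derive t 1 H (h t)) -> {in `]a, b[, derive1 H =1 h}.
  move=> dH t; rewrite in_itv/= => /andP[at_ tb]; rewrite derive1E.
  by apply: (@derive_val _ _ _ _ _ _ _ (dH t _)); rewrite (ltW at_) ltW.
apply: Rintegration_by_parts => //.
- exact: within_itv_continuous.
- exact: LR dF.
- exact: dE.
- exact: within_itv_continuous.
- exact: LR dG.
- exact: dE.
Qed.

Lemma ftc F f a b : a < b ->
  (forall t, a <= t <= b -> is_derive t 1 F (f t)) ->
  (forall t, a <= t <= b -> {for t, continuous f}) ->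
  \int[leb]_(t in `[a, b]) f t = F b - F a.
Proof.
move=> ab dF cf.
have := @ibp (fun=> 1) F (fun=> 0) f a b ab (fun t _ => is_derive_cst _ t _) dF
  (fun t _ => @cst_continuous _ _ 0 t) cf.
rewrite !mul1r => H; transitivity (\int[leb]_(t in `[a, b]) (1 * f t)).
  by apply: eq_Rintegral => t _; rewrite mul1r.
rewrite H [X in _ - X](_ : _ = 0) ?subr0//.
by under eq_Rintegral do rewrite mul0r; rewrite Rintegral_cst//= mul0r.
Qed.

Lemma is_derive_val_eq F t (x y : R) : is_derive t 1 F x -> is_derive t 1 F y -> x = y.
Proof. by move=> [_ <-] [_ <-]. Qed.

(** Write [A cos(p + k)] as [A / p1] times [p1 cos(p + k)], which has the primitive
    [(l / r) sin(p + k)]. The amplitude produced by an integration by parts has size [KA / l], so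
    every round gains a factor [r]; there are no boundary terms because [A] vanishes near both ends.
    The constant [k] in the phase serves the induction: a shift by [pi / 2] turns the sine back into
    a cosine. *)
Lemma nonstationary_phase N (K c : R) : 0 < c -> exists2 C, 0 <= C &
  forall l r a b a' b' D A p p1 KA k, 0 < l -> 0 < r -> a < b -> a < a' -> b' < b ->
  open D -> `[a, b] `<=` D -> (forall t, D t -> t < a' \/ b' < t -> A t = 0) ->
  Cb l N K D p1 -> (forall t, D t -> c <= `|p1 t|) ->
  (forall t, D t -> is_derive t 1 p (r / l * p1 t)) -> Cb l N KA D A ->
  `|\int[leb]_(t in `[a, b]) (A t * cos (p t + k))| <= C * KA * (b - a) / r ^+ N.
Proof.
move=> c0; elim: N => [|N [C C0 IH]].
  exists 1 => // l r a b a' b' D A p p1 KA k l0 r0 ab _ _ _ abD _ _ _ dp cA.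
  rewrite mul1r expr0 divr1; apply: le_itv_Rintegral; first exact: ltW.
    move=> t tab; have Dt : D t by apply: abD; rewrite /= in_itv.
    apply: continuousM; first exact: Cb_cont cA _ Dt.
    apply: (@continuous_comp _ _ _ (fun t => p t + k) cos); last exact: continuous_cos.
    by apply: continuousD; [exact: is_derive_cont (dp _ Dt)|exact: cst_continuous].
  move=> t tab; have Dt : D t by apply: abD; rewrite /= in_itv.
  rewrite normrM -[KA]mulr1 ler_pM// ?(Cb_bound cA)// ler_norml cos_geN1 cos_le1//.
have [K' HV] := CbV N.+1 K c0.
exists (C * (2 ^+ N.+1 * Num.max 0 K')); first by rewrite !mulr_ge0// ?exprn_ge0// le_max lexx.
move=> l r a b a' b' D A p p1 KA k l0 r0 ab aa' b'b oD abD vA cp cp1 dp cA.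
have cq := HV _ _ _ l0 cp cp1.
have [_ [F' dF cF']] := CbM l0 cA cq.
set F := fun t => A t * (p1 t)^-1 in dF.
have Dab t : a <= t <= b -> D t by move=> tab; apply: abD; rewrite /= in_itv.
have p10 t : D t -> p1 t != 0 by move=> Dt; rewrite -normr_gt0 (lt_le_trans c0 (cp1 t Dt)).
have vF t : D t -> t < a' \/ b' < t -> F t = 0 by move=> Dt ht; rewrite /F vA// mul0r.
(* The inequalities are strict, so [F] vanishes on a neighbourhood of such a point and its
   derivative is that of 0. *)
have vF' t : D t -> t < a' \/ b' < t -> F' t = 0.
  move=> Dt ht; apply: (@is_derive_val_eq (fun=> 0) t).
  apply: is_derive_ext (dF t Dt).
  have nD : \forall x \near t, D x by exact: open_nbhs_nbhs.
  case: ht => ht; [have := lt_nbhsl ht|have := lt_nbhsr ht] => nt;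
    by apply: filterS2 nD nt => x Dx xt; apply: vF; tauto.
have cpk k0 t : a <= t <= b -> {for t, continuous (fun t => p t + k0)}.
  move=> tab; apply: continuousD; last exact: cst_continuous.
  by apply: is_derive_cont (dp _ _); exact: Dab.
have E1 : \int[leb]_(t in `[a, b]) (A t * cos (p t + k)) =
    \int[leb]_(t in `[a, b]) (F t * (p1 t * cos (p t + k))).
  apply: eq_Rintegral => t; rewrite inE => /abD Dt.
  by rewrite /F -mulrA mulKf// p10.
have dG t : a <= t <= b ->
    is_derive t 1 (fun t => l / r * sin (p t + k)) (p1 t * cos (p t + k)).
  move=> tab; have dpk : is_derive t 1 (fun t => p t + k) (r / l * p1 t).
    by have := is_deriveD (dp t (Dab _ tab)) (is_derive_cst k t 1); rewrite addr0.
  have ds := @is_derive1_comp _ sin (fun t => p t + k) t _ _ (is_derive_sin (p t + k)) dpk.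
  have -> : p1 t * cos (p t + k) = l / r * (cos (p t + k) * (r / l * p1 t)).
    by rewrite /GRing.scale/=; field; rewrite !lt0r_neq0.
  exact: (is_deriveZ (l / r) ds).
rewrite E1 (@ibp F _ F' _ a b ab _ dG).
- have -> : F b = 0 by apply: vF; [apply: Dab; rewrite lexx ltW|right].
  have -> : F a = 0 by apply: vF; [apply: Dab; rewrite lexx ltW|left].
  rewrite !mul0r subrr add0r normrN.
  have -> : \int[leb]_(t in `[a, b]) (F' t * (l / r * sin (p t + k))) =
     - (l / r) * \int[leb]_(t in `[a, b]) (F' t * cos (p t + (k + pi / 2))).
    rewrite -RintegralZl//; last first.
      apply: itv_integrable => t tab; apply: continuousM.
        by apply: Cb_cont cF' _ _; exact: Dab.
      apply: (@continuous_comp _ _ _ (fun t => p t + (k + pi / 2)) cos); last exact: continuous_cos.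
      exact: cpk.
    apply: eq_Rintegral => t _; rewrite addrA cosD cos_pihalf sin_pihalf; ring.
  have {}IH := IH l r a b a' b' D F' p p1 _ (k + pi / 2) l0 r0 ab aa' b'b oD abD vF' (Cb_pred cp) cp1 dp cF'.
  have lr0 : 0 <= l / r by rewrite divr_ge0// ltW.
  rewrite normrM normrN (ger0_norm lr0).
  apply: (le_trans (ler_wpM2l lr0 IH)).
  have KA0 : 0 <= KA.
    by apply: le_trans (normr_ge0 (A a)) (Cb_bound cA _); apply: Dab; rewrite lexx ltW.
  have -> : l / r * (C * (2 ^+ N.+1 * KA * K' / l) * (b - a) / r ^+ N) =
     C * (2 ^+ N.+1 * K') * KA * (b - a) / r ^+ N.+1.
    by rewrite [r ^+ N.+1]exprS; field; rewrite !lt0r_neq0// exprn_gt0.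
  rewrite ler_wpM2r ?invr_ge0 ?exprn_ge0 ?(ltW r0)//.
  rewrite ler_wpM2r ?subr_ge0 ?(ltW ab)// ler_wpM2r// ler_wpM2l//.
  by rewrite ler_wpM2l ?exprn_ge0// le_max lexx orbT.
- by move=> t /Dab; exact: dF.
- by move=> t /Dab; exact: Cb_cont cF' _.
- move=> t tab; apply: continuousM; first by apply: Cb_cont cp _ _; exact: Dab.
  by apply: (@continuous_comp _ _ _ (fun t => p t + k) cos); [exact: cpk|exact: continuous_cos].
Unshelve. all: end_near. Qed.

End one_variable_integrals.

(** * Square roots, cut-offs of finite smoothness, and an integrable weight *)

Section special_functions.
Variable R : realType.
Implicit Types (l K c t : R) (D : set R) (F G A p f g : R -> R).
Local Notation leb := (@lebesgue_measure R).

(** The two hypotheses provide unrelated functions as derivatives of [F]. Both agree with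
    [derive1 F] on their sets, and [derive1 F] is defined on the union. *)
Lemma Cb_setU l k K D1 D2 F : open D1 -> open D2 ->
  Cb l k K D1 F -> Cb l k K D2 F -> Cb l k K (D1 `|` D2) F.
Proof.
move=> o1 o2; elim: k K F => [|k IH] K F [b1 c1] [b2 c2]; split.
1,3: by move=> t [|]; auto.
  by move=> t [|]; auto.
case: c1 => F1 d1 c1; case: c2 => F2 d2 c2.
have dE (D : set R) G t : is_derive t 1 F (G t) -> G t = derive1 F t.
  by move=> [_ <-]; rewrite derive1E.
exists (derive1 F).
  by move=> t [/d1|/d2] dF; [rewrite -(dE D1 F1)|rewrite -(dE D2 F2)].
by apply: IH; [apply: Cb_ext c1 => // t /d1; exact: dE|apply: Cb_ext c2 => // t /d2; exact: dE].
Qed.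

Lemma Cb_shrink l l' k K D F : 0 < l' <= l -> 0 <= K -> Cb l k K D F -> Cb l' k K D F.
Proof.
move=> /andP[l0 ll]; have l1 := lt_le_trans l0 ll.
elim: k K F => [|k IH] K F K0 [bF cF]; split => //; case: cF => F' dF cF; exists F' => //.
apply: (@Cb_le _ _ _ (K / l)) => //; first by rewrite ler_wpM2l// lef_pV2.
by apply: IH => //; rewrite divr_ge0// ltW.
Qed.

Lemma Cb_rsqrt (k : nat) (K c : R) : 0 < c -> exists K', forall l D F, 0 < l ->
  Cb l k K D F -> (forall t, D t -> c <= F t) ->
  Cb l k K' D (fun t => (Num.sqrt (F t))^-1).
Proof.
move=> c0; have [K' HK] := Cb_ode (- 2^-1) 3 k K (Num.sqrt c)^-1.
exists K' => l D F l0 cF bF.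
have F0 t : D t -> 0 < F t by move=> Dt; rewrite (lt_le_trans c0 (bF t Dt)).
have s0 t : D t -> Num.sqrt (F t) != 0 by move=> Dt; rewrite sqrtr_eq0 -ltNge F0.
apply: HK cF _ _ _ => //.
- move=> t Dt; rewrite normfV (ger0_norm (sqrtr_ge0 _)) lef_pV2 ?posrE ?sqrtr_gt0 ?F0//.
  by rewrite ler_wsqrtr// bF.
- move=> t Dt cFt; apply: continuousV; first exact: s0.
  exact: (continuous_comp cFt (@sqrt_continuous _ _)).
- move=> t dF Dt dF1.
  have ds := @is_derive1_comp _ Num.sqrt F t _ _ (is_derive1_sqrt (F0 t Dt)) dF1.
  have -> : - 2^-1 * (dF * (Num.sqrt (F t))^-1 ^+ 3) =
      - (Num.sqrt (F t)) ^- 2 *: ((2 * Num.sqrt (F t))^-1 * dF).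
    by rewrite /GRing.scale/=; field; exact: s0.
  exact: (is_deriveV (f := Num.sqrt \o F) (s0 t Dt) ds).
Qed.

(** The derivative of the square root brings in its reciprocal, which is not of the form treated by
    [Cb_ode]. The square root is therefore written as [F] times the inverse square root. *)
Lemma Cb_sqrt (k : nat) (K c : R) : 0 < c -> exists K', forall l D F, 0 < l -> open D ->
  Cb l k K D F -> (forall t, D t -> c <= F t) ->
  Cb l k K' D (fun t => Num.sqrt (F t)).
Proof.
move=> c0; have [K' HK] := Cb_rsqrt k K c0.
exists (2 ^+ k * K * K') => l D F l0 oD cF bF.
apply: Cb_ext (CbM l0 cF (HK l D F l0 cF bF)) => // t Dt /=.
have F0 : 0 < F t by rewrite (lt_le_trans c0 (bF t Dt)).
by rewrite -{1}(sqr_sqrtr (ltW F0)) expr2 mulfK// sqrtr_eq0 -ltNge.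
Qed.

(** The truncated power, of class C^(m-1). Only finitely many derivatives are ever taken, so it
    replaces the exp(-1/t) of the usual smooth cut-offs and comes with explicit derivative
    bounds. *)
Definition tpow m t : R := Num.max 0 t ^+ m.

Lemma tpow_neg m t : t <= 0 -> (0 < m)%N -> tpow m t = 0.
Proof. by move=> t0; case: m => // m _; rewrite /tpow max_l// expr0n. Qed.

Lemma tpow_pos m t : 0 <= t -> tpow m t = t ^+ m.
Proof. by move=> t0; rewrite /tpow max_r. Qed.

Lemma tpow_ge0 m t : 0 <= tpow m t.
Proof. by rewrite /tpow exprn_ge0// le_max lexx. Qed.

Lemma is_derive_tpow m t : is_derive t 1 (tpow m.+2) (m.+2%:R * tpow m.+1 t).
Proof.
have [t0|t0|t0] := ltgtP t 0.
- rewrite tpow_neg ?(ltW t0)// mulr0.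
  apply: (@is_derive_ext _ (fun=> 0)).
  by near=> x; rewrite tpow_neg// ltW//; near: x; exact: lt_nbhsl.
- rewrite tpow_pos ?(ltW t0)//.
  have := @is_deriveX _ _ id m.+2 t 1 _ (is_derive_id t 1); rewrite /GRing.scale/= mulr1.
  apply: is_derive_ext; near=> x; rewrite tpow_pos ?exprfctE// ltW//.
  by near: x; exact: lt_nbhsr.
(* At the kink the difference quotient is at most [|h|] in absolute value. *)
- rewrite t0 tpow_neg// mulr0.
  have H : h^-1 *: (tpow m.+2 (h *: 1 + 0) - tpow m.+2 0) @[h --> (0:R)^'] --> (0 : R).
    apply/cvgr0Pnorm_lt => e e0; near=> h.
    have h0 : h != 0 by near: h; exact: nbhs_dnbhs_neq.
    rewrite (tpow_neg (lexx 0))// subr0 addr0 /GRing.scale/= mulr1 normrM normfV.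
    have hm : `|h| < Num.min 1 e.
      near: h; apply: dnbhs0_lt; by rewrite lt_min ltr01.
    move: hm; rewrite lt_min => /andP[h1 he].
    rewrite ltr_pdivrMl ?normr_gt0// (le_lt_trans _ (_ : `|h| * `|h| < _))//; last first.
      by rewrite ltr_pM2l ?normr_gt0.
    have [hn|hp] := leP h 0; first by rewrite tpow_neg// normr0 mulr_ge0.
    rewrite tpow_pos ?(ltW hp)// normrX !exprS mulrA ler_piMr ?mulr_ge0//.
    by rewrite exprn_ile1// ltW.
  have dd : derivable (tpow m.+2) 0 1 by apply/cvg_ex; exists 0.
  split => //; exact: cvg_lim H.
Unshelve. all: end_near. Qed.

Lemma is_derive_tpow_affine m s a l t :
  is_derive t 1 (fun t => tpow m.+2 (s * (t - a) / l))
    (m.+2%:R * (s / l) * tpow m.+1 (s * (t - a) / l)).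
Proof.
have du : is_derive t 1 (fun t => s * (t - a) / l) (s / l).
  have d1 := is_deriveB (is_derive_id t (1 : R)) (is_derive_cst a t (1 : R)).
  have -> : s / l = (s / l) *: (1 - 0 : R) by rewrite /GRing.scale/= subr0 mulr1.
  have -> : (fun t => s * (t - a) / l) = (fun t => (s / l) *: (t - a)).
    by apply/funext => x; rewrite mulrAC.
  exact: (is_deriveZ (s / l) d1).
have := @is_derive1_comp _ (tpow m.+2) (fun t => s * (t - a) / l) t _ _ (is_derive_tpow m _) du.
by rewrite mulrAC.
Qed.

Lemma Cb_tpow (k m : nat) (B : R) : (k.+1 < m)%N -> 1 <= B -> forall l s a D, 0 < l ->
  `|s| <= 1 -> (forall t, D t -> s * (t - a) / l <= B) ->
  Cb l k (m`!%:R * B ^+ m) D (fun t => tpow m (s * (t - a) / l)).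
Proof.
move=> + B1 l s a D l0 s1 DB; have B0 := le_trans ler01 B1.
elim: k m => [|k IH] [|[|m]]// km.
all: have bT t (Dt : D t) : `|tpow m.+2 (s * (t - a) / l)| <= m.+2`!%:R * B ^+ m.+2.
1,3: rewrite ger0_norm ?tpow_ge0// -[tpow _ _]mul1r ler_pM ?tpow_ge0 ?ler1n ?fact_gt0//.
1,2: by rewrite /tpow lerXn2r ?nnegrE ?le_max ?lexx// ge_max DB// B0.
  by split => // t _; exact: is_derive_cont (is_derive_tpow_affine _ _ _ _ _).
split => //; exists (fun t => m.+2%:R * (s / l) * tpow m.+1 (s * (t - a) / l)).
  by move=> t _; exact: is_derive_tpow_affine.
apply: (@Cb_le _ _ _ (`|m.+2%:R * (s / l)| * (m.+1`!%:R * B ^+ m.+1))) => //; last first.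
  by apply: CbZ => //; exact: IH.
rewrite !normrM (ger0_norm (ler0n _ _)) normfV (gtr0_norm l0) [m.+2`!]factS natrM [B ^+ m.+2]exprS.
have -> : m.+2%:R * (`|s| / l) * (m.+1`!%:R * B ^+ m.+1) =
   (m.+2%:R * m.+1`!%:R * B ^+ m.+1 / l) * `|s| by ring.
have -> : m.+2%:R * m.+1`!%:R * (B * B ^+ m.+1) / l =
   (m.+2%:R * m.+1`!%:R * B ^+ m.+1 / l) * B by ring.
by rewrite ler_wpM2l ?(le_trans s1)// divr_ge0 ?(ltW l0)// !mulr_ge0// exprn_ge0.
Qed.

(** The usual quotient for a step from 0 to 1 across the unit interval, built from truncated
    powers. *)
Definition sstep m t : R := tpow m t / (tpow m t + tpow m (1 - t)).

(** One of [t] and [1 - t] is at least 1/2. *)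
Lemma sstep_den m t : 2 ^- m <= tpow m t + tpow m (1 - t).
Proof.
wlog t2 : t / 2^-1 <= t.
  move=> W; have [/W//|t2] := leP 2^-1 t.
  have h : 2^-1 <= 1 - t by lra.
  by move: (W _ h); rewrite subKr [X in _ <= X]addrC.
rewrite ler_wpDr ?tpow_ge0// tpow_pos; last by lra.
by rewrite -exprVn lerXn2r ?nnegrE//; lra.
Qed.

Lemma sstep0 m t : (0 < m)%N -> t <= 0 -> sstep m t = 0.
Proof. by move=> m0 t0; rewrite /sstep tpow_neg// mul0r. Qed.

Lemma sstep1 m t : (0 < m)%N -> 1 <= t -> sstep m t = 1.
Proof.
move=> m0 t1; rewrite /sstep [tpow m (1 - t)]tpow_neg ?subr_le0// addr0 divff//.
by rewrite tpow_pos ?(le_trans ler01)// expf_neq0// gt_eqF// (lt_le_trans ltr01).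
Qed.

Lemma Cb_sstep (k m : nat) : (k.+1 < m)%N -> exists2 K, 0 <= K & forall l a, 0 < l ->
  Cb l k K setT (fun t => sstep m ((t - a) / l)).
Proof.
move=> km; have m0 : (0 < m)%N by apply: leq_trans km.
pose B := m`!%:R * 2 ^+ m : R; have B2 : 1 <= (2 : R) by lra.
have h2 : 0 < (2 : R) ^- m by rewrite invr_gt0 exprn_gt0.
have [K' HK] := CbV k (B + B) h2.
pose K := Num.max 1 (2 ^+ k * B * K'); exists K => [|l a l0]; first by rewrite le_max ler01.
have E t : (t - a) / l = 1 * (t - a) / l by rewrite mul1r.
have E' t : 1 - (t - a) / l = -1 * (t - (a + l)) / l by field; exact: lt0r_neq0.
(* Truncated powers are unbounded, so the quotient is differentiated only on the window [D2], where
   both arguments are at most 2; this is the 2 in [B]. On [D1] and [D3] the step is constant, and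
   the three open sets overlap. *)
pose D1 := [set t | t < a]; pose D2 := [set t | a - l < t] `&` [set t | t < a + 2 * l].
pose D3 := [set t | a + l < t].
have oD1 : open D1 by exact: open_lt.
have oD2 : open D2 by apply: openI; [exact: open_gt|exact: open_lt].
have oD3 : open D3 by exact: open_gt.
have c1 : Cb l k K D1 (fun t => sstep m ((t - a) / l)).
  apply: (@Cb_ext _ _ _ _ _ (fun=> 0)) => //; last first.
    by apply: Cb_cst => //; rewrite normr0 le_max ler01.
  by move=> t /ltW ta; rewrite sstep0// pmulr_lle0 ?invr_gt0// subr_le0.
have c3 : Cb l k K D3 (fun t => sstep m ((t - a) / l)).
  apply: (@Cb_ext _ _ _ _ _ (fun=> 1)) => //; last first.
    by apply: Cb_cst => //; rewrite normr1 le_max lexx.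
  by move=> t /ltW ta; rewrite sstep1// ler_pdivlMr// mul1r lerBrDl.
have c2 : Cb l k K D2 (fun t => sstep m ((t - a) / l)).
  have cA : Cb l k B D2 (fun t => tpow m ((t - a) / l)).
    under eq_fun do rewrite E; apply: Cb_tpow => //; first by rewrite normr1.
    by move=> t [/= t1 t2]; rewrite mul1r ler_pdivrMr//; lra.
  have cB : Cb l k B D2 (fun t => tpow m (1 - (t - a) / l)).
    under eq_fun do rewrite E'; apply: Cb_tpow => //; first by rewrite normrN normr1.
    by move=> t [/= t1 t2]; rewrite ler_pdivrMr//; lra.
  apply: (@Cb_le _ _ _ (2 ^+ k * B * K')) => //; first by rewrite le_max lexx orbT.
  apply: CbM => //; apply: HK => //; first exact: CbD.
  by move=> t _; rewrite ger0_norm ?addr_ge0 ?tpow_ge0//; exact: sstep_den.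
apply: (@Cb_sub _ _ _ _ (D1 `|` D2 `|` D3)); last first.
  by apply: Cb_setU => //; [exact: openU|exact: Cb_setU].
move=> t _; rewrite /D1 /D2 /D3 /=.
have [|?] := ltP t a; first by left; left.
have [|?] := ltP t (a + 2 * l); [left; right; split => //|right]; lra.
Qed.

(** The exponent 4/3 is above 1, so that the function is integrable, and small enough that [d + 1]
    such factors cost at most the power [2d] (see [q43_prod]). *)
Definition q43 t : R := (1 + `|t|) `^ (- (4 / 3)).

Lemma q43_ge0 t : 0 <= q43 t. Proof. exact: powR_ge0. Qed.

Lemma q43_cont : continuous q43.
Proof.
move=> t; have h : 0 < 1 + `|t| by rewrite ltr_pwDl.
have c1 : {for 1 + `|t|, continuous (fun x : R => x `^ (- (4 / 3)))}.
  exact: (is_derive_cont (is_derive1_powR (- (4 / 3)) h)).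
apply: (@continuous_comp _ _ _ (fun t => 1 + `|t|) (fun x : R => x `^ (- (4 / 3)))) => //.
by apply: continuousD; [exact: cst_continuous|exact: norm_continuous].
Qed.

(** The sign [s] selects a side of the centre [e], the left end for [s = 1] and the right end for
    [s = -1]. Both sides have the primitive [- s (3 / mu) (1 + mu s (t - e))^(-1/3)], whose power
    lies in [0, 1]; hence a bound that ignores the length of the interval. *)
Lemma q43_half (mu a b : R) (s : R) : 0 < mu -> `|s| = 1 -> a <= b ->
  (forall t, a <= t <= b -> 0 <= s * (t - (if 0 < s then a else b))) ->
  \int[leb]_(t in `[a, b]) q43 (mu * (t - (if 0 < s then a else b))) <= 3 / mu.
Proof.
move=> mu0 s1; set e := (if 0 < s then a else b) => ab se.
have q0 : 0 <= 3 / mu :> R by rewrite divr_ge0// ltW.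
have ss : s * s = 1 by rewrite -expr2 -real_normK ?num_real// s1 expr1n.
move: ab; rewrite le_eqVlt => /predU1P[E|ab].
  by rewrite /Rintegral E set_itv1 integral_set1.
pose P t : R := - s * (3 / mu) * (1 + mu * (s * (t - e))) `^ (- (1/3)).
have h t : a <= t <= b -> 0 < 1 + mu * (s * (t - e)).
  by move=> /se tab; rewrite ltr_pwDl// mulr_ge0// ltW.
have dP t : a <= t <= b -> is_derive t 1 P (q43 (mu * (t - e))).
  move=> tab; have d1 := is_deriveB (is_derive_id t (1 : R)) (is_derive_cst e t (1 : R)).
  have d2 := is_deriveD (is_derive_cst (1 : R) t (1 : R)) (is_deriveZ mu (is_deriveZ s d1)).
  have d3 := @is_derive1_comp _ (fun x : R => x `^ (- (1/3))) (fun t => 1 + mu * (s * (t - e))) t _ _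
    (is_derive1_powR (- (1/3)) (h t tab)) d2.
  have d4 := is_deriveZ (- s * (3 / mu)) d3.
  suff <- : (- s * (3 / mu)) *: (- (1 / 3) * (1 + mu * (s * (t - e))) `^ (- (1 / 3) - 1) *
       (0 + mu *: (s *: (1 - 0 : R)))) = q43 (mu * (t - e)) by exact: d4.
  rewrite /q43 (_ : `|mu * (t - e)| = mu * (s * (t - e))); last first.
    rewrite normrM (gtr0_norm mu0); congr (_ * _).
    by rewrite -[LHS]mul1r -s1 -normrM ger0_norm// se.
  rewrite (_ : - (1 / 3) - 1 = - (4 / 3)); last by lra.
  rewrite /GRing.scale/= add0r subr0 mulr1.
  set x := _ `^ _; transitivity ((s * s) * x); last by rewrite ss mul1r.
  by field; exact: lt0r_neq0.
rewrite (ftc ab dP); last first.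
  move=> t _; apply: (@continuous_comp _ _ _ (fun t => mu * (t - e)) q43); last exact: q43_cont.
  apply: continuousM; first exact: cst_continuous.
  by apply: continuousB => //; exact: cst_continuous.
have X t : a <= t <= b -> 0 <= (1 + mu * (s * (t - e))) `^ (- (1/3)) <= 1.
  move=> tab; rewrite powR_ge0/= powRN invf_le1 ?powR_gt0 ?h//.
  have E1 : (1 : R) `^ (1 / 3) = 1 by rewrite powR1.
  rewrite -[X in X <= _]E1 ge0_ler_powR ?nnegrE//.
  - exact: ltW (h _ tab).
  - by rewrite lerDl mulr_ge0 ?(ltW mu0)// se.
have /X /andP[a0 a1] : a <= a <= b by rewrite lexx ltW.
have /X /andP[b0 b1] : a <= b <= b by rewrite lexx ltW.
pose Z t := (1 + mu * (s * (t - e))) `^ (- (1/3)) : R.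
have -> : P b - P a = 3 / mu * (s * (Z a - Z b)) by rewrite /P /Z; ring.
rewrite -[Y in _ <= Y]mulr1 ler_wpM2l//.
rewrite (le_trans (ler_norm _))// normrM s1 mul1r ler_norml; move: a0 a1 b0 b1; rewrite -/(Z a) -/(Z b); lra.
Qed.

(** The two sides of [a] contribute [3 / mu] each. Uniformity in [b] matters: this is the factor
    [mu^-1] that every coordinate gains in Schur's test. *)
Lemma q43_int (mu a b : R) : 0 < mu -> `|a| <= b ->
  \int[leb]_(t in `[- b, b]) q43 (mu * (t - a)) <= 6 / mu.
Proof.
move=> mu0; rewrite ler_norml => /andP[ba ab].
have iq u v : leb.-integrable `[u, v] (EFin \o (fun t => q43 (mu * (t - a)))).
  apply: itv_integrable => t _.
  apply: (@continuous_comp _ _ _ (fun t => mu * (t - a)) q43); last exact: q43_cont.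
  apply: continuousM; first exact: cst_continuous.
  by apply: continuousB => //; exact: cst_continuous.
have /eqP := @Rintegral_itvB _ _ (BLeft (- b)) (BRight b) a (iq (-b) b) ba ab.
rewrite subr_eq => /eqP ->.
rewrite Rintegral_itv_obnd_cbnd; last first.
  by apply: integrableS (iq a b) => //; apply: subset_itvr; rewrite bnd_simp.
have := @q43_half mu a b 1 mu0 (normr1 _) ab; rewrite ltr01 => h1.
have := @q43_half mu (- b) a (- 1) mu0 _ ba; rewrite normrN normr1 ltr0N1 => h2.
apply: (le_trans (lerD (h1 _) (h2 _ _))) => //.
- by move=> t /andP[at_ _]; rewrite mul1r subr_ge0.
- by move=> t /andP[_ at_]; rewrite mulN1r opprB subr_ge0.
- by rewrite -mulrDl; lra.
Qed.

End special_functions.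

(** * Partial derivatives: symmetry, reordering, mean value theorem *)

Section calculus.
Variables (R : realType) (n : nat).
Implicit Types (U : set 'rV[R]_n) (f g : 'rV[R]_n -> R) (x y : 'rV[R]_n) (s : seq 'I_n).

Definition unitv (i : 'I_n) : 'rV[R]_n := delta_mx 0 i.

Lemma is_derive_line f x (i : 'I_n) (t : R) : derivable f (x + t *: unitv i) (unitv i) ->
  is_derive t 1 (fun t => f (x + t *: unitv i)) (partial i f (x + t *: unitv i)).
Proof.
have E : (fun h : R => h^-1 *: (f (x + (h *: (1 : R) + t) *: unitv i) - f (x + t *: unitv i))) =
   (fun h : R => h^-1 *: (f (h *: unitv i + (x + t *: unitv i)) - f (x + t *: unitv i))).
  by apply/funext => h; rewrite (_ : h *: (1 : R) = h); [rewrite scalerDl addrCA|exact: mulr1].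
move=> df; apply: DeriveDef; rewrite /derivable /derive /partial /=.
  by rewrite [X in cvg (X @ _)]E.
by rewrite [X in lim (X @ _)]E.
Qed.

Lemma partials_cat s1 s2 f : partials s1 (partials s2 f) = partials (s1 ++ s2) f.
Proof. by rewrite /partials foldr_cat. Qed.

Lemma smooth_partials U f s : smooth_on U f -> smooth_on U (partials s f).
Proof.
move=> sf k s' x s'k Ux; rewrite partials_cat.
have [|c d] := sf (k + size s)%N (s' ++ s) x _ Ux; first by rewrite size_cat leq_add2r.
by split=> // sk; apply: d; rewrite size_cat ltn_add2r.
Qed.

Lemma smooth_cont U f x : smooth_on U f -> U x -> {for x, continuous f}.
Proof. by move=> sf Ux; have [] := sf 0%N [::] x isT Ux. Qed.

Lemma smooth_derivable U f x i : smooth_on U f -> U x -> derivable f x (unitv i).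
Proof. by move=> sf Ux; have [_] := sf 1%N [::] x isT Ux; exact. Qed.

Lemma smooth_line U f x i (t : R) : smooth_on U f -> U (x + t *: unitv i) ->
  is_derive t 1 (fun t => f (x + t *: unitv i)) (partial i f (x + t *: unitv i)).
Proof. by move=> sf Ux; apply: is_derive_line; exact: smooth_derivable sf Ux. Qed.

Lemma Cb_line U f x i s m (C : R) : smooth_on U f ->
  (forall s' y, (size s' <= m + size s)%N -> U y -> `|partials s' f y| <= C) ->
  Cb 1 m C [set t | U (x + t *: unitv i)] (fun t => partials s f (x + t *: unitv i)).
Proof.
move=> sf; elim: m s => [|m IH] s bf; split.
- by move=> t Ut; apply: bf.
- move=> t /= Ut; apply: is_derive_cont; apply: smooth_line Ut; exact: smooth_partials.
- by move=> t Ut; apply: bf => //; rewrite leq_addl.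
exists (fun t => partials (i :: s) f (x + t *: unitv i)).
  move=> t /= Ut; apply: smooth_line Ut; exact: smooth_partials.
by rewrite divr1; apply: IH => s' y /= s'm; apply: bf; rewrite addSnnS.
Qed.

Lemma partial_ext U f g i x : open U -> (forall y, U y -> f y = g y) -> U x ->
  partial i f x = partial i g x.
Proof.
move=> oU fg Ux; rewrite /partial; apply: near_eq_derive.
by near=> y; apply: fg; near: y; exact: open_nbhs_nbhs.
Unshelve. all: end_near. Qed.

Lemma partials_ext U f g s x : open U -> (forall y, U y -> f y = g y) -> U x ->
  partials s f x = partials s g x.
Proof.
by move=> oU fg; elim: s x => [|i s IH] x Ux; [exact: fg|exact: (partial_ext i oU IH)].
Qed.

Lemma mvt1 (F dF : R -> R) (a b : R) : a <= b ->
  (forall t, a <= t <= b -> is_derive t 1 F (dF t)) ->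
  exists2 c, a <= c <= b & F b - F a = dF c * (b - a).
Proof.
move=> ab dd; have h1 t : t \in `]a, b[ -> is_derive t 1 F (dF t).
  by rewrite in_itv/= => /andP[at_ tb]; apply: dd; rewrite (ltW at_) ltW.
have h2 : {within `[a, b], continuous F}.
  by apply: within_itv_continuous => t /dd; exact: is_derive_cont.
by have [c] := MVT_segment ab h1 h2; rewrite in_itv/= => cab E; exists c.
Qed.

Definition nearbox x (e : R) : set 'rV[R]_n := [set y | forall k, `|y 0 k - x 0 k| <= e].

Lemma nbhs_nearbox x (P : set 'rV[R]_n) : nbhs x P ->
  exists2 e : R, 0 < e & nearbox x e `<=` P.
Proof.
move=> /nbhs_ballP[e /= e0 eP]; exists (e / 2); first by rewrite divr_gt0.
move=> y xy; apply: eP; rewrite /ball/= /mx_ball; split=> // i k; rewrite ord1 /ball/=.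
by rewrite distrC (le_lt_trans (xy k))// ltr_pdivrMr// ltr_pMr// ltr1n.
Qed.

(** The second difference in the directions [i] and [j], divided by [h ^+ 2], is symmetric in the
    two directions. Two applications of the mean value theorem express it as one mixed derivative at
    a nearby point, so that it converges to either of them. *)
Lemma clairaut U f i j x : open U -> smooth_on U f -> U x ->
  partial i (partial j f) x = partial j (partial i f) x.
Proof.
move=> oU sf Ux; have [->//|ij] := eqVneq i j.
wlog suff H : i j ij / forall e : R, 0 < e -> exists2 h0 : R, 0 < h0 & forall h, 0 < h <= h0 ->
    `|(f (x + h *: unitv i + h *: unitv j) - f (x + h *: unitv i)
      - f (x + h *: unitv j) + f x) / h ^+ 2 - partial j (partial i f) x| <= e.
  apply/eqP; rewrite -subr_eq0 -normr_le0; apply/ler_addgt0Pl => e e0; rewrite addr0.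
  have e2 : 0 < e / 2 by rewrite divr_gt0.
  have [h1 h10 H1] := H _ _ ij _ e2.
  have ji : j != i by rewrite eq_sym.
  have [h2 h20 H2] := H j i ji _ e2.
  have h0 : 0 < Num.min h1 h2 by rewrite lt_min h10.
  move: (H2 (Num.min h1 h2)); rewrite h0 ge_min lexx orbT => /(_ isT).
  move: (H1 (Num.min h1 h2)); rewrite h0 ge_min lexx => /(_ isT).
  set h := Num.min h1 h2; rewrite [x + h *: unitv j + _]addrAC.
  set A := f _; set B := f _; set C := f _; set D := f _.
  set p := partial j _ _; set q := partial i _ _ => l1 l2.
  rewrite (_ : A - C - B + D = A - B - C + D) in l2; last by rewrite [A - C - B]addrAC.
  by move: (_ / _) p q l1 l2 => X p q; clear; rewrite !ler_norml; lra.
move=> e e0.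
have cp : {for x, continuous (partial j (partial i f))}.
  by apply: smooth_cont Ux; exact: (smooth_partials [:: j; i] sf).
have /nbhs_nearbox[h1 h10 h1P] : nbhs x [set y | `|partial j (partial i f) y - partial j (partial i f) x| <= e].
  by move/cvgr_distC_le : cp => /(_ e e0).
have /nbhs_nearbox[h2 h20 h2P] := open_nbhs_nbhs (conj oU Ux).
exists (Num.min h1 h2) => [|h /andP[hp]]; first by rewrite lt_min h10.
rewrite le_min => /andP[hh1 hh2].
have box (a b : R) : 0 <= a <= h -> 0 <= b <= h -> nearbox x h (x + a *: unitv i + b *: unitv j).
  move=> /andP[a0 ah] /andP[b0 bh] k; rewrite !mxE eqxx/=.
  rewrite -addrA addrAC subrr add0r; have [->|ki] := eqVneq k i.
    by rewrite (negbTE ij) mulr1 mulr0 addr0 ger0_norm.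
  by rewrite mulr0 add0r; case: (k == j); rewrite ?mulr1 ?mulr0 ?normr0 ?ger0_norm// ltW.
have boxU (a b : R) : 0 <= a <= h -> 0 <= b <= h -> U (x + a *: unitv i + b *: unitv j).
  by move=> ha hb; apply: h2P => k; exact: le_trans (box _ _ ha hb k) hh2.
have h00 : 0 <= (0 : R) <= h by rewrite lexx ltW.
have h0h : 0 <= h <= h by rewrite lexx ltW.
pose F t := f (x + h *: unitv j + t *: unitv i) - f (x + t *: unitv i).
have dF t : 0 <= t <= h -> is_derive t 1 F
    (partial i f (x + h *: unitv j + t *: unitv i) - partial i f (x + t *: unitv i)).
  move=> th; apply: is_deriveB; apply: smooth_line sf _.
    by rewrite addrAC; exact: boxU.
  by have := boxU t 0 th h00; rewrite scale0r addr0.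
have [a ah] := mvt1 (ltW hp) dF; rewrite subr0 /F scale0r !addr0 => E1.
have dG t : 0 <= t <= h -> is_derive t 1 (fun t => partial i f (x + a *: unitv i + t *: unitv j))
    (partial j (partial i f) (x + a *: unitv i + t *: unitv j)).
  by move=> th; apply: smooth_line (smooth_partials [:: i] sf) _; exact: boxU.
have [b bh] := mvt1 (ltW hp) dG; rewrite subr0 scale0r !addr0 [x + a *: _ + h *: _]addrAC => E2.
rewrite [x + h *: unitv i + _]addrAC.
have -> : f (x + h *: unitv j + h *: unitv i) - f (x + h *: unitv i) - f (x + h *: unitv j) + f x =
  partial j (partial i f) (x + a *: unitv i + b *: unitv j) * h ^+ 2.
  by rewrite expr2 mulrA -E2 -E1; ring.
rewrite mulfK ?expf_neq0 ?gt_eqF//; apply: h1P => k; exact: le_trans (box _ _ ah bh k) hh1.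
Qed.

Lemma partials_perm U f s t x : open U -> smooth_on U f -> perm_eq s t -> U x ->
  partials s f x = partials t f x.
Proof.
move=> oU sf; elim: s t x => [|i s IH] t x.
  by rewrite perm_sym => /perm_nilP ->.
move=> st Ux; have /path.splitPr E : i \in t by rewrite -(perm_mem st) mem_head.
case: E st => t1 t2; rewrite perm_sym perm_catC/= perm_cons perm_catC perm_sym => st.
rewrite [LHS](partial_ext i oU (fun y Uy => IH _ y st Uy) Ux).
elim: t1 {st IH s} x Ux => //= j t1 IH x Ux; rewrite -(partial_ext j oU IH Ux).
apply: (clairaut i j oU _ Ux); exact: (smooth_partials (t1 ++ t2) sf).
Qed.

(** The hypotheses bound the derivatives in the fixed order in which [mpartial] takes them; sorting
    the list [s] by [partials_perm] carries the bound to derivatives in any order. *)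
Lemma partials_bound k U f (C : R) s x : open U -> smooth_on U f ->
  derivs_bounded_on k U f C -> (size s <= k)%N -> U x -> `|partials s f x| <= C.
Proof.
move=> oU sf bf sk Ux; pose al i := count_mem i s.
have E : mpartial al f = partials (flatten [seq nseq (al i) i | i <- enum 'I_n]) f.
  rewrite /mpartial /partials; elim: (enum 'I_n) => //= i e ->.
  by rewrite foldr_cat; elim: (al i) => //= m ->.
have ps : perm_eq s (flatten [seq nseq (al i) i | i <- enum 'I_n]).
  apply/allP => i _ /=; rewrite count_flatten -map_comp sumnE big_map big_enum/=.
  rewrite (bigD1 i)//= count_nseq/= eqxx mul1n big1 ?addn0// => j ji.
  by rewrite count_nseq/= (negbTE ji).
rewrite (partials_perm oU sf ps Ux) -E; apply: bf => //.
rewrite /morder; suff -> : (\sum_(i < n) al i = size s)%N by [].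
rewrite (perm_size ps) size_flatten /shape -map_comp sumnE big_map big_enum/=.
by apply: eq_bigr => i _; rewrite size_nseq.
Qed.

Definition between x y : set 'rV[R]_n :=
  [set z | forall k, Num.min (x 0 k) (y 0 k) <= z 0 k <= Num.max (x 0 k) (y 0 k)].

(** Pass from [y] to [x] through the corners [h m], one coordinate at a time, with the one-variable
    theorem on each edge. The intermediate point depends on the coordinate, and a coordinate in
    which [x] and [y] agree contributes nothing; both features are exploited later. *)
Lemma mvt_multi U f x y : smooth_on U f -> between y x `<=` U ->
  exists2 p : 'I_n -> 'rV[R]_n, (forall k, between y x (p k)) &
  f x - f y = \sum_k partial k f (p k) * (x 0 k - y 0 k).
Proof.
move=> sf bU; pose h m : 'rV[R]_n := \row_k if (k < m)%N then x 0 k else y 0 k.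
have bh m : between y x (h m).
  by move=> k; rewrite mxE; case: ifP => _; rewrite ge_min le_max lexx ?orbT.
have step (m : 'I_n) : exists p, between y x p /\
    f (h m.+1) - f (h m) = partial m f p * (x 0 m - y 0 m).
  pose z : 'rV[R]_n := h m - y 0 m *: unitv m.
  have zE t k : (z + t *: unitv m) 0 k = if k == m then t else h m 0 k.
    rewrite !mxE eqxx/=; case: eqVneq => [->|]; rewrite ?ltnn ?mulr1 ?mulr0 ?subr0 ?addr0//.
    by rewrite subrr add0r.
  have bz t : Num.min (x 0 m) (y 0 m) <= t <= Num.max (x 0 m) (y 0 m) -> between y x (z + t *: unitv m).
    by move=> tb k; rewrite zE; case: eqVneq => [->|_]; [rewrite minC maxC|exact: bh].
  have E1 : h m.+1 = z + x 0 m *: unitv m.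
    apply/rowP => k; rewrite zE mxE ltnS leq_eqVlt; case: (eqVneq k m) => [->|km].
      by rewrite eqxx.
    by rewrite (negbTE (_ : val k != m))//= mxE.
  have E0 : h m = z + y 0 m *: unitv m by rewrite /z addrNK.
  have dd t : Num.min (x 0 m) (y 0 m) <= t <= Num.max (x 0 m) (y 0 m) ->
      is_derive t 1 (fun t => f (z + t *: unitv m)) (partial m f (z + t *: unitv m)).
    by move=> tb; apply: smooth_line sf _; apply: bU; exact: bz.
  have [xy|xy] := leP (x 0 m) (y 0 m).
    have [|c cb E] := mvt1 xy (dF := fun t => partial m f (z + t *: unitv m)) (F := fun t => f (z + t *: unitv m)).
      by move=> t tb; apply: dd; rewrite min_l ?max_r.
    exists (z + c *: unitv m); split; first by apply: bz; rewrite min_l ?max_r.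
    by rewrite E1 [in f (h m)]E0 -[LHS]opprB E -mulrN opprB.
  have [|c cb E] := mvt1 (ltW xy) (dF := fun t => partial m f (z + t *: unitv m)) (F := fun t => f (z + t *: unitv m)).
    by move=> t tb; apply: dd; rewrite min_r ?max_l ?(ltW xy).
  exists (z + c *: unitv m); split; first by apply: bz; rewrite min_r ?max_l ?(ltW xy).
  by rewrite E1 [in f (h m)]E0 E.
have [p pP] := choice step; exists p => [k|]; first by have [] := pP k.
have -> : f x - f y = \sum_(k < n) (f (h k.+1) - f (h k)).
  rewrite -(big_mkord xpredT (fun k => f (h k.+1) - f (h k))) telescope_sumr//.
  by congr (f _ - f _); apply/rowP => k; rewrite mxE ?ltn_ord.
by apply: eq_bigr => k _; have [] := pP k.
Qed.

End calculus.

(** * Bounded measurable functions against finite measures *)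

Section bounded_measurable.
Context {R : realType}.

(** A class stable under all operations below and integrable for every finite measure, so that
    linearity and Fubini hold without side conditions. The functions [f j] are truncated in order to
    fall into it. *)
Definition bm d (T : measurableType d) (f : T -> R) :=
  measurable_fun setT f /\ exists K : R, forall x, `|f x| <= K.

Section theory.
Context d (T : measurableType d).
Implicit Types (f g : T -> R).

Lemma bm_cst (c : R) : bm (fun _ : T => c).
Proof. by split; [exact: measurable_cst|exists `|c|]. Qed.

Lemma bmD f g : bm f -> bm g -> bm (fun x => f x + g x).
Proof.
move=> [mf [K fK]] [mg [L gL]]; split; first exact: measurable_funD.
by exists (K + L) => x; rewrite (le_trans (ler_normD _ _))// lerD.
Qed.

Lemma bmM f g : bm f -> bm g -> bm (fun x => f x * g x).
Proof.
move=> [mf [K fK]] [mg [L gL]]; split; first exact: measurable_funM.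
by exists (K * L) => x; rewrite normrM ler_pM.
Qed.

Lemma bmZ (c : R) f : bm f -> bm (fun x => c * f x).
Proof. by move=> bf; apply: bmM => //; exact: bm_cst. Qed.

Lemma bmN f : bm f -> bm (fun x => - f x).
Proof. by move=> bf; have := bmZ (-1) bf; under eq_fun do rewrite mulN1r. Qed.

Lemma bmB f g : bm f -> bm g -> bm (fun x => f x - g x).
Proof. by move=> bf bg; apply: bmD => //; exact: bmN. Qed.

Lemma bm_norm f : bm f -> bm (fun x => `|f x|).
Proof.
move=> [mf [K fK]]; split; last by exists K => x; rewrite normr_id.
exact: measurableT_comp.
Qed.

Lemma bmX f k : bm f -> bm (fun x => f x ^+ k).
Proof.
move=> bf; elim: k => [|k IH]; first by under eq_fun do rewrite expr0; exact: bm_cst.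
by under eq_fun do rewrite exprS; exact: bmM.
Qed.

Lemma bm_cos f : measurable_fun setT f -> bm (fun x => cos (f x)).
Proof.
move=> mf; split; last by exists 1 => x; rewrite ler_norml cos_geN1 cos_le1.
by apply: measurableT_comp mf; apply: continuous_measurable_fun; exact: continuous_cos.
Qed.

Lemma bm_sin f : measurable_fun setT f -> bm (fun x => sin (f x)).
Proof.
move=> mf; split; last by exists 1 => x; rewrite ler_norml sin_geN1 sin_le1.
by apply: measurableT_comp mf; apply: continuous_measurable_fun; exact: continuous_sin.
Qed.

Lemma bm_comp d' (T' : measurableType d') (h : T' -> T) f :
  measurable_fun setT h -> bm f -> bm (fun x => f (h x)).
Proof.
move=> mh [mf [K fK]]; split; last by exists K.
exact: measurableT_comp.
Qed.

Lemma bm_prod (I : Type) (s : seq I) (f : I -> T -> R) :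
  (forall i, bm (f i)) -> bm (fun x => \prod_(i <- s) f i x).
Proof.
move=> bf; elim: s => [|i s IH]; first by under eq_fun do rewrite big_nil; exact: bm_cst.
by under eq_fun do rewrite big_cons; exact: bmM.
Qed.

Lemma bm_sum (I : Type) (s : seq I) (f : I -> T -> R) :
  (forall i, bm (f i)) -> bm (fun x => \sum_(i <- s) f i x).
Proof.
move=> bf; elim: s => [|i s IH]; first by under eq_fun do rewrite big_nil; exact: bm_cst.
by under eq_fun do rewrite big_cons; exact: bmD.
Qed.

Variable m : {finite_measure set T -> \bar R}.

Lemma bm_integrable f : bm f -> m.-integrable setT (EFin \o f).
Proof.
move=> [mf [K fK]]; apply: measurable_bounded_integrable => //.
  by rewrite -ge0_fin_numE// fin_num_measure.
by exists K; split; rewrite ?num_real// => x xK t _; exact: le_trans (fK t) (ltW xK).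
Qed.

Lemma le_bm_Rintegral f g : bm f -> bm g -> (forall x, f x <= g x) ->
  \int[m]_x f x <= \int[m]_x g x.
Proof. by move=> bf bg fg; apply: le_Rintegral => //; exact: bm_integrable. Qed.

Lemma bm_le_norm f : bm f -> `|\int[m]_x f x| <= \int[m]_x `|f x|.
Proof. by move=> bf; apply: le_normr_Rintegral => //; exact: bm_integrable. Qed.

Lemma bm_RintegralD f g : bm f -> bm g ->
  \int[m]_x (f x + g x) = \int[m]_x f x + \int[m]_x g x.
Proof. by move=> bf bg; rewrite RintegralD//; exact: bm_integrable. Qed.

Lemma bm_RintegralB f g : bm f -> bm g ->
  \int[m]_x (f x - g x) = \int[m]_x f x - \int[m]_x g x.
Proof. by move=> bf bg; rewrite RintegralB//; exact: bm_integrable. Qed.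

Lemma bm_RintegralZ (c : R) f : bm f -> \int[m]_x (c * f x) = c * \int[m]_x f x.
Proof. by move=> bf; rewrite RintegralZl//; exact: bm_integrable. Qed.

Lemma bm_Rintegral_sum (I : Type) (s : seq I) (f : I -> T -> R) :
  (forall i, bm (f i)) -> \int[m]_x (\sum_(i <- s) f i x) = \sum_(i <- s) \int[m]_x f i x.
Proof.
move=> bf; elim: s => [|i s IH].
  by under eq_Rintegral do rewrite big_nil; rewrite Rintegral_cst// mul0r big_nil.
under eq_Rintegral do rewrite big_cons.
by rewrite bm_RintegralD ?IH ?big_cons//; exact: bm_sum.
Qed.

Lemma le_bm_bound f (K : R) : bm f -> (forall x, `|f x| <= K) ->
  `|\int[m]_x f x| <= K * fine (m setT).
Proof.
move=> bf fK; rewrite (le_trans (bm_le_norm bf))//.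
rewrite -(@Rintegral_cst _ _ _ m setT)//.
by apply: le_bm_Rintegral => //; [exact: bm_norm|exact: bm_cst].
Qed.

(** The quadratic form [Q] is nonnegative, and at [(P, - A)] it equals [A (A B - P^2)]. *)
Lemma bm_cauchy_schwarz f g : bm f -> bm g ->
  (\int[m]_x (f x * g x)) ^+ 2 <= \int[m]_x (f x ^+ 2) * \int[m]_x (g x ^+ 2).
Proof.
move=> bf bg; set A := \int[m]_x (f x ^+ 2); set B := \int[m]_x (g x ^+ 2).
set P := \int[m]_x _.
have Q (s t : R) : 0 <= s ^+ 2 * A + 2 * (s * t) * P + t ^+ 2 * B.
  have -> : s ^+ 2 * A + 2 * (s * t) * P + t ^+ 2 * B =
      \int[m]_x ((s * f x + t * g x) ^+ 2).
    have bff := bmX 2 bf; have bgg := bmX 2 bg; have bfg := bmM bf bg.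
    rewrite -(bm_RintegralZ _ bff) -(bm_RintegralZ _ bfg) -(bm_RintegralZ _ bgg).
    have b1 := bmZ (s ^+ 2) bff; have b2 := bmZ (2 * (s * t)) bfg; have b3 := bmZ (t ^+ 2) bgg.
    rewrite -(bm_RintegralD b1 b2) -(bm_RintegralD (bmD b1 b2) b3).
    by apply: eq_Rintegral => x _; ring.
  by apply: Rintegral_ge0 => x _; exact: sqr_ge0.
have A0 : 0 <= A by apply: Rintegral_ge0 => x _; exact: sqr_ge0.
have B0 : 0 <= B by apply: Rintegral_ge0 => x _; exact: sqr_ge0.
have [A1|A1] := eqVneq A 0.
  have [->|P0] := eqVneq P 0; first by rewrite expr0n mulr_ge0.
  (* With [A = 0] the form is affine in its first variable, and unless [P = 0] this choice gives it
     the value -1. *)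
  have := Q (- (B + 1) / (2 * P)) 1; rewrite A1 mulr0 add0r expr1n mul1r mulr1.
  by rewrite (_ : _ + B = - 1) ?ler0N1//; field.
have := Q P (- A).
rewrite (_ : P ^+ 2 * A + 2 * (P * - A) * P + (- A) ^+ 2 * B = A * (A * B - P ^+ 2)); last by ring.
by rewrite pmulr_rge0 ?subr_ge0// lt_def A1.
Qed.

End theory.

Lemma bm_Rint d1 d2 (T1 : measurableType d1) (T2 : measurableType d2)
    (m2 : {finite_measure set T2 -> \bar R}) (f : T1 * T2 -> R) :
  bm f -> bm (fun x => \int[m2]_y f (x, y)).
Proof.
move=> bf; have [mf [K fK]] := bf; split; last first.
  exists (K * fine (m2 setT)) => x; apply: le_bm_bound => //.
  exact: (bm_comp (pair1_measurable x) bf).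
(* Only measurability in [x] is at stake; the zero measure on [T1] makes the integrability required
   by the library lemma trivial. *)
pose m1 : {finite_measure set T1 -> \bar R} := mzero.
have i12 : (m1 \x m2)%E.-integrable setT (EFin \o f).
  apply/integrable12ltyP; first exact/measurable_EFinP.
  by rewrite integral_measure_zero.
have := measurable_fubini_F i12; rewrite /fubini_F => h.
by apply: (measurableT_comp (fine_measurable measurableT) h).
Qed.

Lemma bm_integrable_prod d1 d2 (T1 : measurableType d1) (T2 : measurableType d2)
    (m1 : {finite_measure set T1 -> \bar R})
    (m2 : {finite_measure set T2 -> \bar R}) (f : T1 * T2 -> R) :
  bm f -> (m1 \x m2)%E.-integrable setT (EFin \o f).
Proof.
move=> [mf [K fK]]; apply: measurable_bounded_integrable => //.
  have := @product_measure1E _ _ _ _ _ m1 m2 _ _ measurableT measurableT.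
  rewrite setXTT /= => ->; rewrite lte_mul_pinfty// ?fin_num_measure//.
  by rewrite -ge0_fin_numE// fin_num_measure.
by exists K; split; rewrite ?num_real// => x xK t _; exact: le_trans (fK t) (ltW xK).
Qed.

Lemma bm_Fubini d1 d2 (T1 : measurableType d1) (T2 : measurableType d2)
    (m1 : {finite_measure set T1 -> \bar R})
    (m2 : {finite_measure set T2 -> \bar R}) (f : T1 * T2 -> R) :
  bm f -> \int[m1]_x \int[m2]_y f (x, y) = \int[m2]_y \int[m1]_x f (x, y) /\
  \int[m1]_x \int[m2]_y f (x, y) = \int[(m1 \x m2)%E]_z f z.
Proof.
move=> bf; have [mf [K fK]] := bf.
have b1 x : bm (fun y => f (x, y)) by exact: (bm_comp (pair1_measurable x) bf).
have b2 y : bm (fun x => f (x, y)) by exact: (bm_comp (pair2_measurable y) bf).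
have i12 := bm_integrable_prod m1 m2 bf.
have E1 : \int[m1]_x \int[m2]_y f (x, y) =
    fine (\int[m1]_x \int[m2]_y (EFin \o f) (x, y))%E.
  congr fine; apply: eq_integral => x _; rewrite fineK//.
  by apply: integrable_fin_num => //; exact: (bm_integrable m2 (b1 x)).
have E2 : \int[m2]_y \int[m1]_x f (x, y) =
    fine (\int[m2]_y \int[m1]_x (EFin \o f) (x, y))%E.
  congr fine; apply: eq_integral => y _; rewrite fineK//.
  by apply: integrable_fin_num => //; exact: (bm_integrable m1 (b2 y)).
by rewrite E1 E2 (Fubini i12); split=> //; rewrite -(Fubini i12) integral12_prod_meas1.
Qed.

End bounded_measurable.

(** * Boxes and open sets in the coordinate sigma-algebra *)

Section rV_measurability.
Variables (R : realType) (n : nat).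
Implicit Types (U : set 'rV[R]_n) (f : 'rV[R]_n -> R) (x y : 'rV[R]_n).

Definition box (A : 'I_n -> set R) : set 'rV[R]_n := [set x | forall i, A i (x 0 i)].

Lemma measurable_box (A : 'I_n -> set (measurableTypeR R)) :
  (forall i, measurable (A i)) -> measurable (box A).
Proof.
move=> mA; have -> : box A = \bigcap_(i in [set: 'I_n]) [set x | A i (x 0 i)].
  by apply/seteqP; split=> x Ax i => [_|]; exact: Ax.
apply: fin_bigcap_measurable => // i _.
by have := @measurable_coord R n i measurableT _ (mA i); rewrite setTI.
Qed.

Lemma nearboxE x (e : R) : nearbox x e = box (fun k => `[x 0 k - e, x 0 k + e]%classic).
Proof.
by apply/seteqP; split=> y xy k; have := xy k; rewrite /= in_itv/= ler_distl.
Qed.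

(** An open set is the union of the rational boxes that it contains, and there are countably many of
    these. *)
Lemma open_measurable_rV U : open U -> measurable U.
Proof.
move=> oU; pose F (p : 'rV[rat]_n * nat) : set 'rV[R]_n :=
  if pselect (nearbox (map_mx ratr p.1) (p.2.+1%:R^-1) `<=` U) then
    nearbox (map_mx ratr p.1) (p.2.+1%:R^-1) else set0.
have -> : U = \bigcup_p F p.
  apply/seteqP; split=> [x Ux|x [p _]]; last by rewrite /F; case: pselect => // h; exact: h.
  have /nbhs_nearbox[e e0 eU] := open_nbhs_nbhs (conj oU Ux).
  (* With [1 / (k + 1) < e / 2], the box of radius [1 / (k + 1)] about a rational point that is this
     close to [x] stays within the box of radius [e] about [x]. *)
  pose k := Num.truncn (2 / e); have ke : k.+1%:R^-1 < e / 2 :> R.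
    by rewrite invf_plt ?posrE ?divr_gt0// invf_div truncnS_gt.
  have k0 : 0 < k.+1%:R^-1 :> R by rewrite invr_gt0.
  have hq i : exists q : rat, x 0 i - k.+1%:R^-1 < ratr q < x 0 i + k.+1%:R^-1.
    have h : x 0 i - k.+1%:R^-1 < x 0 i + k.+1%:R^-1.
      by rewrite ltrD2l (lt_trans _ k0)// oppr_lt0.
    by have [q] := rat_in_itvoo h; rewrite in_itv/=; exists q.
  have [q qP] := choice hq; exists (\row_i q i, k) => //; rewrite /F/=.
  move: ke k0 qP; move: (k.+1%:R^-1) => r ke k0 qP.
  case: pselect => [h|nh]; last case: nh.
    by move=> i; rewrite !mxE ler_distl; have := qP i; lra.
  move=> y qy; apply: eU => i; have := qy i; rewrite !mxE !ler_distl; have := qP i; lra.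
apply: countable_bigcupT_measurable => [|p]; first exact: (@countableP ('rV[rat]_n * nat)%type).
rewrite /F; case: pselect => h /=; last exact: measurable0.
by rewrite nearboxE; apply: measurable_box => i; exact: measurable_itv.
Qed.

Lemma cont_measurable_rV U f : open U -> (forall x, U x -> {for x, continuous f}) ->
  measurable_fun U f.
Proof.
move=> oU cf; apply: (measurability _ (RGenOInfty.measurableE R)).
move=> _ [_ [a ->] <-]; apply: open_measurable_rV; rewrite openE => x [Ux /=].
rewrite in_itv/= andbT => afx; apply: filterI; first exact: open_nbhs_nbhs.
have := cf x Ux _ (lt_nbhsr afx).
by rewrite nbhs_simpl/=; apply: filterS => y; rewrite /= in_itv/= andbT.
Qed.

Lemma measurable_patch U f : measurable U -> measurable_fun U f ->
  measurable_fun setT (f \_ U).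
Proof. by move=> mU; exact: (measurable_restrictT f mU).1. Qed.

(** Boxes are stable under intersection and generate the sigma-algebra, and the total mass is
    finite. *)
Lemma box_measure_unique (m1 m2 : {measure set 'rV[R]_n -> \bar R}) :
  (m1 setT < +oo)%E ->
  (forall A : 'I_n -> set (measurableTypeR R), (forall i, measurable (A i)) ->
    m1 (box A) = m2 (box A)) ->
  forall X, measurable X -> m1 X = m2 X.
Proof.
move=> fm m12.
pose G := [set X : set 'rV[R]_n | exists2 A : 'I_n -> set (measurableTypeR R),
  (forall i, measurable (A i)) & X = box A].
have GT : G setT by exists (fun=> setT) => //; apply/seteqP; split.
apply: (measure_unique G (fun=> setT)) => //.
- apply/seteqP; split.
    apply: smallest_sub; first exact: smallest_sigma_algebra.
    rewrite -bigcup_seq/=; apply: bigcup_sub => i _ _ [B mB <-].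
    apply: sub_sigma_algebra; exists (fun j => if j == i then B else setT).
      by move=> j; case: ifP.
    apply/seteqP; split=> [x [_ Bx] j|x xB].
      by case: eqP => [->|].
    by split=> //; have := xB i; rewrite eqxx.
  apply: smallest_sub; first exact: sigma_algebra_measurable.
  by move=> _ [A mA ->]; exact: measurable_box.
- move=> _ _ [A mA ->] [B mB ->]; exists (fun i => A i `&` B i) => [i|].
    exact: measurableI.
  by apply/seteqP; split=> [x [Ax Bx] i|x AB]; [split|split=> i; have [] := AB i].
- by rewrite bigcup_const.
- by move=> _ [A mA ->]; exact: m12.
Qed.

End rV_measurability.

(** * Lebesgue measure on a cube and its splittings into coordinates *)

Section cube_measure.
Variable R : realType.
Local Notation leb := (@lebesgue_measure R).

Definition mitv (b : R) : set (measurableTypeR R) := `[- b, b]%classic.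

Lemma measurable_mitv b : measurable (mitv b). Proof. exact: measurable_itv. Qed.

Lemma mitv_fin b : (leb (mitv b) < +oo)%E.
Proof. by rewrite lebesgue_measure_itv/=; case: ifP => _; rewrite ?ltry// -EFinD ltry. Qed.

Definition itvM (b : R) : {finite_measure set (measurableTypeR R) -> \bar R} :=
  mfrestr (measurable_mitv b) (mitv_fin b).

Definition ell (b : R) (A : set (measurableTypeR R)) : R := fine (itvM b A).

Lemma ellE b A : measurable A -> itvM b A = (ell b A)%:E.
Proof. by move=> mA; rewrite fineK// fin_num_measure. Qed.

Lemma closed_cubeE n b : closed_cube b = box (fun _ : 'I_n => mitv b).
Proof. by apply/seteqP; split=> x xb i; have := xb i; rewrite /mitv/= in_itv/= ler_norml. Qed.

Lemma lebesgue_rV_box n (A : 'I_n -> set (measurableTypeR R)) :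
  (forall i, measurable (A i)) ->
  lebesgue_rV R n (box A) = (\prod_(i < n) leb (A i))%E.
Proof.
elim: n A => [|n IH] A mA.
  by rewrite big_ord0/= diracE mem_set// => -[].
rewrite big_ord_recl -IH// -product_measure1E//; last exact: measurable_box.
rewrite /= /lebesgue_rV_step /pushforward; congr (product_measure1 _ _ _).
apply/seteqP; split=> -[t y] /=.
  move=> h; split => /= [|i]; first by have := h ord0; rewrite rV_consE unlift_none.
  by have := h (lift ord0 i); rewrite rV_consE liftK.
by move=> [/= At Ay] i; rewrite rV_consE; case: unliftP => [j ->|->] //; exact: Ay.
Qed.

Lemma measurable_cube n b : measurable (closed_cube b : set 'rV[R]_n).
Proof. by rewrite closed_cubeE; apply: measurable_box => i; exact: measurable_mitv. Qed.

Lemma prode_fin (I : Type) (s : seq I) (F : I -> \bar R) :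
  (forall i, F i \is a fin_num) ->
  (\prod_(i <- s) F i = (\prod_(i <- s) fine (F i))%:E)%E.
Proof.
move=> Ff; elim: s => [|i s IH]; first by rewrite !big_nil.
by rewrite !big_cons IH EFinM fineK.
Qed.

Lemma lebesgue_cube_box n b (A : 'I_n -> set (measurableTypeR R)) :
  (forall i, measurable (A i)) ->
  lebesgue_rV R n (box A `&` closed_cube b) = (\prod_(i < n) ell b (A i))%:E.
Proof.
move=> mA; rewrite closed_cubeE.
have -> : box A `&` box (fun=> mitv b) = box (fun i => A i `&` mitv b).
  by apply/seteqP; split=> [x [Ax Bx] i|x AB]; [split|split=> i; have [] := AB i].
rewrite lebesgue_rV_box; last by move=> i; apply: measurableI => //; exact: measurable_mitv.
rewrite prode_fin// => i; exact: (@fin_num_measure _ _ _ (itvM b) (A i) (mA i)).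
Qed.

Lemma cube_fin n b : (lebesgue_rV R n (closed_cube b) < +oo)%E.
Proof.
have := @lebesgue_cube_box n b (fun=> setT) (fun=> measurableT).
rewrite (_ : box _ = setT) ?setTI; first by move=> ->; rewrite ltry.
by apply/seteqP; split.
Qed.

(** Integrals over a cube are written as integrals against a finite measure on the whole space, for
    which every [bm] function is integrable. *)
Definition cubeM n (b : R) : {finite_measure set 'rV[R]_n -> \bar R} :=
  mfrestr (@measurable_cube n b) (@cube_fin n b).

Lemma cubeM_box n b (A : 'I_n -> set (measurableTypeR R)) :
  (forall i, measurable (A i)) -> cubeM n b (box A) = (\prod_(i < n) ell b (A i))%:E.
Proof. exact: lebesgue_cube_box. Qed.

Lemma ell_setT b : 0 <= b -> ell b setT = 2 * b.
Proof.
move=> b0; rewrite /ell /= /mfrestr /mrestr setTI lebesgue_measure_itv/= lte_fin.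
by case: ltP => /= h; lra.
Qed.

Lemma cubeM_setT n b : 0 <= b -> cubeM n b setT = ((2 * b) ^+ n)%:E.
Proof.
move=> b0; rewrite (_ : setT = box (fun=> setT)); last by apply/seteqP; split.
by rewrite cubeM_box//; under eq_bigr do rewrite ell_setT//; rewrite prodr_const card_ord.
Qed.

Lemma transfer_Rintegral d1 d2 (X : measurableType d1) (Y : measurableType d2)
    (m1 : {measure set X -> \bar R}) (m2 : {measure set Y -> \bar R})
    (phi : X -> Y) (F : Y -> R) : measurable_fun setT phi ->
  (forall B, measurable B -> m1 (phi @^-1` B) = m2 B) -> measurable_fun setT F ->
  m1.-integrable setT (EFin \o (F \o phi)) ->
  \int[m2]_y F y = \int[m1]_x F (phi x).
Proof.
move=> mphi m12 mF iF; pose phi' : {mfun X >-> Y} := HB.pack phi (isMeasurableFun.Build _ _ _ _ phi mphi).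
transitivity (fine (\int[pushforward m1 phi']_y (F y)%:E)%E).
  by congr fine; apply: eq_measure_integral => B mB _; rewrite -m12.
by rewrite /Rintegral integral_pushforward//; exact/measurable_EFinP.
Qed.

Lemma mfrestr_Rintegral d (T : measurableType d) (m : {measure set T -> \bar R})
    (D : set T) (mD : measurable D) (fD : (m D < +oo)%E) (f : T -> R) : bm f ->
  \int[mfrestr mD fD]_x f x = \int[m]_(x in D) f x.
Proof.
move=> bf; set m' := mfrestr mD fD.
have D0 : \int[m']_(x in ~` D) f x = 0.
  rewrite /Rintegral null_set_integral//; first exact: measurableC.
    by apply: measurable_funTS; apply/measurable_EFinP; case: bf.
  by rewrite -[LHS]/(m (~` D `&` D)) setICl measure0.
rewrite -(setUv D) Rintegral_setU//=; last 3 first.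
- exact: measurableC.
- by rewrite setUv; exact: (bm_integrable m' bf).
- by apply/disj_set2P; rewrite setICr.
rewrite D0 addr0; congr fine; apply: eq_measure_integral => A mA AD.
by rewrite -[LHS]/(m (A `&` D)) setIidl.
Qed.

(* [mix i j u v] has the coordinates u at the indices i and v at the indices j. *)
Definition mix d n (i j : 'I_d -> 'I_n) (p : 'rV[R]_d * 'rV[R]_d) : 'rV[R]_n :=
  \row_k if [pick l | i l == k] is Some l then p.1 0 l
         else if [pick l | j l == k] is Some l then p.2 0 l else 0.

Section mix.
Variables (d n : nat) (i j : 'I_d -> 'I_n).
Hypothesis ij : is_bipartition i j.

Lemma mix_ij l m : i l != j m.
Proof.
have [_ _ E] := ij; apply/negP => /eqP lm.
have : i l \in [set k | k \in codom i]%SET by rewrite inE codom_f.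
by rewrite E !inE lm codom_f.
Qed.

Lemma mixl p l : mix i j p 0 (i l) = p.1 0 l.
Proof.
have [injl _ _] := ij; rewrite mxE; case: pickP => [m /eqP/injl ->//|/(_ l)].
by rewrite eqxx.
Qed.

Lemma mixr p l : mix i j p 0 (j l) = p.2 0 l.
Proof.
have [_ injr _] := ij; rewrite mxE; case: pickP => [m|_].
  by rewrite (negbTE (mix_ij _ _)).
by case: pickP => [m /eqP/injr ->//|/(_ l)]; rewrite eqxx.
Qed.

Lemma mix_split k : (exists l, k = i l) \/ (exists l, k = j l).
Proof.
have [_ _ E] := ij; have [/codomP[l ->]|ki] := boolP (k \in codom i).
  by left; exists l.
have : k \in ~: [set k | k \in codom i]%SET by rewrite !inE.
rewrite E finset.setCK inE => /codomP[l ->].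
by right; exists l.
Qed.

Lemma measurable_mix : measurable_fun setT (mix i j).
Proof.
apply: measurable_fun_coordP => k; have [[l ->]|[l ->]] := mix_split k.
  under eq_fun do rewrite mixl.
  exact: (measurableT_comp (measurable_coord l) measurable_fst).
under eq_fun do rewrite mixr.
exact: (measurableT_comp (measurable_coord l) measurable_snd).
Qed.

Lemma big_mix (G : 'I_n -> R) : \prod_k G k = \prod_l G (i l) * \prod_l G (j l).
Proof.
have [injl injr E] := ij.
rewrite (bigID (fun k => k \in codom i))/=; congr (_ * _).
  rewrite -(big_imset (h := i) (A := predT) G) /=; last by move=> ? ? _ _; exact: injl.
  by apply: eq_bigl => k; apply/idP/imsetP => [/codomP[l ->]|[l _ ->]]; [exists l|exact: codom_f].
rewrite -(big_imset (h := j) (A := predT) G) /=; last by move=> ? ? _ _; exact: injr.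
apply: eq_bigl => k; have := mix_split k.
have : k \in [set k | k \in codom i]%SET = (k \notin [set k | k \in codom j]%SET) by rewrite E inE.
rewrite !inE => -> _; rewrite negbK.
by apply/idP/imsetP => [/codomP[l ->]|[l _ ->]]; [exists l|exact: codom_f].
Qed.

(** The image of the product measure under [mix] and the measure of the cube agree on boxes, where
    both are products over all coordinates; [box_measure_unique] extends this to all measurable
    sets. [integral_ins] has the same proof. *)
Lemma integral_mix (b : R) (F : 'rV[R]_n -> R) : bm F ->
  \int[cubeM n b]_x F x = \int[cubeM d b]_u \int[cubeM d b]_v F (mix i j (u, v)).
Proof.
move=> bF; have bFm : bm (fun p => F (mix i j p)) by exact: bm_comp measurable_mix bF.
have [_ ->] := bm_Fubini (cubeM d b) (cubeM d b) bFm.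
apply: (@transfer_Rintegral _ _ _ _ (cubeM d b \x cubeM d b)%E (cubeM n b)) => //.
- exact: measurable_mix.
- pose phi : {mfun _ >-> _} := HB.pack (mix i j) (isMeasurableFun.Build _ _ _ _ (mix i j) measurable_mix).
  move=> B mB; symmetry.
  apply: (@box_measure_unique R n (cubeM n b) (pushforward (cubeM d b \x cubeM d b)%E phi)) => //.
    by rewrite -ge0_fin_numE// fin_num_measure.
  move=> A mA; transitivity (\prod_(l < n) ell b (A l))%:E; first exact: cubeM_box.
  rewrite big_mix EFinM.
  rewrite -(cubeM_box b (A := fun l => A (i l)))// -(cubeM_box b (A := fun l => A (j l)))//.
  rewrite -product_measure1E; [|exact: measurable_box..].
  rewrite /= /pushforward; congr (product_measure1 _ _ _).
  apply/seteqP; split=> [[u v] [/= Au Av] k|[u v] /= h].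
    by have [[l ->]|[l ->]] := mix_split k; rewrite ?mixl ?mixr.
  by split=> l /=; [have := h (i l); rewrite mixl|have := h (j l); rewrite mixr].
- by case: bF.
- exact: bm_integrable_prod.
Qed.

End mix.

(* [ins k (t, y)] inserts the coordinate t at position k. *)
Definition ins n (k : 'I_n.+1) (p : measurableTypeR R * 'rV[R]_n) : 'rV[R]_n.+1 :=
  \row_l if unlift k l is Some m then p.2 0 m else p.1.

Section ins.
Variables (n : nat) (k : 'I_n.+1).

Lemma ins_same p : ins k p 0 k = p.1.
Proof. by rewrite mxE unlift_none. Qed.

Lemma ins_lift p l : ins k p 0 (lift k l) = p.2 0 l.
Proof. by rewrite mxE liftK. Qed.

Lemma measurable_ins : measurable_fun setT (ins k).
Proof.
apply: measurable_fun_coordP => l; case: (unliftP k l) => [m ->|->].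
  under eq_fun do rewrite ins_lift.
  exact: (measurableT_comp (measurable_coord m) measurable_snd).
by under eq_fun do rewrite ins_same; exact: measurable_fst.
Qed.

Lemma ins_line (t : R) (y : 'rV[R]_n) : ins k (t, y) = ins k (0, y) + t *: unitv R k.
Proof.
apply/rowP => l; rewrite !mxE eqxx /=; case: unliftP => [m ->|->].
  by rewrite eq_sym (negbTE (neq_lift _ _)) mulr0 addr0.
by rewrite eqxx mulr1 add0r.
Qed.

Lemma ins_col' (x : 'rV[R]_n.+1) : ins k (x 0 k, col' k x) = x.
Proof. by apply/rowP => l; rewrite !mxE; case: unliftP => [m ->|->]; rewrite ?mxE. Qed.

Lemma integral_ins (b : R) (F : 'rV[R]_n.+1 -> R) : bm F ->
  \int[cubeM n.+1 b]_x F x = \int[cubeM n b]_y \int[itvM b]_t F (ins k (t, y)).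
Proof.
move=> bF; have bFm : bm (fun p => F (ins k p)) by exact: bm_comp measurable_ins bF.
have [<- E] := bm_Fubini (itvM b) (cubeM n b) bFm; rewrite {}E.
apply: (@transfer_Rintegral _ _ _ _ (itvM b \x cubeM n b)%E (cubeM n.+1 b)) => //.
- exact: measurable_ins.
- pose phi : {mfun _ >-> _} := HB.pack (ins k) (isMeasurableFun.Build _ _ _ _ (ins k) measurable_ins).
  move=> B mB; symmetry.
  apply: (@box_measure_unique R n.+1 (cubeM n.+1 b) (pushforward (itvM b \x cubeM n b)%E phi)) => //.
    by rewrite -ge0_fin_numE// fin_num_measure.
  move=> A mA; transitivity (\prod_(l < n.+1) ell b (A l))%:E; first exact: cubeM_box.
  rewrite (bigD1_ord k)//= EFinM.
  rewrite -ellE// -(cubeM_box b (A := fun l => A (lift k l)))//.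
  rewrite -product_measure1E//; [|exact: measurable_box].
  rewrite /= /pushforward; congr (product_measure1 _ _ _).
  apply/seteqP; split=> [[t y] [/= At Ay] l|[t y] /= h].
    by rewrite /=; case: (unliftP k l) => [m ->|->]; rewrite ?ins_same ?ins_lift//; exact: Ay.
  by split=> [|l] /=; [have := h k; rewrite ins_same|have := h (lift k l); rewrite ins_lift].
- by case: bF.
- exact: bm_integrable_prod.
Qed.

End ins.

Lemma cubeM_prod n b (u : 'I_n -> R -> R) : (forall i, bm (u i : measurableTypeR R -> R)) ->
  \int[cubeM n b]_x (\prod_i u i (x 0 i)) = \prod_i \int[itvM b]_t u i t.
Proof.
move=> bu; have bc m (v : 'I_m -> R -> R) : (forall i, bm (v i : measurableTypeR R -> R)) ->
    bm (fun x : 'rV[R]_m => \prod_i v i (x 0 i)).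
  by move=> bv; apply: bm_prod => i; exact: (bm_comp (measurable_coord i) (bv i)).
elim: n u bu => [|n IH] u bu.
  under eq_Rintegral do rewrite big_ord0.
  have := @cubeM_box 0 b (fun=> setT) (fun=> measurableT).
  rewrite big_ord0 (_ : box _ = setT); last by apply/seteqP; split.
  by move=> E; rewrite Rintegral_cst// mul1r big_ord0 (_ : fine _ = fine (1%:E : \bar R))// -E.
rewrite (integral_ins ord0 b (bc _ _ bu)) [RHS](bigD1_ord ord0)//= -IH//.
rewrite -bm_RintegralZ; last by apply: (bc _ (fun i => u (lift ord0 i))) => i; exact: bu.
apply: eq_Rintegral => y _; rewrite [RHS]mulrC -(bm_RintegralZ _ _ (bu ord0)).
apply: eq_Rintegral => t _; rewrite (bigD1_ord ord0)//= ins_same mulrC; congr (_ * _).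
by apply: eq_bigr => l _; rewrite ins_lift.
Qed.

End cube_measure.

(** * The TT-star argument with Schur's test *)

Section TTstar.
Context {R : realType} d1 d2 (U : measurableType d1) (Y : measurableType d2).
Variables (mU : {finite_measure set U -> \bar R}) (mY : {finite_measure set Y -> \bar R}).

(** [Kc] and [Ks] are the real and imaginary parts of one complex kernel, and the sum of their
    products is the real part of K(y, u) times the conjugate of K(y, v), so that only the difference
    of two phases occurs. The square that belongs to [Ks] is added for this purpose; being
    nonnegative, it can only increase the bound. *)
Lemma TTstar (F : U -> R) (G eta : Y -> R) (Q : set Y) (Kc Ks : Y * U -> R)
    (L : U * U -> R) (S : R) :
  bm F -> bm G -> bm eta -> measurable Q -> bm Kc -> bm Ks -> bm L ->
  (forall y, ~ Q y -> G y = 0) -> (forall y, 0 <= eta y) -> (forall y, Q y -> 1 <= eta y) ->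
  (forall u v, L (u, v) = L (v, u)) -> (forall u v, 0 <= L (u, v)) ->
  (forall u, F u != 0 -> \int[mU]_v L (u, v) <= S) ->
  (forall u v, F u != 0 -> F v != 0 ->
    `|\int[mY]_y (eta y * (Kc (y, u) * Kc (y, v) + Ks (y, u) * Ks (y, v)))| <= L (u, v)) ->
  (\int[mY]_y (G y * \int[mU]_u (F u * Kc (y, u)))) ^+ 2 <=
    S * \int[mY]_y (G y ^+ 2) * \int[mU]_u (F u ^+ 2).
Proof.
move=> bF bG be mQ bKc bKs bL GQ e0 e1 Lsym L0 LS KL.
have bH (K : Y * U -> R) : bm K -> bm (fun y => \int[mU]_u (F u * K (y, u))).
  move=> bK; apply: (bm_Rint mU (f := fun p => F p.2 * K p)).
  by apply: bmM => //; exact: (bm_comp measurable_snd bF).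
pose H (K : Y * U -> R) y := \int[mU]_u (F u * K (y, u)).
have bH1 : bm (fun y => (\1_Q y : R) * H Kc y).
  apply: bmM; last exact: bH.
  split; first exact: measurable_indic.
  by exists 1 => y; rewrite indicE; case: (_ \in _); rewrite ?normr1 ?normr0.
(* [G] lives on [Q], so the indicator of [Q] can be inserted before Cauchy-Schwarz and replaced by
   [eta] only afterwards. *)
have -> : \int[mY]_y (G y * \int[mU]_u (F u * Kc (y, u))) =
    \int[mY]_y (G y * (\1_Q y * H Kc y)).
  apply: eq_Rintegral => y _; rewrite indicE; case: (boolP (y \in Q)) => [_|]; first by rewrite mul1r.
  by move=> /negP; rewrite inE => /GQ ->; rewrite !mul0r.
apply: le_trans (bm_cauchy_schwarz mY bG bH1) _.
rewrite mulrAC [X in _ <= X]mulrC ler_wpM2l//.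
  by apply: Rintegral_ge0 => y _; exact: sqr_ge0.
pose g y u v := eta y * (F u * F v * (Kc (y, u) * Kc (y, v) + Ks (y, u) * Ks (y, v))).
have m1 : measurable_fun setT (fun q : (Y * U) * U => q.1.1).
  exact: (measurableT_comp measurable_fst measurable_fst).
have m2 : measurable_fun setT (fun q : (Y * U) * U => q.1.2).
  exact: (measurableT_comp measurable_snd measurable_fst).
have m12 : measurable_fun setT (fun q : (Y * U) * U => (q.1.1, q.2)).
  by apply/measurable_fun_pairP; split; [exact: m1|exact: measurable_snd].
have bK2 (K : Y * U -> R) : bm K -> bm (fun q : (Y * U) * U => K q.1 * K (q.1.1, q.2)).
  by move=> bK; apply: bmM; [exact: (bm_comp measurable_fst bK)|exact: (bm_comp m12 bK)].
have bg : bm (fun q : (Y * U) * U => g q.1.1 q.1.2 q.2).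
  apply: bmM; first exact: (bm_comp m1 be).
  apply: bmM; first by apply: bmM; [exact: (bm_comp m2 bF)|exact: (bm_comp measurable_snd bF)].
  have -> : (fun q : (Y * U) * U => Kc (q.1.1, q.1.2) * Kc (q.1.1, q.2) + Ks (q.1.1, q.1.2) * Ks (q.1.1, q.2))
     = (fun q => Kc q.1 * Kc (q.1.1, q.2) + Ks q.1 * Ks (q.1.1, q.2)).
    by apply/funext => -[[]].
  by apply: bmD; exact: bK2.
(* Here [eta] takes the place of the indicator. A function smooth in [y] is what later allows
   integration by parts in [y]. *)
have le1 : \int[mY]_y ((\1_Q y * H Kc y) ^+ 2) <= \int[mY]_y \int[mU]_u \int[mU]_v g y u v.
  apply: le_bm_Rintegral; first exact: bmX.
    apply: (bm_Rint mU (f := fun p => \int[mU]_v g p.1 p.2 v)).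
    exact: (bm_Rint mU bg).
  move=> y; have HE (K : Y * U -> R) : bm K -> H K y ^+ 2 = \int[mU]_u \int[mU]_v (F u * F v * (K (y, u) * K (y, v))).
    move=> bK; have bFK : bm (fun u => F u * K (y, u)).
      by apply: bmM => //; exact: (bm_comp (pair1_measurable y) bK).
    rewrite expr2 -bm_RintegralZ//; apply: eq_Rintegral => u _.
    by rewrite mulrC -bm_RintegralZ//; apply: eq_Rintegral => v _; ring.
  have -> : \int[mU]_u \int[mU]_v g y u v = eta y * (H Kc y ^+ 2 + H Ks y ^+ 2).
    have bFF (K : Y * U -> R) : bm K -> bm (fun p : U * U => F p.1 * F p.2 * (K (y, p.1) * K (y, p.2))).
      move=> bK; have bK1 : bm (fun u => K (y, u)) by exact: (bm_comp (pair1_measurable y) bK).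
      apply: bmM; first by apply: bmM; [exact: (bm_comp measurable_fst bF)|exact: (bm_comp measurable_snd bF)].
      by apply: bmM; [exact: (bm_comp measurable_fst bK1)|exact: (bm_comp measurable_snd bK1)].
    have bFF2 (K : Y * U -> R) u : bm K -> bm (fun v => F u * F v * (K (y, u) * K (y, v))).
      by move=> bK; exact: (bm_comp (pair1_measurable u) (bFF K bK)).
    have bIK (K : Y * U -> R) (bK : bm K) := bm_Rint mU (bFF K bK).
    rewrite HE// HE// -bm_RintegralD ?bIK//; [|exact: bIK|exact: bIK].
    rewrite -bm_RintegralZ; last by apply: bmD; exact: bIK.
    apply: eq_Rintegral => u _; rewrite /= -bm_RintegralD; [|exact: bFF2|exact: bFF2].
    rewrite -bm_RintegralZ; last by apply: bmD; exact: bFF2.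
    by apply: eq_Rintegral => v _; rewrite /g; ring.
  have h0 : 0 <= H Kc y ^+ 2 + H Ks y ^+ 2 by rewrite addr_ge0 ?sqr_ge0.
  rewrite indicE; case: (boolP (y \in Q)) => [|_].
    rewrite inE => /e1 e1y; rewrite mul1r (le_trans (_ : _ <= H Kc y ^+ 2 + H Ks y ^+ 2))//.
      by rewrite lerDl sqr_ge0.
    by rewrite ler_peMl.
  by rewrite mul0r expr0n mulr_ge0.
apply: le_trans le1 _.
have [-> _] := bm_Fubini mY mU (f := fun p => \int[mU]_v g p.1 p.2 v) (bm_Rint mU bg).
pose g' u (p : Y * U) := g p.1 u p.2.
have bg' u : bm (g' u).
  have mm : measurable_fun setT (fun p : Y * U => ((p.1, u), p.2)).
    apply/measurable_fun_pairP; split; last exact: measurable_snd.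
    by apply/measurable_fun_pairP; split; [exact: measurable_fst|exact: measurable_cst].
  exact: (bm_comp mm bg).
have -> : \int[mU]_u \int[mY]_y \int[mU]_v g y u v = \int[mU]_u \int[mU]_v \int[mY]_y g y u v.
  by apply: eq_Rintegral => u _; have [] := bm_Fubini mY mU (bg' u).
have bFF : bm (fun p : U * U => L p * (F p.1 ^+ 2 + F p.2 ^+ 2)).
  apply: bmM => //; apply: bmD; apply: bmX.
    exact: (bm_comp measurable_fst bF).
  exact: (bm_comp measurable_snd bF).
have ble u v : \int[mY]_y g y u v <= 2^-1 * (L (u, v) * (F u ^+ 2 + F v ^+ 2)).
  have bKK : bm (fun y => eta y * (Kc (y, u) * Kc (y, v) + Ks (y, u) * Ks (y, v))).
    have bKu (K : Y * U -> R) w : bm K -> bm (fun y => K (y, w)) by move=> bK; exact: (bm_comp (pair2_measurable w) bK).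
    by apply: bmM => //; apply: bmD; apply: bmM; exact: bKu.
  have -> : \int[mY]_y g y u v = F u * F v * \int[mY]_y (eta y * (Kc (y, u) * Kc (y, v) + Ks (y, u) * Ks (y, v))).
    by rewrite -bm_RintegralZ//; apply: eq_Rintegral => y _; rewrite /g; ring.
  rewrite (le_trans (ler_norm _))// !normrM.
  have [->|Fu] := eqVneq (F u) 0.
    by rewrite normr0 !mul0r !mulr_ge0// addr_ge0 ?sqr_ge0.
  have [->|Fv] := eqVneq (F v) 0.
    by rewrite normr0 mulr0 mul0r !mulr_ge0// addr_ge0 ?sqr_ge0.
  apply: le_trans (ler_wpM2l _ (KL u v Fu Fv)) _; first by rewrite mulr_ge0.
  rewrite [X in X <= _]mulrC [X in _ <= X]mulrCA ler_wpM2l//.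
  rewrite -[F u ^+ 2]real_normK ?num_real// -[F v ^+ 2]real_normK ?num_real//.
  by have := sqr_ge0 (`|F u| - `|F v|); rewrite sqrrB; lra.
have bint : bm (fun u => \int[mU]_v \int[mY]_y g y u v).
  have bq : bm (fun p : (U * U) * Y => g p.2 p.1.1 p.1.2).
    have mm : measurable_fun setT (fun p : (U * U) * Y => ((p.2, p.1.1), p.1.2)).
      apply/measurable_fun_pairP; split; last exact: (measurableT_comp measurable_snd measurable_fst).
      apply/measurable_fun_pairP; split; first exact: measurable_snd.
      exact: (measurableT_comp measurable_fst measurable_fst).
    exact: (bm_comp mm bg).
  exact: (bm_Rint mU (f := fun p => \int[mY]_y g y p.1 p.2) (bm_Rint mY bq)).
have bint1 u : bm (fun v => \int[mY]_y g y u v).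
  have mm : measurable_fun setT (fun p : U * Y => (p.2, p.1)).
    by apply/measurable_fun_pairP; split; [exact: measurable_snd|exact: measurable_fst].
  exact: (bm_Rint mY (bm_comp mm (bg' u))).
have bFF1 u : bm (fun v => L (u, v) * (F u ^+ 2 + F v ^+ 2)).
  exact: (bm_comp (pair1_measurable u) bFF).
pose W := \int[mU]_u \int[mU]_v (L (u, v) * F u ^+ 2).
have bL1 : bm (fun p : U * U => L p * F p.1 ^+ 2).
  by apply: bmM => //; apply: bmX; exact: (bm_comp measurable_fst bF).
have bL2 : bm (fun p : U * U => L p * F p.2 ^+ 2).
  by apply: bmM => //; apply: bmX; exact: (bm_comp measurable_snd bF).
(* Schur's test: [F u * F v] was bounded by half the sum of the squares, and by the symmetry of [L]
   the two halves have the same integral [W]. *)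
apply: (@le_trans _ _ W).
  have E : W = \int[mU]_u \int[mU]_v (2^-1 * (L (u, v) * (F u ^+ 2 + F v ^+ 2))).
    have [E1 _] := bm_Fubini mU mU bL2.
    have E2 : W = \int[mU]_u \int[mU]_v (L (u, v) * F v ^+ 2).
      rewrite /= in E1; rewrite E1; apply: eq_Rintegral => u _; apply: eq_Rintegral => v _.
      by rewrite Lsym.
    rewrite (_ : W = 2^-1 * (W + W)); last by field.
    rewrite {2}E2 /W -bm_RintegralD; [|exact: (bm_Rint mU bL1)|exact: (bm_Rint mU bL2)].
    rewrite -bm_RintegralZ; last by apply: bmD; [exact: (bm_Rint mU bL1)|exact: (bm_Rint mU bL2)].
    apply: eq_Rintegral => u _; rewrite -bm_RintegralD;
      [|exact: (bm_comp (pair1_measurable u) bL1)|exact: (bm_comp (pair1_measurable u) bL2)].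
    rewrite -bm_RintegralZ; last by apply: bmD;
      [exact: (bm_comp (pair1_measurable u) bL1)|exact: (bm_comp (pair1_measurable u) bL2)].
    by apply: eq_Rintegral => v _ /=; rewrite [in RHS]mulrDr.
  have bFFu u : bm (fun v => 2^-1 * (L (u, v) * (F u ^+ 2 + F v ^+ 2))) := bmZ 2^-1 (bFF1 u).
  have bFFI : bm (fun u => \int[mU]_v (2^-1 * (L (u, v) * (F u ^+ 2 + F v ^+ 2)))) :=
    bm_Rint mU (bmZ 2^-1 bFF).
  rewrite E; apply: (le_bm_Rintegral mU bint bFFI) => u.
  exact: (le_bm_Rintegral mU (bint1 u) (bFFu u) (ble u)).
rewrite -bm_RintegralZ; last exact: bmX.
apply: le_bm_Rintegral => [||u]; [exact: (bm_Rint mU bL1)|by apply: bmZ; exact: bmX|].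
have [->|Fu] := eqVneq (F u) 0.
  by rewrite expr0n mulr0; under eq_Rintegral do rewrite mulr0; rewrite Rintegral_cst// mul0r.
under eq_Rintegral do rewrite mulrC.
rewrite bm_RintegralZ; last exact: (bm_comp (pair1_measurable u) bL).
by rewrite mulrC ler_wpM2r ?sqr_ge0// LS.
Qed.

End TTstar.

(** * Oscillatory integrals in t and along one coordinate of y *)

Section oscillation.
Variable R : realType.
Local Notation leb := (@lebesgue_measure R).

(** The [d + 1] factors are each at least [q43 r], so their product is at least
    [(1 + r)^(-4 (d + 1) / 3)], and [4 (d + 1) / 3 <= 2 d] says exactly that [2 <= d]. *)
Lemma q43_prod (d : nat) (r : R) (t : 'I_d -> R) (s : R) : (2 <= d)%N -> 0 <= r ->
  (forall l, `|t l| <= r) -> `|s| <= r ->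
  (1 + r) ^- (2 * d) <= (\prod_l q43 (t l)) * q43 s.
Proof.
move=> d2 r0 tr sr; have r1 : 1 <= 1 + r by rewrite lerDl.
have r1' : 0 <= 1 + r by rewrite (le_trans _ r1).
have qr x : `|x| <= r -> q43 r <= q43 x.
  move=> xr; rewrite /q43 (ger0_norm r0) !powRN lef_pV2 ?posrE ?powR_gt0 ?ltr_pwDl//.
  by rewrite ge0_ler_powR ?nnegrE ?addr_ge0 ?lerD2l// divr_ge0.
apply: (@le_trans _ _ (q43 r ^+ d.+1)); last first.
  rewrite exprSr ler_pM ?exprn_ge0 ?q43_ge0 ?qr//.
  rewrite -[d in X in X <= _]card_ord -prodr_const; apply: ler_prod => l _.
  by rewrite q43_ge0 qr.
rewrite -powR_invn// /q43 (ger0_norm r0) -powR_mulrn ?powR_ge0// -powRrM.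
apply: ler_powR => //; rewrite mulNr lerN2 natrM.
rewrite -[d.+1%:R]natr1; have : (2 : R) <= d%:R by rewrite ler_nat.
by move=> h; lra.
Qed.

Lemma Rintegral_itvM (b : R) (f : R -> R) : bm (f : measurableTypeR R -> R) ->
  \int[itvM b]_t f t = \int[leb]_(t in `[- b, b]) f t.
Proof. by move=> bf; rewrite /itvM mfrestr_Rintegral. Qed.

Lemma Rintegral_eqset (A B : set R) (f : R -> R) : 
  (forall t, (A t /\ ~ B t) \/ (B t /\ ~ A t) -> f t = 0) ->
  \int[leb]_(t in A) f t = \int[leb]_(t in B) f t.
Proof.
move=> AB; rewrite Rintegral_mkcond [RHS]Rintegral_mkcond; apply: eq_Rintegral => t _.
rewrite /patch; case: (boolP (t \in A)) => [|/negP]; case: (boolP (t \in B)) => [|/negP] //;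
  rewrite !inE => hB hA; [|symmetry]; apply: AB; tauto.
Qed.

(** The substitution [x = t - s]. As [|t| <= T], letting [s] run over the doubled interval makes
    [t - s] cover the support of [g]. *)
Lemma Rintegral_reflect (g : R -> R) (T t : R) : 0 < T -> `|t| <= T ->
  (forall x, {for x, continuous g}) -> bm (g : measurableTypeR R -> R) ->
  (forall x, T < `|x| -> g x = 0) ->
  \int[itvM T]_x g x = \int[itvM (2 * T)]_s g (t - s).
Proof.
move=> T0; rewrite ler_norml => /andP[Tt tT] cg bg g0.
have bgt : bm (fun s : measurableTypeR R => g (t - s)).
  apply: (bm_comp _ bg (h := fun s : measurableTypeR R => t - s)).
  by apply: measurable_funB => //; exact: measurable_cst.
rewrite !Rintegral_itvM// (@Rintegral_eqset _ `[t - 2 * T, t + 2 * T]); last first.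
  move=> x; rewrite /= !in_itv/= => h; apply: g0; rewrite ltNge ler_norml; apply/negP.
  by move=> /andP[h1 h2]; case: h => -[/andP[h3 h4] /negP]; rewrite negb_and -!ltNge => /orP[]; lra.
have dF (s : R) : is_derive s 1 (fun s : R => t - s) (- 1 : R).
  have := is_deriveB (is_derive_cst t s (1 : R)) (is_derive_id s (1 : R)).
  by rewrite sub0r.
have dE : derive1 (fun s : R => t - s) = cst (-1).
  by apply/funext => s; rewrite derive1E; have [_ ->] := dF s.
have cF (s : R) : {for s, continuous (fun s : R => t - s)} := is_derive_cont (dF s).
have TT : - (2 * T) <= 2 * T by lra.
pose F s : R := t - s.
transitivity (fine (\int[leb]_(x in `[F (2 * T)%R, F (- (2 * T))%R]) (g x)%:E)%E).
  by rewrite /F opprK.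
rewrite (integration_by_substitution_decreasing TT); last 6 first.
- by move=> x y _ _ /= xy; rewrite ltrD2l ltrN2.
- by rewrite dE => ? _; exact: cvg_cst.
- by rewrite dE; exact: is_cvg_cst.
- by rewrite dE; exact: is_cvg_cst.
- split; first by move=> s _; have [] := dF s.
    by apply: cvg_at_right_filter; exact: cF.
  by apply: cvg_at_left_filter; exact: cF.
- by apply: within_itv_continuous => x _; exact: cg.
by congr fine; apply: eq_integral => s _; rewrite !fctE dE /= opprK mulr1.
Qed.

Lemma osc_0 d (b T a e KA KB : R) (A : R -> R) (B : 'rV[R]_d -> R)
    (P : 'rV[R]_d * measurableTypeR R -> R) :
  0 <= b -> - T <= a -> e <= T -> a <= e -> 0 <= KA -> 0 <= KB ->
  (forall t, t < a \/ e < t -> A t = 0) -> bm (A : measurableTypeR R -> R) ->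
  (forall t, `|A t| <= KA) -> bm B -> (forall y, `|B y| <= KB) -> measurable_fun setT P ->
  (forall y, {in `[a, e], continuous (fun t => A t * cos (P (y, t)))}) ->
  `|\int[cubeM d b]_y \int[itvM T]_t (B y * (A t * cos (P (y, t))))|
    <= KA * KB * (e - a) * (2 * b) ^+ d.
Proof.
move=> b0 Ta eT ae KA0 KB0 vA bA AK bB BK mP cP.
have bI : bm (fun p : 'rV[R]_d * measurableTypeR R => B p.1 * (A p.2 * cos (P p))).
  apply: bmM; first exact: (bm_comp measurable_fst bB).
  by apply: bmM; [exact: (bm_comp measurable_snd bA)|exact: bm_cos].
have -> : KA * KB * (e - a) * (2 * b) ^+ d = (KB * (KA * (e - a))) * fine (cubeM d b setT).
  by rewrite cubeM_setT//=; ring.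
have bI2 : bm (fun y => \int[itvM T]_t (B y * (A t * cos (P (y, t))))) := bm_Rint (itvM T) bI.
apply: le_bm_bound bI2 _ => y; have bAc : bm (fun t : measurableTypeR R => A t * cos (P (y, t))).
  by apply: bmM => //; apply: bm_cos; exact: (measurableT_comp mP (pair1_measurable y)).
rewrite bm_RintegralZ// normrM ler_pM// Rintegral_itvM// (@Rintegral_eqset _ `[a, e]); last first.
  move=> t; rewrite /= !in_itv/= => h; rewrite vA ?mul0r//.
  have [ta|at_] := ltP t a; [by left|right].
  case: h => -[/andP[h1 h2] /negP]; rewrite negb_and -!ltNge => /orP[]; lra.
apply: le_itv_Rintegral => // t tae.
  by apply: cP; rewrite in_itv.
by rewrite normrM -[KA]mulr1 ler_pM// ler_norml cos_geN1 cos_le1.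
Qed.

(** A predicate on the constant, so that a [C] fixed before all other data can be carried through
    the later sections as a hypothesis. *)
Definition osc_t_bound (N : nat) (C : R) :=
  forall d (b T l r a a' b' e KA KB : R) (A : R -> R) (B slope cst : 'rV[R]_d -> R),
  0 <= b -> 0 < l -> 0 < r -> - T <= a -> a < a' -> b' < e -> e <= T -> a < e ->
  (forall t, t < a' \/ b' < t -> A t = 0) -> Cb l N KA setT A ->
  bm B -> (forall y, `|B y| <= KB) ->
  (forall y, B y != 0 -> r <= l * `|slope y|) ->
  measurable_fun setT slope -> measurable_fun setT cst ->
  `|\int[cubeM d b]_y \int[itvM T]_t (B y * (A t * cos (slope y * t + cst y)))|
    <= C * KA * KB * (e - a) * (2 * b) ^+ d / r ^+ N.

Lemma osc_t (N : nat) : exists2 C, 0 <= C & osc_t_bound N C.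
Proof.
have [C C0 HC] := nonstationary_phase N 1 (@ltr01 R).
exists C => // d b T l r a a' b' e KA KB A B slope cst b0 l0 r0 Ta aa' b'e eT ae vA cA bB BK slr mslope mcst.
have bA : bm (A : measurableTypeR R -> R).
  split; last by exists KA => t; exact: Cb_bound cA _ _.
  by apply: continuous_measurable_fun => t; exact: Cb_cont cA t I.
have KA0 : 0 <= KA by apply: le_trans (normr_ge0 (A a)) (Cb_bound cA _).
have KB0 : 0 <= KB by apply: le_trans (normr_ge0 (B 0)) (BK _).
have bcos : bm (fun p : 'rV[R]_d * measurableTypeR R => cos (slope p.1 * p.2 + cst p.1)).
  apply: bm_cos; apply: measurable_funD; last exact: (measurableT_comp mcst measurable_fst).
  apply: measurable_funM; [exact: (measurableT_comp mslope measurable_fst)|exact: measurable_snd].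
have bI : bm (fun p : 'rV[R]_d * measurableTypeR R => B p.1 * (A p.2 * cos (slope p.1 * p.2 + cst p.1))).
  apply: bmM; first exact: (bm_comp measurable_fst bB).
  by apply: bmM => //; exact: (bm_comp measurable_snd bA).
have vol : fine (cubeM d b setT) = (2 * b) ^+ d by rewrite cubeM_setT.
have -> : C * KA * KB * (e - a) * (2 * b) ^+ d / r ^+ N = (KB * (C * KA * (e - a) / r ^+ N)) * (2 * b) ^+ d by ring.
have e0 : 0 <= C * KA * (e - a) / r ^+ N.
  by rewrite divr_ge0 ?exprn_ge0 ?(ltW r0)// !mulr_ge0// subr_ge0 ltW.
rewrite -vol; apply: le_bm_bound; first exact: (bm_Rint (itvM T) bI).
move=> y; have bAc : bm (fun t : measurableTypeR R => A t * cos (slope y * t + cst y)).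
  by apply: bmM => //; exact: (bm_comp (pair1_measurable y) bcos).
rewrite bm_RintegralZ// normrM; have [->|By] := eqVneq (B y) 0.
  by rewrite normr0 mul0r mulr_ge0.
rewrite ler_pM//.
have r1 := slr _ By; have s0 : 0 < `|slope y| by rewrite -(pmulr_rgt0 _ l0) (lt_le_trans r0).
have s1 : slope y != 0 by rewrite -normr_gt0.
rewrite Rintegral_itvM// (@Rintegral_eqset _ `[a, e]); last first.
  move=> t; rewrite /= !in_itv/= => h; rewrite vA ?mul0r//.
  have [ta|at_] := ltP t a'; [by left|right].
  case: h => -[/andP[h1 h2] /negP]; rewrite negb_and -!ltNge => /orP[]; lra.
(* The phase is affine in [t]: its derivative is [(l |slope y| / l)] times the sign of the slope, so
   [p1] is a constant of modulus 1 and the gain is [l |slope y|], at least [r]. *)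
have := HC l (l * `|slope y|) a e a' b' setT A (fun t => slope y * t) (fun=> Num.sg (slope y)) KA (cst y) l0 _ ae aa' b'e openT.
move=> /(_ (mulr_gt0 l0 s0) (fun _ _ => I)) H.
apply: le_trans (H _ _ _ _ _) _ => //.
- by move=> t _; exact: vA.
- by apply: Cb_cst => //; rewrite normr_sg s1.
- by move=> t _; rewrite normr_sg s1.
- move=> t _; have -> : l * `|slope y| / l * Num.sg (slope y) = slope y *: (1 : R).
    rewrite (_ : l * `|slope y| / l = `|slope y|); last by field; exact: lt0r_neq0.
    by rewrite /GRing.scale/= mulr1 mulrC -numEsg.
  by apply: is_deriveZ.
rewrite ler_wpM2l ?mulr_ge0 ?subr_ge0 ?(ltW ae)// lef_pV2 ?posrE ?exprn_gt0 ?mulr_gt0//.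
by rewrite lerXn2r ?nnegrE ?(ltW r0)// ltW// mulr_gt0.
Qed.

(** On a line in direction [k] either the amplitude vanishes, or it is supported inside an interval
    with some margin and the phase is non-stationary there. The interval, [D] and [p1] may vary with
    the line; the constants may not. *)
Definition osc_y_bound (N : nat) (K c C : R) :=
  forall d (k : 'I_d.+1) (b l r KB e : R) (B P : 'rV[R]_d.+1 -> R),
  0 <= b -> 0 < l -> 0 < r -> 0 <= KB -> 0 <= e ->
  bm B -> measurable_fun setT P ->
  (forall y, (forall t, B (ins k (t, y)) = 0) \/
    exists a a' b' f (D : set R) p1,
    [/\ [/\ - b <= a, a < a', b' < f, f <= b & a < f], f - a <= e,
       [/\ open D, `[a, f] `<=` D & forall t, t < a' \/ b' < t -> B (ins k (t, y)) = 0],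
       [/\ Cb l N K D p1, forall t, D t -> c <= `|p1 t| &
         forall t, D t -> is_derive t 1 (fun t => P (ins k (t, y))) (r / l * p1 t)] &
       Cb l N KB D (fun t => B (ins k (t, y)))]) ->
  `|\int[cubeM d.+1 b]_y (B y * cos (P y))| <= C * KB * e * (2 * b) ^+ d / r ^+ N.

Lemma osc_y (N : nat) (K c : R) : 0 < c -> exists2 C, 0 <= C & osc_y_bound N K c C.
Proof.
move=> c0; have [C C0 HC] := nonstationary_phase N K c0.
exists C => // d k b l r KB e B P b0 l0 r0 KB0 e0 bB mP H.
have bI : bm (fun y => B y * cos (P y)) by apply: bmM => //; exact: bm_cos.
rewrite (integral_ins k b bI).
have bIi : bm (fun p : 'rV[R]_d * measurableTypeR R => B (ins k (p.2, p.1)) * cos (P (ins k (p.2, p.1)))).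
  have ms : measurable_fun setT (fun p : 'rV[R]_d * measurableTypeR R => ins k (p.2, p.1)).
    apply: (measurableT_comp (measurable_ins k)).
    by apply/measurable_fun_pairP; split; [exact: measurable_snd|exact: measurable_fst].
  exact: (bm_comp ms bI).
have -> : C * KB * e * (2 * b) ^+ d / r ^+ N = (C * KB * e / r ^+ N) * fine (cubeM d b setT).
  by rewrite cubeM_setT//= mulrAC.
have rN : 0 <= (r ^+ N)^-1 by rewrite invr_ge0 exprn_ge0// ltW.
apply: le_bm_bound; first exact: (bm_Rint (itvM b) bIi).
move=> y; have [B0|] := H y.
  under eq_Rintegral do rewrite B0 mul0r.
  by rewrite Rintegral_cst// mul0r normr0 !mulr_ge0.
move=> [a [a' [b' [f [D [p1 [[ba aa' b'f fb af] fae [oD aD vB] [cp cp1 dp] cB]]]]]]].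
have by_ := bm_comp (pair1_measurable y) bIi.
rewrite (Rintegral_itvM _ by_) (@Rintegral_eqset _ `[a, f]); last first.
  move=> t; rewrite /= !in_itv/= => h; rewrite vB ?mul0r//.
  have [ta|at_] := ltP t a'; [by left|right].
  case: h => -[/andP[h1 h2] /negP]; rewrite negb_and -!ltNge => /orP[]; lra.
have := HC l r a f a' b' D (fun t => B (ins k (t, y))) (fun t => P (ins k (t, y))) p1 KB 0 l0 r0 af aa' b'f oD aD
  (fun t _ => vB t) cp cp1 dp cB.
under eq_Rintegral do rewrite addr0; move=> h; apply: le_trans h _.
by rewrite ler_wpM2r// ler_wpM2l// mulr_ge0.
Qed.

End oscillation.

(** * A lower bound for vector-matrix products *)

Section linear_algebra.
Variable R : realType.

Lemma det_bound m (K : R) (A : 'M[R]_m) : 0 <= K -> (forall i j, `|A i j| <= K) ->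
  `|\det A| <= m`!%:R * K ^+ m.
Proof.
move=> K0 AK; rewrite /determinant (le_trans (ler_norm_sum _ _ _))//.
apply: (@le_trans _ _ (\sum_(s : 'S_m) K ^+ m)); last first.
  by rewrite sumr_const mulr_natl (card_Sn m).
apply: ler_sum => s _; rewrite normrM normrX normrN normr1 expr1n !mul1r normr_prod.
rewrite -[X in K ^+ X]card_ord -prodr_const; apply: ler_prod => k _.
by rewrite normr_ge0 AK.
Qed.

(** Cramer's rule: [w] times [\det A] equals [w *m A *m \adj A], and [Ka] bounds the cofactors. The
    column is that of the largest entry of [w *m A]. *)
Lemma row_lower_bound m (K c : R) : 0 <= K -> 0 < c -> exists2 c3, 0 < c3 &
  forall A : 'M[R]_m.+1, (forall i j, `|A i j| <= K) -> c <= `|\det A| ->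
  forall w : 'rV[R]_m.+1, exists col, c3 * \sum_k `|w 0 k| <= `|(w *m A) 0 col|.
Proof.
move=> K0 c0; pose Ka := m`!%:R * K ^+ m + 1 : R.
have Ka0 : 0 < Ka by rewrite ltr_wpDl// mulr_ge0// exprn_ge0.
have m0 : 0 < (m.+1%:R * m.+1%:R * Ka) by rewrite !mulr_gt0.
exists (c / (m.+1%:R * m.+1%:R * Ka)); first by rewrite divr_gt0.
move=> A AK Ac w; have [col _ colP] := @arg_maxP _ _ _ ord0 predT (fun k => `|(w *m A) 0 k|) isT.
exists col; rewrite mulrAC ler_pdivrMr// [X in _ <= X]mulrC.
have adjK i j : `|\adj A i j| <= Ka.
  rewrite mxE /cofactor normrM normrX normrN normr1 expr1n mul1r.
  rewrite (le_trans (det_bound K0 _))//; first by move=> ? ?; rewrite !mxE.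
  by rewrite lerDl.
have wk k : c * `|w 0 k| <= m.+1%:R * Ka * `|(w *m A) 0 col|.
  apply: (@le_trans _ _ `|((w *m A) *m \adj A) 0 k|).
    by rewrite -mulmxA mul_mx_adj mul_mx_scalar mxE normrM ler_wpM2r.
  rewrite mxE (le_trans (ler_norm_sum _ _ _))//.
  rewrite -[X in X%:R * _ * _]card_ord -sum1_card natr_sum !mulr_suml; apply: ler_sum => l _.
  by rewrite mul1r normrM mulrC ler_pM//; exact: colP.
rewrite mulr_sumr; apply: (le_trans (ler_sum _ (fun k _ => wk k))).
by rewrite sumr_const card_ord -[X in X <= _]mulr_natl !mulrA.
Qed.

End linear_algebra.

(** * Derivatives and mean values on open cubes *)

Section cubes.
Variables (R : realType) (n : nat).
Implicit Types (f g : 'rV[R]_n -> R) (x y : 'rV[R]_n).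

Lemma open_cube_open (b : R) : open (open_cube b : set 'rV[R]_n).
Proof.
rewrite openE => x xb; apply/nbhs_ballP; pose e := \big[Num.min/1]_k (b - `|x 0 k|).
have e0 : 0 < e.
  by rewrite /e; elim/big_ind : _ => // [u v u0 v0|k _]; rewrite ?lt_min ?u0// subr_gt0 xb.
exists e => // y [_ xy] k; have := xy ord0 k; rewrite /ball/= distrC => h.
have := ler_normD (y 0 k - x 0 k) (x 0 k); rewrite subrK => h1.
have he : e <= b - `|x 0 k| by rewrite /e; exact: bigmin_le_cond.
by rewrite (le_lt_trans h1)// -ltrBrDr (lt_le_trans h).
Qed.

Lemma between_le x y z (c : 'rV[R]_n) (e : R) k : between x y z ->
  `|x 0 k - c 0 k| <= e -> `|y 0 k - c 0 k| <= e -> `|z 0 k - c 0 k| <= e.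
Proof.
move=> /(_ k)/andP[]; rewrite ge_min le_max => /orP h1 /orP h2.
by rewrite !ler_distl => /andP[? ?] /andP[? ?]; case: h1 => ?; case: h2 => ?; apply/andP; split; lra.
Qed.

Lemma between_cube (b : R) x y : open_cube b x -> open_cube b y ->
  between x y `<=` open_cube b.
Proof.
move=> xb yb z xyz k; have [h1 h2] := (xb k, yb k).
pose e := Num.max `|x 0 k| `|y 0 k|.
have := @between_le x y z 0 e k xyz; rewrite !mxE !subr0 /e !le_max !lexx orbT => /(_ isT isT).
by move=> /orP[] h; exact: le_lt_trans h _.
Qed.

Lemma partials_lin U (a c : R) f g s x : open U -> smooth_on U f -> smooth_on U g -> U x ->
  partials s (fun y => a * f y + c * g y) x = a * partials s f x + c * partials s g x.
Proof.
move=> oU sf sg; elim: s x => [//|i s IH] x Ux /=.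
rewrite (partial_ext i oU IH Ux) /partial.
have df : derivable (partials s f) x (delta_mx 0 i) by apply: smooth_derivable Ux; exact: smooth_partials.
have dg : derivable (partials s g) x (delta_mx 0 i) by apply: smooth_derivable Ux; exact: smooth_partials.
have dz (e : R) h : derivable h x (delta_mx 0 i) -> derivable (fun y => e * h y) x (delta_mx 0 i).
  by move=> dh; exact: derivableZ.
rewrite deriveD; [|exact: dz|exact: dz].
by rewrite (deriveZ a df) (deriveZ c dg).
Qed.

Lemma mvt_l1 (b C : R) f x y : smooth_on (open_cube b) f ->
  (forall k z, open_cube b z -> `|partial k f z| <= C) ->
  open_cube b x -> open_cube b y -> `|f x - f y| <= C * \sum_k `|x 0 k - y 0 k|.
Proof.
move=> sf fC xb yb; have bU := between_cube yb xb.
have [p pb ->] := mvt_multi sf bU.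
rewrite (le_trans (ler_norm_sum _ _ _))// mulr_sumr; apply: ler_sum => k _.
by rewrite normrM ler_wpM2r// fC//; exact: bU.
Qed.

End cubes.

(** * From the determinant to a lower bound for the gradient of the phase difference *)

Section nondegeneracy.
Variable R : realType.

Lemma sum_mix d n (i j : 'I_d -> 'I_n) (G : 'I_n -> R) : is_bipartition i j ->
  \sum_k G k = \sum_l G (i l) + \sum_l G (j l).
Proof.
move=> ij; have [injl injr E] := ij.
rewrite (bigID (fun k => k \in codom i))/=; congr (_ + _).
  rewrite -(big_imset (h := i) (A := predT) G) /=; last by move=> ? ? _ _; exact: injl.
  by apply: eq_bigl => k; apply/idP/imsetP => [/codomP[l ->]|[l _ ->]]; [exists l|exact: codom_f].
rewrite -(big_imset (h := j) (A := predT) G) /=; last by move=> ? ? _ _; exact: injr.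
apply: eq_bigl => k; have := mix_split ij k.
have : k \in [set k | k \in codom i]%SET = (k \notin [set k | k \in codom j]%SET) by rewrite E inE.
rewrite !inE => -> _; rewrite negbK.
by apply/idP/imsetP => [/codomP[l ->]|[l _ ->]]; [exists l|exact: codom_f].
Qed.

(* [dphase s x y] is the s-th partial derivative of the difference of the phases
   lambda Phi + tau rho at x and lambda Phi + (tau - sg) rho at y. *)
Definition dphase n (Phi rho : 'rV[R]_n -> R) (lambda tau sg : R) (s : seq 'I_n) x y :=
  lambda * (partials s Phi x - partials s Phi y) +
  tau * (partials s rho x - partials s rho y) + sg * partials s rho y.

Lemma norm_combination (x y z a b c e K t1 t2 t3 : R) :
  `|x| <= t1 -> `|y| <= 4 * t1 -> `|z| <= t3 -> `|a| <= e -> `|b| <= e -> `|c| <= K ->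
  `|x * a + y * b + z * c| <= 5 * t1 * e + t3 * K.
Proof.
move=> xt yt zt ae be cK.
have -> : 5 * t1 * e = t1 * e + 4 * t1 * e by ring.
rewrite (le_trans (ler_normD _ _))// lerD//; last by rewrite normrM ler_pM.
by rewrite (le_trans (ler_normD _ _))// lerD// normrM ler_pM.
Qed.

Lemma lower_bound_perturb (c W S a t e : R) :
  c / 2 * W <= c * S -> c * S <= a -> a - t <= e -> e <= c / 4 * W -> c / 4 * W <= t.
Proof. by lra. Qed.

(** A product of a suitable vector with the bordered Hessian at the centre [q] linearizes the
    gradient in (t, y) of the phase difference. By [row_lower_bound] one of its components is large:
    the t-derivative, which is the difference of [rho], or the derivative along some [j m].
    Replacing all points of the box and all [tau] of the piece by [q] and [tau0] costs a small
    multiple of the same quantity. *)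
Lemma nondegenerate d n (C1 c : R) : 0 < C1 -> 0 < c -> exists c1 r e : R,
  [/\ 0 < c1, 0 < r <= 2^-1, 0 < e <= 2^-1 &
  forall (b1 : R) (Phi rho : 'rV[R]_n -> R) (i j : 'I_d -> 'I_n) (lambda tau0 mu mu0 : R) (q : 'rV[R]_n),
  smooth_on (open_cube b1) Phi -> smooth_on (open_cube b1) rho ->
  (forall s x, (size s <= 3)%N -> open_cube b1 x -> `|partials s Phi x| <= C1) ->
  (forall s x, (size s <= 3)%N -> open_cube b1 x -> `|partials s rho x| <= C1) ->
  is_bipartition i j -> open_cube b1 q -> mu = `|lambda| + `|tau0| -> 0 < mu ->
  mu0 = Num.sqrt (lambda ^+ 2 + tau0 ^+ 2) ->
  c <= `|\det (bordered_hessian rho (fun y => lambda / mu0 * Phi y + tau0 / mu0 * rho y) i j q)| ->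
  forall (u v : 'rV[R]_d) (sg : R),
  (forall l, `|u 0 l - q 0 (i l)| <= 3 * r /\ `|u 0 l| < b1) ->
  (forall l, `|v 0 l - q 0 (i l)| <= 3 * r /\ `|v 0 l| < b1) ->
  let V := \sum_l `|u 0 l - v 0 l| in
  let Y := [set y : 'rV[R]_d | forall l, `|y 0 l - q 0 (j l)| <= 3 * r /\ `|y 0 l| < b1] in
  (forall y, Y y -> c1 * (mu * V + `|sg|) <= mu * `|rho (mix i j (u, y)) - rho (mix i j (v, y))|) \/
  (exists m, forall y, Y y -> forall tau, `|tau - tau0| <= 3 * (e * mu) ->
    c1 * (mu * V + `|sg|) <=
      `|dphase Phi rho lambda tau sg [:: j m] (mix i j (u, y)) (mix i j (v, y))|)].
Proof.
move=> C10 c0.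
have K0 : 0 <= 2 * C1 by rewrite mulr_ge0// ltW.
have [c3 c30 Hc3] := row_lower_bound d K0 c0.
(* [r] also serves as [e]. With [E = 3 r (n + 1) C1], the variation of derivatives over the box, the
   linearization error is governed by [5 E + 3 r C1]; this [D] keeps it below [c3 / 4]. The summand
   [c3] ensures [r <= 1 / 2]. *)
pose D := 64 * (n.+1%:R * C1 + C1 + c3) : R.
have nC : 0 < n.+1%:R * C1 by rewrite mulr_gt0.
have D0 : 0 < D by rewrite /D; lra.
pose r := c3 / D; have r0 : 0 < r by rewrite divr_gt0.
have rD : r * (64 * (n.+1%:R * C1 + C1 + c3)) = c3 by rewrite /r -/D mulfVK// gt_eqF.
have r2 : r <= 2^-1.
  by rewrite /r ler_pdivrMr// /D; lra.
exists (c3 / 4), r, r; split=> //; [by rewrite divr_gt0|by rewrite r0|by rewrite r0|].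
move=> b1 Phi rho i j lambda tau0 mu mu0 q sPhi srho bPhi brho ij qB muE mu_gt0 mu0E Hdet u v sg hu hv V Y.
have oB := @open_cube_open R n b1.
have mu00 : 0 <= mu0 by rewrite mu0E sqrtr_ge0.
have mu0sq : mu0 ^+ 2 = `|lambda| ^+ 2 + `|tau0| ^+ 2.
  by rewrite mu0E sqr_sqrtr ?addr_ge0 ?sqr_ge0// !real_normK ?num_real.
(* [mu0] is the Euclidean norm of [(lambda, tau0)], which normalizes the pair to the unit circle of
   the hypothesis, and [mu] is its l^1 norm; they agree up to a factor 2. *)
have mu0le : mu0 <= mu.
  rewrite -(ler_pXn2r (_ : 0 < 2)%N) ?nnegrE ?(ltW mu_gt0)// mu0sq muE sqrrD.
  have h : 0 <= `|lambda| * `|tau0| by rewrite mulr_ge0.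
  by lra.
have mu0ge : mu / 2 <= mu0.
  rewrite -(ler_pXn2r (_ : 0 < 2)%N) ?nnegrE ?divr_ge0 ?(ltW mu_gt0)// mu0sq muE expr_div_n sqrrD.
  have := sqr_ge0 (`|lambda| - `|tau0|); rewrite sqrrB => h.
  rewrite ler_pdivrMr ?exprn_gt0//.
  have h1 := sqr_ge0 `|lambda|; have h2 := sqr_ge0 `|tau0|; lra.
have mu0gt0 : 0 < mu0 by apply: lt_le_trans mu0ge; rewrite divr_gt0.
have mu0n : mu0 != 0 by rewrite gt_eqF.
have lam1 : `|lambda / mu0| <= 1.
  rewrite normrM normfV (ger0_norm mu00) ler_pdivrMr// mul1r.
  by rewrite -(ler_pXn2r (_ : 0 < 2)%N) ?nnegrE// mu0sq lerDl sqr_ge0.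
have tau1 : `|tau0 / mu0| <= 1.
  rewrite normrM normfV (ger0_norm mu00) ler_pdivrMr// mul1r.
  by rewrite -(ler_pXn2r (_ : 0 < 2)%N) ?nnegrE// mu0sq lerDr sqr_ge0.
set M := bordered_hessian _ _ _ _ _ in Hdet.
have hess k l : partial k (partial l (fun y => lambda / mu0 * Phi y + tau0 / mu0 * rho y)) q =
   lambda / mu0 * partials [:: k; l] Phi q + tau0 / mu0 * partials [:: k; l] rho q.
  exact: (partials_lin (lambda / mu0) (tau0 / mu0) [:: k; l] oB sPhi srho qB).
have MK k l : `|M k l| <= 2 * C1.
  have C12 : C1 <= 2 * C1 by lra.
  rewrite mxE; case: unlift => [k'|]; case: unlift => [l'|].
  - rewrite hess; apply: (le_trans (ler_normD _ _)).
    rewrite (_ : 2 * C1 = 1 * C1 + 1 * C1); last by ring.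
    apply: lerD; rewrite normrM; apply: ler_pM; rewrite ?normr_ge0//.
      by apply: bPhi.
    by apply: brho.
  - by apply: le_trans C12; exact: (brho [:: i k']).
  - by apply: le_trans C12; exact: (brho [:: j l']).
  - by rewrite normr0.
(* Column 0 of [w *m M] linearizes [mu0] times the difference of [rho]. Column [lift ord0 m]
   linearizes the [j m] derivative of the phase difference, where the border row, weighted by [sg],
   accounts for the different values of t in the two phases. *)
pose w : 'rV[R]_d.+1 := \row_k if unlift ord_max k is Some l then mu0 * (u 0 l - v 0 l) else sg.
have wsum : \sum_k `|w 0 k| = mu0 * V + `|sg|.
  rewrite (bigD1_ord ord_max)//= !mxE unlift_none addrC mulr_sumr; congr (_ + _).
  by apply: eq_bigr => l _; rewrite !mxE liftK normrM (ger0_norm mu00).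
have V0 : 0 <= V by apply: sumr_ge0 => l _.
have wlow : (mu * V + `|sg|) / 2 <= \sum_k `|w 0 k|.
  rewrite wsum; have : mu / 2 * V <= mu0 * V by rewrite ler_wpM2r.
  by have := normr_ge0 sg; lra.
have [col hcol] := Hc3 M MK Hdet w.
have pt_near y z : Y y -> between (mix i j (v, y)) (mix i j (u, y)) z ->
    open_cube b1 z /\ \sum_k `|z 0 k - q 0 k| <= n.+1%:R * (3 * r).
  move=> Yy bz.
  have bb (x : 'rV[R]_d) : (forall l, `|x 0 l - q 0 (i l)| <= 3 * r /\ `|x 0 l| < b1) ->
      open_cube b1 (mix i j (x, y)) /\ (forall k, `|mix i j (x, y) 0 k - q 0 k| <= 3 * r).
    move=> hx; split=> k; have [[l ->]|[l ->]] := mix_split ij k; rewrite ?mixl ?mixr//=.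
    - by have [] := hx l.
    - by have [] := Yy l.
    - by have [] := hx l.
    - by have [] := Yy l.
  have [ub un] := bb u hu; have [vb vn] := bb v hv; split; first exact: between_cube vb ub _ bz.
  apply: (@le_trans _ _ (\sum_(k < n) (3 * r))).
    by apply: ler_sum => k _; apply: between_le bz _ _.
  have r30 : 0 <= 3 * r by rewrite mulr_ge0// ltW.
  by rewrite sumr_const card_ord -[X in X <= _]mulr_natl ler_wpM2r// ler_nat.
have ptP : forall (y : 'rV[R]_d) (z : 'rV[R]_n) (s : seq 'I_n) (f : 'rV[R]_n -> R), Y y -> between (mix i j (v, y)) (mix i j (u, y)) z -> (size s <= 2)%N ->
    smooth_on (open_cube b1) f ->
    (forall s x, (size s <= 3)%N -> open_cube b1 x -> `|partials s f x| <= C1) ->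
    `|partials s f z - partials s f q| <= C1 * (n.+1%:R * (3 * r)).
  move=> y z s f Yy bz s2 sf bf; have [zb zs] := pt_near y z Yy bz.
  apply: le_trans (mvt_l1 (smooth_partials s sf) _ zb qB) _.
    by move=> k x xb; exact: (bf (k :: s)).
  by rewrite ler_wpM2l// ltW.
have expand : forall (y : 'rV[R]_d) (s : seq 'I_n) (f : 'rV[R]_n -> R), Y y -> smooth_on (open_cube b1) f -> exists2 p : 'I_d -> 'rV[R]_n,
    (forall l, between (mix i j (v, y)) (mix i j (u, y)) (p l)) &
    partials s f (mix i j (u, y)) - partials s f (mix i j (v, y)) =
    \sum_l partials (i l :: s) f (p l) * (u 0 l - v 0 l).
  move=> y s f Yy sf.
  have bU : between (mix i j (v, y)) (mix i j (u, y)) `<=` open_cube b1.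
    by move=> z bz; have [] := pt_near y z Yy bz.
  have [p pb ->] := mvt_multi (smooth_partials s sf) bU.
  exists (fun l => p (i l)) => //; rewrite (sum_mix _ ij) [X in _ + X]big1 ?addr0.
    by apply: eq_bigr => l _; rewrite !mixl.
  by move=> l _; rewrite !mixr//= subrr mulr0.
set E := C1 * (n.+1%:R * (3 * r)) in ptP.
have Ec : E = 3 * (r * (n.+1%:R * C1)) by rewrite /E; ring.
have rC : 0 < r * C1 by rewrite mulr_gt0.
have rnC : 0 < r * (n.+1%:R * C1) by rewrite mulr_gt0.
have rc3 : 0 < r * c3 by rewrite mulr_gt0.
have E0 : 0 <= E by rewrite Ec mulr_ge0// ltW.
have Esmall : 64 * (r * (n.+1%:R * C1)) + 64 * (r * C1) <= c3.
  rewrite -[X in _ <= X]rD; rewrite (_ : r * (64 * (n.+1%:R * C1 + C1 + c3)) =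
    64 * (r * (n.+1%:R * C1)) + 64 * (r * C1) + 64 * (r * c3)); last by ring.
  lra.
have hE1 : 5 * E + 3 * (r * C1) <= c3 / 4 by rewrite Ec; move: (r * _) (r * _) rnC rC Esmall => a1 a2; clear; lra.
have hE2 : E <= c3 / 4 by apply: le_trans hE1; rewrite -subr_ge0 (_ : _ - E = 4 * E + 3 * (r * C1)); [rewrite addr_ge0// mulr_ge0// ltW|ring].
set W := mu * V + `|sg|; have W0 : 0 <= W by rewrite addr_ge0 ?mulr_ge0// ltW.
have lowW : c3 / 2 * W <= c3 * \sum_k `|w 0 k|.
  by rewrite -mulrA ler_wpM2l ?(ltW c30)// mulrC.
have muV : 0 <= mu * V by rewrite mulr_ge0// ltW.
have muVW : mu * V <= W by rewrite lerDl.
have sgW : `|sg| <= W by rewrite lerDr.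
(* The column was selected at [q], before [y] and [tau], so one alternative holds on the whole box
   and piece. *)
move: hcol; case: (unliftP ord0 col) => [m ->|->] hcol; [right; exists m|left].
  move=> y Yy tau htau; rewrite /dphase.
  have [p pb ->] := expand y [:: j m] Phi Yy sPhi.
  have [p' pb' ->] := expand y [:: j m] rho Yy srho.
  set x' := mix i j (v, y).
  have bx' : between x' (mix i j (u, y)) x' by move=> k; rewrite ge_min le_max lexx ?orbT.
  have wM : (w *m M) 0 (lift ord0 m) =
      \sum_l (u 0 l - v 0 l) * (lambda * partials [:: i l; j m] Phi q + tau0 * partials [:: i l; j m] rho q)
      + sg * partials [:: j m] rho q.
    rewrite mxE (bigD1_ord ord_max)//= addrC !mxE !unlift_none liftK; congr (_ + _).
    apply: eq_bigr => l _; rewrite !mxE !liftK hess.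
    rewrite /=; move: (partial _ (partial _ Phi) q) (partial _ (partial _ rho) q) (u 0 l - v 0 l) => a1 a2 a3.
    by clear -mu0n; field.
  set T := _ + _ + sg * _.
  have TE : T - (w *m M) 0 (lift ord0 m) =
     \sum_l (u 0 l - v 0 l) * (lambda * (partials [:: i l; j m] Phi (p l) - partials [:: i l; j m] Phi q) +
        tau * (partials [:: i l; j m] rho (p' l) - partials [:: i l; j m] rho q)
        + (tau - tau0) * partials [:: i l; j m] rho q)
     + sg * (partials [:: j m] rho x' - partials [:: j m] rho q).
    rewrite wM /T !mulr_sumr [sg * (_ - _)]mulrBr [in LHS]opprD addrACA -big_split/= -sumrB; congr (_ + _).
    apply: eq_bigr => l _.
    move: (partial _ (partial _ Phi) (p l)) (partial _ (partial _ Phi) q) => a1 a2.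
    move: (partial _ (partial _ rho) (p' l)) (partial _ (partial _ rho) q) => a3 a4.
    by move: (u 0 l - v 0 l) => a5; clear; ring.
  have Ttau : `|tau| <= 4 * mu.
    have -> : tau = (tau - tau0) + tau0 by rewrite subrK.
    rewrite (le_trans (ler_normD _ _))//.
    have t0 : `|tau0| <= mu by rewrite muE lerDr.
    have : r * mu <= 2^-1 * mu by rewrite ler_wpM2r// ltW.
    lra.
  have Terr : `|T - (w *m M) 0 (lift ord0 m)| <= V * (5 * mu * E + 3 * (r * mu) * C1) + `|sg| * E.
    rewrite TE; apply: (le_trans (ler_normD _ _)); apply: lerD; last first.
      rewrite normrM ler_wpM2l//; exact: (ptP y x' [:: j m] rho Yy bx' isT srho brho).
    apply: (le_trans (ler_norm_sum _ _ _)); rewrite /V mulr_suml; apply: ler_sum => l _.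
    rewrite normrM; apply: ler_wpM2l => //.
    have h1 := ptP y (p l) [:: i l; j m] Phi Yy (pb l) isT sPhi bPhi.
    have h2 := ptP y (p' l) [:: i l; j m] rho Yy (pb' l) isT srho brho.
    have lm : `|lambda| <= mu by rewrite muE lerDl.
    exact: norm_combination lm Ttau htau h1 h2 (brho [:: i l; j m] q isT qB).
  have h := lerB_dist ((w *m M) 0 (lift ord0 m)) T; rewrite distrC in h.
  have hE : V * (5 * mu * E + 3 * (r * mu) * C1) + `|sg| * E <= c3 / 4 * W.
    have -> : V * (5 * mu * E + 3 * (r * mu) * C1) + `|sg| * E =
      (mu * V) * (5 * E + 3 * (r * C1)) + `|sg| * E.
      by move: (V) (E) (`|sg|) (r) => a1 a2 a3 a4; clear; ring.
    have a1 : (mu * V) * (5 * E + 3 * (r * C1)) <= (mu * V) * (c3 / 4).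
      exact: ler_wpM2l.
    have a2 : `|sg| * E <= `|sg| * (c3 / 4) by exact: ler_wpM2l.
    by rewrite /W [c3 / 4 * (mu * V + _)]mulrDr [c3 / 4 * (mu * V)]mulrC [c3 / 4 * `|sg|]mulrC; exact: lerD.
  exact: (lower_bound_perturb lowW hcol (le_trans h Terr) hE).
move=> y Yy; have [p pb /= ->] := expand y [::] rho Yy srho.
have wM : (w *m M) 0 ord0 = mu0 * \sum_l (u 0 l - v 0 l) * partial (i l) rho q.
  rewrite mxE (bigD1_ord ord_max)//= !mxE !unlift_none mulr0 add0r mulr_sumr.
  by apply: eq_bigr => l _; rewrite !mxE !liftK unlift_none mulrA.
set S0 := \sum_l _ in wM; set T := \sum_l _.
have Terr : `|T - S0| <= V * E.
  rewrite /T /S0 -sumrB; apply: (le_trans (ler_norm_sum _ _ _)).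
  rewrite /V mulr_suml; apply: ler_sum => l _.
  rewrite mulrC -mulrBr normrM; apply: ler_wpM2l => //.
  exact: (ptP y (p l) [:: i l] rho Yy (pb l) isT srho brho).
have h : `|S0| - `|T| <= V * E.
  by apply: le_trans Terr; rewrite distrC; exact: lerB_dist.
have h1 : mu0 * `|S0| <= mu * `|S0| by rewrite ler_wpM2r.
have h2 : mu * `|S0| - mu * `|T| <= (mu * V) * E by rewrite -mulrBr -mulrA ler_wpM2l// ltW.
rewrite wM normrM (ger0_norm mu00) in hcol.
have h3 : (mu * V) * E <= (mu * V) * (c3 / 4) by exact: ler_wpM2l.
have h4 : mu * V * (c3 / 4) <= c3 / 4 * W by rewrite [c3 / 4 * W]mulrC; apply: ler_wpM2r => //; rewrite divr_ge0// ltW.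
exact: (lower_bound_perturb lowW (le_trans hcol h1) h2 (le_trans h3 h4)).
Qed.

End nondegeneracy.

(** * A majorant of the indicator of an interval *)

Section bump.
Variable R : realType.

(** Both truncated powers have arguments at least 1/2 for [|t - a| <= r], and [4 ^+ m] lifts the
    product to at least 1 there; beyond distance [2 r] one of them vanishes. [TTstar] asks for a
    majorant of an indicator, so no normalization to the value 1 is made. *)
Definition bump (m : nat) (r a t : R) : R :=
  4 ^+ m * (tpow m (1 * (t - (a - 2 * r)) / (2 * r)) * tpow m (-1 * (t - (a + 2 * r)) / (2 * r))).

Lemma bump_ge0 m r a t : 0 <= bump m r a t.
Proof. by rewrite !mulr_ge0 ?tpow_ge0// exprn_ge0. Qed.

Lemma bump_ge1 m r a t : 0 < r -> `|t - a| <= r -> 1 <= bump m r a t.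
Proof.
move=> r0; rewrite ler_distl => /andP[h1 h2].
have e1 : 2^-1 <= 1 * (t - (a - 2 * r)) / (2 * r) by rewrite mul1r ler_pdivlMr ?mulr_gt0//; lra.
have e2 : 2^-1 <= -1 * (t - (a + 2 * r)) / (2 * r) by rewrite ler_pdivlMr ?mulr_gt0//; lra.
rewrite /bump !tpow_pos; [|by apply: le_trans e2|by apply: le_trans e1].
rewrite -exprMn -exprMn exprn_ege1//.
have : 4 * (2^-1 * 2^-1) <= 4 * (1 * (t - (a - 2 * r)) / (2 * r) * (-1 * (t - (a + 2 * r)) / (2 * r))) :> R.
  by rewrite ler_wpM2l// ler_pM.
by apply: le_trans; lra.
Qed.

Lemma bump0 m r a t : 0 < r -> 2 * r <= `|t - a| -> bump m.+1 r a t = 0.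
Proof.
move=> r0; rewrite ler_normr => /orP[h|h]; rewrite /bump.
  rewrite [X in _ * (_ * X)]tpow_neg ?mulr0// pmulr_lle0 ?invr_gt0 ?mulr_gt0//; lra.
rewrite [X in _ * (X * _)]tpow_neg ?mul0r ?mulr0// pmulr_lle0 ?invr_gt0 ?mulr_gt0//; lra.
Qed.

Lemma Cb_bump (N : nat) : exists2 K, 1 <= K & forall r a, 0 < r ->
  Cb (2 * r) N K [set t | `|t - a| < 3 * r] (bump N.+2 r a) /\
  bm (bump N.+2 r a : measurableTypeR R -> R) /\ forall t, `|bump N.+2 r a t| <= K.
Proof.
(* On [|t - a| < 3 r] both arguments are at most 5/2. *)
pose B := N.+2`!%:R * (5/2) ^+ N.+2 : R.
pose K := Num.max 1 (4 ^+ N.+2 * (2 ^+ N * B * B)); exists K; first by rewrite le_max lexx.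
move=> r a r0; have r20 : 0 < 2 * r by rewrite mulr_gt0.
have c52 : 1 <= (5/2 : R) by lra.
have cB : Cb (2 * r) N K [set t | `|t - a| < 3 * r] (bump N.+2 r a).
  apply: (@Cb_le _ _ _ (`|4 ^+ N.+2| * (2 ^+ N * B * B))) => //.
    by rewrite ger0_norm ?exprn_ge0// le_max lexx orbT.
  apply: CbZ => //; apply: CbM => //; apply: Cb_tpow => //; rewrite ?normrN ?normr1//.
    by move=> t /=; rewrite ltr_distl => /andP[h1 h2]; rewrite ler_pdivrMr//; lra.
  by move=> t /=; rewrite ltr_distl => /andP[h1 h2]; rewrite ler_pdivrMr//; lra.
have bK t : `|bump N.+2 r a t| <= K.
  have [h|h] := ltP `|t - a| (3 * r); first exact: Cb_bound cB t h.
  rewrite bump0// ?normr0 ?le_max ?ler01//; lra.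
split=> //; split=> //; split; last by exists K.
have c (s e : R) : continuous (fun t : R => tpow N.+2 (s * (t - e) / (2 * r))).
  by move=> t; exact: (is_derive_cont (is_derive_tpow_affine N s e (2 * r) t)).
apply: measurable_funM; first exact: measurable_cst.
by apply: measurable_funM; apply: continuous_measurable_fun; exact: c.
Qed.

End bump.

(** * Phase differences along coordinate lines *)

Section kernel_helpers.
Variable R : realType.

Lemma Cb_translate (l K s : R) (k : nat) (F : R -> R) : Cb l k K setT F -> Cb l k K setT (fun t => F (t - s)).
Proof.
elim: k K F => [|k IH] K F [bF cF]; split; try by move=> t _; exact: bF.
  move=> t _; apply: (@continuous_comp _ _ _ (fun t => t - s) F); last exact: cF.
  by apply: continuousB => //; exact: cst_continuous.
case: cF => F' dF cF; exists (fun t => F' (t - s)); last exact: IH.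
move=> t _; have ds : is_derive t 1 (fun t => t - s) (1 : R).
  by have := is_deriveB (is_derive_id t (1 : R)) (is_derive_cst s t (1 : R)); rewrite subr0.
by have := @is_derive1_comp _ F (fun t => t - s) t _ _ (dF (t - s) I) ds; rewrite mulr1.
Qed.

Variables (n : nat).
Implicit Types (Phi rho : 'rV[R]_n -> R).

Lemma Cb_dphase (b1 lambda tau sg K : R) Phi rho (x y : 'rV[R]_n) k s m (D : set R) :
  smooth_on (open_cube b1) Phi -> smooth_on (open_cube b1) rho ->
  (forall t, D t -> open_cube b1 (x + t *: unitv R k) /\ open_cube b1 (y + t *: unitv R k)) ->
  (forall s' t, (size s' <= m + size s)%N -> D t ->
    `|dphase Phi rho lambda tau sg s' (x + t *: unitv R k) (y + t *: unitv R k)| <= K) ->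
  Cb 1 m K D (fun t => dphase Phi rho lambda tau sg s (x + t *: unitv R k) (y + t *: unitv R k)) /\
  (forall t, D t -> is_derive t 1
    (fun t => dphase Phi rho lambda tau sg s (x + t *: unitv R k) (y + t *: unitv R k))
    (dphase Phi rho lambda tau sg (k :: s) (x + t *: unitv R k) (y + t *: unitv R k))).
Proof.
move=> sP sr DU bD.
have dd s' t : D t -> is_derive t 1
    (fun t => dphase Phi rho lambda tau sg s' (x + t *: unitv R k) (y + t *: unitv R k))
    (dphase Phi rho lambda tau sg (k :: s') (x + t *: unitv R k) (y + t *: unitv R k)).
  move=> /DU[xt yt].
  have l f z : smooth_on (open_cube b1) f -> open_cube b1 (z + t *: unitv R k) ->
     is_derive t 1 (fun t => partials s' f (z + t *: unitv R k)) (partials (k :: s') f (z + t *: unitv R k)).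
    by move=> sf zt; apply: smooth_line zt; exact: smooth_partials.
  apply: is_deriveD; last by apply: is_deriveZ; exact: l sr yt.
  apply: is_deriveD; apply: is_deriveZ; apply: is_deriveB.
  - exact: l sP xt.
  - exact: l sP yt.
  - exact: l sr xt.
  - exact: l sr yt.
split; last by move=> t Dt; exact: dd.
elim: m s bD => [|m IH] s bD; split.
- by move=> t Dt; exact: bD.
- by move=> t Dt; exact: is_derive_cont (dd s t Dt).
- by move=> t Dt; apply: bD => //; rewrite leq_addl.
exists (fun t => dphase Phi rho lambda tau sg (k :: s) (x + t *: unitv R k) (y + t *: unitv R k)).
  by move=> t Dt; exact: dd.
by rewrite divr1; apply: IH => s' t /= s'm; apply: bD; rewrite addSnnS.
Qed.

Lemma mix_ins_line d (i j : 'I_d.+1 -> 'I_n) (u : 'rV[R]_d.+1) l (t : R) (y : 'rV[R]_d) :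
  is_bipartition i j ->
  mix i j (u, ins l (t, y)) = mix i j (u, ins l (0, y)) + t *: unitv R (j l).
Proof.
move=> ij; have [_ injj _] := ij; apply/rowP => k; rewrite [RHS]mxE [X in _ + X]mxE [X in _ + _ * X]mxE eqxx /=.
have [[m ->]|[m ->]] := mix_split ij k.
  by rewrite !mixl//= (negbTE (mix_ij ij _ _)) mulr0 addr0.
rewrite !mixr//= (inj_eq injj); case: (unliftP l m) => [m' ->|->].
  by rewrite !ins_lift eq_sym (negbTE (neq_lift _ _)) mulr0 addr0.
by rewrite !ins_same eqxx mulr1 add0r.
Qed.

End kernel_helpers.

Lemma four_mu (R : realType) (m x1 x2 x3 : R) :
  x1 <= 2^-1 * m -> x2 <= 3 * x1 -> x3 <= m -> 0 < m -> x2 + x3 <= 4 * m.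
Proof. by lra. Qed.

Lemma le_sub_pos (R : realType) (a b l : R) : 0 < l -> a <= b - l -> a <= b.
Proof. by lra. Qed.

Lemma le_add_pos (R : realType) (a b l : R) : 0 < l -> b + l <= a -> b <= a.
Proof. by lra. Qed.

Lemma comb5 (R : realType) (C m V s : R) : 5 * C * (m * V + s) = 5 * m * (C * V) + 5 * (s * C).
Proof. by ring. Qed.

Lemma le35 (R : realType) (a l : R) : 0 < l -> a <= 3 * l -> a <= 5 * l.
Proof. by lra. Qed.

Lemma len5 (R : realType) (a b l : R) : b - a <= 3 * l -> b + l - (a - l) <= 5 * l.
Proof. by lra. Qed.

Lemma prod4 (R : realType) (x a1 a2 b : R) : x * (b * a1 * a2) = b * x * (a1 * a2).
Proof. by ring. Qed.

(** Two nested families of margins in one coordinate: radii [2 r], [5/2 r], [3 r] about the centre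
    and half-sides [b0], [b2], [b1]. The smallest of each confine the amplitude, the middle ones
    give the interval of integration, and the largest the open set on which all functions are
    differentiated. *)
Lemma window (R : realType) (b0 b1 b2 r q : R) : 0 < b0 -> b0 < b2 -> b2 < b1 -> 0 < r -> `|q| <= b0 ->
  let a := Num.max (- b2) (q - 5 / 2 * r) in let a' := Num.max (- b0) (q - 2 * r) in
  let b' := Num.min b0 (q + 2 * r) in let f := Num.min b2 (q + 5 / 2 * r) in
  [/\ [/\ - b2 <= a, a < a', b' < f, f <= b2 & a < f], f - a <= 2 * b2 &
    (forall x, a <= x <= f -> `|x| < b1 /\ `|x - q| < 3 * r) /\
    (forall x, x < a' \/ b' < x -> `|x - q| < 2 * r -> `|x| <= b0 -> False)].
Proof.
move=> b00 b02 b21 r0; rewrite ler_norml => /andP[q1 q2] a a' b' f.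
have ha : - b2 <= a by rewrite le_max lexx.
have ha2 : q - 5 / 2 * r <= a by rewrite le_max lexx orbT.
have hf : f <= b2 by rewrite ge_min lexx.
have hf2 : f <= q + 5 / 2 * r by rewrite ge_min lexx orbT.
split; first split => //.
- by rewrite gt_max !lt_max; apply/andP; split; apply/orP; [left|right]; lra.
- by rewrite lt_min !gt_min; apply/andP; split; apply/orP; [left|right]; lra.
- by rewrite lt_min !gt_max; apply/andP; split; apply/andP; split; lra.
- by lra.
split=> [x /andP[ax xf]|x].
  by rewrite ltr_norml ltr_distl; split; apply/andP; split; lra.
rewrite ltr_distl ler_norml lt_max gt_min => h /andP[h1 h2] /andP[h3 h4].
by case: h => /orP[]; lra.
Qed.

Lemma bm_window (R : realType) (T a b K : R) (f : measurableTypeR R -> R) :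
  bm f -> - T <= a -> b <= T -> a <= b -> (forall t, `|f t| <= K) ->
  (forall t, t < a \/ b < t -> f t = 0) -> `|\int[itvM T]_t f t| <= K * (b - a).
Proof.
move=> bf Ta bT ab fK f0.
have b1 : bm (fun t : measurableTypeR R => K * (\1_(`[a, b]%classic : set R) t : R)).
  apply: bmZ; split; last by exists 1 => t; rewrite indicE; case: (_ \in _); rewrite ?normr1 ?normr0.
  exact: measurable_indic.
apply: le_trans (bm_le_norm (itvM T) bf) _.
apply: le_trans (le_bm_Rintegral (itvM T) (bm_norm bf) b1 _) _.
  move=> t; rewrite indicE; case: (boolP (t \in _)) => [_|/negP]; first by rewrite mulr1.
  rewrite inE/= in_itv/= => /negP; rewrite negb_and -!ltNge => /orP h.
  by rewrite f0 ?normr0 ?mulr0.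
rewrite Rintegral_itvM// (@Rintegral_eqset _ _ `[a, b]%classic); last first.
  move=> t h; rewrite indicE memNset ?mulr0//= => tab; case: h => -[h1 h2] //.
  by apply: h2; move: tab; rewrite /= !in_itv/= => /andP[? ?]; apply/andP; split; lra.
rewrite (@eq_Rintegral _ _ _ _ _ (fun=> K)); last first.
  by move=> t; rewrite indicE => ->; rewrite mulr1.
apply: le_trans (ler_norm _) (le_itv_Rintegral ab _ _) => t _; first exact: cst_continuous.
by rewrite ger0_norm// (le_trans _ (fK t)).
Qed.

Section kernel_const.
Variables (R : realType) (N : nat) (G l ec r2 Ct Cy W x : R).
Hypotheses (G0 : 0 <= G) (l0 : 0 < l) (ec0 : 0 < ec) (r20 : 0 < r2) (Ct0 : 0 <= Ct) (Cy0 : 0 <= Cy).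

Let C0 : 0 <= Ct / ec ^+ N.
Proof. by rewrite divr_ge0// exprn_ge0// ltW. Qed.
Let C0' : 0 <= Cy / r2 ^+ N.
Proof. by rewrite divr_ge0// exprn_ge0// ltW. Qed.

(** The trivial bound for [W <= 1] and the gains [W^-N] for [W >= 1] are merged into one multiple of
    [(1 + W)^-N], at the cost of [2 ^+ N]; [kernel_const_large] is the other half. *)
Lemma kernel_const_small : 0 <= W -> W <= 1 -> x <= G * l ->
  x <= 2 ^+ N * G * (1 + Ct / ec ^+ N + Cy / r2 ^+ N) * l * (1 + W) ^- N.
Proof.
move=> W0 W1 xG; apply: le_trans xG _.
have -> : 2 ^+ N * G * (1 + Ct / ec ^+ N + Cy / r2 ^+ N) * l * (1 + W) ^- N =
  (G * l) * ((1 + Ct / ec ^+ N + Cy / r2 ^+ N) * ((2 / (1 + W)) ^+ N)).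
  by rewrite exprMn exprVn; ring.
rewrite ler_peMr ?mulr_ge0 ?(ltW l0)//.
have h1 : 1 <= (2 / (1 + W)) ^+ N by rewrite exprn_ege1// ler_pdivlMr; lra.
have h2 : 1 <= 1 + Ct / ec ^+ N + Cy / r2 ^+ N by move: C0 C0'; lra.
by rewrite -[X in X <= _]mulr1; apply: ler_pM.
Qed.

Lemma kernel_const_large : 1 <= W ->
  x <= G * l * Ct / (ec * W) ^+ N \/ x <= G * l * Cy / (r2 * W) ^+ N ->
  x <= 2 ^+ N * G * (1 + Ct / ec ^+ N + Cy / r2 ^+ N) * l * (1 + W) ^- N.
Proof.
move=> W1 h; have W0 : 0 < W by rewrite (lt_le_trans _ W1).
have h1 : W ^- N <= 2 ^+ N * (1 + W) ^- N.
  rewrite -exprVn -exprVn -exprMn lerXn2r// ?nnegrE ?invr_ge0 ?mulr_ge0 ?invr_ge0; try lra.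
  by rewrite -(ler_pM2r W0) mulVf ?gt_eqF// mulrAC ler_pdivlMr; lra.
have {h} h : x <= G * l * ((Ct / ec ^+ N + Cy / r2 ^+ N) * W ^- N).
  have Wn : 0 <= W ^- N by rewrite invr_ge0 exprn_ge0// ltW.
  case: h => h; apply: (le_trans h).
    rewrite exprMn invfM -!mulrA ler_wpM2l// ler_wpM2l ?(ltW l0)// !mulrA ler_wpM2r//.
    by rewrite lerDl.
  rewrite exprMn invfM -!mulrA ler_wpM2l// ler_wpM2l ?(ltW l0)// !mulrA ler_wpM2r//.
  by rewrite lerDr.
apply: (le_trans h).
have -> : 2 ^+ N * G * (1 + Ct / ec ^+ N + Cy / r2 ^+ N) * l * (1 + W) ^- N =
  G * l * ((1 + Ct / ec ^+ N + Cy / r2 ^+ N) * (2 ^+ N * (1 + W) ^- N)) by ring.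
rewrite ler_wpM2l ?mulr_ge0 ?(ltW l0)// ler_pM ?addr_ge0 ?invr_ge0 ?exprn_ge0 ?(ltW W0)//.
by rewrite -addrA lerDr.
Qed.

End kernel_const.

Lemma cancel_scale (R : realType) (r W x : R) : 0 < r -> 0 < W -> r * W / r * (W^-1 * x) = x.
Proof. by move=> r0 W0; field; rewrite !gt_eqF. Qed.

(** * Decay of the TT-star kernel of one piece *)

Section kernel.
Variables (R : realType) (d n : nat) (i j : 'I_d.+1 -> 'I_n).
Implicit Types (y : 'rV[R]_d.+1) (t tau sg : R).
Hypothesis ij : is_bipartition i j.
Hypothesis d2 : (2 <= d.+1)%N.
Local Notation N := (2 * d.+1)%N.
Variables (b0 b1 b2 Bm C1 Kw lambda tau0 mu e l Kchi alpha beta T r c1 Kb Ct Cy : R).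
Variables (Phi rho w : 'rV[R]_n -> R) (chi : R -> R) (q : 'rV[R]_n).
Hypotheses (b00 : 0 < b0) (b02 : b0 < b2) (b21 : b2 < b1) (b1B : b1 <= Bm).
Hypotheses (mPhi : measurable_fun setT Phi) (mrho : measurable_fun setT rho).
Hypotheses (sPhi : smooth_on (open_cube b1) Phi) (srho : smooth_on (open_cube b1) rho).
Hypothesis C10 : 0 < C1.
Hypothesis bPhi : forall s x, (size s <= N.+2)%N -> open_cube b1 x -> `|partials s Phi x| <= C1.
Hypothesis brho : forall s x, (size s <= N.+2)%N -> open_cube b1 x -> `|partials s rho x| <= C1.
Hypotheses (bw : bm w) (wK : forall x, `|w x| <= Kw).
Hypothesis w0 : forall x, w x != 0 -> closed_cube b0 x.
Hypothesis cw : forall x k, Cb 1 N Kw [set t | open_cube b1 (x + t *: unitv R k)] (fun t => w (x + t *: unitv R k)).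
Hypotheses (mu0 : 0 < mu) (muE : mu = `|lambda| + `|tau0|) (e0 : 0 < e <= 2^-1) (lE : l = e * mu).
Hypotheses (cchi : Cb l N Kchi setT chi) (chi0 : forall t, t < alpha \/ beta < t -> chi t = 0).
Hypotheses (ab : alpha <= beta) (ablen : beta - alpha <= 3 * l).
Hypothesis tau0near : forall t, alpha <= t <= beta -> `|t - tau0| <= 3 * (e * mu).
Hypotheses (Talpha : - T <= alpha - l) (Tbeta : beta + l <= T).
Hypothesis qb : closed_cube b0 q.
Hypothesis r0 : 0 < r <= 2^-1.
Hypothesis c10 : 0 < c1.
Hypothesis nondeg : forall (u v : 'rV[R]_d.+1) (sg : R),
  (forall l, `|u 0 l - q 0 (i l)| <= 3 * r /\ `|u 0 l| < b1) ->
  (forall l, `|v 0 l - q 0 (i l)| <= 3 * r /\ `|v 0 l| < b1) ->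
  let V := \sum_l `|u 0 l - v 0 l| in
  let Y := [set y : 'rV[R]_d.+1 | forall l, `|y 0 l - q 0 (j l)| <= 3 * r /\ `|y 0 l| < b1] in
  (forall y, Y y -> c1 * (mu * V + `|sg|) <= mu * `|rho (mix i j (u, y)) - rho (mix i j (v, y))|) \/
  (exists m, forall y, Y y -> forall tau, `|tau - tau0| <= 3 * (e * mu) ->
    c1 * (mu * V + `|sg|) <=
      `|dphase Phi rho lambda tau sg [:: j m] (mix i j (u, y)) (mix i j (v, y))|).
Hypothesis Kb1 : 1 <= Kb.
Hypothesis HKb : forall r a : R, 0 < r ->
  Cb (2 * r) N Kb [set t | `|t - a| < 3 * r] (bump N.+2 r a) /\
  bm (bump N.+2 r a : measurableTypeR R -> R) /\ forall t, `|bump N.+2 r a t| <= Kb.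
Hypotheses (Ct0 : 0 <= Ct) (HCt : osc_t_bound N Ct).
Hypotheses (Cy0 : 0 <= Cy) (HCy : osc_y_bound N (5 * C1) c1 Cy).

(** Bounds, with [N] derivatives, for the amplitude along a line in [y] and ([KA]) for the double
    cut-off in t. The [d] bumps that are constant on the line give [Kb ^+ d], and every product of
    varying factors a [2 ^+ N] from [CbM]. In [Ck], the 5 is the length of the t-interval in units
    of [l] after widening it by [l] on both sides. *)
Definition KB : R := Kb ^+ d * (2 ^+ N * (2 ^+ N * Kb * Kw) * Kw).
Definition KA : R := 2 ^+ N * Kchi * Kchi.
Definition Ck : R := 2 ^+ N * (KA * KB * 5 * (2 * Bm) ^+ d.+1) *
  (1 + Ct / (e * c1) ^+ N + Cy / (2 * r) ^+ N).

Definition eta (y : 'rV[R]_d.+1) : R := \prod_m bump N.+2 r (q 0 (j m)) (y 0 m).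

Lemma l0 : 0 < l. Proof. by rewrite lE mulr_gt0//; case/andP: e0. Qed.
Lemma r_gt0 : 0 < r. Proof. by case/andP: r0. Qed.
Lemma Kw0 : 0 <= Kw. Proof. exact: le_trans (normr_ge0 (w 0)) (wK 0). Qed.
Lemma Kchi0 : 0 <= Kchi. Proof. exact: le_trans (normr_ge0 (chi 0)) (Cb_bound cchi I). Qed.
Lemma Kb_ge0 : 0 <= Kb. Proof. exact: le_trans ler01 Kb1. Qed.
Lemma KA0 : 0 <= KA. Proof. by rewrite /KA !mulr_ge0 ?exprn_ge0 ?Kchi0//. Qed.
Lemma KB0 : 0 <= KB. Proof. by rewrite /KB !mulr_ge0 ?exprn_ge0 ?Kb_ge0 ?Kw0//. Qed.
Lemma b20 : 0 < b2. Proof. exact: lt_trans b00 b02. Qed.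
Lemma Bm0 : 0 < Bm. Proof. exact: lt_le_trans (lt_trans b20 b21) b1B. Qed.
Lemma vol_le k : (2 * b2) ^+ k <= (2 * Bm) ^+ k.
Proof.
have h : b2 <= Bm by apply: le_trans b1B; exact: ltW.
by rewrite lerXn2r ?nnegrE ?mulr_ge0 ?(ltW b20) ?(ltW Bm0)// ler_wpM2l.
Qed.

Lemma eta_bm : bm eta.
Proof.
apply: bm_prod => m; have [_ [h _]] := HKb (q 0 (j m)) r_gt0.
exact: (bm_comp (measurable_coord m) h).
Qed.

Lemma eta_ge0 y : 0 <= eta y.
Proof. by apply: prodr_ge0 => m _; exact: bump_ge0. Qed.

Lemma eta_ge1 y : (forall m, `|y 0 m - q 0 (j m)| <= r) -> 1 <= eta y.
Proof.
move=> h; apply: (@le_trans _ _ (\prod_(m < d.+1) 1)); first by rewrite big1.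
by apply: ler_prod => m _; rewrite ler01 bump_ge1// r_gt0.
Qed.

Section pair.
Variables u v : 'rV[R]_d.+1.
Hypothesis hu : forall m, `|u 0 m - q 0 (i m)| <= r /\ `|u 0 m| <= b0.
Hypothesis hv : forall m, `|v 0 m - q 0 (i m)| <= r /\ `|v 0 m| <= b0.

Definition ampl (y : 'rV[R]_d.+1) : R := eta y * (w (mix i j (u, y)) * w (mix i j (v, y))).

Lemma mix_bm (x : 'rV[R]_d.+1) (f : 'rV[R]_n -> R) : bm f -> bm (fun y => f (mix i j (x, y))).
Proof. by move=> bf; exact: (bm_comp (pair1_measurable x) (bm_comp (measurable_mix ij) bf)). Qed.

Lemma mix_meas (x : 'rV[R]_d.+1) (f : 'rV[R]_n -> R) : measurable_fun setT f ->
  measurable_fun setT (fun y => f (mix i j (x, y))).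
Proof.
by move=> mf; exact: (measurableT_comp mf (measurableT_comp (measurable_mix ij) (pair1_measurable x))).
Qed.

Lemma ampl_bm : bm ampl.
Proof. by apply: bmM; [exact: eta_bm|apply: bmM; exact: mix_bm]. Qed.

Lemma ampl_supp y : ampl y != 0 ->
  forall m, `|y 0 m - q 0 (j m)| < 2 * r /\ `|y 0 m| <= b0.
Proof.
rewrite !mulf_eq0 !negb_or => /andP[eta0 /andP[wu _]] m; split.
  rewrite ltNge; apply: contra eta0 => h; apply/eqP.
  by rewrite /eta (bigD1 m)//= bump0 ?mul0r// r_gt0.
by have := w0 wu (j m); rewrite mixr.
Qed.

Lemma in_cube_u (x y : 'rV[R]_d.+1) (b : R) : (forall m, `|x 0 m| < b) -> (forall m, `|y 0 m| < b) ->
  open_cube b (mix i j (x, y)).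
Proof. by move=> hx hy k; have [[m ->]|[m ->]] := mix_split ij k; rewrite ?mixl ?mixr//. Qed.

Lemma ub1 m : `|u 0 m| < b1.
Proof. by have [_ h] := hu m; apply: le_lt_trans h _; exact: lt_trans b02 b21. Qed.
Lemma vb1 m : `|v 0 m| < b1.
Proof. by have [_ h] := hv m; apply: le_lt_trans h _; exact: lt_trans b02 b21. Qed.

Lemma ampl_le y : `|ampl y| <= KB.
Proof.
rewrite normrM normrM; have [_ [_ hK]] := HKb 0 r_gt0.
have : `|eta y| <= Kb ^+ d.+1.
  rewrite normr_prod -[X in Kb ^+ X]card_ord -prodr_const; apply: ler_prod => m _.
  by rewrite normr_ge0/=; have [_ [_ ->]] := HKb (q 0 (j m)) r_gt0.
have n1 : 1 <= (2 : R) ^+ N by rewrite exprn_ege1// ler1n.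
move=> h; apply: (@le_trans _ _ (Kb ^+ d.+1 * (Kw * Kw))).
  by apply: ler_pM => //; rewrite ?mulr_ge0//; apply: ler_pM.
rewrite /KB exprSr -mulrA ler_wpM2l ?exprn_ge0 ?Kb_ge0//.
rewrite -[X in X <= _]mul1r mulrA [X in _ <= X](_ : _ = (2 ^+ N * 2 ^+ N) * (Kb * (Kw * Kw))); last by ring.
rewrite -mulrA mul1r ler_peMl ?mulr_ge0 ?Kb_ge0 ?Kw0//.
by rewrite -[X in X <= _]mulr1 ler_pM.
Qed.

Local Notation V := (\sum_m `|u 0 m - v 0 m|).

Lemma V_ge0 : 0 <= V. Proof. by apply: sumr_ge0. Qed.

(** Integration by parts uses one derivative of the phase and [N] further ones, and the mean value
    theorem in [u - v] costs another: this accounts for the order [N.+2], which is the [2d + 2] of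
    the theorem. *)
Lemma dphase_le tau sg (s : seq 'I_n) y : `|tau - tau0| <= 3 * (e * mu) -> (size s <= N.+1)%N ->
  (forall m, `|y 0 m| < b1) ->
  `|dphase Phi rho lambda tau sg s (mix i j (u, y)) (mix i j (v, y))| <= 5 * C1 * (mu * V + `|sg|).
Proof.
move=> ht sN yb; have ux := in_cube_u ub1 yb; have vx := in_cube_u vb1 yb.
have sumV : \sum_k `|mix i j (u, y) 0 k - mix i j (v, y) 0 k| = V.
  rewrite (sum_mix _ ij) [X in _ + X]big1 ?addr0; last by move=> m _; rewrite !mixr// subrr normr0.
  by apply: eq_bigr => m _; rewrite !mixl.
have hP : `|partials s Phi (mix i j (u, y)) - partials s Phi (mix i j (v, y))| <= C1 * V.
  rewrite -sumV; apply: mvt_l1 ux vx; first exact: smooth_partials.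
  by move=> k x xb; exact: (@bPhi (k :: s) x sN xb).
have hr : `|partials s rho (mix i j (u, y)) - partials s rho (mix i j (v, y))| <= C1 * V.
  rewrite -sumV; apply: mvt_l1 ux vx; first exact: smooth_partials.
  by move=> k x xb; exact: (@brho (k :: s) x sN xb).
have hs : `|partials s rho (mix i j (v, y))| <= C1 by apply: brho => //; exact: leqW.
have lm : `|lambda| <= mu by rewrite muE lerDl.
have tm : `|tau| <= 4 * mu.
  have -> : tau = (tau - tau0) + tau0 by rewrite subrK.
  apply: le_trans (ler_normD _ _) _.
  have t0 : `|tau0| <= mu by rewrite muE lerDr.
  have h2 : e * mu <= 2^-1 * mu by rewrite ler_wpM2r ?(ltW mu0)//; case/andP: e0.
  exact: four_mu h2 ht t0 mu0.
have H := norm_combination 0 lm tm (lexx `|sg|) hP hr hs.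
rewrite /dphase; apply: (le_trans H); clear H.
rewrite comb5; apply: lerD => //; apply: ler_peMl; last by rewrite ler1n.
by rewrite mulr_ge0// ltW.
Qed.

(** The kernel before integration in [s]. The second t-variable has been replaced by [t - s], which
    produces the second cut-off and the last term of [dphase]. *)
Definition osc (s : R) : R := \int[cubeM d.+1 b2]_y \int[itvM T]_t
  (ampl y * ((chi t * chi (t - s)) *
    cos (dphase Phi rho lambda t s [::] (mix i j (u, y)) (mix i j (v, y))))).

Definition chi2 s t := chi t * chi (t - s).

Lemma chi2_Cb s : Cb l N KA setT (chi2 s).
Proof. by apply: CbM; [exact: l0|exact: cchi|exact: Cb_translate]. Qed.

Lemma cont_bm (f : R -> R) (K : R) : (forall t, {for t, continuous f}) -> (forall t, `|f t| <= K) ->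
  bm (f : measurableTypeR R -> R).
Proof. by move=> cf fK; split; [exact: continuous_measurable_fun|exists K]. Qed.

Lemma chi2_bm s : bm (chi2 s : measurableTypeR R -> R).
Proof. by apply: (@cont_bm _ KA) => t; [exact: Cb_cont (chi2_Cb s) t I|exact: Cb_bound (chi2_Cb s) t I]. Qed.

Lemma chi2_supp s t : t < alpha \/ beta < t -> chi2 s t = 0.
Proof. by move=> h; rewrite /chi2 chi0// mul0r. Qed.

Lemma chi2_le s t : `|chi2 s t| <= KA. Proof. exact: Cb_bound (chi2_Cb s) t I. Qed.

(* The phase is affine in t. *)
Lemma dphaseE s t y : dphase Phi rho lambda t s [::] (mix i j (u, y)) (mix i j (v, y)) =
  (rho (mix i j (u, y)) - rho (mix i j (v, y))) * t +
  (lambda * (Phi (mix i j (u, y)) - Phi (mix i j (v, y))) + s * rho (mix i j (v, y))).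
Proof. by rewrite /dphase/=; ring. Qed.

Lemma dphase_cont s y t : {for t, continuous (fun t : R => dphase Phi rho lambda t s [::] (mix i j (u, y)) (mix i j (v, y)))}.
Proof.
have -> : (fun t : R => dphase Phi rho lambda t s [::] (mix i j (u, y)) (mix i j (v, y))) = 
  (fun t => (rho (mix i j (u, y)) - rho (mix i j (v, y))) * t +
  (lambda * (Phi (mix i j (u, y)) - Phi (mix i j (v, y))) + s * rho (mix i j (v, y)))).
  by apply/funext => t'; exact: dphaseE.
by apply: continuousD; last exact: cst_continuous; apply: continuousM => //; exact: cst_continuous.
Qed.

Lemma dphase_meas s : measurable_fun setT (fun p : 'rV[R]_d.+1 * measurableTypeR R =>
  dphase Phi rho lambda p.2 s [::] (mix i j (u, p.1)) (mix i j (v, p.1))).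
Proof.
under eq_fun do rewrite dphaseE.
have c (f : 'rV[R]_n -> R) (x : 'rV[R]_d.+1) : measurable_fun setT f ->
    measurable_fun setT (fun p : 'rV[R]_d.+1 * measurableTypeR R => f (mix i j (x, p.1))).
  by move=> mf; exact: (measurableT_comp (mix_meas x mf) measurable_fst).
apply: measurable_funD.
  by apply: measurable_funM; [apply: measurable_funB; exact: c|exact: measurable_snd].
apply: measurable_funD; apply: measurable_funM; try exact: measurable_cst.
  by apply: measurable_funB; exact: c.
exact: c.
Qed.

Lemma osc_trivial s : `|osc s| <= KA * KB * 5 * (2 * Bm) ^+ d.+1 * l.
Proof.
apply: le_trans (@osc_0 R d.+1 b2 T alpha beta KA KB (chi2 s) ampl
  (fun p => dphase Phi rho lambda p.2 s [::] (mix i j (u, p.1)) (mix i j (v, p.1))) _ _ _ _ _ _ _ _ _ _ _ _ _) _.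
- exact: ltW b20.
- exact: le_sub_pos l0 Talpha.
- exact: le_add_pos l0 Tbeta.
- exact: ab.
- exact: KA0.
- exact: KB0.
- exact: chi2_supp.
- exact: chi2_bm.
- exact: chi2_le.
- exact: ampl_bm.
- exact: ampl_le.
- exact: dphase_meas.
- move=> y t _; apply: continuousM; first exact: Cb_cont (chi2_Cb s) t I.
  apply: (@continuous_comp _ _ _ (fun t => dphase Phi rho lambda t s [::] (mix i j (u, y)) (mix i j (v, y))) cos); last exact: continuous_cos.
  exact: dphase_cont.
have -> : KA * KB * 5 * (2 * Bm) ^+ d.+1 * l = KA * KB * (5 * l) * (2 * Bm) ^+ d.+1 by ring.
have ab' := le35 l0 ablen.
have K0 : 0 <= KA * KB := mulr_ge0 KA0 KB0.
apply: ler_pM.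
- by rewrite mulr_ge0// subr_ge0.
- by rewrite exprn_ge0// mulr_ge0// ltW ?b20.
- exact: ler_wpM2l K0 _ _ ab'.
- exact: vol_le.
Qed.

Lemma near3 m : (`|u 0 m - q 0 (i m)| <= 3 * r /\ `|u 0 m| < b1) /\
  (`|v 0 m - q 0 (i m)| <= 3 * r /\ `|v 0 m| < b1).
Proof.
have h : r <= 3 * r by rewrite ler_peMl ?ler1n// ltW ?r_gt0.
have [h1 _] := hu m; have [h2 _] := hv m.
by split; split; rewrite ?ub1 ?vb1// ?(le_trans h1) ?(le_trans h2).
Qed.

Lemma ampl_Y y : ampl y != 0 -> forall m, `|y 0 m - q 0 (j m)| <= 3 * r /\ `|y 0 m| < b1.
Proof.
move=> /ampl_supp h m; have [h1 h2] := h m; split.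
  by apply: le_trans (ltW h1) _; rewrite ler_wpM2r ?ler_nat// ltW ?r_gt0.
by apply: le_lt_trans h2 _; exact: lt_trans b02 b21.
Qed.

(** Integration by parts in t. The slope of the phase is the difference of [rho], and the scale
    [l = e mu] of the cut-offs turns the hypothesis into a gain of at least [e c1 (mu V + |s|)]. The
    interval is widened by [l] on both sides to have the strict margin. *)
Lemma osc_slope s : 0 < mu * V + `|s| ->
  (forall y, (forall m, `|y 0 m - q 0 (j m)| <= 3 * r /\ `|y 0 m| < b1) ->
    c1 * (mu * V + `|s|) <= mu * `|rho (mix i j (u, y)) - rho (mix i j (v, y))|) ->
  `|osc s| <= Ct * KA * KB * (5 * l) * (2 * Bm) ^+ d.+1 / (e * c1 * (mu * V + `|s|)) ^+ N.
Proof.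
move=> W0 H; have e1 : 0 < e by case/andP: e0.
pose sl y := rho (mix i j (u, y)) - rho (mix i j (v, y)).
pose cs y := lambda * (Phi (mix i j (u, y)) - Phi (mix i j (v, y))) + s * rho (mix i j (v, y)).
have -> : osc s = \int[cubeM d.+1 b2]_y \int[itvM T]_t (ampl y * (chi2 s t * cos (sl y * t + cs y))).
  by apply: eq_Rintegral => y _; apply: eq_Rintegral => t _; rewrite dphaseE.
have al : alpha - l < alpha by rewrite ltrBlDr ltrDl l0.
have bl : beta < beta + l by rewrite ltrDl l0.
have rr : 0 < e * c1 * (mu * V + `|s|) by rewrite !mulr_gt0.
have K0 : 0 <= Ct * KA * KB := mulr_ge0 (mulr_ge0 Ct0 KA0) KB0.
have len : beta + l - (alpha - l) <= 5 * l by exact: len5 ablen.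
apply: le_trans (@HCt d.+1 b2 T l (e * c1 * (mu * V + `|s|)) (alpha - l) alpha beta (beta + l)
  KA KB (chi2 s) ampl sl cs _ _ _ _ _ _ _ _ _ _ _ _ _ _ _) _ => //.
- exact: ltW b20.
- exact: l0.
- by apply: lt_le_trans al _; apply: le_trans ab _; exact: ltW.
- exact: chi2_supp.
- exact: chi2_Cb.
- exact: ampl_bm.
- exact: ampl_le.
- move=> y /ampl_Y /H h; rewrite lE -mulrA -[X in _ <= X]mulrA; apply: ler_wpM2l => //.
  exact: ltW.
- by apply: measurable_funB; exact: mix_meas.
- apply: measurable_funD; apply: measurable_funM; try exact: measurable_cst.
    by apply: measurable_funB; exact: mix_meas.
  exact: mix_meas.
rewrite ler_wpM2r ?invr_ge0 ?exprn_ge0 ?(ltW rr)//; apply: ler_pM.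
- rewrite mulr_ge0// subr_ge0; apply: le_trans (ltW al) _; apply: le_trans ab _; exact: ltW.
- by rewrite exprn_ge0// mulr_ge0// ltW ?b20.
- exact: ler_wpM2l K0 _ _ len.
- exact: vol_le.
Qed.

Section line.
Variables (s : R) (m : 'I_d.+1) (t : R).
Hypothesis W0 : 0 < mu * V + `|s|.
Hypothesis Hm : forall y, (forall m, `|y 0 m - q 0 (j m)| <= 3 * r /\ `|y 0 m| < b1) ->
    c1 * (mu * V + `|s|) <= `|dphase Phi rho lambda t s [:: j m] (mix i j (u, y)) (mix i j (v, y))|.
Hypothesis tab : `|t - tau0| <= 3 * (e * mu).
Variable y' : 'rV[R]_d.
Hypothesis hy' : forall l, `|y' 0 l - q 0 (j (lift m l))| < 2 * r /\ `|y' 0 l| <= b0.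

Let D : set R := [set x | `|x| < b1 /\ `|x - q 0 (j m)| < 3 * r].

Lemma line_open : open D.
Proof.
have -> : D = `]- b1, b1[%classic `&` `](q 0 (j m) - 3 * r), (q 0 (j m) + 3 * r)[%classic.
  by apply/seteqP; split=> x; rewrite /D /= !in_itv/= ltr_norml ltr_distl.
by apply: openI; exact: interval_open.
Qed.

Lemma line_Y x : D x -> forall l, `|ins m (x, y') 0 l - q 0 (j l)| <= 3 * r /\ `|ins m (x, y') 0 l| < b1.
Proof.
move=> [xb xr] l'; case: (unliftP m l') => [l2 ->|->].
  rewrite ins_lift; have [h1 h2] := hy' l2; split.
    by apply: le_trans (ltW h1) _; rewrite ler_wpM2r ?ler_nat// ltW ?r_gt0.
  by apply: le_lt_trans h2 _; exact: lt_trans b02 b21.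
by rewrite ins_same; split => //; exact: ltW.
Qed.

Lemma line_cube x : D x -> open_cube b1 (mix i j (u, ins m (0, y')) + x *: unitv R (j m)) /\
  open_cube b1 (mix i j (v, ins m (0, y')) + x *: unitv R (j m)).
Proof.
move=> Dx; rewrite -!(mix_ins_line _ _ _ _ ij).
have h l' : `|ins m (x, y') 0 l'| < b1 by have [] := line_Y Dx l'.
by split; apply: in_cube_u h; [exact: ub1|exact: vb1].
Qed.

(** All derivatives of the phase difference are at most [5 C1] times [mu V + |s|], the size of the
    lower bound for the derivative along [j m]. After division by this quantity the derivative is a
    function [p1] bounded above and below independently of [mu]. The scale may be reduced from 1 to
    [2 r] because [r <= 1 / 2]. *)
Lemma line_dphase : Cb (2 * r) N (5 * C1) D (fun x =>
    (mu * V + `|s|)^-1 * dphase Phi rho lambda t s [:: j m] (mix i j (u, ins m (x, y'))) (mix i j (v, ins m (x, y')))) /\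
  forall x, D x -> is_derive x 1
    (fun x : R => dphase Phi rho lambda t s [::] (mix i j (u, ins m (x, y'))) (mix i j (v, ins m (x, y'))))
    (dphase Phi rho lambda t s [:: j m] (mix i j (u, ins m (x, y'))) (mix i j (v, ins m (x, y')))).
Proof.
have r20 : 0 < 2 * r by rewrite mulr_gt0// r_gt0.
have r21 : 2 * r <= 1 by case/andP: r0 => _; rewrite -(ler_pM2l (ltr0n R 2)) mulfV.
have E z x : mix i j (z, ins m (x, y')) = mix i j (z, ins m (0, y')) + x *: unitv R (j m).
  exact: mix_ins_line.
have bd s' x : (size s' <= N.+1)%N -> D x ->
   `|dphase Phi rho lambda t s s' (mix i j (u, ins m (0, y')) + x *: unitv R (j m)) (mix i j (v, ins m (0, y')) + x *: unitv R (j m))|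
    <= 5 * C1 * (mu * V + `|s|).
  by move=> s'N Dx; rewrite -!E; apply: dphase_le => // l'; have [] := line_Y Dx l'.
split.
  have [h _] := @Cb_dphase _ _ b1 lambda t s (5 * C1 * (mu * V + `|s|)) Phi rho
    (mix i j (u, ins m (0, y'))) (mix i j (v, ins m (0, y'))) (j m) [:: j m] N D sPhi srho line_cube
    (fun s' x h => bd s' x (eq_rect _ (fun k => (size s' <= k)%N) h _ (addn1 N))).
  have h2 := CbZ (mu * V + `|s|)^-1 (@ltr01 R) h.
  have E2 : `|(mu * V + `|s|)^-1| * (5 * C1 * (mu * V + `|s|)) = 5 * C1.
    by rewrite gtr0_norm ?invr_gt0// mulrC mulfK// gt_eqF.
  rewrite E2 in h2.
  have h3 : Cb (2 * r) N (5 * C1) D (fun x => (mu * V + `|s|)^-1 * dphase Phi rho lambda t s [:: j m]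
     (mix i j (u, ins m (0, y')) + x *: unitv R (j m)) (mix i j (v, ins m (0, y')) + x *: unitv R (j m))).
    by apply: Cb_shrink h2; [rewrite r20 r21|rewrite mulr_ge0// ltW].
  by apply: Cb_ext line_open _ h3 => x _; rewrite -!E.
move=> x Dx.
have [_ h] := @Cb_dphase _ _ b1 lambda t s (5 * C1 * (mu * V + `|s|)) Phi rho
    (mix i j (u, ins m (0, y'))) (mix i j (v, ins m (0, y'))) (j m) [::] 0 D sPhi srho line_cube
    (fun s' x h => bd s' x (leq_trans h (leq0n _))).
by have := h x Dx; rewrite -!E; apply: is_derive_ext; near=> z; rewrite -!E.
Unshelve. all: end_near. Qed.

Lemma line_ampl : Cb (2 * r) N KB D (fun x => ampl (ins m (x, y'))).
Proof.
have r20 : 0 < 2 * r by rewrite mulr_gt0// r_gt0.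
have r21 : 2 * r <= 1 by case/andP: r0 => _; rewrite -(ler_pM2l (ltr0n R 2)) mulfV.
pose E := \prod_l bump N.+2 r (q 0 (j (lift m l))) (y' 0 l).
have EK : `|E| <= Kb ^+ d.
  rewrite normr_prod -[X in Kb ^+ X]card_ord -prodr_const; apply: ler_prod => l' _.
  by rewrite normr_ge0/=; have [_ [_ ->]] := HKb (q 0 (j (lift m l'))) r_gt0.
have cwx (z : 'rV[R]_d.+1) : (forall l, `|z 0 l| < b1) -> Cb (2 * r) N Kw D (fun x => w (mix i j (z, ins m (x, y')))).
  move=> zb; apply: Cb_shrink (_ : Cb 1 N Kw D _); rewrite ?r20 ?Kw0//.
  apply: Cb_ext line_open _ (Cb_sub _ (cw (mix i j (z, ins m (0, y'))) (j m))).
    by move=> x _; rewrite -mix_ins_line.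
  move=> x Dx /=; rewrite -mix_ins_line//; apply: in_cube_u => // l'.
  by have [] := line_Y Dx l'.
have cb : Cb (2 * r) N Kb D (bump N.+2 r (q 0 (j m))).
  by apply: Cb_sub (HKb (q 0 (j m)) r_gt0).1 => x [_].
have h := CbZ E r20 (CbM r20 (CbM r20 cb (cwx u ub1)) (cwx v vb1)).
apply: Cb_ext line_open _ (Cb_le r20 _ h).
  move=> x _; rewrite /ampl /eta (bigD1_ord m)//= ins_same.
  under eq_bigr do rewrite ins_lift.
  exact: prod4.
rewrite /KB; apply: ler_wpM2r => //.
by rewrite !mulr_ge0 ?exprn_ge0 ?Kb_ge0 ?Kw0.
Qed.

Lemma line_supp x : ampl (ins m (x, y')) != 0 -> `|x - q 0 (j m)| < 2 * r /\ `|x| <= b0.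
Proof. by move=> /ampl_supp /(_ m); rewrite ins_same. Qed.

End line.

Lemma osc_line s m t : 0 < mu * V + `|s| -> `|t - tau0| <= 3 * (e * mu) ->
  (forall y, (forall m, `|y 0 m - q 0 (j m)| <= 3 * r /\ `|y 0 m| < b1) ->
    c1 * (mu * V + `|s|) <= `|dphase Phi rho lambda t s [:: j m] (mix i j (u, y)) (mix i j (v, y))|) ->
  `|\int[cubeM d.+1 b2]_y (ampl y * cos (dphase Phi rho lambda t s [::] (mix i j (u, y)) (mix i j (v, y))))|
  <= Cy * KB * (2 * Bm) ^+ d.+1 / (2 * r * (mu * V + `|s|)) ^+ N.
Proof.
move=> W0 tt Hm; have r20 : 0 < 2 * r by rewrite mulr_gt0// r_gt0.
have rW : 0 < 2 * r * (mu * V + `|s|) by rewrite mulr_gt0.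
have B0 : 0 <= 2 * Bm by rewrite mulr_ge0// ltW ?Bm0.
have K0 : 0 <= Cy * KB * (2 * Bm) := mulr_ge0 (mulr_ge0 Cy0 KB0) B0.
have mP : measurable_fun setT (fun y : 'rV[R]_d.+1 => dphase Phi rho lambda t s [::] (mix i j (u, y)) (mix i j (v, y))).
  exact: (measurableT_comp (dphase_meas s) (pair2_measurable t)).
(* At scale [2 r] the gain is [2 r (mu V + |s|)], since the phase derivative is [mu V + |s|] times
   the normalized [p1] of [line_dphase]. *)
apply: le_trans (@HCy d m b2 (2 * r) (2 * r * (mu * V + `|s|)) KB (2 * Bm) ampl
  (fun y => dphase Phi rho lambda t s [::] (mix i j (u, y)) (mix i j (v, y)))
  (ltW b20) r20 rW KB0 B0 ampl_bm mP _) _; last first.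
  rewrite exprS [Cy * KB * (2 * Bm * _)]mulrA; apply: ler_wpM2r; first by rewrite invr_ge0 exprn_ge0// ltW.
  by apply: (ler_wpM2l K0); exact: vol_le.
move=> y'; have [hy'|] := pselect (forall l, `|y' 0 l - q 0 (j (lift m l))| < 2 * r /\ `|y' 0 l| <= b0); last first.
  move=> h; left=> x; apply/eqP; apply: contrapT => /negP/ampl_supp h2; apply: h => l'.
  by have := h2 (lift m l'); rewrite ins_lift.
right; have qm := qb (j m); have r0' := r_gt0.
exists (Num.max (- b2) (q 0 (j m) - 5 / 2 * r)), (Num.max (- b0) (q 0 (j m) - 2 * r)),
  (Num.min b0 (q 0 (j m) + 2 * r)), (Num.min b2 (q 0 (j m) + 5 / 2 * r)),
  [set x | `|x| < b1 /\ `|x - q 0 (j m)| < 3 * r],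
  (fun x => (mu * V + `|s|)^-1 * dphase Phi rho lambda t s [:: j m] (mix i j (u, ins m (x, y'))) (mix i j (v, ins m (x, y')))).
have [g1 g2 g3] := window b00 b02 b21 r0' qm.
split.
- exact: g1.
- by apply: le_trans g2 _; rewrite ler_wpM2l//; apply: le_trans b1B; exact: ltW.
- split; first exact: line_open.
    by move=> x xi; apply: g3.1; move: xi; rewrite /= in_itv.
  move=> x xo; apply/eqP; apply: contrapT => /negP/(line_supp)[h1 h2].
  exact: g3.2 xo h1 h2.
- have [h1 h2] := line_dphase W0 tt hy'.
  split=> //.
    move=> x Dx; rewrite normrM gtr0_norm ?invr_gt0// ler_pdivlMl// mulrC.
    by apply: Hm; exact: line_Y.
  move=> x Dx; have := h2 x Dx; set D1 := dphase _ _ _ _ _ [:: j m] _ _.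
  suff -> : 2 * r * (mu * V + `|s|) / (2 * r) * ((mu * V + `|s|)^-1 * D1) = D1 by [].
  exact: cancel_scale.
- exact: line_ampl.
Qed.

(** With the t-integral outside, [osc_line] bounds the y-integral for each fixed t in the support of
    the cut-off, and t contributes the length of that support. *)
Lemma osc_direction s m : 0 < mu * V + `|s| ->
  (forall y, (forall m, `|y 0 m - q 0 (j m)| <= 3 * r /\ `|y 0 m| < b1) ->
    forall t, `|t - tau0| <= 3 * (e * mu) ->
    c1 * (mu * V + `|s|) <= `|dphase Phi rho lambda t s [:: j m] (mix i j (u, y)) (mix i j (v, y))|) ->
  `|osc s| <= KA * (Cy * KB * (2 * Bm) ^+ d.+1 / (2 * r * (mu * V + `|s|)) ^+ N) * (beta - alpha).
Proof.
move=> W0 Hm.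
have bI : bm (fun p : 'rV[R]_d.+1 * measurableTypeR R => ampl p.1 * (chi2 s p.2 *
    cos (dphase Phi rho lambda p.2 s [::] (mix i j (u, p.1)) (mix i j (v, p.1))))).
  apply: bmM; first exact: (bm_comp measurable_fst ampl_bm).
  by apply: bmM; [exact: (bm_comp measurable_snd (chi2_bm s))|exact: bm_cos (dphase_meas s)].
rewrite /osc; have [-> _] := bm_Fubini (cubeM d.+1 b2) (itvM T) bI.
have bsw : bm (fun p : measurableTypeR R * 'rV[R]_d.+1 => ampl p.2 * (chi2 s p.1 *
    cos (dphase Phi rho lambda p.1 s [::] (mix i j (u, p.2)) (mix i j (v, p.2))))).
  have ms : measurable_fun setT (fun p : measurableTypeR R * 'rV[R]_d.+1 => (p.2, p.1)).
    by apply/measurable_fun_pairP; split; [exact: measurable_snd|exact: measurable_fst].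
  exact: (bm_comp ms bI).
have bt t : bm (fun y : 'rV[R]_d.+1 => ampl y * cos (dphase Phi rho lambda t s [::] (mix i j (u, y)) (mix i j (v, y)))).
  apply: bmM; first exact: ampl_bm.
  exact: bm_cos (measurableT_comp (dphase_meas s) (pair2_measurable t)).
have E t : \int[cubeM d.+1 b2]_y (ampl y * (chi2 s t *
    cos (dphase Phi rho lambda t s [::] (mix i j (u, y)) (mix i j (v, y))))) =
  chi2 s t * \int[cubeM d.+1 b2]_y (ampl y *
    cos (dphase Phi rho lambda t s [::] (mix i j (u, y)) (mix i j (v, y)))).
  by rewrite -(bm_RintegralZ _ _ (bt t)); apply: eq_Rintegral => y _; rewrite mulrCA.
apply: bm_window (bm_Rint (cubeM d.+1 b2) bsw) _ _ _ _ _.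
- exact: le_sub_pos l0 Talpha.
- exact: le_add_pos l0 Tbeta.
- exact: ab.
- move=> t; rewrite E normrM; have [tab|tab] := boolP (alpha <= t <= beta).
    apply: ler_pM => //; first exact: chi2_le.
    by apply: osc_line (tau0near tab) _ => // y hy; apply: Hm => //; exact: tau0near.
  rewrite chi2_supp ?normr0 ?mul0r.
    rewrite mulr_ge0 ?KA0// divr_ge0 ?exprn_ge0// ?(mulr_ge0 (mulr_ge0 Cy0 KB0))// ?exprn_ge0//.
      by rewrite mulr_ge0// ltW ?Bm0.
    by rewrite !mulr_ge0 ?(ltW W0)// ltW ?r_gt0.
  by move: tab; rewrite negb_and -!ltNge => /orP[]; [left|right].
- by move=> t h; rewrite E chi2_supp ?mul0r.
Qed.

(** For [W <= 1] the trivial bound suffices. For larger [W] the alternative of [nondeg] decides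
    whether the [N] integrations by parts are made in t or along one coordinate of [y]. *)
Lemma osc_le s : `|osc s| <= Ck * l * (1 + (mu * V + `|s|)) ^- N.
Proof.
have W0 : 0 <= mu * V + `|s| by rewrite addr_ge0// mulr_ge0 ?(ltW mu0) ?V_ge0.
set W := mu * V + `|s| in W0 *.
pose G := KA * KB * 5 * (2 * Bm) ^+ d.+1.
have G0 : 0 <= G.
  by rewrite /G; apply: mulr_ge0; [exact: mulr_ge0 (mulr_ge0 KA0 KB0) _|rewrite exprn_ge0// mulr_ge0// ltW ?Bm0].
have ec0 : 0 < e * c1 by rewrite mulr_gt0//; case/andP: e0.
have r20 : 0 < 2 * r by rewrite mulr_gt0// r_gt0.
have [W1|/ltW W1] := leP W 1.
  exact: kernel_const_small G0 l0 ec0 r20 Ct0 Cy0 W0 W1 (osc_trivial s).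
have Wp : 0 < W by exact: lt_le_trans W1.
apply: kernel_const_large G0 l0 ec0 r20 Ct0 Cy0 W1 _.
have [nu nv] : (forall m, `|u 0 m - q 0 (i m)| <= 3 * r /\ `|u 0 m| < b1) /\
    (forall m, `|v 0 m - q 0 (i m)| <= 3 * r /\ `|v 0 m| < b1).
  by split=> m; have [] := near3 m.
have [H|[m H]] := nondeg s nu nv.
  left; apply: le_trans (osc_slope Wp H) _; rewrite le_eqVlt; apply/orP; left; apply/eqP.
  by rewrite /G -/W; ring.
right; apply: le_trans (osc_direction Wp H) _.
rewrite -/W; have -> : G * l * Cy / (2 * r * W) ^+ N = KA * (Cy * KB * (2 * Bm) ^+ d.+1 / (2 * r * W) ^+ N) * (5 * l).
  by rewrite /G; ring.
apply: ler_wpM2l; last exact: le35 l0 ablen.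
apply: mulr_ge0; first exact: KA0.
apply: divr_ge0; last by apply: exprn_ge0; apply: mulr_ge0; [apply: mulr_ge0 => //; rewrite ltW ?r_gt0 | exact: ltW Wp].
by rewrite (mulr_ge0 (mulr_ge0 Cy0 KB0))// exprn_ge0// mulr_ge0// ltW ?Bm0.
Qed.

End pair.
End kernel.

(** * The estimate for one piece of the t-axis and one box *)

Section piece.
Variables (R : realType) (d n : nat) (i j : 'I_d.+1 -> 'I_n).
Hypothesis ij : is_bipartition i j.
Hypothesis d2 : (2 <= d.+1)%N.
Local Notation N := (2 * d.+1)%N.
Variables (b2 T mu lambda kappa C : R) (Phi rho w : 'rV[R]_n -> R) (chi : R -> R).
Variable eta : 'rV[R]_d.+1 -> R.
Hypotheses (b20 : 0 <= b2) (T0 : 0 < T) (mu0 : 0 < mu) (C0 : 0 <= C).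
Hypotheses (mPhi : measurable_fun setT Phi) (mrho : measurable_fun setT rho).
Hypotheses (bw : bm w) (beta : bm eta).
Hypothesis cchi : forall t, {for t, continuous chi}.
Hypothesis bchi : bm (chi : measurableTypeR R -> R).
Hypothesis chi0 : forall t, T < `|t| -> chi t = 0.

(** The shift [kappa] lets cosine integrals stand for the real and the imaginary part of the
    exponential alike. It cancels in the difference of two phases. *)
Definition phase (t : R) (x : 'rV[R]_n) : R := lambda * Phi x + t * rho x + kappa.

Definition Kc (p : 'rV[R]_d.+1 * 'rV[R]_d.+1) : R :=
  w (mix i j (p.2, p.1)) * \int[itvM T]_t (chi t * cos (phase t (mix i j (p.2, p.1)))).
Definition Ks (p : 'rV[R]_d.+1 * 'rV[R]_d.+1) : R :=
  w (mix i j (p.2, p.1)) * \int[itvM T]_t (chi t * sin (phase t (mix i j (p.2, p.1)))).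

Lemma q43N (t : R) : q43 (- t) = q43 t. Proof. by rewrite /q43 normrN. Qed.

Lemma q43_bm : bm (@q43 R : measurableTypeR R -> R).
Proof.
split; first by apply: continuous_measurable_fun; exact: q43_cont.
exists 1 => t; rewrite ger0_norm ?q43_ge0// /q43 -[leRHS](powRr0 (1 + `|t|)).
by rewrite ler_powR ?lerDl// oppr_le0 divr_ge0.
Qed.

Lemma phase_meas2 : measurable_fun setT (fun p : 'rV[R]_n * measurableTypeR R => phase p.2 p.1).
Proof.
apply: measurable_funD; last exact: measurable_cst.
apply: measurable_funD; apply: measurable_funM.
- exact: measurable_cst.
- exact: (measurableT_comp mPhi measurable_fst).
- exact: measurable_snd.
- exact: (measurableT_comp mrho measurable_fst).
Qed.

Lemma phase_cont x t : {for t, continuous (fun t : R => phase t x)}.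
Proof.
apply: continuousD; last exact: cst_continuous.
by apply: continuousD; [exact: cst_continuous|apply: continuousM => //; exact: cst_continuous].
Qed.

Lemma swap_meas : measurable_fun setT (fun p : 'rV[R]_d.+1 * 'rV[R]_d.+1 => mix i j (p.2, p.1)).
Proof.
apply: (measurableT_comp (measurable_mix ij)).
by apply/measurable_fun_pairP; split; [exact: measurable_snd|exact: measurable_fst].
Qed.

Lemma Kc_bm : bm Kc.
Proof.
apply: (bm_comp swap_meas (f := fun x => w x * \int[itvM T]_t (chi t * cos (phase t x)))).
apply: bmM => //; apply: (bm_Rint (itvM T) (f := fun p => chi p.2 * cos (phase p.2 p.1))).
by apply: bmM; [exact: (bm_comp measurable_snd bchi)|exact: bm_cos phase_meas2].
Qed.

Lemma Ks_bm : bm Ks.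
Proof.
apply: (bm_comp swap_meas (f := fun x => w x * \int[itvM T]_t (chi t * sin (phase t x)))).
apply: bmM => //; apply: (bm_Rint (itvM T) (f := fun p => chi p.2 * sin (phase p.2 p.1))).
by apply: bmM; [exact: (bm_comp measurable_snd bchi)|exact: bm_sin phase_meas2].
Qed.

Section pair.
Variables u v : 'rV[R]_d.+1.
Local Notation xu y := (mix i j (u, y)).
Local Notation xv y := (mix i j (v, y)).

Lemma chi_cos_bm x : bm (fun t : measurableTypeR R => chi t * cos (phase t x)).
Proof. by apply: bmM => //; apply: bm_cos; exact: (measurableT_comp phase_meas2 (pair1_measurable x)). Qed.

Lemma chi_sin_bm x : bm (fun t : measurableTypeR R => chi t * sin (phase t x)).
Proof. by apply: bmM => //; apply: bm_sin; exact: (measurableT_comp phase_meas2 (pair1_measurable x)). Qed.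

(** The addition formula for the cosine, followed by the reflection of the second t-variable about
    the first; this turns a product of two integrals into one with phase [dphase]. *)
Lemma double_phase x x' :
  (\int[itvM T]_t (chi t * cos (phase t x))) * (\int[itvM T]_t (chi t * cos (phase t x'))) +
  (\int[itvM T]_t (chi t * sin (phase t x))) * (\int[itvM T]_t (chi t * sin (phase t x'))) =
  \int[itvM T]_t \int[itvM (2 * T)]_s ((chi t * chi (t - s)) * cos (dphase Phi rho lambda t s [::] x x')).
Proof.
rewrite mulrC -(bm_RintegralZ _ _ (chi_cos_bm x)).
rewrite [X in _ + X]mulrC -(bm_RintegralZ _ _ (chi_sin_bm x)).
rewrite -bm_RintegralD; [|exact: bmZ (chi_cos_bm x)|exact: bmZ (chi_sin_bm x)].
apply: eq_Rintegral => t _.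
have [tT|tT] := ltP T `|t|.
  rewrite chi0// !mul0r !mulr0 addr0 (@eq_Rintegral _ _ _ _ _ (fun=> 0)); first by rewrite Rintegral_cst// mul0r.
  by move=> s _; rewrite !mul0r.
rewrite [_ * (chi t * cos _)]mulrC -(bm_RintegralZ _ _ (chi_cos_bm x')).
rewrite [_ * (chi t * sin _)]mulrC -(bm_RintegralZ _ _ (chi_sin_bm x')).
rewrite -bm_RintegralD; [|exact: bmZ (chi_cos_bm x')|exact: bmZ (chi_sin_bm x')].
rewrite (@Rintegral_reflect _ _ T t)//.
- apply: eq_Rintegral => s _.
  have -> : dphase Phi rho lambda t s [::] x x' = phase t x - phase (t - s) x'.
    by rewrite /dphase /phase/=; ring.
  by rewrite cosB; ring.
- move=> t'; have ct : {for t', continuous (fun t : R => phase t x')} by exact: phase_cont.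
  apply: continuousD; apply: continuousM; try exact: cst_continuous; apply: continuousM => //.
    by apply: (@continuous_comp _ _ _ (fun t => phase t x') cos); [exact: ct|exact: continuous_cos].
  by apply: (@continuous_comp _ _ _ (fun t => phase t x') sin); [exact: ct|exact: continuous_sin].
- by apply: bmD; [exact: bmZ (chi_cos_bm x')|exact: bmZ (chi_sin_bm x')].
- by move=> t' ht'; rewrite (chi0 ht') !mul0r !mulr0 addr0.
Qed.

Definition osc0 (s : R) : R := \int[cubeM d.+1 b2]_y \int[itvM T]_t
  ((eta y * (w (xu y) * w (xv y))) * ((chi t * chi (t - s)) * cos (dphase Phi rho lambda t s [::] (xu y) (xv y)))).

Hypothesis Hosc : forall s, `|osc0 s| <=
  C * (1 + (mu * (\sum_m `|u 0 m - v 0 m|) + `|s|)) ^- N.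

Lemma mix_meas1 (x : 'rV[R]_d.+1) : measurable_fun setT (fun y => mix i j (x, y)).
Proof. exact: (measurableT_comp (measurable_mix ij) (pair1_measurable x)). Qed.

Lemma kernel_eq : \int[cubeM d.+1 b2]_y (eta y * (Kc (y, u) * Kc (y, v) + Ks (y, u) * Ks (y, v))) =
  \int[itvM (2 * T)]_s osc0 s.
Proof.
pose g (p : ('rV[R]_d.+1 * measurableTypeR R) * measurableTypeR R) : R := (eta p.1.1 * (w (xu p.1.1) * w (xv p.1.1))) *
  ((chi p.2 * chi (p.2 - p.1.2)) * cos (dphase Phi rho lambda p.2 p.1.2 [::] (xu p.1.1) (xv p.1.1))).
have m11 : measurable_fun setT (fun p : ('rV[R]_d.+1 * measurableTypeR R) * measurableTypeR R => p.1.1).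
  exact: (measurableT_comp measurable_fst measurable_fst).
have m12 : measurable_fun setT (fun p : ('rV[R]_d.+1 * measurableTypeR R) * measurableTypeR R => p.1.2).
  exact: (measurableT_comp measurable_snd measurable_fst).
have m2 : measurable_fun setT (fun p : ('rV[R]_d.+1 * measurableTypeR R) * measurableTypeR R => p.2).
  exact: measurable_snd.
have mF (f : 'rV[R]_n -> R) (x : 'rV[R]_d.+1) : measurable_fun setT f ->
    measurable_fun setT (fun p : ('rV[R]_d.+1 * measurableTypeR R) * measurableTypeR R => f (mix i j (x, p.1.1))).
  by move=> mf; exact: (measurableT_comp mf (measurableT_comp (mix_meas1 x) m11)).
have bg : bm g.
  apply: bmM.
    apply: bmM; first exact: (bm_comp m11 beta).
    by apply: bmM; exact: (bm_comp m11 (bm_comp (mix_meas1 _) bw)).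
  apply: bmM.
    apply: bmM; first exact: (bm_comp m2 bchi).
    by apply: (bm_comp _ bchi); exact: measurable_funB.
  apply: bm_cos; apply: measurable_funD; first apply: measurable_funD; apply: measurable_funM => //.
  - by apply: measurable_funB; exact: mF.
  - by apply: measurable_funB; exact: mF.
  - exact: mF.
have bgi := bm_Rint (itvM T) bg.
transitivity (\int[cubeM d.+1 b2]_y \int[itvM (2 * T)]_s \int[itvM T]_t g ((y, s), t)); last first.
  by have [-> _] := bm_Fubini (cubeM d.+1 b2) (itvM (2 * T)) bgi.
apply: eq_Rintegral => y _.
have mi : measurable_fun setT (fun q : measurableTypeR R * measurableTypeR R => ((y, q.2), q.1)).
  by apply/measurable_fun_pairP; split=> /=; [apply/measurable_fun_pairP; split; [exact: measurable_cst|exact: measurable_snd]|exact: measurable_fst].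
have [<- _] := bm_Fubini (itvM T) (itvM (2 * T)) (bm_comp mi bg).
have -> : Kc (y, u) * Kc (y, v) + Ks (y, u) * Ks (y, v) = (w (xu y) * w (xv y)) *
  ((\int[itvM T]_t (chi t * cos (phase t (xu y)))) * (\int[itvM T]_t (chi t * cos (phase t (xv y)))) +
  (\int[itvM T]_t (chi t * sin (phase t (xu y)))) * (\int[itvM T]_t (chi t * sin (phase t (xv y))))).
  by rewrite /Kc /Ks/=; move: (w _) (w _) => a1 a2; rewrite mulrDr; congr (_ + _); rewrite mulrACA.
rewrite double_phase mulrA.
pose h q := (chi q.1 * chi (q.1 - q.2)) * cos (dphase Phi rho lambda q.1 q.2 [::] (xu y) (xv y)).
have bh : bm (h : measurableTypeR R * measurableTypeR R -> R).
  apply: bmM.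
    apply: bmM; first exact: (bm_comp measurable_fst bchi).
    by apply: (bm_comp _ bchi); apply: measurable_funB; [exact: measurable_fst|exact: measurable_snd].
  apply: bm_cos; apply: measurable_funD; first apply: measurable_funD; apply: measurable_funM => //.
rewrite -(bm_RintegralZ _ _ (bm_Rint (itvM (2 * T)) bh)); apply: eq_Rintegral => t _.
by rewrite -(bm_RintegralZ _ _ (bm_comp (pair1_measurable t) bh)).
Qed.

Lemma osc0_bm : bm (osc0 : measurableTypeR R -> R).
Proof.
have m11 : measurable_fun setT (fun p : (measurableTypeR R * 'rV[R]_d.+1) * measurableTypeR R => p.1.1).
  exact: (measurableT_comp measurable_fst measurable_fst).
have m12 : measurable_fun setT (fun p : (measurableTypeR R * 'rV[R]_d.+1) * measurableTypeR R => p.1.2).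
  exact: (measurableT_comp measurable_snd measurable_fst).
have m2 : measurable_fun setT (fun p : (measurableTypeR R * 'rV[R]_d.+1) * measurableTypeR R => p.2).
  exact: measurable_snd.
have mF (f : 'rV[R]_n -> R) (x : 'rV[R]_d.+1) : measurable_fun setT f ->
    measurable_fun setT (fun p : (measurableTypeR R * 'rV[R]_d.+1) * measurableTypeR R => f (mix i j (x, p.1.2))).
  by move=> mf; exact: (measurableT_comp mf (measurableT_comp (mix_meas1 x) m12)).
have bg : bm (fun p : (measurableTypeR R * 'rV[R]_d.+1) * measurableTypeR R => (eta p.1.2 * (w (xu p.1.2) * w (xv p.1.2))) *
  ((chi p.2 * chi (p.2 - p.1.1)) * cos (dphase Phi rho lambda p.2 p.1.1 [::] (xu p.1.2) (xv p.1.2)))).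
  apply: bmM.
    apply: bmM; first exact: (bm_comp m12 beta).
    by apply: bmM; exact: (bm_comp m12 (bm_comp (mix_meas1 _) bw)).
  apply: bmM.
    apply: bmM; first exact: (bm_comp m2 bchi).
    by apply: (bm_comp _ bchi); exact: measurable_funB.
  apply: bm_cos; apply: measurable_funD; first apply: measurable_funD; apply: measurable_funM => //.
  - by apply: measurable_funB; exact: mF.
  - by apply: measurable_funB; exact: mF.
  - exact: mF.
exact: (bm_Rint (cubeM d.+1 b2) (bm_Rint (itvM T) bg)).
Qed.

(** [q43_prod] splits the decay of [osc0] into one factor for [s] and one for every coordinate of
    [u - v]. The factor for [s] integrates to at most 6, and a separable bound is left. *)
Lemma kernel_le :
  `|\int[cubeM d.+1 b2]_y (eta y * (Kc (y, u) * Kc (y, v) + Ks (y, u) * Ks (y, v)))|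
    <= 6 * C * \prod_m q43 (mu * (u 0 m - v 0 m)).
Proof.
rewrite kernel_eq; set Q := \prod_m _.
have Q0 : 0 <= Q by apply: prodr_ge0 => m _; exact: q43_ge0.
apply: le_trans (bm_le_norm _ osc0_bm) _.
apply: le_trans (le_bm_Rintegral (itvM (2 * T)) (bm_norm osc0_bm) (bmZ (C * Q) q43_bm) _) _.
  move=> s; apply: le_trans (Hosc s) _; rewrite -mulrA ler_wpM2l//.
  have V0 : 0 <= \sum_m `|u 0 m - v 0 m| by apply: sumr_ge0.
  apply: q43_prod => //.
  - by rewrite addr_ge0// mulr_ge0// ltW.
  - move=> m; rewrite normrM gtr0_norm//; apply: (@le_trans _ _ (mu * \sum_m `|u 0 m - v 0 m|)).
      by rewrite ler_wpM2l ?(ltW mu0)// (bigD1 m)//= lerDl sumr_ge0.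
    by rewrite lerDl.
  - by rewrite lerDr mulr_ge0// ltW.
rewrite (bm_RintegralZ _ _ q43_bm) (Rintegral_itvM _ q43_bm).
have h : \int[@lebesgue_measure R]_(t in `[- (2 * T), 2 * T]) q43 t <= 6.
  have := @q43_int R 1 0 (2 * T) ltr01; rewrite normr0 divr1 => /(_ (mulr_ge0 (ler0n _ _) (ltW T0))).
  by under eq_Rintegral do rewrite mul1r subr0.
have -> : 6 * C * Q = C * Q * 6 by rewrite -mulrA mulrC.
by rewrite ler_wpM2l ?mulr_ge0.
Qed.

End pair.

Variables (b0 r : R) (q : 'rV[R]_n) (f : 'I_n -> R -> R).
Hypotheses (b02 : b0 <= b2) (bf : forall k, bm (f k : measurableTypeR R -> R)).
Hypothesis fsupp : forall k t, f k t != 0 -> `|t - q 0 k| <= r /\ `|t| <= b0.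
Hypotheses (eta0 : forall y, 0 <= eta y).
Hypotheses (eta1 : forall y : 'rV[R]_d.+1, (forall m, `|y 0 m - q 0 (j m)| <= r) -> 1 <= eta y).
Hypothesis Hosc : forall u v : 'rV[R]_d.+1,
  (forall m, `|u 0 m - q 0 (i m)| <= r /\ `|u 0 m| <= b0) ->
  (forall m, `|v 0 m - q 0 (i m)| <= r /\ `|v 0 m| <= b0) ->
  forall s, `|osc0 u v s| <= C * (1 + (mu * (\sum_m `|u 0 m - v 0 m|) + `|s|)) ^- N.

(** [F] collects the functions of the coordinates [i], [G] those of the coordinates [j], and [L] is
    the separable bound of [kernel_le]. Its integral in [v] is a product of one-variable integrals,
    each at most [6 / mu] by [q43_int]. *)
Lemma piece_le :
  (\int[cubeM n b2]_x (\prod_k f k (x 0 k) * (w x * \int[itvM T]_t (chi t * cos (phase t x))))) ^+ 2 <=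
  (6 * C * (6 / mu) ^+ d.+1) * \prod_k \int[itvM b2]_t (f k t ^+ 2).
Proof.
have bprod m (g : 'I_m -> R -> R) : (forall k, bm (g k : measurableTypeR R -> R)) ->
    bm (fun x : 'rV[R]_m => \prod_k g k (x 0 k)).
  by move=> bg; apply: bm_prod => k; exact: (bm_comp (measurable_coord k) (bg k)).
pose F (u : 'rV[R]_d.+1) := \prod_m f (i m) (u 0 m).
pose G (y : 'rV[R]_d.+1) := \prod_m f (j m) (y 0 m).
have bF : bm F by exact: (bprod _ (fun m => f (i m))).
have bG : bm G by exact: (bprod _ (fun m => f (j m))).
have bK : bm (fun x => w x * \int[itvM T]_t (chi t * cos (phase t x))).
  apply: bmM => //; apply: (bm_Rint (itvM T) (f := fun p => chi p.2 * cos (phase p.2 p.1))).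
  by apply: bmM; [exact: (bm_comp measurable_snd bchi)|exact: bm_cos phase_meas2].
rewrite (integral_mix ij b2 (bmM (bprod _ _ bf) bK)).
have bmixall := bm_comp (measurable_mix ij) (bmM (bprod _ _ bf) bK).
have [-> _] := bm_Fubini (cubeM d.+1 b2) (cubeM d.+1 b2) bmixall.
have -> : \int[cubeM d.+1 b2]_y \int[cubeM d.+1 b2]_u
   (\prod_k f k (mix i j (u, y) 0 k) * (w (mix i j (u, y)) * \int[itvM T]_t (chi t * cos (phase t (mix i j (u, y)))))) =
  \int[cubeM d.+1 b2]_y (G y * \int[cubeM d.+1 b2]_u (F u * Kc (y, u))).
  apply: eq_Rintegral => y _.
  have bFK : bm (fun u => F u * Kc (y, u)).
    by apply: bmM => //; exact: (bm_comp (pair1_measurable y) Kc_bm).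
  rewrite -(bm_RintegralZ _ _ bFK); apply: eq_Rintegral => u _.
  rewrite (big_mix ij) [RHS]mulrA [X in _ = X * _]mulrC; congr (_ * _ * _).
    by apply: eq_bigr => m _; rewrite (mixl ij).
  by apply: eq_bigr => m _; rewrite (mixr ij).
pose Q : set 'rV[R]_d.+1 := box (fun m => (`[q 0 (j m) - r, q 0 (j m) + r]%classic : set R)).
pose L (p : 'rV[R]_d.+1 * 'rV[R]_d.+1) := 6 * C * \prod_m q43 (mu * (p.1 0 m - p.2 0 m)).
have bL : bm L.
  apply: bmZ; apply: bm_prod => m; apply: (bm_comp _ q43_bm).
  apply: measurable_funM; first exact: measurable_cst.
  by apply: measurable_funB; [exact: (measurableT_comp (measurable_coord m) measurable_fst)|
    exact: (measurableT_comp (measurable_coord m) measurable_snd)].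
have Fsupp u : F u != 0 -> forall m, `|u 0 m - q 0 (i m)| <= r /\ `|u 0 m| <= b0.
  by move=> /prodf_neq0 h m; apply: fsupp; exact: h.
have H := @TTstar R _ _ _ _ (cubeM d.+1 b2) (cubeM d.+1 b2) F G eta Q Kc Ks L
  (6 * C * (6 / mu) ^+ d.+1) bF bG beta _ Kc_bm Ks_bm bL _ eta0 _ _ _ _ _.
apply: le_trans (H _ _ _ _ _ _ _) _.
- by apply: measurable_box => m; exact: measurable_itv.
- move=> y Qy; apply/eqP; apply: contrapT => /negP /prodf_neq0 h; apply: Qy => m.
  by rewrite /= in_itv/= -ler_distl; have [] := @fsupp (j m) (y 0 m) (h m isT).
- move=> y Qy; apply: eta1 => m; have := Qy m; by rewrite /= in_itv/= -ler_distl.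
- move=> u v; rewrite /L/=; congr (_ * _); apply: eq_bigr => m _.
  by rewrite -q43N -mulrN opprB.
- by move=> u v; rewrite !mulr_ge0// prodr_ge0// => m _; exact: q43_ge0.
- move=> u /Fsupp hu.
  have bq m : bm (fun t : measurableTypeR R => q43 (mu * (u 0 m - t))).
    apply: (bm_comp _ q43_bm); apply: measurable_funM; first exact: measurable_cst.
    by apply: measurable_funB; [exact: measurable_cst|exact: measurable_id].
  have bq2 : bm (fun v : 'rV[R]_d.+1 => \prod_m q43 (mu * (u 0 m - v 0 m))).
    exact: (bprod _ (fun m t => q43 (mu * (u 0 m - t))) bq).
  rewrite /L/= (bm_RintegralZ _ _ bq2) ler_wpM2l ?mulr_ge0//.
  rewrite (cubeM_prod _ bq) -[X in _ <= _ ^+ X]card_ord -prodr_const.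
  apply: ler_prod => m _; rewrite Rintegral_ge0/=; last by move=> t _; exact: q43_ge0.
  rewrite (Rintegral_itvM _ (bq m)).
  under eq_Rintegral do rewrite -q43N -mulrN opprB.
  by apply: q43_int => //; have [_ h] := hu m; exact: le_trans h b02.
- move=> u v Fu Fv; exact: kernel_le (Hosc (Fsupp _ Fu) (Fsupp _ Fv)).
rewrite -[X in X <= _]mulrA le_eqVlt; apply/orP; left; apply/eqP; congr (_ * _).
have bf2 k : bm (fun t : measurableTypeR R => f k t ^+ 2) by exact: bmX.
rewrite [RHS](big_mix ij) mulrC -(cubeM_prod b2 (fun m => bf2 (i m))) -(cubeM_prod b2 (fun m => bf2 (j m))).
by congr (_ * _); apply: eq_Rintegral => y _; rewrite -prodrXl.
Qed.

End piece.

Definition good_chi (R : realType) (N : nat) (l K a b : R) (chi : R -> R) :=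
  [/\ a <= b, b - a <= 3 * l, Cb l N K setT chi & forall t, t < a \/ b < t -> chi t = 0].

(** Regularity is asked only along coordinate lines inside the open cube, which is what integration
    by parts in a single coordinate uses. *)
Definition good_weight (R : realType) (n N : nat) (b0 b1 K : R) (w : 'rV[R]_n -> R) :=
  [/\ measurable_fun setT w, forall x, `|w x| <= K, forall x, w x != 0 -> closed_cube b0 x &
   forall x k, Cb 1 N K [set t | open_cube b1 (x + t *: unitv R k)] (fun t => w (x + t *: unitv R k))].

(** Power count: the kernel constant of [osc_le] is a multiple of [e mu], the length scale of the
    piece, and [piece_le] multiplies it by [(6 / mu)^(d + 1)], which leaves [mu^-d] for the square.
    From here on [d.+1] is the [d] of the theorem. [r] and [e] are chosen before [Kchi], since the
    bounds of the cut-offs depend on [e]. *)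
Lemma piece_estimate (R : realType) (d n : nat) (C1 c : R) : (2 <= d.+1)%N -> 0 < C1 -> 0 < c ->
  exists r e : R, [/\ 0 < r, 0 < e <= 2^-1 & forall Kw Kchi Bm, exists2 CC, 0 <= CC &
  forall (i j : 'I_d.+1 -> 'I_n) (b0 b1 b2 lambda tau0 mu mu0 kappa alpha beta T : R)
    (Phi rho w : 'rV[R]_n -> R) (chi : R -> R) (q : 'rV[R]_n) (f : 'I_n -> R -> R),
  is_bipartition i j -> 0 < b0 -> b0 < b2 -> b2 < b1 -> b1 <= Bm ->
  measurable_fun setT Phi -> measurable_fun setT rho ->
  smooth_on (open_cube b1) Phi -> smooth_on (open_cube b1) rho ->
  (forall s x, (size s <= (2 * d.+1).+2)%N -> open_cube b1 x -> `|partials s Phi x| <= C1) ->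
  (forall s x, (size s <= (2 * d.+1).+2)%N -> open_cube b1 x -> `|partials s rho x| <= C1) ->
  good_weight (2 * d.+1) b0 b1 Kw w ->
  0 < mu -> mu = `|lambda| + `|tau0| -> mu0 = Num.sqrt (lambda ^+ 2 + tau0 ^+ 2) ->
  good_chi (2 * d.+1) (e * mu) Kchi alpha beta chi ->
  (forall t, alpha <= t <= beta -> `|t - tau0| <= 3 * (e * mu)) ->
  0 < T -> - T <= alpha - e * mu -> beta + e * mu <= T ->
  closed_cube b0 q ->
  c <= `|\det (bordered_hessian rho (fun y => lambda / mu0 * Phi y + tau0 / mu0 * rho y) i j q)| ->
  (forall k, bm (f k : measurableTypeR R -> R)) ->
  (forall k t, f k t != 0 -> `|t - q 0 k| <= r /\ `|t| <= b0) ->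
  (\int[cubeM n b2]_x (\prod_k f k (x 0 k) *
     (w x * \int[itvM T]_t (chi t * cos (lambda * Phi x + t * rho x + kappa))))) ^+ 2 <=
  CC * mu ^- d * \prod_k \int[itvM b2]_t (f k t ^+ 2)].
Proof.
move=> d2 C10 c0.
have [c1 [r [e [c10 r0 e0 nondeg]]]] := @nondegenerate R d.+1 n C1 c C10 c0.
have [Kb Kb1 HKb] := @Cb_bump R (2 * d.+1).
have [Ct Ct0 HCt] := @osc_t R (2 * d.+1).
have [Cy Cy0 HCy] := @osc_y R (2 * d.+1) (5 * C1) c1 c10.
have r_gt0 : 0 < r by case/andP: r0.
exists r, e; split=> // Kw Kchi Bm.
pose K := Ck d Bm Kw e Kchi r c1 Kb Ct Cy.
exists (Num.max 0 (6 * K * e * 6 ^+ d.+1)); first by rewrite le_max lexx.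
move=> i j b0 b1 b2 lambda tau0 mu mu0 kappa alpha beta T Phi rho w chi q f.
move=> ij b00 b02 b21 b1B mPhi mrho sPhi srho bPhi brho [mw wK w0 cw] mu_gt0 muE mu0E.
move=> [ab ablen cchi chi0] near0 T0 Ta bT qb det bf fsupp.
have bw : bm w by split => //; exists Kw.
have b20 : 0 < b2 by exact: lt_trans b02.
have qB : open_cube b1 q by move=> k; exact: le_lt_trans (qb k) (lt_trans b02 b21).
have leN (s : seq 'I_n) : (size s <= 3)%N -> (size s <= (2 * d.+1).+2)%N.
  by move=> h; apply: leq_trans h _; rewrite mulnS.
have nd := nondeg b1 Phi rho i j lambda tau0 mu mu0 q sPhi srho (fun s x h => bPhi s x (leN s h))
   (fun s x h => brho s x (leN s h)) ij qB muE mu_gt0 mu0E det.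
have lE : e * mu = e * mu by [].
have Kchi_ge0 : 0 <= Kchi := le_trans (normr_ge0 (chi 0)) (Cb_bound cchi I).
have e_gt0 : 0 < e by case/andP: e0.
have osc := @osc_le R d n i j ij b0 b1 b2 Bm C1 Kw lambda tau0 mu e (e * mu) Kchi alpha beta T r c1 Kb Ct Cy
  Phi rho w chi q.
have oscK (u v : 'rV[R]_d.+1) : (forall m, `|u 0 m - q 0 (i m)| <= r /\ `|u 0 m| <= b0) ->
  (forall m, `|v 0 m - q 0 (i m)| <= r /\ `|v 0 m| <= b0) ->
  forall s, `|osc0 i j b2 T lambda Phi rho w chi (eta j r q) u v s| <=
    K * (e * mu) * (1 + (mu * (\sum_m `|u 0 m - v 0 m|) + `|s|)) ^- (2 * d.+1).
  by move=> hu hv s; apply: osc.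
have K0 : 0 <= K * (e * mu).
  pose u : 'rV[R]_d.+1 := \row_m q 0 (i m).
  have hu m : `|u 0 m - q 0 (i m)| <= r /\ `|u 0 m| <= b0.
    by rewrite mxE subrr normr0 ltW.
  have := le_trans (normr_ge0 _) (oscK u u hu hu 0).
  by rewrite pmulr_lge0// invr_gt0 exprn_gt0// ltr_pwDl// addr_ge0// mulr_ge0 ?(ltW mu_gt0)// sumr_ge0.
have H := @piece_le R d n i j ij d2 b2 T mu lambda kappa (K * (e * mu)) Phi rho w chi (eta j r q)
  T0 mu_gt0 K0 mPhi mrho bw _ _ _ _ b0 r q f (ltW b02) bf fsupp _ _ oscK.
rewrite /phase in H; apply: (le_trans (H _ _ _ _ _ _)) => //.
- exact: eta_bm r0 HKb.
- by move=> t; exact: Cb_cont cchi t I.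
- split; last by exists Kchi => t; exact: Cb_bound cchi t I.
  by apply: continuous_measurable_fun => t; exact: Cb_cont cchi t I.
- move=> t; rewrite ltr_normr => h; apply: chi0; have l0 : 0 < e * mu by rewrite mulr_gt0.
  case/orP: h => h; [right|left]; first exact: le_lt_trans (le_add_pos l0 bT) h.
  by apply: lt_le_trans (le_sub_pos l0 Ta); rewrite ltrNr.
- by move=> y; exact: eta_ge0.
- by move=> y; exact: eta_ge1.
have P0 : 0 <= \prod_k \int[itvM b2]_t (f k t ^+ 2).
  by apply: prodr_ge0 => k _; apply: Rintegral_ge0 => t _; exact: sqr_ge0.
rewrite ler_wpM2r// [X in X <= _](_ : _ = (6 * K * e * 6 ^+ d.+1) * mu ^- d).
  by rewrite ler_wpM2r ?invr_ge0 ?exprn_ge0 ?(ltW mu_gt0)// le_max lexx orbT.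
rewrite exprMn exprVn [mu ^+ d.+1]exprS invfM.
by move: (mu ^- d) (6 ^+ d.+1) => x y; field; rewrite gt_eqF.
Qed.

(** * The partition of the t-axis into geometrically growing pieces *)

Section knots.
Variable R : realType.
Implicit Types (e L M t x l a : R).

(** With [m = 2 N + 1] one has [1 + x <= m (1 + x / m) <= m exp(x / m)], and [N / m <= 1 / 2]. *)
Lemma exp_pow_half (N : nat) x : 0 <= x -> (1 + x) ^+ N * expR (- (x / 2)) <= (2 * N + 1)%:R ^+ N.
Proof.
move=> x0; set m : R := (2 * N + 1)%:R; have m1 : 1 <= m by rewrite ler1n addn1.
have m0 : 0 < m by exact: lt_le_trans m1.
have h : 1 + x <= m * (1 + x / m) by rewrite mulrDr mulr1 mulrCA mulfV ?gt_eqF// mulr1 lerD2r.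
have h2 : (1 + x / m) ^+ N <= expR (x / 2).
  apply: (@le_trans _ _ (expR (x / m) ^+ N)).
    by rewrite lerXn2r ?nnegrE ?expR_ge0 ?addr_ge0 ?divr_ge0 ?(ltW m0)// expR_ge1Dx.
  rewrite -expRM_natl ler_expR mulrCA ler_wpM2l// ler_pdivrMr// /m natrD natrM mulrDr mulrA mulVf// mul1r lerDl.
  by rewrite mulr1 invr_ge0.
rewrite expRN ler_pdivrMr ?expR_gt0//.
apply: le_trans (_ : (m * (1 + x / m)) ^+ N <= _).
  by rewrite lerXn2r ?nnegrE ?addr_ge0 ?mulr_ge0 ?addr_ge0 ?divr_ge0 ?(ltW m0).
by rewrite exprMn ler_wpM2l ?exprn_ge0 ?(ltW m0).
Qed.

(** A derivative of the exponential brings [1 / M], which measured at scale [l] is a factor [l / M];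
    the supremum over the half-line is attained at its left end. *)
Lemma Cb_exp l k K a M (c : R) : 0 < l -> 0 < M ->
  `|c| * expR (- (a / M)) * Num.max 1 (l / M) ^+ k <= K ->
  Cb l k K [set t | a < t] (fun t => c * expR (- (t / M))).
Proof.
move=> l0 M0; set y := Num.max 1 (l / M); have y1 : 1 <= y by rewrite le_max lexx.
have dE t (c' : R) : is_derive t 1 (fun t : R => c' * expR (- (t / M))) ((- c' / M) * expR (- (t / M))).
  have d1 : is_derive t 1 (fun t : R => - (t / M)) (- M^-1 : R).
    have -> : (fun t : R => - (t / M)) = (fun t => - M^-1 * t) by apply/funext => z; rewrite mulNr mulrC.
    rewrite -[X in is_derive _ _ _ X]mulr1.
    by apply: is_deriveZ.
  have d2 := @is_derive1_comp _ expR (fun t : R => - (t / M)) t _ _ (is_derive_expR (- (t / M))) d1.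
  have -> : (- c' / M) * expR (- (t / M)) = c' *: (expR (- (t / M)) * - M^-1).
    by rewrite /GRing.scale/= mulNr mulrN mulrN mulNr mulrAC -mulrA.
  by apply: is_deriveZ.
have bE (c' K' : R) m t : `|c'| * expR (- (a / M)) * y ^+ m <= K' -> a < t -> `|c' * expR (- (t / M))| <= K'.
  move=> h at_; apply: le_trans h; rewrite normrM (ger0_norm (expR_ge0 _)).
  apply: (@le_trans _ _ (`|c'| * expR (- (a / M)))); last first.
    by rewrite ler_peMr ?mulr_ge0 ?expR_ge0// exprn_ege1.
  by rewrite ler_wpM2l// ler_expR lerN2 ler_wpM2r ?invr_ge0 ?ltW.
elim: k c K => [|k IH] c K hK; split; try by move=> t; exact: bE hK.
  by move=> t _; exact: is_derive_cont (dE t c).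
exists (fun t => (- c / M) * expR (- (t / M))); first by move=> t _; exact: dE.
apply: IH; rewrite normrM normrN gtr0_norm ?invr_gt0// ler_pdivlMr//; apply: le_trans hK.
have -> : `|c| / M * expR (- (a / M)) * y ^+ k * l = `|c| * expR (- (a / M)) * y ^+ k * (l / M) by ring.
have -> : `|c| * expR (- (a / M)) * y ^+ k.+1 = `|c| * expR (- (a / M)) * y ^+ k * y by rewrite exprSr mulrA.
apply: ler_wpM2l.
  apply: mulr_ge0; first by rewrite mulr_ge0 ?expR_ge0.
  by apply: exprn_ge0; exact: le_trans ler01 y1.
by rewrite le_max lexx orbT.
Qed.

Lemma Cb_opp l k K (F : R -> R) : 0 < l -> Cb l k K setT F -> Cb l k K setT (fun t => F (- t)).
Proof.
move=> l0; elim: k K F => [|k IH] K F [bF cF]; split; try by move=> t _; exact: bF.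
  by move=> t _; apply: (@continuous_comp _ _ _ (fun t => - t) F); [exact: opp_continuous|exact: cF].
case: cF => F' dF cF; exists (fun t => -1 * F' (- t)) => [t _|].
  have d1 : is_derive t 1 (fun t : R => - t) (-1 : R) by apply: is_deriveN; exact: is_derive_id.
  by rewrite mulrC; exact: is_derive1_comp (dF _ I) d1.
by have := CbZ (-1) l0 (IH _ _ cF); rewrite normrN normr1 mul1r.
Qed.

(** With [L = |lambda|] the recursion is t_(k+1) = t_k + e (L + t_k) from t_0 = 0: each step has
    width [e] times the value of mu at its knot. *)
Definition knot e L (k : nat) : R := L * ((1 + e) ^+ k - 1).
Definition scale e L (k : nat) : R := e * (L * (1 + e) ^+ k).
Definition kstep (m : nat) e L k t : R := sstep m ((t - knot e L k) / scale e L k).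
Definition chik m e L k t : R := kstep m e L k t - kstep m e L k.+1 t.
Definition chi0 m e L t : R := 1 - kstep m e L 0 t - kstep m e L 0 (- t).

Section props.
Variables (e L : R) (m : nat).
Hypotheses (e0 : 0 < e <= 2^-1) (L0 : 0 < L) (m0 : (0 < m)%N).

Let e_gt0 : 0 < e. Proof. by case/andP: e0. Qed.
Let e1 : 0 < 1 + e. Proof. by rewrite addr_gt0. Qed.

Lemma knotE k : L + knot e L k = L * (1 + e) ^+ k.
Proof. by rewrite /knot mulrBr mulr1 addrC subrK. Qed.

Lemma knotS k : knot e L k.+1 = knot e L k + scale e L k.
Proof. by rewrite /knot /scale exprS; ring. Qed.

Lemma scale_gt0 k : 0 < scale e L k. Proof. by rewrite !mulr_gt0// exprn_gt0. Qed.

Lemma scaleS k : scale e L k.+1 = (1 + e) * scale e L k.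
Proof. by rewrite /scale exprS; ring. Qed.

Lemma knot0 : knot e L 0 = 0. Proof. by rewrite /knot expr0 subrr mulr0. Qed.

Lemma knot_ge k : k%:R * (e * L) <= knot e L k.
Proof.
elim: k => [|k IH]; first by rewrite knot0 mul0r.
rewrite knotS -natr1 mulrDl mul1r lerD// /scale ler_wpM2l ?(ltW e_gt0)//.
by rewrite ler_peMr ?(ltW L0)// exprn_ege1// lerDl ltW.
Qed.

Lemma knot_ge0 k : 0 <= knot e L k.
Proof. by apply: le_trans (knot_ge k); rewrite !mulr_ge0 ?(ltW L0) ?(ltW e_gt0). Qed.

Lemma knot_le k p : (k <= p)%N -> knot e L k <= knot e L p.
Proof. by move=> /subnK <-; elim: (p - k)%N => // p' IH; rewrite addSn knotS (le_trans IH)// lerDl ltW ?scale_gt0. Qed.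

Lemma kstep0 k t : t <= knot e L k -> kstep m e L k t = 0.
Proof. by move=> h; apply: sstep0 => //; rewrite pmulr_lle0 ?invr_gt0 ?scale_gt0// subr_le0. Qed.

Lemma kstep1 k t : knot e L k.+1 <= t -> kstep m e L k t = 1.
Proof.
by move=> h; apply: sstep1 => //; rewrite ler_pdivlMr ?scale_gt0// mul1r lerBrDl -knotS.
Qed.

Lemma chik_supp k t : t < knot e L k \/ knot e L k.+2 < t -> chik m e L k t = 0.
Proof.
case=> [h|h]; rewrite /chik; first by rewrite !kstep0 ?subrr ?(le_trans (ltW h))// knot_le.
by rewrite !kstep1 ?subrr ?(le_trans _ (ltW h))// knot_le.
Qed.

Lemma chi0_supp t : t < - (e * L) \/ e * L < t -> chi0 m e L t = 0.
Proof.
have k1 : knot e L 1 = e * L by rewrite knotS knot0 add0r /scale expr0 mulr1.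
have eL : 0 < e * L by rewrite mulr_gt0.
have z t' : t' <= 0 -> kstep m e L 0 t' = 0 by move=> h; apply: kstep0; rewrite knot0.
have o t' : e * L < t' -> kstep m e L 0 t' = 1 by move=> h; apply: kstep1; rewrite k1 ltW.
case=> h; rewrite /chi0.
  rewrite z; first by rewrite o ?subr0 ?subrr// ltrNr.
  by apply: le_trans (ltW h) _; rewrite oppr_le0 ltW.
by rewrite o// z ?subr0 ?subrr// oppr_le0 (le_trans (ltW eL) (ltW h)).
Qed.

Lemma chik_neg k t : t <= 0 -> chik m e L k t = 0.
Proof. by move=> h; rewrite /chik !kstep0 ?subrr ?(le_trans h)// knot_ge0. Qed.

(* The pieces add up to one on |t| <= t_n. *)
Lemma chi_sum k t : chi0 m e L t + \sum_(p < k) (chik m e L p t + chik m e L p (- t)) =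
  1 - kstep m e L k t - kstep m e L k (- t).
Proof.
elim: k => [|k IH]; first by rewrite big_ord0 addr0.
by rewrite big_ord_recr/= addrA IH /chik; ring.
Qed.

End props.

(** The point is a bound uniform in [M]. On pieces beyond [M] the width [l] exceeds [M] and the
    derivatives of the exponential grow at that scale, but only polynomially in the knot over [M];
    the exponential itself absorbs this. The central piece carries no exponential. *)
Lemma pieces_good (N : nat) e : 0 < e <= 2^-1 -> exists K : R, forall L M, 0 < L -> L <= M ->
  good_chi N (e * L) K (- (e * L)) (e * L) (chi0 N.+2 e L) /\
  forall k, good_chi N (scale e L k) K (knot e L k) (knot e L k.+2)
     (fun t => chik N.+2 e L k t * expR (- (t / M))) /\
   good_chi N (scale e L k) K (- knot e L k.+2) (- knot e L k)
     (fun t => chik N.+2 e L k (- t) * expR (t / M)).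
Proof.
move=> e0; have e_gt0 : 0 < e by case/andP: e0.
have [K K0 HK] := @Cb_sstep R N N.+2 (ltnSn _).
pose E : R := (2 * N + 1)%:R ^+ N * expR 2^-1.
exists (Num.max (1 + K + K) (2 ^+ N * (K + K) * E)) => L M L0 LM.
have M0 : 0 < M := lt_le_trans L0 LM.
have sc k := scale_gt0 e0 L0 k.
have cS k : Cb (scale e L k) N K setT (kstep N.+2 e L k) by exact: HK.
split.
  have eL : 0 < e * L by rewrite mulr_gt0.
  have s0 : scale e L 0 = e * L by rewrite /scale expr0 mulr1.
  split.
  - by rewrite (@le_trans _ _ 0)// ?oppr_le0 ltW.
  - by rewrite opprK; clear -eL; move: (e * L) eL => x x0; lra.
  - apply: (Cb_le eL (_ : 1 + K + K <= _)); first by rewrite le_max lexx.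
    have c0 := cS 0; rewrite s0 in c0.
    have cN (F : R -> R) : Cb (e * L) N K setT F -> Cb (e * L) N K setT (fun t => - F t).
      move=> cF; have := CbZ (-1) eL cF; rewrite normrN normr1 mul1r.
      by apply: Cb_ext; [exact: openT|move=> t _; rewrite mulN1r].
    apply: CbD; last exact/cN/Cb_opp.
    by apply: CbD; [apply: Cb_cst => //; rewrite normr1|exact: cN].
  - by move=> t; exact: chi0_supp.
move=> k; have l0 := sc k; set l := scale e L k in l0 *; set a := knot e L k.
have ab : knot e L k.+2 = a + (2 + e) * l by rewrite !knotS scaleS -/l -/a; ring.
have el : (2 + e) * l <= 3 * l.
  by rewrite ler_wpM2r ?(ltW l0)//; case/andP: e0 => _ he; lra.
have al : a <= knot e L k.+2 by rewrite ab lerDl mulr_ge0 ?addr_ge0 ?(ltW l0) ?(ltW e_gt0).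
have supp : forall t, t < a \/ knot e L k.+2 < t -> chik N.+2 e L k t * expR (- (t / M)) = 0.
  by move=> t h; rewrite chik_supp ?mul0r.
suff cc : Cb l N (Num.max (1 + K + K) (2 ^+ N * (K + K) * E)) setT (fun t => chik N.+2 e L k t * expR (- (t / M))).
  split; first by split => //; rewrite ab addrC addKr.
  split.
  - by rewrite lerN2.
  - by rewrite ab opprK addKr.
  - by have := Cb_opp l0 cc; apply: Cb_ext; [exact: openT|move=> t _; rewrite mulNr opprK].
  - move=> t h; rewrite chik_supp ?mul0r//.
    by case: h => h; [right; rewrite ltrNr|left; rewrite ltrNl].
have cchi : Cb l N (K + K) setT (chik N.+2 e L k).
  apply: CbD => //; first exact: cS.
  have cS' : Cb l N K setT (kstep N.+2 e L k.+1).
    apply: Cb_shrink (cS k.+1) => //; rewrite l0 scaleS -/l mulrDl mul1r lerDl mulr_ge0 ?(ltW l0)//.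
    exact: ltW.
  have := CbZ (-1) l0 cS'; rewrite normrN normr1 mul1r.
  by apply: Cb_ext; [exact: openT|move=> t _; rewrite mulN1r].
(* The exponential is bounded only on half-lines to the right, so it is estimated from [a - l] on;
   left of [a] the product is 0. *)
apply: (@Cb_sub _ _ _ _ ([set t | t < a] `|` [set t | a - l < t])).
  by move=> t _ /=; have [|h] := ltP t a; [left|right; apply: lt_le_trans h; rewrite gtrBl].
apply: Cb_setU; [exact: open_lt|exact: open_gt| |].
  have c0 : Cb l N (Num.max (1 + K + K) (2 ^+ N * (K + K) * E)) [set t | t < a] (fun=> (0 : R)).
    by apply: Cb_cst => //; rewrite normr0 le_max; apply/orP; left; rewrite !addr_ge0.
  by apply: Cb_ext c0; [exact: open_lt|move=> t /= ta; rewrite supp//; left].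
apply: (Cb_le l0 (_ : 2 ^+ N * (K + K) * E <= _)); first by rewrite le_max lexx orbT.
apply: CbM => //; first by apply: Cb_sub cchi.
have a0 : 0 <= a := knot_ge0 e0 L0 k.
(* From [l = e (L + a)], [e <= 1 / 2] and [L <= M]. Hence the value of the exponential at [a - l] is
   at most [exp(1/2) exp(- a / (2 M))], and [exp_pow_half] weighs this against the powers of
   [1 + a / M]. *)
have lM : l / M <= (1 + a / M) / 2.
  have laM : l <= (M + a) / 2.
    rewrite /l /scale -knotE -/a mulrC ler_pdivlMr// -mulrA.
    have : e * 2 <= 1 by rewrite -ler_pdivlMr// mul1r; case/andP: e0.
    have : 0 <= L + a by rewrite addr_ge0// ltW.
    have : L + a <= M + a by rewrite lerD2r.
    move: (L + a) (M + a) (e * 2) => x y z h1 h2 h3; apply: le_trans h1.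
    by rewrite ler_piMr.
  rewrite ler_pdivrMr//; suff -> : (1 + a / M) / 2 * M = (M + a) / 2 by [].
  by move: M0; move: (M) (a) => x y x0; field; rewrite gt_eqF.
have x0 : 0 <= a / M by rewrite divr_ge0 ?(ltW M0).
have -> : (fun t : R => expR (- (t / M))) = (fun t => 1 * expR (- (t / M))) by apply/funext => t; rewrite mul1r.
apply: Cb_exp => //.
rewrite normr1 mul1r.
apply: (@le_trans _ _ ((1 + a / M) ^+ N * expR (- (a / M / 2)) * expR 2^-1)); last first.
  by rewrite ler_wpM2r ?expR_ge0// exp_pow_half.
rewrite -mulrA -expRD mulrC ler_pM ?expR_ge0 ?exprn_ge0 ?le_max ?ler01//.
  rewrite lerXn2r ?nnegrE ?le_max ?ler01 ?addr_ge0// ge_max lerDl x0/=.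
  by move: lM x0; move: (l / M) (a / M) => x y; lra.
rewrite ler_expR mulrBl; move: lM; move: (l / M) (a / M) => x y; lra.
Qed.

End knots.

(** * The Poisson kernel as a truncated cosine integral *)

Section poisson.
Variable R : realType.
Local Notation leb := (@lebesgue_measure R).

Lemma itv_split (F : R -> R) (a c b : R) : a <= c -> c <= b ->
  (forall t, a <= t <= b -> {for t, continuous F}) ->
  \int[leb]_(t in `[a, b]) F t = \int[leb]_(t in `[a, c]) F t + \int[leb]_(t in `[c, b]) F t.
Proof.
move=> ac cb cF; have iF := itv_integrable cF.
have /eqP := @Rintegral_itvB _ F (BLeft a) (BRight b) c iF ac cb.
rewrite subr_eq => /eqP ->; rewrite addrC Rintegral_itv_obnd_cbnd//.
apply: integrableS iF => //; apply: subset_itvl || apply: subset_itvr; rewrite bnd_simp//.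
Qed.

Lemma is_derive_poisson (s h A t : R) : s ^+ 2 + h ^+ 2 != 0 ->
  is_derive t 1 (fun t : R => expR (h * t) * (s * sin (A + t * s) + h * cos (A + t * s)) / (s ^+ 2 + h ^+ 2))
    (expR (h * t) * cos (A + t * s)).
Proof.
move=> D0.
have d1 : is_derive t 1 (fun t : R => h * t) (h : R).
  by rewrite -[X in is_derive _ _ _ X]mulr1; apply: is_deriveZ.
have dA : is_derive t 1 (fun t : R => A + t * s) (s : R).
  have -> : (fun t : R => A + t * s) = (fun t => A + s * t) by apply/funext => z; rewrite [z * s]mulrC.
  by rewrite -[X in is_derive _ _ _ X]add0r; apply: is_deriveD; rewrite -[X in is_derive _ _ _ X]mulr1; apply: is_deriveZ.
have dexp := @is_derive1_comp _ expR (fun t : R => h * t) t _ _ (is_derive_expR (h * t)) d1.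
have dsin := @is_derive1_comp _ sin (fun t : R => A + t * s) t _ _ (is_derive_sin (A + t * s)) dA.
have dcos := @is_derive1_comp _ cos (fun t : R => A + t * s) t _ _ (is_derive_cos (A + t * s)) dA.
have ds := is_deriveZ s dsin; have dc := is_deriveZ h dcos.
have dM := is_deriveM dexp (is_deriveD ds dc).
have dV := is_deriveZ (s ^+ 2 + h ^+ 2)^-1 dM.
have -> : (fun t : R => expR (h * t) * (s * sin (A + t * s) + h * cos (A + t * s)) / (s ^+ 2 + h ^+ 2)) =
  ((s ^+ 2 + h ^+ 2)^-1 \*: ((expR \o (fun t => h * t)) * ((s \*: (sin \o (fun t => A + t * s))) + (h \*: (cos \o (fun t => A + t * s)))))).
  by apply/funext => z /=; rewrite mulrC.
move: dV; rewrite /GRing.scale/= !fctE/=; congr is_derive.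
rewrite /GRing.scale/=.
by move: (expR (h * t)) (sin _) (cos _) => x y z; field.
Qed.

(** Each half of the interval has an explicit primitive. The two values at 0 combine to the kernel,
    as their sine parts cancel; the values at the ends [- T] and [T] make up the error. *)
Lemma poisson (s M A T : R) : 0 < M -> 0 < T ->
  `|\int[itvM T]_t (expR (- (`|t| / M)) * cos (A + t * s)) - cos A * (2 * M / (1 + (M * s) ^+ 2))|
    <= 4 * M * expR (- (T / M)).
Proof.
move=> M0 T0; have M0' : M != 0 by rewrite gt_eqF.
have cE (h : R) t : {for t, continuous (fun t : R => expR (h * t) * cos (A + t * s))}.
  apply: continuousM.
    apply: (@continuous_comp _ _ _ (fun t : R => h * t) expR); last exact: continuous_expR.
    by apply: continuousM => //; exact: cst_continuous.
  apply: (@continuous_comp _ _ _ (fun t : R => A + t * s) cos); last exact: continuous_cos.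
  by apply: continuousD; [exact: cst_continuous|apply: continuousM => //; exact: cst_continuous].
have cF t : {for t, continuous (fun t : R => expR (- (`|t| / M)) * cos (A + t * s))}.
  apply: continuousM.
    apply: (@continuous_comp _ _ _ (fun t : R => - (`|t| / M)) expR); last exact: continuous_expR.
    by apply: continuousN; apply: continuousM; [exact: norm_continuous|exact: cst_continuous].
  apply: (@continuous_comp _ _ _ (fun t : R => A + t * s) cos); last exact: continuous_cos.
  by apply: continuousD; [exact: cst_continuous|apply: continuousM => //; exact: cst_continuous].
rewrite Rintegral_itvM; last first.
  split; first exact: continuous_measurable_fun.
  exists 1 => t; rewrite normrM -[1]mulr1 ler_pM//; last by rewrite ler_norml cos_geN1 cos_le1.
  by rewrite ger0_norm ?expR_ge0// expR_le1 oppr_le0 divr_ge0// ltW.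
have Tn : - T <= 0 by rewrite oppr_le0 ltW.
rewrite (@itv_split _ _ 0 _ Tn (ltW T0)); last by move=> t _; exact: cF.
have -> : \int[leb]_(t in `[- T, 0]) (expR (- (`|t| / M)) * cos (A + t * s)) =
    \int[leb]_(t in `[- T, 0]) (expR (M^-1 * t) * cos (A + t * s)).
  apply: eq_Rintegral => t; rewrite inE/= in_itv/= => /andP[_ t0]; congr (expR _ * _).
  by rewrite ler0_norm// mulNr opprK mulrC.
have -> : \int[leb]_(t in `[0, T]) (expR (- (`|t| / M)) * cos (A + t * s)) =
    \int[leb]_(t in `[0, T]) (expR (- M^-1 * t) * cos (A + t * s)).
  by apply: eq_Rintegral => t; rewrite inE/= in_itv/= => /andP[t0 _]; congr (expR _ * _); rewrite ger0_norm// mulNr mulrC.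
have D0 (h : R) : h != 0 -> s ^+ 2 + h ^+ 2 != 0.
  by move=> h0; rewrite gt_eqF// ltr_wpDl ?sqr_ge0// exprn_even_gt0.
have Mi0 : M^-1 != 0 by rewrite invr_eq0.
have Mn0 : - M^-1 != 0 by rewrite oppr_eq0.
have TN : - T < 0 by rewrite oppr_lt0.
rewrite (ftc TN (fun t _ => @is_derive_poisson s M^-1 A t (D0 _ Mi0)) (fun t _ => cE M^-1 t)).
rewrite (ftc T0 (fun t _ => @is_derive_poisson s (- M^-1) A t (D0 _ Mn0)) (fun t _ => cE (- M^-1) t)).
rewrite !mulr0 !expR0 !mul0r !addr0 sqrrN !mul1r.
have -> : M^-1 * - T = - (T / M) by rewrite mulrN mulrC.
have -> : - M^-1 * T = - (T / M) by rewrite mulNr mulrC.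
set E := expR _; have E0 : 0 <= E by exact: expR_ge0.
set D := s ^+ 2 + _; have Dp : 0 < D by rewrite /D ltr_wpDl ?sqr_ge0// exprn_even_gt0.
have -> : 2 * M / (1 + (M * s) ^+ 2) = 2 * M^-1 / D.
  have -> : 1 + (M * s) ^+ 2 = D * M ^+ 2 by rewrite /D; field.
  by move: D Dp => x x0; field; rewrite M0' gt_eqF.
set s1 := sin (A + - T * s); set c1 := cos (A + - T * s).
set s2 := sin (A + T * s); set c2 := cos (A + T * s).
have -> : (s * sin A + M^-1 * cos A) / D - E * (s * s1 + M^-1 * c1) / D +
   (E * (s * s2 + - M^-1 * c2) / D - (s * sin A + - M^-1 * cos A) / D) - cos A * (2 * M^-1 / D) =
   E * ((s * s2 - M^-1 * c2 - s * s1 - M^-1 * c1) / D) by ring.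
rewrite normrM ger0_norm// mulrC ler_wpM2r// normrM [`|D^-1|]gtr0_norm ?invr_gt0// ler_pdivrMr//.
(* Completing the square: with [D = s^2 + M^-2], [M D] dominates both [|s|] and [1 / M], so the four
   terms of the error give the factor 4. *)
have sm : `|s| <= M * D.
  have -> : M * D = M * `|s| ^+ 2 + M^-1 by rewrite /D real_normK ?num_real// mulrDr; congr (_ + _); rewrite expr2 mulrA mulfV// mul1r.
  have : 0 <= (M * `|s| - 2^-1) ^+ 2 / M by rewrite divr_ge0 ?sqr_ge0// ltW.
  have -> : (M * `|s| - 2^-1) ^+ 2 / M = M * `|s| ^+ 2 - `|s| + 4^-1 / M by field.
  have : 0 < M^-1 by rewrite invr_gt0.
  by move: (M * `|s| ^+ 2) `|s| M^-1 => x y z; lra.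
have mi : M^-1 <= M * D.
  rewrite /D mulrDr [X in _ + X](_ : _ = M^-1); last by rewrite expr2 mulrA mulfV// mul1r.
  by rewrite lerDr mulr_ge0 ?sqr_ge0// ltW.
have b (x y : R) : `|x| <= M * D -> `|y| <= 1 -> `|x * y| <= M * D.
  by move=> hx hy; rewrite normrM -[leRHS]mulr1 ler_pM.
have bs x : `|sin x| <= (1 : R) by rewrite ler_norml sin_geN1 sin_le1.
have bc x : `|cos x| <= (1 : R) by rewrite ler_norml cos_geN1 cos_le1.
have mi' : `|M^-1| <= M * D by rewrite gtr0_norm ?invr_gt0.
have := b _ _ sm (bs (A + T * s)); have := b _ _ sm (bs (A + - T * s)).
have := b _ _ mi' (bc (A + T * s)); have := b _ _ mi' (bc (A + - T * s)).
rewrite -/s1 -/s2 -/c1 -/c2 -mulrA; move: (M * D) (s * s1) (s * s2) (M^-1 * c1) (M^-1 * c2) => K a1 a2 a3 a4.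
rewrite !ler_norml => /andP[? ?] /andP[? ?] /andP[? ?] /andP[? ?].
by apply/andP; split; lra.
Qed.

End poisson.

(** * Linearity of the integral in the t-cut-off *)

Section op.
Variables (R : realType) (n : nat) (b2 T lambda kappa KF Kw : R).
Variables (Phi rho w F : 'rV[R]_n -> R).
Hypotheses (b20 : 0 <= b2) (mPhi : measurable_fun setT Phi) (mrho : measurable_fun setT rho).
Hypotheses (bw : bm w) (bF : bm F) (FK : forall x, `|F x| <= KF) (wK : forall x, `|w x| <= Kw).
Implicit Types chi : measurableTypeR R -> R.

Definition opx chi (x : 'rV[R]_n) : R := \int[itvM T]_t (chi t * cos (lambda * Phi x + t * rho x + kappa)).
Definition op chi : R := \int[cubeM n b2]_x (F x * (w x * opx chi x)).

Lemma op_arg_bm chi x : bm chi -> bm (fun t : measurableTypeR R => chi t * cos (lambda * Phi x + t * rho x + kappa)).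
Proof.
move=> bchi; apply: bmM => //; apply: bm_cos.
exact: (measurableT_comp (phase_meas2 lambda kappa mPhi mrho) (pair1_measurable x)).
Qed.

Lemma opx_bm chi : bm chi -> bm (opx chi).
Proof.
move=> bchi; apply: (bm_Rint (itvM T) (f := fun p => chi p.2 * cos (lambda * Phi p.1 + p.2 * rho p.1 + kappa))).
by apply: bmM; [exact: (bm_comp measurable_snd bchi)|exact: bm_cos (phase_meas2 lambda kappa mPhi mrho)].
Qed.

Lemma op_integrand_bm chi : bm chi -> bm (fun x => F x * (w x * opx chi x)).
Proof. by move=> bchi; apply: bmM => //; apply: bmM => //; exact: opx_bm. Qed.

Lemma opD chi1 chi2 : bm chi1 -> bm chi2 -> op (fun t => chi1 t + chi2 t) = op chi1 + op chi2.
Proof.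
move=> b1 b2'; rewrite /op -bm_RintegralD; try exact: op_integrand_bm.
apply: eq_Rintegral => x _; rewrite -mulrDr -mulrDr; congr (_ * (_ * _)).
by rewrite /opx -bm_RintegralD; try exact: op_arg_bm; apply: eq_Rintegral => t _; rewrite mulrDl.
Qed.

Lemma op_sum (k : nat) (chi : nat -> measurableTypeR R -> R) : (forall p, bm (chi p)) ->
  op (fun t => \sum_(p < k) chi p t) = \sum_(p < k) op (chi p).
Proof.
move=> bc; elim: k => [|k IH].
  rewrite big_ord0 /op (@eq_Rintegral _ _ _ _ _ (fun=> 0)) ?Rintegral_cst ?mul0r// => x _.
  rewrite /opx (@eq_Rintegral _ _ _ _ _ (fun=> 0)) ?Rintegral_cst ?mul0r ?mulr0// => t _.
  by rewrite big_ord0 mul0r.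
have h : bm (fun t => \sum_(p < k) chi p t) by apply: bm_sum.
rewrite big_ord_recr/= -IH -(opD h (bc k)).
by congr op; apply/funext => t; rewrite big_ord_recr.
Qed.

Lemma op_le (G : 'rV[R]_n -> R) (E : R) : bm G -> (forall x, `|G x| <= E) ->
  `|\int[cubeM n b2]_x (F x * (w x * G x))| <= KF * (Kw * E) * (2 * b2) ^+ n.
Proof.
move=> bG GE; have -> : (2 * b2) ^+ n = fine (cubeM n b2 setT) by rewrite cubeM_setT.
apply: le_bm_bound; first by apply: bmM => //; exact: bmM.
by move=> x; rewrite normrM ler_pM// normrM ler_pM.
Qed.

End op.

Lemma limit_of_bounds (R : realType) (x A B M s : R) : 0 < M -> 0 < s -> 0 <= B ->
  (forall k : nat, x <= A + B / (M + k%:R * s)) -> x <= A.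
Proof.
move=> M0 s0 B0 h; apply/ler_addgt0Pr => d d0.
pose k := Num.truncn (B / (d * s)).
apply: le_trans (h k.+1) _; rewrite lerD2l ler_pdivrMr; last by rewrite addr_gt0// mulr_gt0.
apply: (@le_trans _ _ (d * (k.+1%:R * s))); last by rewrite ler_wpM2l ?(ltW d0)// lerDr ltW.
have : B / (d * s) < k.+1%:R by exact: truncnS_gt.
by rewrite ltr_pdivrMr ?mulr_gt0// => /ltW; rewrite mulrCA.
Qed.

Lemma sstep_le1 (R : realType) m (t : R) : `|sstep m t| <= 1.
Proof.
rewrite /sstep; have a0 := tpow_ge0 m t; have b0 := tpow_ge0 m (1 - t).
rewrite ger0_norm ?divr_ge0 ?addr_ge0//.
have d := lt_le_trans _ (sstep_den m t); rewrite ler_pdivrMr ?mul1r ?lerDl// d// invr_gt0 exprn_gt0//.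
Qed.

Lemma sqrt_expV_ratio (R : realType) (d k : nat) (L e CC P x : R) : 0 < L -> 0 < e -> 0 <= CC -> 0 <= P ->
  x ^+ 2 <= CC * (L * (1 + e) ^+ k) ^- d * P ->
  `|x| <= Num.sqrt CC * Num.sqrt (L ^- d) * Num.sqrt P * Num.sqrt ((1 + e) ^- d) ^+ k.
Proof.
move=> L0 e0 C0 P0; have Ld : 0 <= L ^- d by rewrite invr_ge0 exprn_ge0// ltW.
have ed : 0 <= (1 + e) ^- d by rewrite invr_ge0 exprn_ge0// addr_ge0// ltW.
have sk : Num.sqrt ((1 + e) ^- d) ^+ k = Num.sqrt (((1 + e) ^+ k) ^- d).
  have -> : ((1 + e) ^+ k) ^- d = ((1 + e) ^- d) ^+ k by rewrite -exprVn -exprVn -exprVn -!exprM mulnC.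
  by elim: k => [|k IH]; [rewrite !expr0 sqrtr1|rewrite !exprS IH sqrtrM].
rewrite sk -!sqrtrM ?mulr_ge0// => h; rewrite -sqrtr_sqr ler_wsqrtr//; apply: le_trans h _.
by rewrite exprMn invfM le_eqVlt; apply/orP; left; apply/eqP; ring.
Qed.

Lemma geometric_le (R : realType) (g : R) k : 0 <= g < 1 -> \sum_(p < k) g ^+ p <= (1 - g)^-1.
Proof.
move=> /andP[g0 g1]; have h : 0 < 1 - g by rewrite subr_gt0.
rewrite -(ler_pM2l h) mulfV ?gt_eqF//.
have := subrX1 g k; rewrite -opprB -[X in _ = X * _ -> _]opprB mulNr => /oppr_inj <-.
by rewrite gerBl exprn_ge0.
Qed.

Lemma unit_circle (R : realType) (a b : R) : a != 0 ->
  (a / Num.sqrt (a ^+ 2 + b ^+ 2)) ^+ 2 + (b / Num.sqrt (a ^+ 2 + b ^+ 2)) ^+ 2 = 1.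
Proof.
move=> a0; have h : 0 < a ^+ 2 + b ^+ 2 by rewrite ltr_wpDr ?sqr_ge0// exprn_even_gt0.
by rewrite !exprMn -mulrDl exprVn sqr_sqrtr ?(ltW h)// mulfV// gt_eqF.
Qed.

Lemma tail_lin (R : realType) (t a l m : R) : l + t <= 4 * (l + a) -> l <= m -> 0 < l -> 0 <= a ->
  t + m <= 5 * (m + a).
Proof. by lra. Qed.

Lemma final_sum (R : realType) (a b c g A B V x y z : R) :
  `|a| <= A -> `|b| <= B -> `|c| <= V * x -> `|g| <= V * y -> V * (x + y) <= z ->
  `|a + (b + c) - g| <= A + B + z.
Proof.
rewrite mulrDr !ler_norml => /andP[? ?] /andP[? ?] /andP[? ?] /andP[? ?] ?.
by apply/andP; split; lra.
Qed.

(** * Summation over the pieces of the t-axis *)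

Section tau.
Variables (R : realType) (d n : nat) (e Kchi CC KF Kw : R).
Hypotheses (d1 : (1 <= d)%N) (e0 : 0 < e <= 2^-1) (C0 : 0 <= CC).
Local Notation N := (2 * d.+1)%N.
Variables (b2 lambda kappa M P : R) (Phi rho w F : 'rV[R]_n -> R).
Hypotheses (b20 : 0 <= b2) (mPhi : measurable_fun setT Phi) (mrho : measurable_fun setT rho).
Hypotheses (bw : bm w) (bF : bm F) (FK : forall x, `|F x| <= KF) (wK : forall x, `|w x| <= Kw).
Hypotheses (P0 : 0 <= P) (l0 : lambda != 0) (LM : `|lambda| <= M).
Local Notation L := (`|lambda|).
Local Notation opT T := (op b2 T lambda kappa Phi rho w F).
Hypothesis pieces : forall M, L <= M ->
  good_chi N (e * L) Kchi (- (e * L)) (e * L) (chi0 N.+2 e L) /\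
  forall k, good_chi N (scale e L k) Kchi (knot e L k) (knot e L k.+2)
     (fun t => chik N.+2 e L k t * expR (- (t / M))) /\
   good_chi N (scale e L k) Kchi (- knot e L k.+2) (- knot e L k)
     (fun t => chik N.+2 e L k (- t) * expR (t / M)).
Hypothesis piece : forall (tau0 alpha beta T mu : R) chi, mu = L + `|tau0| ->
  good_chi N (e * mu) Kchi alpha beta chi ->
  (forall t, alpha <= t <= beta -> `|t - tau0| <= 3 * (e * mu)) ->
  0 < T -> - T <= alpha - e * mu -> beta + e * mu <= T ->
  (opT T chi) ^+ 2 <= CC * mu ^- d * P.

Let L0 : 0 < L. Proof. by rewrite normr_gt0. Qed.
Let M0 : 0 < M. Proof. exact: lt_le_trans LM. Qed.
Let e_gt0 : 0 < e. Proof. by case/andP: e0. Qed.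

(** The central piece plus two geometric series of ratio [(1 + e)^(-d/2)], one for each half of the
    t-axis. *)
Definition tau_const : R := Num.sqrt CC * (1 + 2 / (1 - Num.sqrt ((1 + e) ^- d))).

Lemma good_bm l a b chi : good_chi N l Kchi a b chi -> bm (chi : measurableTypeR R -> R).
Proof.
move=> [_ _ c _]; split; last by exists Kchi => t; exact: Cb_bound c t I.
by apply: continuous_measurable_fun => t; exact: Cb_cont c t I.
Qed.

(** The pieces with index below [k] end before knot [k.+2], and the estimate of a piece asks for a
    further width on either side; this choice leaves room for both, also for the central piece. *)
Let T k : R := knot e L k.+3.
Let chiP k (t : measurableTypeR R) : R := chik N.+2 e L k t * expR (- (t / M)).
Let chiM k (t : measurableTypeR R) : R := chik N.+2 e L k (- t) * expR (t / M).

Lemma T_gt0 k : 0 < T k.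
Proof.
apply: lt_le_trans (knot_ge e0 L0 k.+3); by rewrite !mulr_gt0.
Qed.

Lemma gP p : good_chi N (e * (L + knot e L p)) Kchi (knot e L p) (knot e L p.+2) (chiP p).
Proof. by have [_ /(_ p)[]] := pieces LM; rewrite knotE. Qed.
Lemma gM p : good_chi N (e * (L + knot e L p)) Kchi (- knot e L p.+2) (- knot e L p) (chiM p).
Proof. by have [_ /(_ p)[]] := pieces LM; rewrite knotE. Qed.

(** The two pieces of index [p] have mu equal to [L (1 + e)^p], so their bounds [mu^(-d/2)] form a
    geometric series; it converges because [1 <= d]. *)
Lemma main_sum k : `|opT (T k) (chi0 N.+2 e L) + \sum_(p < k) (opT (T k) (chiP p) + opT (T k) (chiM p))| <=
  tau_const * Num.sqrt (L ^- d) * Num.sqrt P.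
Proof.
pose Q := Num.sqrt CC * Num.sqrt (L ^- d) * Num.sqrt P; set g := Num.sqrt ((1 + e) ^- d).
have Q0 : 0 <= Q by rewrite !mulr_ge0 ?sqrtr_ge0.
have k1 : knot e L 1 = e * L by rewrite knotS knot0 add0r /scale expr0 mulr1.
have eL : 0 < e * L by rewrite mulr_gt0.
have b0 : `|opT (T k) (chi0 N.+2 e L)| <= Q.
  have [gc _] := pieces LM.
  have := @piece 0 (- (e * L)) (e * L) (T k) L (chi0 N.+2 e L); rewrite normr0 addr0.
  have h2 : e * L + e * L <= T k.
    apply: le_trans (knot_le e0 L0 (_ : (2 <= k.+3)%N)) => //.
    rewrite !knotS knot0 add0r scaleS /scale expr0 mulr1 mulrDl mul1r addrA lerDl.
    by rewrite !mulr_ge0 // ?(ltW e_gt0) ?(ltW L0).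
  have h3 : - T k <= - (e * L) - e * L by rewrite -opprD lerN2.
  have h1 t : - (e * L) <= t <= e * L -> `|t - 0| <= 3 * (e * L).
    by rewrite subr0 -ler_norml => h; apply: le_trans h _; rewrite ler_peMl ?(ltW eL)// ler1n.
  move=> /(_ erefl gc h1 (T_gt0 k) h3 h2) h.
  by have := @sqrt_expV_ratio R d 0 L e CC P _ L0 e_gt0 C0 P0; rewrite !expr0 !mulr1; apply.
have bk p chi tau0 alpha beta : (p < k)%N -> `|tau0| = knot e L p ->
    good_chi N (e * (L + knot e L p)) Kchi alpha beta chi -> alpha = tau0 \/ beta = tau0 ->
    - knot e L p.+2 <= alpha -> beta <= knot e L p.+2 -> `|opT (T k) chi| <= Q * g ^+ p.
  move=> pk t0 gc ab al be.
  have s0 := scale_gt0 e0 L0 p.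
  have sE : e * (L + knot e L p) = scale e L p by rewrite knotE.
  have [_ len _ _] := gc.
  have hT : knot e L p.+2 + e * (L + knot e L p) <= T k.
    apply: le_trans (knot_le e0 L0 (_ : (p.+3 <= k.+3)%N)); last by rewrite !ltnS ltnW.
    rewrite [leRHS]knotS lerD2l sE !scaleS; have h : 1 <= 1 + e by rewrite lerDl ltW.
    apply: (@le_trans _ _ ((1 + e) * scale e L p)); first by rewrite ler_peMl ?(ltW s0).
    by rewrite ler_peMl// mulr_ge0 ?(ltW s0)// (le_trans ler01).
  have := @piece tau0 alpha beta (T k) (L + knot e L p) chi; rewrite t0 => /(_ erefl gc).
  move=> h; apply: (@sqrt_expV_ratio R d p L e CC P _ L0 e_gt0 C0 P0); rewrite -knotE; apply: h.
  - move=> t /andP[h1 h2]; rewrite ler_norml; apply/andP.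
    by case: ab => E; move: h1 h2 len; rewrite E; move: (3 * _) => x; split; lra.
  - exact: T_gt0.
  - by rewrite lerBrDr; apply: le_trans al; rewrite -lerBrDr -opprD lerN2.
  - by apply: le_trans hT; rewrite lerD2r.
have g01 : 0 <= g < 1.
  rewrite sqrtr_ge0/= -[X in _ < X]sqrtr1 ltr_sqrt// invf_lt1 ?exprn_gt0 ?addr_gt0//.
  by rewrite exprn_egt1 ?ltrDl// -lt0n.
have kn p : 0 <= knot e L p := knot_ge0 e0 L0 p.
apply: le_trans (ler_normD _ _) _; apply: le_trans (lerD b0 (ler_norm_sum _ _ _)) _.
apply: (@le_trans _ _ (Q + \sum_(p < k) (2 * Q) * g ^+ p)).
  rewrite lerD2l; apply: ler_sum => p _; apply: le_trans (ler_normD _ _) _.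
  rewrite -mulrA mulr_natl mulr2n; apply: lerD.
    apply: (@bk p (chiP p) (knot e L p) (knot e L p) (knot e L p.+2) (ltn_ord p) (ger0_norm (kn p)) (gP p) (or_introl erefl) _ (lexx _)).
    by rewrite (le_trans _ (kn p))// oppr_le0.
  apply: (@bk p (chiM p) (- knot e L p) (- knot e L p.+2) (- knot e L p) (ltn_ord p) _ (gM p) (or_intror erefl) (lexx _)).
    by rewrite normrN ger0_norm.
  by rewrite (@le_trans _ _ 0)// oppr_le0.
rewrite -mulr_sumr; have G := geometric_le k g01.
have -> : tau_const * Num.sqrt (L ^- d) * Num.sqrt P = Q + 2 * Q * (1 - g)^-1.
  by rewrite /tau_const -/g /Q; ring.
by rewrite lerD2l ler_wpM2l// mulr_ge0.
Qed.

Let E (t : measurableTypeR R) : R := expR (- (`|t| / M)).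
Let D1 (t : measurableTypeR R) : R := chi0 N.+2 e L t * (E t - 1).
Let D2 k (t : measurableTypeR R) : R := E t * (kstep N.+2 e L k t + kstep N.+2 e L k (- t)).

(** [exp(-|t| / M)] is not differentiable at 0, so the central cut-off enters without it and [D1] is
    the resulting error, of order [1 / M]. [D2] is what lies beyond the last piece. On the other
    pieces t has a fixed sign and the absolute value is harmless. *)
Lemma split_exp k t : E t = (chi0 N.+2 e L t + \sum_(p < k) (chiP p t + chiM p t)) + (D1 t + D2 k t).
Proof.
have -> : \sum_(p < k) (chiP p t + chiM p t) = (\sum_(p < k) (chik N.+2 e L p t + chik N.+2 e L p (- t))) * E t.
  rewrite mulr_suml; apply: eq_bigr => p _; rewrite mulrDl; congr (_ + _); rewrite /chiP /chiM /E.
    have [t0|/ltW t0] := leP 0 t; first by rewrite (ger0_norm t0).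
    by rewrite (chik_neg e0 L0)// !mul0r.
  have [t0|/ltW t0] := leP 0 t; last by rewrite (ler0_norm t0) mulNr opprK.
  by rewrite (chik_neg e0 L0)// ?oppr_le0// !mul0r.
have := chi_sum e L N.+2 k t => /eqP; rewrite addrC -subr_eq opprK => /eqP.
move: (\sum_(p < k) _) => S1 E1; rewrite /D1 /D2.
have -> : S1 = 1 - kstep N.+2 e L k t - kstep N.+2 e L k (- t) - chi0 N.+2 e L t.
  by have := chi_sum e L N.+2 k t; move: E1; lra.
by move: (kstep _ _ _ _ _) (kstep _ _ _ _ (- t)) (E t) (chi0 _ _ _ _) => x y z v; ring.
Qed.

Lemma E_bm : bm E.
Proof.
split.
  apply: continuous_measurable_fun => t.
  apply: (@continuous_comp _ _ _ (fun t : R => - (`|t| / M)) expR); last exact: continuous_expR.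
  by apply: continuousN; apply: continuousM; [exact: norm_continuous|exact: cst_continuous].
by exists 1 => t; rewrite ger0_norm ?expR_ge0// expR_le1 oppr_le0 divr_ge0// ltW.
Qed.

Lemma chi0_bm : bm (chi0 N.+2 e L : measurableTypeR R -> R).
Proof. by have [gc _] := pieces LM; exact: good_bm gc. Qed.

Lemma D1_bm : bm D1.
Proof. by apply: bmM; [exact: chi0_bm|apply: bmB; [exact: E_bm|exact: bm_cst]]. Qed.

Lemma D2_bm k : bm (D2 k).
Proof.
have -> : D2 k = fun t => (E t - ((chi0 N.+2 e L t + \sum_(p < k) (chiP p t + chiM p t)) + D1 t)).
  by apply/funext => t; move: (split_exp k t); move: (chi0 _ _ _ t + _) (D1 t) (D2 k t) (E t) => a b c f ->; ring.
apply: bmB; first exact: E_bm.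
apply: bmD; last exact: D1_bm.
apply: bmD; first exact: chi0_bm.
by apply: bm_sum => p; apply: bmD; [exact: good_bm (gP p)|exact: good_bm (gM p)].
Qed.

Lemma D1_le t : `|D1 t| <= Kchi * (e * L / M).
Proof.
have [[_ _ cc sc] _] := pieces LM.
have K0 : 0 <= Kchi := le_trans (normr_ge0 _) (Cb_bound cc (I : setT (0 : R))).
have eLM : 0 <= e * L / M by rewrite divr_ge0 ?mulr_ge0 ?(ltW M0) ?(ltW e_gt0).
have [tL|tL] := leP `|t| (e * L).
  rewrite normrM ler_pM//; first exact: Cb_bound cc t I.
  rewrite distrC ger0_norm ?subr_ge0 ?expR_le1 ?oppr_le0 ?divr_ge0 ?(ltW M0)//.
  apply: (@le_trans _ _ (`|t| / M)); last by rewrite ler_wpM2r ?invr_ge0 ?(ltW M0).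
  by rewrite lerBlDl -lerBlDr; exact: expR_ge1Dx.
have E0 : chi0 N.+2 e L t = 0.
  by apply: sc; move: tL; rewrite ltr_normr => /orP[h|h]; [right|left; rewrite ltrNr].
by rewrite /D1 E0 mul0r normr0 mulr_ge0.
Qed.

Lemma D2_le k t : `|D2 k t| <= 2 * expR (- (knot e L k / M)).
Proof.
have kn := knot_ge0 e0 L0 k; have [tL|/ltW tL] := leP `|t| (knot e L k).
  have [h1 h2] : t <= knot e L k /\ - t <= knot e L k by move: tL; rewrite ler_norml => /andP[]; split; lra.
  by rewrite /D2 !(kstep0 e0 L0)// addr0 mulr0 normr0 mulr_ge0 ?expR_ge0.
rewrite normrM mulrC ler_pM//.
  by apply: le_trans (ler_normD _ _) _; rewrite [leRHS](_ : 2 = 1 + 1) ?lerD ?sstep_le1.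
by rewrite ger0_norm ?expR_ge0// ler_expR lerN2 ler_wpM2r ?invr_ge0 ?(ltW M0).
Qed.

(** [T k] exceeds knot [k] by a bounded factor at most, so the tail is a multiple of
    [M (1 + x) exp(- x)] with [x = a / M]. The 25 comes from [exp_pow_half] with [N = 2], and 500 is
    4 times 25 times 5; [knot_ge] then produces a denominator linear in [k]. *)
Lemma tail_le k : 2 * expR (- (knot e L k / M)) * (2 * T k) + 4 * M * expR (- (T k / M)) <=
  500 * M ^+ 2 / (M + k%:R * (e * L)).
Proof.
set a := knot e L k; set x := a / M; have a0 : 0 <= a := knot_ge0 e0 L0 k.
have x0 : 0 <= x by rewrite divr_ge0 ?(ltW M0).
have TM : T k + M <= 5 * (M * (1 + x)).
  have e32 : (1 + e) ^+ 3 <= 4.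
    have h : 1 + e <= 3 / 2 by case/andP: e0; lra.
    apply: (@le_trans _ _ ((3 / 2) ^+ 3)); last by rewrite !exprS expr0; lra.
    by rewrite lerXn2r ?nnegrE// addr_ge0 ?(ltW e_gt0).
  have h1 : L + T k <= 4 * (L + a).
    by rewrite /T /a !knotE -addn3 exprD mulrA mulrC ler_wpM2r// mulr_ge0 ?exprn_ge0 ?addr_ge0 ?(ltW e_gt0).
  have -> : M * (1 + x) = M + a by rewrite mulrDr mulr1 /x mulrCA mulfV ?mulr1// gt_eqF.
  exact: tail_lin h1 LM L0 a0.
have ET : expR (- (T k / M)) <= expR (- x).
  by rewrite ler_expR lerN2 ler_wpM2r ?invr_ge0 ?(ltW M0)//; exact: (knot_le e0 L0 (leq_addl 3 k : (k <= k.+3)%N)).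
have ex : expR (- x) <= 25 / (1 + x) ^+ 2.
  have x1 : 0 < (1 + x) ^+ 2 by rewrite exprn_gt0// ltr_pwDl.
  rewrite ler_pdivlMr// mulrC; apply: le_trans (_ : (1 + x) ^+ 2 * expR (- (x / 2)) <= _).
    by rewrite ler_wpM2l ?(ltW x1)// ler_expR lerN2 ler_pdivrMr// ler_peMr// ler1n.
  by have := exp_pow_half 2 x0; rewrite (_ : (2 * 2 + 1)%:R ^+ 2 = 25 :> R)//; rewrite -natrX.
apply: (@le_trans _ _ (4 * expR (- x) * (T k + M))).
  rewrite mulrDr; apply: lerD; first by rewrite -/x [leLHS](_ : _ = 4 * expR (- x) * T k)//; ring.
  by rewrite [leRHS](_ : _ = 4 * M * expR (- x)); [rewrite ler_wpM2l// mulr_ge0 ?(ltW M0)|ring].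
have h1x : 0 < 1 + x by rewrite ltr_pwDl.
apply: (@le_trans _ _ (4 * (25 / (1 + x) ^+ 2) * (5 * (M * (1 + x))))).
  by rewrite ler_pM ?mulr_ge0 ?expR_ge0 ?addr_ge0 ?(ltW M0) ?(ltW (T_gt0 k))// ler_wpM2l.
have -> : 4 * (25 / (1 + x) ^+ 2) * (5 * (M * (1 + x))) = 500 * M ^+ 2 / (M * (1 + x)).
  by move: x h1x x0 TM ET ex M0 => y y1 _ _ _ _; move: (M) => m m0; field; rewrite !gt_eqF.
have h500 : 0 <= 500 * M ^+ 2 := mulr_ge0 (ler0n _ _) (sqr_ge0 M).
apply: (ler_wpM2l h500); rewrite lef_pV2 ?posrE; last 2 first.
- exact: mulr_gt0 M0 h1x.
- by rewrite ltr_wpDr// mulr_ge0// mulr_ge0 ?(ltW e_gt0).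
have -> : M * (1 + x) = M + a by rewrite mulrDr mulr1 /x mulrCA mulfV ?mulr1// gt_eqF.
by rewrite lerD2l; exact: knot_ge.
Qed.

(** With [M] fixed, [k] tends to infinity, which removes [D2] and the truncation error of [poisson].
    The error of [D1] remains, of order [1 / M] with a constant that depends on [F]. *)
Lemma tau_bound : `|\int[cubeM n b2]_x (F x * (w x *
     (cos (lambda * Phi x + kappa) * (2 * M / (1 + (M * rho x) ^+ 2)))))| <=
  tau_const * Num.sqrt (L ^- d) * Num.sqrt P + KF * Kw * (2 * b2) ^+ n * (2 * Kchi * (e * L) ^+ 2) / M.
Proof.
have KF0 : 0 <= KF := le_trans (normr_ge0 _) (FK 0).
have Kw0 : 0 <= Kw := le_trans (normr_ge0 _) (wK 0).
pose V := KF * Kw * (2 * b2) ^+ n; have V0 : 0 <= V := mulr_ge0 (mulr_ge0 KF0 Kw0) (exprn_ge0 n (mulr_ge0 (ler0n R 2) b20)).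
have B0 : 0 <= V * (500 * M ^+ 2) := mulr_ge0 V0 (mulr_ge0 (ler0n _ _) (sqr_ge0 M)).
apply: (@limit_of_bounds _ _ _ (V * (500 * M ^+ 2)) M (e * L) M0 (mulr_gt0 e_gt0 L0) B0) => k.
pose G x := opx (T k) lambda kappa Phi rho E x - cos (lambda * Phi x + kappa) * (2 * M / (1 + (M * rho x) ^+ 2)).
have bE := opx_bm (T k) lambda kappa mPhi mrho E_bm.
have bker : bm (fun x => cos (lambda * Phi x + kappa) * (2 * M / (1 + (M * rho x) ^+ 2))).
  apply: bmM.
    by apply: bm_cos; apply: measurable_funD; [apply: measurable_funM => //; exact: measurable_cst|exact: measurable_cst].
  have cc (s : R) : {for s, continuous (fun s : R => 2 * M / (1 + (M * s) ^+ 2))}.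
    apply: continuousM; first exact: cst_continuous.
    apply: continuousV; first by rewrite gt_eqF// ltr_wpDr ?sqr_ge0.
    apply: continuousD; first exact: cst_continuous.
    have c1 : {for s, continuous (fun s : R => M * s)} by apply: continuousM => //; exact: cst_continuous.
    exact: (continuousM c1 c1).
  split; first exact: (measurableT_comp (continuous_measurable_fun (cc : continuous _)) mrho).
  exists (2 * M) => x; have h : 1 <= 1 + (M * rho x) ^+ 2 by rewrite lerDl sqr_ge0.
  by rewrite ger0_norm ?divr_ge0 ?(le_trans ler01 h) ?mulr_ge0 ?(ltW M0)// ler_pdivrMr ?(lt_le_trans ltr01 h)// ler_peMr// mulr_ge0 ?(ltW M0).
have bG : bm G by exact: bmB.
have GE x : `|G x| <= 4 * M * expR (- (T k / M)).
  have := @poisson R (rho x) M (lambda * Phi x + kappa) (T k) M0 (T_gt0 k).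
  rewrite /G /opx; apply: le_trans; rewrite le_eqVlt; apply/orP; left; apply/eqP; congr (`| _ - _ |).
  by apply: eq_Rintegral => t _; rewrite addrAC.
have -> : \int[cubeM n b2]_x (F x * (w x * (cos (lambda * Phi x + kappa) * (2 * M / (1 + (M * rho x) ^+ 2))))) =
   opT (T k) E - \int[cubeM n b2]_x (F x * (w x * G x)).
  rewrite /op -bm_RintegralB; [|by apply: bmM => //; exact: bmM|by apply: bmM => //; exact: bmM].
  by apply: eq_Rintegral => x _; rewrite -!mulrBr /G subKr.
have bsum : bm (fun t : measurableTypeR R => \sum_(p < k) (chiP p t + chiM p t)).
  by apply: bm_sum => p; apply: bmD; [exact: good_bm (gP p)|exact: good_bm (gM p)].
have -> : opT (T k) E = (opT (T k) (chi0 N.+2 e L) + \sum_(p < k) (opT (T k) (chiP p) + opT (T k) (chiM p))) +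
    (opT (T k) D1 + opT (T k) (D2 k)).
  have oD := opD b2 (T k) lambda kappa mPhi mrho bw bF.
  have bpm p : bm (fun t : measurableTypeR R => chiP p t + chiM p t).
    by apply: bmD; [exact: good_bm (gP p)|exact: good_bm (gM p)].
  transitivity (opT (T k) (fun t => (chi0 N.+2 e L t + \sum_(p < k) (chiP p t + chiM p t)) + (D1 t + D2 k t))).
    by congr (op _ _ _ _ _ _ _ _); apply/funext => t; exact: split_exp.
  etransitivity; first exact: oD (bmD chi0_bm bsum) (bmD D1_bm (D2_bm k)).
  congr (_ + _); last exact: oD D1_bm (D2_bm k).
  etransitivity; first exact: oD chi0_bm bsum.
  congr (_ + _); etransitivity; first exact: (op_sum b2 (T k) lambda kappa mPhi mrho bw bF k bpm).
  by apply: eq_bigr => p _; exact: oD (good_bm (gP p)) (good_bm (gM p)).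
have eL : 0 < e * L by rewrite mulr_gt0.
have eT : e * L <= T k.
  apply: le_trans (knot_le e0 L0 (_ : (1 <= k.+3)%N)) => //.
  by rewrite knotS knot0 add0r /scale expr0 mulr1.
have x1 x : `|opx (T k) lambda kappa Phi rho D1 x| <= Kchi * (e * L / M) * (2 * (e * L)).
  have h := @bm_window R (T k) (- (e * L)) (e * L) (Kchi * (e * L / M)) _
    (op_arg_bm lambda kappa mPhi mrho x D1_bm).
  rewrite /opx; apply: le_trans (h _ _ _ _ _) _ => //.
  - by rewrite lerN2.
  - by rewrite (@le_trans _ _ 0)// ?oppr_le0 ltW.
  - by move=> t; rewrite normrM -[leRHS]mulr1 ler_pM// ?D1_le// ler_norml cos_geN1 cos_le1.
  - move=> t ht; rewrite /D1; have [[_ _ _ sc] _] := pieces LM; by rewrite sc ?mul0r.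
  by rewrite opprK [e * L + _](_ : _ = 2 * (e * L))// mulr_natl mulr2n.
have x2 x : `|opx (T k) lambda kappa Phi rho (D2 k) x| <= 2 * expR (- (knot e L k / M)) * (2 * T k).
  rewrite /opx -(ell_setT (ltW (T_gt0 k))).
  apply: le_bm_bound; first exact: (op_arg_bm lambda kappa mPhi mrho x (D2_bm k)).
  by move=> t; rewrite normrM -[leRHS]mulr1 ler_pM// ?D2_le// ler_norml cos_geN1 cos_le1.
have VE (z : R) : KF * (Kw * z) * (2 * b2) ^+ n = V * z by rewrite /V; ring.
have h1 := op_le b20 bw bF FK wK (opx_bm (T k) lambda kappa mPhi mrho D1_bm) x1.
have h2 := op_le b20 bw bF FK wK (opx_bm (T k) lambda kappa mPhi mrho (D2_bm k)) x2.
have h3 := op_le b20 bw bF FK wK bG GE.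
have h4 := main_sum k.
have h5 := ler_wpM2l V0 (tail_le k).
rewrite VE in h1; rewrite VE in h2; rewrite VE in h3.
have -> : V * (500 * M ^+ 2) / (M + k%:R * (e * L)) = V * (500 * M ^+ 2 / (M + k%:R * (e * L))) by rewrite -[LHS]mulrA.
have E1 : V * (Kchi * (e * L / M) * (2 * (e * L))) = KF * Kw * (2 * b2) ^+ n * (2 * Kchi * (e * L) ^+ 2) / M.
  by rewrite -/V; move: (V) (e * L) (M^-1) => z1 z2 z3; ring.
rewrite E1 in h1; exact: final_sum h4 h1 h2 h3 h5.
Qed.

End tau.

(* The oscillatory integral with the Poisson kernel 2M/(1+(M rho)^2) in place of the measure of the surface rho = 0. *)
Definition Jint (R : realType) n (b2 lambda kappa M : R) (Phi rho w : 'rV[R]_n -> R) (f : 'I_n -> R -> R) : R :=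
  \int[cubeM n b2]_x (\prod_k f k (x 0 k) * (w x *
     (cos (lambda * Phi x + kappa) * (2 * M / (1 + (M * rho x) ^+ 2))))).

(** On one box the partition of the coordinates is read off at the centre [q] from the direction of
    [(lambda, tau0)]; it may change from one piece of the t-axis to the next. The constant [E]
    depends on the functions, [C] does not. *)
Lemma box_estimate (R : realType) (d n : nat) (C1 c : R) : (1 <= d)%N -> 0 < C1 -> 0 < c ->
  exists2 r : R, 0 < r & forall Kw Bm, exists2 C, 0 <= C &
  forall (b0 b1 b2 lambda kappa : R) (Phi rho w : 'rV[R]_n -> R) (q : 'rV[R]_n),
  0 < b0 -> b0 < b2 -> b2 < b1 -> b1 <= Bm ->
  measurable_fun setT Phi -> measurable_fun setT rho ->
  smooth_on (open_cube b1) Phi -> smooth_on (open_cube b1) rho ->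
  (forall s x, (size s <= (2 * d.+1).+2)%N -> open_cube b1 x -> `|partials s Phi x| <= C1) ->
  (forall s x, (size s <= (2 * d.+1).+2)%N -> open_cube b1 x -> `|partials s rho x| <= C1) ->
  good_weight (2 * d.+1) b0 b1 Kw w -> lambda != 0 ->
  (forall ttau tau : R, ttau ^+ 2 + tau ^+ 2 = 1 ->
    exists i j : 'I_d.+1 -> 'I_n, is_bipartition i j /\
      c <= `|\det (bordered_hessian rho (fun y => ttau * Phi y + tau * rho y) i j q)|) ->
  closed_cube b0 q -> forall f : 'I_n -> R -> R,
  (forall k, bm (f k : measurableTypeR R -> R)) ->
  (forall k t, f k t != 0 -> `|t - q 0 k| <= r /\ `|t| <= b0) ->
  exists E, forall M, `|lambda| <= M ->
  `|Jint b2 lambda kappa M Phi rho w f| <=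
   C * Num.sqrt (`|lambda| ^- d) * Num.sqrt (\prod_k \int[itvM b2]_t (f k t ^+ 2)) + E / M.
Proof.
move=> d1 C10 c0; have [r [e [r0 e0 H]]] := @piece_estimate R d n C1 c d1 C10 c0.
have [Kchi HK] := @pieces_good R (2 * d.+1) e e0.
exists r => // Kw Bm; have [CC CC0 HC] := H Kw Kchi Bm.
have g0 : Num.sqrt ((1 + e) ^- d) < 1.
  have e_gt0 : 0 < e by case/andP: e0.
  by rewrite -[X in _ < X]sqrtr1 ltr_sqrt// invf_lt1 ?exprn_gt0 ?addr_gt0// exprn_egt1 ?ltrDl// -lt0n.
exists (tau_const d e CC).
  by rewrite /tau_const mulr_ge0 ?sqrtr_ge0// addr_ge0// divr_ge0// subr_ge0 ltW.
move=> b0 b1 b2 lambda kappa Phi rho w q b00 b02 b21 b1B mPhi mrho sPhi srho bPhi brho gw l0 det qb f bf fsupp.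
have [mw wK w0 cw] := gw; have bw : bm w by split => //; exists Kw.
have b20 : 0 <= b2 by apply: ltW; exact: lt_trans b02.
pose F (x : 'rV[R]_n) := \prod_k f k (x 0 k).
have bF : bm F by apply: bm_prod => k; exact: (bm_comp (measurable_coord k) (bf k)).
have [KF FK] := bF.2.
pose P := \prod_k \int[itvM b2]_t (f k t ^+ 2).
have P0 : 0 <= P by apply: prodr_ge0 => k _; apply: Rintegral_ge0 => t _; exact: sqr_ge0.
exists (KF * Kw * (2 * b2) ^+ n * (2 * Kchi * (e * `|lambda|) ^+ 2)) => M LM.
have L0 : 0 < `|lambda| by rewrite normr_gt0.
apply: (@tau_bound R d n e Kchi CC KF Kw d1 e0 CC0 b2 lambda kappa M P Phi rho w F b20 mPhi mrho bw bF FK wK P0 l0 LM).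
  by move=> M' LM'; exact: HK.
move=> tau0 alpha beta T mu chi muE gc near T0 Ta Tb.
have mu0 : 0 < mu by rewrite muE ltr_pwDl.
have [i [j [ij dd]]] := det _ _ (unit_circle tau0 l0).
exact: (HC i j b0 b1 b2 lambda tau0 mu _ kappa alpha beta T Phi rho w chi q f ij b00 b02 b21 b1B mPhi mrho
  sPhi srho bPhi brho gw mu0 muE erefl gc near T0 Ta Tb qb dd bf fsupp).
Qed.

(** Localization by indicators of small intervals in every coordinate, permitted because the
    functions [f k] need no regularity. The number of boxes depends only on [Bm / r] and the
    dimension, and enters the constant. *)
Lemma Jint_estimate (R : realType) (d n : nat) (C1 c Kw Bm : R) : (1 <= d)%N -> 0 < C1 -> 0 < c -> 0 < Bm ->
  exists2 C, 0 <= C &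
  forall (b0 b1 b2 lambda kappa : R) (Phi rho w : 'rV[R]_n -> R),
  0 < b0 -> b0 < b2 -> b2 < b1 -> b1 <= Bm ->
  measurable_fun setT Phi -> measurable_fun setT rho ->
  smooth_on (open_cube b1) Phi -> smooth_on (open_cube b1) rho ->
  (forall s x, (size s <= (2 * d.+1).+2)%N -> open_cube b1 x -> `|partials s Phi x| <= C1) ->
  (forall s x, (size s <= (2 * d.+1).+2)%N -> open_cube b1 x -> `|partials s rho x| <= C1) ->
  good_weight (2 * d.+1) b0 b1 Kw w -> lambda != 0 ->
  (forall x, open_cube b1 x -> forall ttau tau : R, ttau ^+ 2 + tau ^+ 2 = 1 ->
    exists i j : 'I_d.+1 -> 'I_n, is_bipartition i j /\
      c <= `|\det (bordered_hessian rho (fun y => ttau * Phi y + tau * rho y) i j x)|) ->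
  forall f : 'I_n -> R -> R, (forall k, bm (f k : measurableTypeR R -> R)) ->
  exists E, forall M, `|lambda| <= M ->
  `|Jint b2 lambda kappa M Phi rho w f| <=
   C * Num.sqrt (`|lambda| ^- d) * Num.sqrt (\prod_k \int[itvM b2]_t (f k t ^+ 2)) + E / M.
Proof.
move=> d1 C10 c0 Bm0; have [r r0 H] := @box_estimate R d n C1 c d1 C10 c0.
have [C C0 HC] := H Kw Bm; pose m := (Num.truncn (Bm / r)).+1.
have m0 : (0 : R) < m%:R by rewrite ltr0n.
exists (#|{ffun 'I_n -> 'I_m}|%:R * C); first by rewrite mulr_ge0.
move=> b0 b1 b2 lambda kappa Phi rho w b00 b02 b21 b1B mPhi mrho sPhi srho bPhi brho gw l0 det f bf.
have [mw wK w0 cw] := gw; have bw : bm w by split => //; exists Kw.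
have mr : b0 / m%:R <= r.
  rewrite ler_pdivrMr//; have : Bm / r < m%:R by exact: truncnS_gt.
  rewrite ltr_pdivrMr// mulrC => /ltW; apply: le_trans; apply: le_trans b1B.
  by apply: ltW; exact: lt_trans b02 b21.
pose ctr (p : nat) : R := - b0 + (2 * p%:R + 1) * (b0 / m%:R).
(* The intervals are half-open except for the last, so that they partition the closed interval
   exactly. *)
pose I (p : 'I_m) : set (measurableTypeR R) := if (p.+1 == m)%N
  then `[(ctr p - b0 / m%:R), (ctr p + b0 / m%:R)]%classic
  else `[(ctr p - b0 / m%:R), (ctr p + b0 / m%:R)[%classic.
have mI p : measurable (I p) by rewrite /I; case: ifP => _; exact: measurable_itv.
have Isub p t : I p t -> `|t - ctr p| <= b0 / m%:R.
  by rewrite /I; case: ifP => _; rewrite /= in_itv/= ler_distl => /andP[-> // /ltW].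
pose h := b0 / m%:R; have h0 : 0 < h by rewrite divr_gt0.
have hm : m%:R * h = b0 by rewrite /h mulrC divfK// gt_eqF.
have ctrb (p : 'I_m) : `|ctr p| <= b0 - h.
  have p1 : p%:R + 1 <= m%:R :> R by rewrite natr1 ler_nat.
  have p0 : (0 : R) <= p%:R by [].
  rewrite /ctr -/h ler_norml; apply/andP; split.
    rewrite -subr_ge0 [X in 0 <= X](_ : _ = 2 * (p%:R * h)); last by ring.
    exact: mulr_ge0 (ler0n _ 2) (mulr_ge0 p0 (ltW h0)).
  rewrite -subr_ge0 [X in 0 <= X](_ : _ = 2 * ((m%:R - (p%:R + 1)) * h)); last by rewrite -[in LHS]hm; ring.
  by apply: mulr_ge0 (ler0n _ 2) (mulr_ge0 _ (ltW h0)); rewrite subr_ge0.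
pose g (p : 'I_m) k t := f k t * (\1_(I p) t : R).
have bI p : bm (\1_(I p) : measurableTypeR R -> R).
  by split; [exact: measurable_indic|exists 1 => t; rewrite indicE; case: (_ \in _); rewrite ?normr1 ?normr0].
have bg p k : bm (g p k : measurableTypeR R -> R) by exact: bmM.
have Ipart t : `|t| <= b0 -> \sum_(p < m) (\1_(I p) t : R) = 1.
  rewrite ler_norml => /andP[t1 t2].
  have h2 : 0 < 2 * h := mulr_gt0 (ltr0n R 2) h0.
  pose z := (t + b0) / (2 * h); have z0 : 0 <= z by apply: divr_ge0 (ltW h2); lra.
  have tz : t = - b0 + 2 * h * z by rewrite /z [2 * h * _]mulrC divfK; [rewrite addrC addrK|rewrite gt_eqF].
  have zm : z <= m%:R by rewrite ler_pdivrMr// mulrCA hm; lra.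
  have IE (p : 'I_m) : I p t <-> (p%:R <= z) /\ (if (p.+1 == m)%N then z <= p.+1%:R else z < p.+1%:R).
    have e1 : (ctr p - h <= t) = (p%:R <= z).
      rewrite tz /ctr -/h -[RHS](ler_pM2l h2) -[LHS]subr_ge0 -[RHS]subr_ge0; congr (0 <= _); ring.
    have e2 : (t <= ctr p + h) = (z <= p.+1%:R).
      rewrite tz /ctr -/h -[RHS](ler_pM2l h2) -[LHS]subr_ge0 -[RHS]subr_ge0 -natr1; congr (0 <= _); ring.
    have e3 : (t < ctr p + h) = (z < p.+1%:R).
      rewrite tz /ctr -/h -[RHS](ltr_pM2l h2) -[LHS]subr_gt0 -[RHS]subr_gt0 -natr1; congr (0 < _); ring.
    by rewrite /I -/h; case: ifP => _; rewrite /= in_itv/= e1 ?e2 ?e3; split=> [/andP[]|[-> ->]].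
  have /andP[q1 q2] := truncn_itv z0.
  have p0m : (minn (Num.truncn z) m.-1 < m)%N by rewrite gtn_min ltnSn orbT.
  have Huniq (p : 'I_m) : I p t -> p = Ordinal p0m.
    move=> /IE[u1 u2]; apply: val_inj => /=.
    have pz : (p <= Num.truncn z)%N by rewrite truncn_ge_nat.
    move: u2; case: eqP => pm u2.
      have pE : nat_of_ord p = m.-1 by have := congr1 predn pm.
      by move: pz; rewrite pE => pz; apply/esym/minn_idPr.
    have : (Num.truncn z < p.+1)%N by rewrite -(ltr_nat R); exact: le_lt_trans u2.
    rewrite ltnS => zp; have E : Num.truncn z = p by apply/eqP; rewrite eqn_leq zp pz.
    by rewrite E; apply/esym/minn_idPl; exact: (ltn_ord p).
  have Iin : I (Ordinal p0m) t.
    apply/IE => /=; have [zlt|zge] := ltnP (Num.truncn z) m.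
      have -> : minn (Num.truncn z) m.-1 = Num.truncn z by apply/minn_idPl; exact: zlt.
      by split => //; case: ifP => // _; exact: ltW.
    have zE : z = m%:R by apply/eqP; rewrite eq_le zm/= (le_trans _ q1)// ler_nat.
    have -> : minn (Num.truncn z) m.-1 = m.-1 by apply/minn_idPr; apply: leq_trans zge; exact: leq_pred.
    by rewrite eqxx zE; split; [rewrite ler_nat; exact: leq_pred|exact: lexx].
  rewrite (bigD1 (Ordinal p0m))//= big1 ?addr0; first by rewrite indicE mem_set.
  move=> p pp; rewrite indicE memNset// => /Huniq pE.
  by move: pp; rewrite pE eqxx.
(* Distributing the product over the sums of indicators gives one term for each choice of an
   interval in every coordinate. Outside the support of [w] both sides vanish, so the partition is
   used only where all coordinates are at most [b0]. *)
have Jsplit M : Jint b2 lambda kappa M Phi rho w f =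
    \sum_(phi : {ffun 'I_n -> 'I_m}) Jint b2 lambda kappa M Phi rho w (fun k => g (phi k) k).
  have bK : bm (fun x => w x * (cos (lambda * Phi x + kappa) * (2 * M / (1 + (M * rho x) ^+ 2)))).
    apply: bmM => //; apply: bmM.
      by apply: bm_cos; apply: measurable_funD; [apply: measurable_funM => //; exact: measurable_cst|exact: measurable_cst].
    have cc (s : R) : {for s, continuous (fun s : R => 2 * M / (1 + (M * s) ^+ 2))}.
      apply: continuousM; first exact: cst_continuous.
      apply: continuousV; first by rewrite gt_eqF// ltr_wpDr ?sqr_ge0.
      apply: continuousD; first exact: cst_continuous.
      have c1 : {for s, continuous (fun s : R => M * s)} by apply: continuousM => //; exact: cst_continuous.
      exact: (continuousM c1 c1).
    split; first exact: (measurableT_comp (continuous_measurable_fun (cc : continuous _)) mrho).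
    exists (`|2 * M|) => x; have h1 : 1 <= 1 + (M * rho x) ^+ 2 by rewrite lerDl sqr_ge0.
    by rewrite normrM ler_piMr// normfV invf_le1 ger0_norm ?(le_trans ler01 h1)// (lt_le_trans ltr01 h1).
  have bG (phi : {ffun 'I_n -> 'I_m}) : bm (fun x : 'rV[R]_n => \prod_k g (phi k) k (x 0 k) *
      (w x * (cos (lambda * Phi x + kappa) * (2 * M / (1 + (M * rho x) ^+ 2))))).
    by apply: bmM => //; apply: bm_prod => k; exact: (bm_comp (measurable_coord k) (bg (phi k) k)).
  rewrite /Jint -(bm_Rintegral_sum _ _ bG); apply: eq_Rintegral => x _.
  rewrite -mulr_suml; have [w00|wx] := eqVneq (w x) 0; first by rewrite w00 !mul0r !mulr0.
  congr (_ * _); rewrite -(bigA_distr_bigA (fun k p => g p k (x 0 k))).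
  by apply: eq_bigr => k _; rewrite /g -mulr_sumr Ipart ?mulr1//; exact: w0.
have EX (phi : {ffun 'I_n -> 'I_m}) : exists E, forall M, `|lambda| <= M ->
    `|Jint b2 lambda kappa M Phi rho w (fun k => g (phi k) k)| <=
     C * Num.sqrt (`|lambda| ^- d) * Num.sqrt (\prod_k \int[itvM b2]_t (f k t ^+ 2)) + E / M.
  pose q : 'rV[R]_n := \row_k ctr (phi k).
  have qb : closed_cube b0 q by move=> k; rewrite mxE; apply: le_trans (ctrb _) _; rewrite gerBl ltW.
  have qB : open_cube b1 q by move=> k; apply: le_lt_trans (qb k) _; exact: lt_trans b02 b21.
  have gs k t : g (phi k) k t != 0 -> `|t - q 0 k| <= r /\ `|t| <= b0.
    rewrite mulf_eq0 negb_or indicE => /andP[_]; case: (boolP (t \in _)); last by rewrite eqxx.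
    rewrite inE => /Isub tI _; rewrite mxE; split; first exact: le_trans tI mr.
    have -> : t = (t - ctr (phi k)) + ctr (phi k) by rewrite subrK.
    by apply: le_trans (ler_normD _ _) _; rewrite -[b0](subrK h) addrC; apply: lerD; [exact: ctrb|exact: tI].
  have [E HE] := HC b0 b1 b2 lambda kappa Phi rho w q b00 b02 b21 b1B mPhi mrho sPhi srho bPhi brho gw l0 (det q qB) qb
    (fun k => g (phi k) k) (fun k => bg (phi k) k) gs.
  exists E => M LM; apply: le_trans (HE M LM) _; rewrite lerD2r; apply: ler_wpM2l; first by rewrite mulr_ge0 ?sqrtr_ge0.
  apply: ler_wsqrtr; apply: ler_prod => k _; rewrite Rintegral_ge0/=; last by move=> t _; exact: sqr_ge0.
  have ind1 t : (\1_(I (phi k)) t : R) ^+ 2 <= 1 by rewrite indicE; case: (_ \in _); rewrite ?expr1n ?expr0n.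
  apply: (le_bm_Rintegral (itvM b2) (bmX 2 (bg (phi k) k)) (bmX 2 (bf k))) => t.
  by rewrite /g exprMn; apply: ler_piMr (sqr_ge0 _) (ind1 t).
have [Ef HEf] := choice EX.
exists (\sum_phi Ef phi) => M LM; rewrite Jsplit; apply: le_trans (ler_norm_sum _ _ _) _.
apply: (@le_trans _ _ (\sum_(phi : {ffun 'I_n -> 'I_m}) (C * Num.sqrt (`|lambda| ^- d) *
    Num.sqrt (\prod_k \int[itvM b2]_t (f k t ^+ 2)) + Ef phi / M))).
  by apply: ler_sum => phi _; exact: HEf.
by rewrite big_split/= sumr_const -mulr_suml -!mulrA mulr_natl.
Qed.

Lemma between_zero (R : realType) (a v : R) : 0 < a * v -> `|v| <= `|a| ->
  (a <= v) || (0 <= v) /\ (v <= a) || (v <= 0).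
Proof.
have [a0|a0|->] := ltrgt0P a; last by rewrite mul0r ltxx.
  by rewrite pmulr_rgt0// => v0; rewrite (gtr0_norm v0) => ->; rewrite (ltW v0) orbT.
by rewrite nmulr_rgt0// => v0; rewrite (ltr0_norm v0) lerN2 => ->; rewrite (ltW v0) orbT.
Qed.

(** * The zero set as a graph: a quantitative implicit function theorem *)

Section graph.
Variables (R : realType) (m : nat) (k : 'I_m.+1) (b1 C1 c0 : R) (rho : 'rV[R]_m.+1 -> R).
Hypotheses (b10 : 0 < b1) (srho : smooth_on (open_cube b1) rho) (c00 : 0 < c0) (C10 : 0 < C1).
Hypothesis brho : forall s x, (size s <= 2)%N -> open_cube b1 x -> `|partials s rho x| <= C1.
Hypothesis lrho : forall x, open_cube b1 x -> c0 <= `|partial k rho x|.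
Implicit Types (y : 'rV[R]_m) (t : R).

Lemma open_cube_ins t y : open_cube b1 (ins k (t, y)) <-> `|t| < b1 /\ open_cube b1 y.
Proof.
split=> [h|[tb yb] l]; last by case: (unliftP k l) => [p ->|->]; rewrite ?ins_lift ?ins_same.
by split=> [|l]; [have := h k; rewrite ins_same|have := h (lift k l); rewrite ins_lift].
Qed.

Lemma lip s x x' : (size s <= 1)%N -> open_cube b1 x -> open_cube b1 x' ->
  `|partials s rho x - partials s rho x'| <= C1 * \sum_l `|x 0 l - x' 0 l|.
Proof.
move=> s1 xb xb'; apply: mvt_l1 xb xb'; first exact: smooth_partials.
by move=> l z zb; exact: (@brho (l :: s) z).
Qed.

Lemma sum_ins t t' y y' : \sum_l `|ins k (t, y) 0 l - ins k (t', y') 0 l| =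
  `|t - t'| + \sum_l `|y 0 l - y' 0 l|.
Proof.
rewrite (bigD1_ord k)//= !ins_same; congr (_ + _).
by apply: eq_bigr => l _; rewrite !ins_lift.
Qed.

(** The mean value theorem for points that differ only in the coordinate [k]. A line in this
    direction meets the zero set at most once. *)
Lemma zero_lin t t' y : `|t| < b1 -> `|t'| < b1 -> open_cube b1 y ->
  c0 * `|t - t'| <= `|rho (ins k (t, y)) - rho (ins k (t', y))|.
Proof.
move=> tb tb' yb.
have [p pb ->] := mvt_multi srho (between_cube (proj2 (open_cube_ins t' y) (conj tb' yb))
  (proj2 (open_cube_ins t y) (conj tb yb))).
rewrite (bigD1_ord k)//= big1 ?addr0; last by move=> l _; rewrite !ins_lift subrr mulr0.
rewrite !ins_same normrM ler_wpM2r//; apply: lrho.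
by apply: (between_cube _ _ (pb k)); apply/open_cube_ins.
Qed.

Lemma line_cont t y : `|t| < b1 -> open_cube b1 y -> {for t, continuous (fun t : R => rho (ins k (t, y)))}.
Proof.
move=> tb yb; have E : (fun t : R => rho (ins k (t, y))) = (fun t => rho (ins k (0, y) + t *: unitv R k)).
  by apply/funext => t'; rewrite ins_line.
rewrite E; apply: (is_derive_cont (smooth_line (i := k) srho _)).
by rewrite -ins_line; apply/open_cube_ins.
Qed.

(* On each line the sign of rho changes at its zero. *)
Lemma zero_between t t' y : t <= t' -> `|t| < b1 -> `|t'| < b1 -> open_cube b1 y ->
  rho (ins k (t, y)) * rho (ins k (t', y)) <= 0 ->
  exists2 z, t <= z <= t' & rho (ins k (z, y)) = 0.
Proof.
move=> tt tb tb' yb h.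
have cc : {within `[t, t'], continuous (fun t : R => rho (ins k (t, y)))}.
  apply: within_itv_continuous => z /andP[z1 z2]; apply: line_cont => //.
  by move: tb tb'; rewrite !ltr_norml => /andP[? ?] /andP[? ?]; apply/andP; split; lra.
have [c] : exists2 c, c \in `[t, t'] & rho (ins k (c, y)) = 0.
  apply: (IVT tt cc); rewrite ge_min le_max.
  by move: h; move: (rho _) (rho _) => u v h; apply/andP; split; nra.
by rewrite in_itv/= => ct rc; exists c.
Qed.

(** If [rho] had the same sign at [t] and [t'], a small value [v] of that sign would be attained on
    both sides of [t0]. By [zero_lin] the two points coincide, hence both are [t0], where [rho] is 0
    and not [v]. *)
Lemma zero_sign t t0 t' y : t < t0 -> t0 < t' -> `|t| < b1 -> `|t'| < b1 -> open_cube b1 y ->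
  rho (ins k (t0, y)) = 0 -> rho (ins k (t, y)) * rho (ins k (t', y)) < 0.
Proof.
move=> tt0 tt' tb tb' yb r0.
have t0b : `|t0| < b1 by move: tb tb'; rewrite !ltr_norml => /andP[? ?] /andP[? ?]; apply/andP; split; lra.
have nz s : `|s| < b1 -> s != t0 -> rho (ins k (s, y)) != 0.
  move=> sb st; rewrite -normr_gt0; have := zero_lin sb t0b yb; rewrite r0 subr0; apply: lt_le_trans.
  by rewrite mulr_gt0// normr_gt0 subr_eq0.
rewrite ltNge; apply/negP => h.
have nt : rho (ins k (t, y)) != 0 by apply: nz => //; rewrite lt_eqF.
have nt' : rho (ins k (t', y)) != 0 by apply: nz => //; rewrite gt_eqF.
pose a := rho (ins k (t, y)); pose b := rho (ins k (t', y)).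
have ab : 0 < a * b by rewrite lt_neqAle eq_sym mulf_neq0.
pose v := Num.sg a * (Num.min `|a| `|b| / 2).
have v0 : 0 < Num.min `|a| `|b| by rewrite lt_min !normr_gt0 nt.
have hit s s' (ss' : s <= s') : `|s| < b1 -> `|s'| < b1 -> Num.min (rho (ins k (s, y))) (rho (ins k (s', y))) <= v <=
    Num.max (rho (ins k (s, y))) (rho (ins k (s', y))) -> exists2 c, s <= c <= s' & rho (ins k (c, y)) = v.
  move=> sb sb' hv; have cc : {within `[s, s'], continuous (fun t : R => rho (ins k (t, y)))}.
    apply: within_itv_continuous => z /andP[z1 z2]; apply: line_cont => //.
    by move: sb sb'; rewrite !ltr_norml => /andP[? ?] /andP[? ?]; apply/andP; split; lra.
  by have [c] := IVT ss' cc hv; rewrite in_itv/= => ? ?; exists c.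
have [sa sb] : `|v| <= `|a| /\ `|v| <= `|b|.
  have -> : `|v| = Num.min `|a| `|b| / 2 by rewrite normrM normr_sg nt mul1r gtr0_norm ?divr_gt0.
  have h1 : Num.min `|a| `|b| <= `|a| by rewrite ge_min lexx.
  have h2 : Num.min `|a| `|b| <= `|b| by rewrite ge_min lexx orbT.
  by move: v0 h1 h2; move: (Num.min _ _) => z; split; lra.
have vn : v != 0 by rewrite mulf_neq0 ?sgr_eq0// gt_eqF// divr_gt0.
have av : 0 < a * v by rewrite /v mulrA -[a * Num.sg a]mulrC -normrEsg mulr_gt0 ?normr_gt0// divr_gt0.
have [c1 /andP[c11 c12] r1] : exists2 c, t <= c <= t0 & rho (ins k (c, y)) = v.
  apply: hit => //; first exact: ltW.
  rewrite r0 -/a; apply/andP; rewrite ge_min le_max; move: av sa.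
  exact: between_zero.
have [c2 /andP[c21 c22] r2] : exists2 c, t0 <= c <= t' & rho (ins k (c, y)) = v.
  apply: hit => //; first exact: ltW.
  have bv : 0 < b * v by have : 0 < (a * b) * (a * v) := mulr_gt0 ab av; rewrite mulrACA pmulr_rgt0// -expr2 exprn_even_gt0.
  rewrite r0 -/b; apply/andP; rewrite ge_min le_max; move: bv sb.
  by move=> h1 h2; have [h3 h4] := between_zero h1 h2; split; rewrite orbC.
have c1b : `|c1| < b1 by move: tb t0b; rewrite !ltr_norml => /andP[? ?] /andP[? ?]; apply/andP; split; lra.
have c2b : `|c2| < b1 by move: tb' t0b; rewrite !ltr_norml => /andP[? ?] /andP[? ?]; apply/andP; split; lra.
have := zero_lin c1b c2b yb; rewrite r1 r2 subrr normr0 pmulr_rle0// normr_le0 subr_eq0 => /eqP c12E.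
have c1t0 : c1 = t0 by lra.
by move: r1; rewrite c1t0 r0 => /esym/eqP; rewrite (negbTE vn).
Qed.

Definition dom : set 'rV[R]_m := [set y | open_cube b1 y /\ exists2 t, `|t| < b1 & rho (ins k (t, y)) = 0].
(** The implicit function, taken by choice of a zero on the line. The bounds on [rho] are uniform on
    the whole cube, so openness of its domain and differentiability are proved directly and
    globally. *)
Definition gr y : R := if pselect (exists2 t, `|t| < b1 & rho (ins k (t, y)) = 0) is left P
  then sval (cid2 P) else 0.

Lemma grP y : dom y -> `|gr y| < b1 /\ rho (ins k (gr y, y)) = 0.
Proof. by move=> [yb h]; rewrite /gr; case: pselect => // P; case: cid2. Qed.

Lemma gr_uniq y t : dom y -> `|t| < b1 -> rho (ins k (t, y)) = 0 -> t = gr y.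
Proof.
move=> Dy tb rt; have [gb rg] := grP Dy; have := zero_lin tb gb (proj1 Dy).
by rewrite rt rg subrr normr0 pmulr_rle0// normr_le0 subr_eq0 => /eqP.
Qed.

Lemma gr_lip y y' : dom y -> dom y' -> c0 * `|gr y' - gr y| <= C1 * \sum_l `|y' 0 l - y 0 l|.
Proof.
move=> Dy Dy'; have [gb rg] := grP Dy; have [gb' rg'] := grP Dy'.
have [yb _] := Dy; have [yb' _] := Dy'.
apply: le_trans (zero_lin gb' gb yb') _; rewrite rg' sub0r normrN.
have -> : `|rho (ins k (gr y, y'))| = `|rho (ins k (gr y, y')) - rho (ins k (gr y, y))| by rewrite rg subr0.
have cb t z : `|t| < b1 -> open_cube b1 z -> open_cube b1 (ins k (t, z)) by move=> ? ?; apply/open_cube_ins.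
apply: le_trans (lip (s := [::]) isT (cb _ _ gb yb') (cb _ _ gb yb)) _.
by rewrite sum_ins subrr normr0 add0r.
Qed.

Lemma nbhs_sum y (e : R) : 0 < e -> \forall z \near y, \sum_l `|(z : 'rV[R]_m) 0 l - y 0 l| < e.
Proof.
move=> e0; apply/nbhs_ballP; have h : 0 < e / m.+1%:R by rewrite divr_gt0.
exists (e / m.+1%:R) => // z [_ yz].
apply: (@le_lt_trans _ _ (\sum_(l < m) (e / m.+1%:R))).
  by apply: ler_sum => l _; have := yz ord0 l; rewrite /ball/= distrC => /ltW.
by rewrite sumr_const card_ord -[_ *+ m]mulr_natr mulrAC ltr_pdivrMr// ltr_pM2l// ltr_nat.
Qed.

(** At [gr y + e] and [gr y - e] the function [rho] has opposite signs and modulus at least [c0 e].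
    Moving [y] by less than this margin divided by [C1] preserves the signs, and a zero lies in
    between. *)
Lemma dom_open : open dom.
Proof.
rewrite openE => y Dy; have [gb rg] := grP Dy; have [yb _] := Dy.
pose e := (b1 - `|gr y|) / 2; have e0 : 0 < e by rewrite divr_gt0 ?subr_gt0.
have gp : `|gr y + e| < b1.
  by apply: le_lt_trans (ler_normD _ _) _; rewrite [`|e|]gtr0_norm// /e; lra.
have gm : `|gr y - e| < b1.
  by apply: le_lt_trans (ler_normB _ _) _; rewrite [`|e|]gtr0_norm// /e; lra.
have h1 : 0 < c0 * e / C1 by rewrite divr_gt0// mulr_gt0.
near=> z; have zb : open_cube b1 z by near: z; exact: open_nbhs_nbhs (conj (@open_cube_open R m b1) yb).
have zy : C1 * \sum_l `|z 0 l - y 0 l| < c0 * e.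
  rewrite mulrC -ltr_pdivlMr//; near: z; exact: nbhs_sum.
split=> //.
have sgn := @zero_sign (gr y - e) (gr y) (gr y + e) y _ _ gm gp yb rg.
have {}sgn : rho (ins k (gr y - e, y)) * rho (ins k (gr y + e, y)) < 0 by apply: sgn; lra.
have lp := @lip [::] (ins k (gr y + e, z)) (ins k (gr y + e, y)) isT (proj2 (open_cube_ins _ _) (conj gp zb)) (proj2 (open_cube_ins _ _) (conj gp yb)).
have lm := @lip [::] (ins k (gr y - e, z)) (ins k (gr y - e, y)) isT (proj2 (open_cube_ins _ _) (conj gm zb)) (proj2 (open_cube_ins _ _) (conj gm yb)).
rewrite sum_ins subrr normr0 add0r /= in lp; rewrite sum_ins subrr normr0 add0r /= in lm.
have bp : c0 * e <= `|rho (ins k (gr y + e, y))|.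
  by have := zero_lin gp gb yb; rewrite rg subr0 addrC addKr gtr0_norm.
have bmm : c0 * e <= `|rho (ins k (gr y - e, y))|.
  by have := zero_lin gm gb yb; rewrite rg subr0 addrC addKr normrN gtr0_norm.
have tt : gr y - e <= gr y + e by lra.
have [|z0 /andP[z1 z2] rz] := zero_between tt gm gp zb.
  have := le_lt_trans lp zy; have := le_lt_trans lm zy; move: sgn bp bmm.
  move: (rho _) (rho _) (rho _) (rho _) (c0 * e) => u1 u2 u3 u4 E s1 s2 s3.
  rewrite !ltr_norml => /andP[q1 q2] /andP[q3 q4].
  by move: s2 s3; rewrite !ler_normr => /orP[s2|s2] /orP[s3|s3]; nra.
by exists z0 => //; move: gp gm; rewrite !ltr_norml => /andP[? ?] /andP[? ?]; apply/andP; split; lra.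
Unshelve. all: end_near. Qed.

Definition slope l y : R := - (partial (lift k l) rho (ins k (gr y, y)) / partial k rho (ins k (gr y, y))).

(** [rho] vanishes at both points of the graph, so [mvt_multi] gives the difference quotient as
    minus a ratio of partial derivatives at intermediate points. The derivatives are Lipschitz and
    [gr] is Lipschitz, so moving these points to the base point costs a multiple of [|h|]. *)
Lemma gr_quot l : exists K, forall y, dom y -> forall h, h != 0 -> dom (y + h *: unitv R l) ->
  `|(gr (y + h *: unitv R l) - gr y) / h - slope l y| <= K * `|h|.
Proof.
exists (2 * (C1 * C1 * (C1 / c0 + 1)) / (c0 * c0)) => y Dy h h0 Dy'.
set y' := y + _; have [gb rg] := grP Dy; have [gb' rg'] := grP Dy'; rewrite -/y' in gb' rg' Dy' *.
have [yb _] := Dy; have [yb' _] := Dy'.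
have xb : open_cube b1 (ins k (gr y, y)) by apply/open_cube_ins.
have xb' : open_cube b1 (ins k (gr y', y')) by apply/open_cube_ins.
have sy : \sum_p `|y' 0 p - y 0 p| = `|h|.
  rewrite (bigD1 l)//= big1 ?addr0; first by rewrite !mxE !eqxx /= mulr1 addrC addKr.
  by move=> p pl; rewrite !mxE eqxx (negbTE pl) /= mulr0 addr0 subrr normr0.
have gl : c0 * `|gr y' - gr y| <= C1 * `|h| by rewrite -sy; exact: gr_lip.
have [p pb E] := mvt_multi srho (between_cube xb xb').
rewrite rg rg' subrr (bigD1_ord k)//= !ins_same (bigD1 l)//= big1 ?addr0 in E; last first.
  by move=> q ql; rewrite !ins_lift !mxE eqxx (negbTE ql) /= mulr0 addr0 subrr mulr0.
rewrite !ins_lift !mxE !eqxx /= mulr1 [_ + h - _]addrC addKr in E.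
have near s q : (size s <= 1)%N -> `|partials s rho (p q) - partials s rho (ins k (gr y, y))| <= C1 * (C1 / c0 + 1) * `|h|.
  move=> s1; apply: le_trans (lip s1 (between_cube xb xb' (pb q)) xb) _; rewrite -mulrA ler_wpM2l ?(ltW C10)//.
  apply: (@le_trans _ _ (\sum_r `|ins k (gr y', y') 0 r - ins k (gr y, y) 0 r|)).
    apply: ler_sum => r _; have := pb q r; rewrite ge_min le_max.
    move: (p q 0 r) (ins k (gr y', y') 0 r) (ins k (gr y, y) 0 r) => a b c /andP[/orP h1 /orP h2].
    rewrite ler_norml; apply/andP; have := ler_norm (b - c); have := ler_norm (c - b); rewrite distrC.
    by case: h1; case: h2; split; lra.
  rewrite sum_ins sy mulrDl mul1r lerD2r -(ler_pM2l c00); apply: le_trans gl _.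
  by rewrite mulrA [c0 * _]mulrC divfK ?gt_eqF.
have N1 := near [:: k] k isT; have N2 := near [:: lift k l] (lift k l) isT.
have pk := lrho (between_cube xb xb' (pb k)); have xk := lrho xb.
have B1 := @brho [:: k] (ins k (gr y, y)) isT xb; have B2 := @brho [:: lift k l] (ins k (gr y, y)) isT xb.
rewrite /= in N1 N2 B1 B2; rewrite /slope.
move: E N1 N2 pk xk B1 B2; move: (partial k rho (p k)) (partial (lift k l) rho (p (lift k l)))
  (partial k rho (ins _ _)) (partial (lift k l) rho (ins _ _)) => a1 a2 a3 a4 E N1 N2 pk xk B1 B2.
have a10 : a1 != 0 by rewrite -normr_gt0 (lt_le_trans c00).
have a30 : a3 != 0 by rewrite -normr_gt0 (lt_le_trans c00).
have -> : (gr y' - gr y) / h - - (a4 / a3) = ((a4 - a2) * a3 + a4 * (a1 - a3)) / (a1 * a3).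
  have -> : gr y' - gr y = - (a2 * h) / a1.
    by apply: (mulfI a10); rewrite [RHS]mulrC divfK//; apply/eqP; rewrite -addr_eq0 -E.
  by field; rewrite a10 a30.
rewrite normrM normfV normrM.
have D : (`|a1| * `|a3|)^-1 <= (c0 * c0)^-1.
  by rewrite lef_pV2 ?posrE ?mulr_gt0// ?normr_gt0//; apply: ler_pM => //; exact: ltW.
have Nm : `|(a4 - a2) * a3 + a4 * (a1 - a3)| <= 2 * (C1 * C1 * (C1 / c0 + 1)) * `|h|.
  apply: le_trans (ler_normD _ _) _; rewrite !normrM [`|a4 - a2|]distrC.
  have -> : 2 * (C1 * C1 * (C1 / c0 + 1)) * `|h| = C1 * (C1 / c0 + 1) * `|h| * C1 + C1 * (C1 * (C1 / c0 + 1) * `|h|) by ring.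
  by apply: lerD; apply: ler_pM.
by rewrite mulrAC; apply: ler_pM => //; rewrite invr_ge0 mulr_ge0.
Qed.

Lemma dom_line y l : dom y -> \forall h \near (0 : R), dom (y + h *: unitv R l).
Proof.
move=> Dy; have c : {for (0 : R), continuous (fun h : R => y + h *: unitv R l)}.
  by apply: continuousD; [exact: cst_continuous|exact: scalel_continuous].
by apply: c; rewrite scale0r addr0; exact: open_nbhs_nbhs (conj dom_open Dy).
Qed.

Lemma gr_derive y l : dom y -> derivable gr y (unitv R l) /\ partial l gr y = slope l y.
Proof.
move=> Dy; have [K HK] := gr_quot l.
suff L : h^-1 *: (gr (h *: unitv R l + y) - gr y) @[h --> (0 : R)^'] --> slope l y.
  by split; [apply/cvg_ex; exists (slope l y)|exact: cvg_lim L].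
apply/cvgrPdist_le => e e0; near=> h.
have h0 : h != 0 by near: h; exact: nbhs_dnbhs_neq.
rewrite distrC addrC [_ *: unitv R l + y]addrC [_^-1 *: _]mulrC.
have Dh : dom (y + h *: unitv R l) by near: h; apply: nbhs_dnbhs; exact: dom_line.
apply: le_trans (_ : K * `|h| <= _); first by have := HK y Dy h h0 Dh; rewrite addrC.
have K0 : 0 < `|K| + 1 by rewrite ltr_wpDl.
apply: (@le_trans _ _ ((`|K| + 1) * `|h|)); first by rewrite ler_wpM2r// (le_trans (ler_norm K))// lerDl.
rewrite mulrC -ler_pdivlMr//; near: h; apply: dnbhs0_le; exact: divr_gt0.
Unshelve. all: end_near. Qed.

End graph.

(** [F] is approximated uniformly within [e] by a step function on its level sets [A p]; the
    identity for indicators applies to that function, and both errors are controlled by total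
    masses. *)
Lemma bm_density d1 d2 (X : measurableType d1) (Y : measurableType d2) (R : realType)
    (m1 : {finite_measure set X -> \bar R}) (m2 : {finite_measure set Y -> \bar R})
    (g : Y -> X) (D : Y -> R) : measurable_fun setT g -> bm D ->
  (forall A, measurable A -> \int[m1]_x (\1_A x : R) = \int[m2]_y ((\1_A (g y) : R) * D y)) ->
  forall F : X -> R, bm F -> \int[m1]_x F x = \int[m2]_y (F (g y) * D y).
Proof.
move=> mg bD H F bF; have [mF [K0 FK0]] := bF; have [mD [KD DK]] := bD.
have bgF (f : X -> R) : bm f -> bm (fun y => f (g y) * D y).
  by move=> bf; apply: bmM => //; exact: bm_comp mg bf.
have KD0 : 0 <= KD := le_trans (normr_ge0 _) (DK point).
pose V := fine (m1 setT) + KD * fine (m2 setT).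
have V0 : 0 <= V by rewrite addr_ge0 ?mulr_ge0 ?fine_ge0.
pose K := `|K0| + 1; have Kp : 0 < K by rewrite ltr_wpDl.
have FK x : `|F x| < K by apply: le_lt_trans (FK0 x) _; rewrite (le_lt_trans (ler_norm K0))// ltrDl.
suff S e : 0 < e -> `|\int[m1]_x F x - \int[m2]_y (F (g y) * D y)| <= e * V.
  apply/eqP; rewrite -subr_eq0 -normr_le0; apply/ler_addgt0Pr => e e0; rewrite add0r.
  apply: le_trans (S (e / (V + 1)) _) _; first by rewrite divr_gt0// ltr_wpDl.
  by rewrite mulrAC ler_pdivrMr ?ltr_wpDl// ler_wpM2l ?(ltW e0)// lerDl.
move=> e0; pose P := (Num.truncn (2 * K / e)).+1.
pose A (p : nat) := F @^-1` `[- K + p%:R * e, - K + p.+1%:R * e[%classic.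
have mA p : measurable (A p) by rewrite -[A p]setTI; apply: mF => //; exact: measurable_itv.
have bA p : bm (\1_(A p) : X -> R).
  by split; [exact: measurable_indic|exists 1 => x; rewrite indicE; case: (_ \in _); rewrite ?normr1 ?normr0].
pose G x := \sum_(p < P) (- K + p%:R * e) * (\1_(A p) x : R).
have bG : bm G by apply: bm_sum => p; exact: bmZ.
have GE : \int[m1]_x G x = \int[m2]_y (G (g y) * D y).
  have bAp (p : 'I_P) : bm (fun x => (- K + p%:R * e) * (\1_(A p) x : R)) by exact: bmZ (bA p).
  have bAg (p : 'I_P) : bm (fun y => (- K + p%:R * e) * ((\1_(A p) (g y) : R) * D y)) by exact: bmZ (bgF _ (bA p)).
  have e1 := bm_Rintegral_sum m1 (index_enum 'I_P) bAp.
  have e2 := bm_Rintegral_sum m2 (index_enum 'I_P) bAg.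
  rewrite e1; transitivity (\sum_(p < P) \int[m2]_y ((- K + p%:R * e) * ((\1_(A p) (g y) : R) * D y))).
    by apply: eq_bigr => p _; rewrite (bm_RintegralZ _ _ (bA p)) (bm_RintegralZ _ _ (bgF _ (bA p))) H.
  rewrite -e2; apply: eq_Rintegral => y _; rewrite mulr_suml; apply: eq_bigr => p _; exact: mulrA.
have FG x : `|F x - G x| <= e.
  have /andP[f1 f2] : - K < F x < K by rewrite -ltr_norml.
  pose z := (F x + K) / e; have q0 : 0 <= z by rewrite divr_ge0 ?(ltW e0)//; lra.
  have fz : F x = - K + z * e by rewrite /z divfK ?gt_eqF// addrC addrK.
  have /andP[t1 t2] := truncn_itv q0.
  have p0P : (Num.truncn z < P)%N.
    by rewrite ltnS; apply: le_truncn; rewrite ler_pM2r ?invr_gt0//; lra.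
  have s1 : (Num.truncn z)%:R * e <= z * e by rewrite ler_wpM2r ?(ltW e0).
  have s2 : z * e < (Num.truncn z).+1%:R * e by rewrite ltr_pM2r.
  rewrite /G (bigD1 (Ordinal p0P))//= big1 ?addr0 => [|p pp].
    rewrite indicE mem_set ?mulr1; last first.
      by rewrite /A/= in_itv/= fz lerD2l ltrD2l s1 s2.
    move: s1 s2; rewrite -natr1 mulrDl mul1r fz; move: (_ * e) (z * e) => w1 w2 s1 s2.
    by rewrite ler_norml; apply/andP; split; lra.
  rewrite indicE memNset ?mulr0// /A/= in_itv/= fz lerD2l ltrD2l ler_pM2r// ltr_pM2r// => h.
  by case/eqP: pp; apply: val_inj; apply/eqP; rewrite /= eq_sym truncn_eq.
have bFG : bm (fun x => F x - G x) by exact: bmB.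
have -> : \int[m1]_x F x - \int[m2]_y (F (g y) * D y) =
    \int[m1]_x (F x - G x) - \int[m2]_y ((F (g y) - G (g y)) * D y).
  rewrite (bm_RintegralB _ bF bG) GE; under [X in _ = _ - X]eq_Rintegral do rewrite mulrBl.
  by rewrite (bm_RintegralB _ (bgF _ bF) (bgF _ bG)) opprB addrA subrK.
apply: le_trans (ler_normB _ _) _; rewrite /V mulrDr; apply: lerD; first exact: le_bm_bound.
rewrite mulrA; apply: le_bm_bound; first exact: bgF bFG.
by move=> y; rewrite normrM ler_pM.
Qed.

(** * The Poisson kernel as an approximate identity on a line *)

Section one_dim_limit.
Variable R : realType.
Local Notation leb := (@lebesgue_measure R).

(** The derivative of [2 atan(M x)]: the total mass is [2 pi] for every [M], which is the factor
    [2 pi] in all limits below. *)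
Definition pker (M x : R) : R := 2 * M / (1 + (M * x) ^+ 2).

Lemma is_derive_2atan (M : R) (phi : R -> R) (t dphi : R) : is_derive t 1 phi dphi ->
  is_derive t 1 (fun t => 2 * atan (M * phi t)) (pker M (phi t) * dphi).
Proof.
move=> d; have d1 : is_derive t 1 (fun t : R => M * phi t) (M * dphi) by exact: is_deriveZ.
have d2 := @is_derive1_comp _ atan (fun t : R => M * phi t) t _ _ (is_derive1_atan (M * phi t)) d1.
have d3 := is_deriveZ 2 d2.
have -> : pker M (phi t) * dphi = 2 *: ((1 + (M * phi t) ^+ 2)^-1 * (M * dphi)).
  by rewrite /GRing.scale/= /pker; ring.
exact: d3.
Qed.

Lemma pker_ge0 (M x : R) : 0 <= M -> 0 <= pker M x.
Proof. by move=> M0; rewrite divr_ge0 ?mulr_ge0// addr_ge0// sqr_ge0. Qed.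

Lemma pker_far (M x d : R) : 0 < M -> 0 < d -> d <= `|x| -> pker M x <= 2 / (d ^+ 2) / M.
Proof.
move=> M0 d0 dx; rewrite /pker ler_pdivrMr ?ltr_wpDr ?sqr_ge0//.
have h : d ^+ 2 <= x ^+ 2 by rewrite -[x ^+ 2]real_normK ?num_real// lerXn2r ?nnegrE ?(ltW d0).
have -> : 2 / d ^+ 2 / M * (1 + (M * x) ^+ 2) = 2 / d ^+ 2 / M + 2 * M * (x ^+ 2 / d ^+ 2).
  by field; rewrite !gt_eqF.
have h2 : 1 <= x ^+ 2 / d ^+ 2 by rewrite ler_pdivlMr ?exprn_gt0// mul1r.
have h3 : 0 <= 2 / d ^+ 2 / M by rewrite !divr_ge0 ?sqr_ge0 ?(ltW M0).
apply: (@le_trans _ _ (2 * M * (x ^+ 2 / d ^+ 2))); last by rewrite lerDr.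
by rewrite ler_peMr// mulr_ge0// ltW.
Qed.

Lemma atan_le (x : R) : `|2 * atan x| <= pi.
Proof.
rewrite ler_norml; have := atan_ltpi2 x; have := atan_gtNpi2 x => h1 h2.
by apply/andP; split; lra.
Qed.


Section line.
Variables (c0 C1 b1 b2 U : R) (phi dphi u : R -> R).
Implicit Types (t : R).
Hypotheses (b20 : 0 < b2) (b21 : b2 < b1) (c00 : 0 < c0).
Hypothesis dphiP : forall t, `|t| < b1 -> is_derive t 1 phi (dphi t).
Hypothesis cdphi : forall t, `|t| < b1 -> {for t, continuous dphi}.
Hypothesis ldphi : forall t, `|t| < b1 -> c0 <= `|dphi t|.
Hypothesis udphi : forall t, `|t| < b1 -> `|dphi t| <= C1.
Hypothesis cu : forall t, `|t| < b1 -> {for t, continuous u}.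
Hypothesis uU : forall t, `|u t| <= U.

Let itv_b1 t : - b2 <= t <= b2 -> `|t| < b1.
Proof. by move=> h; apply: le_lt_trans b21; rewrite ler_norml. Qed.

Let bb0 : 0 <= b2 - - b2. Proof. by rewrite opprK addr_ge0 ?(ltW b20). Qed.
Let U0 : 0 <= U. Proof. exact: le_trans (normr_ge0 _) (uU 0). Qed.

Lemma dphi_sign : exists2 s, s = 1 \/ s = -1 & forall t, - b2 <= t <= b2 -> `|dphi t| = s * dphi t.
Proof.
have z0 : - b2 <= 0 <= b2 by rewrite oppr_le0 ltW.
have nz t : - b2 <= t <= b2 -> dphi t != 0.
  by move=> /itv_b1 h; rewrite -normr_gt0; exact: lt_le_trans (ldphi h).
have same t t' : - b2 <= t <= b2 -> - b2 <= t' <= b2 -> 0 < dphi t * dphi t'.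
  wlog tt : t t' / t <= t'.
    by move=> W h h'; have [/W|/ltW/W] := leP t t'; [exact|rewrite mulrC; exact].
  move=> h h'; rewrite lt_neqAle eq_sym mulf_neq0 ?nz//= leNgt; apply/negP => neg.
  have sub z : t <= z <= t' -> - b2 <= z <= b2.
    by move=> /andP[z1 z2]; move/andP: h => [h1 h2]; move/andP: h' => [h3 h4]; apply/andP; split; lra.
  have cc : {within `[t, t'], continuous dphi}.
    by apply: within_itv_continuous => z /sub/itv_b1; exact: cdphi.
  have [|c] := IVT (v := 0) tt cc.
    rewrite ge_min le_max; move: neg; move: (dphi t) (dphi t') => x y neg.
    by have [x0|x0] := leP x 0; have [y0|y0] := leP y 0; rewrite ?orbT//=; nra.
  by rewrite in_itv/= => /sub/nz/eqP.
exists (Num.sg (dphi 0)) => [|t ht].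
  by case: sgrP => h; [have /eqP := nz 0 z0|left|right].
have := same _ _ z0 ht; case: sgrP => h.
- by rewrite h mul0r ltxx.
- by rewrite (pmulr_rgt0 _ h) mul1r => /gtr0_norm.
- by rewrite (nmulr_rgt0 _ h) mulN1r => /ltr0_norm.
Qed.

(** [dphi] has constant sign, so that the kernel weighted by [|dphi|] has the primitive
    [2 atan(M phi)] up to that sign. *)
Lemma mass (M : R) : 0 < M -> exists2 s, s = 1 \/ s = -1 &
  \int[leb]_(t in `[- b2, b2]) (pker M (phi t) * `|dphi t|) =
  s * (2 * atan (M * phi b2) - 2 * atan (M * phi (- b2))) /\ 
  forall t, - b2 <= t <= b2 -> `|dphi t| = s * dphi t.
Proof.
move=> M0; have [s s1 sE] := dphi_sign; exists s => //; split=> //.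
have bb : - b2 < b2 by rewrite gtrN.
have cpk t : `|t| < b1 -> {for t, continuous (fun t => pker M (phi t))}.
  move=> tb; have c1 : {for t, continuous (fun t => M * phi t)}.
    by apply: continuousM; [exact: cst_continuous|exact: is_derive_cont (dphiP tb)].
  apply: continuousM; first exact: cst_continuous.
  apply: continuousV; first by rewrite gt_eqF// ltr_wpDr ?sqr_ge0.
  by apply: continuousD; [exact: cst_continuous|exact: (continuousM c1 c1)].
have dd t : - b2 <= t <= b2 -> is_derive t 1 (fun t => 2 * atan (M * phi t)) (pker M (phi t) * dphi t).
  by move=> /itv_b1 tb; exact: is_derive_2atan (dphiP tb).
have cc t : - b2 <= t <= b2 -> {for t, continuous (fun t => pker M (phi t) * dphi t)}.
  by move=> /itv_b1 tb; apply: continuousM; [exact: cpk|exact: cdphi].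
rewrite -(ftc bb dd cc) -RintegralZl//; last exact: itv_integrable.
by apply: eq_Rintegral => t; rewrite inE/= in_itv/= => /sE ->; rewrite mulrCA.
Qed.

Lemma pker_phi_cont (M : R) t : `|t| < b1 -> {for t, continuous (fun t => pker M (phi t))}.
Proof.
move=> tb; have c1 : {for t, continuous (fun t => M * phi t)}.
  by apply: continuousM; [exact: cst_continuous|exact: is_derive_cont (dphiP tb)].
apply: continuousM; first exact: cst_continuous.
apply: continuousV; first by rewrite gt_eqF// ltr_wpDr ?sqr_ge0.
by apply: continuousD; [exact: cst_continuous|exact: (continuousM c1 c1)].
Qed.

Lemma norm_cont (f : R -> R) t : {for t, continuous f} -> {for t, continuous (fun t => `|f t|)}.
Proof. by move=> cf; apply: (@continuous_comp _ _ _ f (fun x : R => `|x|)); [exact: cf|exact: norm_continuous]. Qed.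

Lemma mass_le (M : R) : 0 < M -> \int[leb]_(t in `[- b2, b2]) (pker M (phi t) * `|dphi t|) <= 2 * pi.
Proof.
move=> M0; have [s s1 [-> _]] := mass M0.
have := atan_le (M * phi b2); have := atan_le (M * phi (- b2)); rewrite !ler_norml => /andP[? ?] /andP[? ?].
by case: s1 => ->; lra.
Qed.

Lemma le_itv (f g : R -> R) : (forall t, - b2 <= t <= b2 -> {for t, continuous f}) ->
  (forall t, - b2 <= t <= b2 -> {for t, continuous g}) -> (forall t, - b2 <= t <= b2 -> `|f t| <= g t) ->
  `|\int[leb]_(t in `[- b2, b2]) f t| <= \int[leb]_(t in `[- b2, b2]) g t.
Proof.
move=> cf cg fg; apply: le_trans (le_normr_Rintegral _ _) _ => //; first exact: itv_integrable.
have i1 : leb.-integrable `[- b2, b2] (EFin \o (fun t => `|f t|)).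
  by apply: itv_integrable => t ht; apply: norm_cont; exact: cf.
have i2 := itv_integrable cg.
by apply: le_Rintegral => // t; rewrite /= in_itv/=; exact: fg.
Qed.

(** [|dphi| >= c0] allows comparison with the weighted mass, which is at most [2 pi]. The bound is
    independent of [M] and serves as the dominating constant later. *)
Lemma pker_bound (M : R) : 0 < M ->
  `|\int[leb]_(t in `[- b2, b2]) (u t * pker M (phi t))| <= U / c0 * (2 * pi).
Proof.
move=> M0; have Uc : 0 <= U / c0 by rewrite divr_ge0// ltW.
have ck t : - b2 <= t <= b2 -> {for t, continuous (fun t => pker M (phi t) * `|dphi t|)}.
  by move=> /itv_b1 tb; apply: continuousM; [exact: pker_phi_cont|apply: norm_cont; exact: cdphi].
apply: (@le_trans _ _ (\int[leb]_(t in `[- b2, b2]) (U / c0 * (pker M (phi t) * `|dphi t|)))).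
  apply: le_itv => t ht; first by have tb := itv_b1 ht; apply: continuousM; [exact: cu|exact: pker_phi_cont].
    by apply: continuousM; [exact: cst_continuous|exact: ck].
  have p0 := pker_ge0 (phi t) (ltW M0); rewrite normrM [`|pker _ _|]ger0_norm// [X in _ <= _ * X]mulrC [X in _ <= X]mulrA; apply: ler_wpM2r => //.
  apply: le_trans (uU t) _; rewrite mulrAC ler_pdivlMr// ler_wpM2l//; exact: ldphi (itv_b1 ht).
rewrite RintegralZl//; last exact: itv_integrable.
by rewrite ler_wpM2l// mass_le.
Qed.

Lemma pker_limit_none (d : R) : 0 < d -> (forall t, - b2 <= t <= b2 -> u t != 0 -> d <= `|phi t|) ->
  (\int[leb]_(t in `[- b2, b2]) (u t * pker k.+1%:R (phi t))) @[k --> \oo] --> (0 : R).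
Proof.
move=> d0 h; pose K := U * (2 / d ^+ 2) * (b2 - - b2).
have K0 : 0 <= K by rewrite !mulr_ge0 ?invr_ge0 ?sqr_ge0 ?(ltW c00).
have b (k : nat) : `|\int[leb]_(t in `[- b2, b2]) (u t * pker k.+1%:R (phi t))| <= K * k.+1%:R^-1.
  rewrite /K mulrAC; apply: le_itv_Rintegral; first by rewrite (@le_trans _ _ 0) ?oppr_le0 ?(ltW b20).
    by move=> t /itv_b1 tb; apply: continuousM; [exact: cu|exact: pker_phi_cont].
  move=> t ht; have [->|ut] := eqVneq (u t) 0.
    by rewrite mul0r normr0 !mulr_ge0 ?invr_ge0 ?sqr_ge0 ?(ltW c00).
  rewrite normrM -mulrA; apply: ler_pM => //; rewrite ger0_norm ?pker_ge0//.
  by apply: pker_far => //; exact: h.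
apply/cvgr0Pnorm_le => e e0; have := @cvg_harmonic R.
have Ke : 0 < e / (K + 1) by rewrite divr_gt0// ltr_wpDl.
move=> /cvgr0Pnorm_le /(_ _ Ke) [N _ HN]; exists N => // k Nk; apply: le_trans (b k) _.
have := HN k Nk; rewrite /= ger0_norm ?invr_ge0// => hk.
apply: le_trans (ler_wpM2l K0 hk) _.
by rewrite mulrA ler_pdivrMr ?ltr_wpDl// mulrC ler_wpM2l ?(ltW e0)// lerDl.
Qed.

(** In the variable [phi] this is the usual approximate identity, and the Jacobian accounts for the
    division by [|dphi t0|]. *)
Lemma pker_limit (t0 : R) : - b2 < t0 < b2 -> phi t0 = 0 ->
  (forall t t', `|t| < b1 -> `|t'| < b1 -> c0 * `|t - t'| <= `|phi t - phi t'|) ->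
  phi (- b2) * phi b2 < 0 ->
  (\int[leb]_(t in `[- b2, b2]) (u t * pker k.+1%:R (phi t))) @[k --> \oo] --> (2 * pi * (u t0 / `|dphi t0|)).
Proof.
move=> /andP[t01 t02] phi0 lin opp.
have t0b : - b2 <= t0 <= b2 by rewrite !ltW.
pose v t := u t / `|dphi t|; pose V := U / c0; have V0 : 0 <= V by rewrite divr_ge0// ltW.
have dn t : - b2 <= t <= b2 -> `|dphi t| != 0 by move=> /itv_b1 h; rewrite gt_eqF// (lt_le_trans c00 (ldphi h)).
have cv t : - b2 <= t <= b2 -> {for t, continuous v}.
  move=> ht; have tb := itv_b1 ht; apply: continuousM; first exact: cu.
  by apply: continuousV; [exact: dn|apply: norm_cont; exact: cdphi].
have vV t : - b2 <= t <= b2 -> `|v t| <= V.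
  move=> ht; rewrite normrM normfV normr_id; apply: ler_pM => //.
  by rewrite lef_pV2 ?posrE ?(lt_le_trans c00 (ldphi (itv_b1 ht)))//; exact: ldphi (itv_b1 ht).
(* The weighted mass tends to the full [2 pi] because [phi] has opposite signs at the two ends, so
   that the doubled arctangents tend to [pi] and [- pi]. *)
pose ka (k : nat) := \int[leb]_(t in `[- b2, b2]) (pker k.+1%:R (phi t) * `|dphi t|).
have ck (k : nat) t : - b2 <= t <= b2 -> {for t, continuous (fun t => pker k.+1%:R (phi t) * `|dphi t|)}.
  by move=> /itv_b1 tb; apply: continuousM; [exact: pker_phi_cont|apply: norm_cont; exact: cdphi].
have kaL : ka k @[k --> \oo] --> 2 * pi.
  have at_lim (a : R) : 0 < a -> (2 * atan (k.+1%:R * a)) @[k --> \oo] --> pi.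
    move=> a0; have -> : pi = 2 * (pi / 2) :> R by rewrite mulrC divfK.
    apply: cvgM; first exact: cvg_cst.
    have c1 : (k.+1%:R * a)%R @[k --> \oo] --> +oo.
      apply/cvgryPge => A; exists (Num.truncn (A / a)) => // k /= hk.
      have h : A / a < k.+1%:R by apply: lt_le_trans (truncnS_gt _) _; rewrite ler_nat ltnS.
      by move: h; rewrite ltr_pdivrMr// => /ltW.
    exact: (cvg_comp _ _ c1 (@cvgy_atan R)).
  have at_limN (a : R) : a < 0 -> (2 * atan (k.+1%:R * a)) @[k --> \oo] --> - pi.
    move=> a0; have := at_lim (- a); rewrite oppr_gt0 => /(_ a0) /cvgN.
    rewrite (_ : (- (fun k : nat => 2 * atan (k.+1%:R * - a)))%R = (fun k : nat => 2 * atan (k.+1%:R * a)))//.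
    by apply/funext => k; rewrite !fctE mulrN atanN mulrN opprK.
  have sgn : phi b2 != 0 /\ phi (- b2) != 0 by split; apply/eqP => z; move: opp; rewrite z ?mul0r ?mulr0 ltxx.
  have kE k : exists2 s, s = 1 \/ s = -1 & ka k = s * (2 * atan (k.+1%:R * phi b2) - 2 * atan (k.+1%:R * phi (- b2))).
    by have [s' s1' [E _]] := @mass k.+1%:R (ltr0Sn _ _); exists s'.
  have ka0 k : 0 <= ka k by apply: Rintegral_ge0 => t _; rewrite mulr_ge0 ?pker_ge0.
  have kE2 k : ka k = `|2 * atan (k.+1%:R * phi b2) - 2 * atan (k.+1%:R * phi (- b2))|.
    by rewrite -(ger0_norm (ka0 k)); have [s' s1' ->] := kE k; case: s1' => ->; rewrite ?mul1r ?mulN1r ?normrN.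
  apply: cvg_trans (_ : (`|2 * atan (k.+1%:R * phi b2) - 2 * atan (k.+1%:R * phi (- b2))|) @[k --> \oo] --> _).
    by apply: near_eq_cvg; near=> k; rewrite kE2.
  have [p|p] := ltP 0 (phi b2).
    have q : phi (- b2) < 0 by move: opp; rewrite mulrC pmulr_rlt0.
    have -> : 2 * pi = `|pi - - pi| :> R by rewrite opprK -mulr2n -[pi *+ 2]mulr_natl ger0_norm// mulr_ge0// pi_ge0.
    by apply: cvg_norm; apply: cvgB; [exact: at_lim|exact: at_limN].
  have {}p : phi b2 < 0 by rewrite lt_neqAle p (proj1 sgn).
  have q : 0 < phi (- b2) by move: opp; rewrite mulrC nmulr_rlt0.
  have -> : 2 * pi = `|- pi - pi| :> R by rewrite -opprD normrN -mulr2n -[pi *+ 2]mulr_natl ger0_norm// mulr_ge0// pi_ge0.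
  by apply: cvg_norm; apply: cvgB; [exact: at_limN|exact: at_lim].
(* [v = u / |dphi|] is compared with its value at [t0]. The difference is small near [t0] by
   continuity; at distance [d] or more, [|phi| >= c0 d] and the kernel is of order [1 / k]. *)
have split k : \int[leb]_(t in `[- b2, b2]) (u t * pker k.+1%:R (phi t)) =
    v t0 * ka k + \int[leb]_(t in `[- b2, b2]) ((v t - v t0) * (pker k.+1%:R (phi t) * `|dphi t|)).
  rewrite /ka -RintegralZl//; last by apply: itv_integrable; exact: ck.
  rewrite -RintegralD//.
  - apply: eq_Rintegral => t; rewrite inE/= in_itv/= => ht; rewrite -mulrDl addrC subrK /v.
    by rewrite -mulrA [pker _ _ * _]mulrC [X in _ = u t * X]mulrA mulVf ?mul1r ?dn.
  - by apply: itv_integrable => t ht; apply: continuousM; [exact: cst_continuous|exact: ck].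
  - apply: itv_integrable => t ht; apply: continuousM; last exact: ck.
    by apply: continuousB; [exact: cv|exact: cst_continuous].
have -> : 2 * pi * (u t0 / `|dphi t0|) = v t0 * (2 * pi) + 0 by rewrite addr0 mulrC.
apply: cvg_trans (_ : (v t0 * ka k + \int[leb]_(t in `[- b2, b2]) ((v t - v t0) * (pker k.+1%:R (phi t) * `|dphi t|))) @[k --> \oo] --> _).
  by apply: near_eq_cvg; near=> k; rewrite split.
apply: cvgD; first by apply: cvgM => //; exact: cvg_cst.
apply/cvgr0Pnorm_le => e e0.
pose e1 := e / (2 * (2 * pi + 1)); have p0 : 0 < 2 * (2 * pi + 1) :> R by rewrite mulr_gt0// ltr_wpDl// mulr_ge0// pi_ge0.
have e10 : 0 < e1 by rewrite divr_gt0.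
have [d /= d0 Hd] : \forall t \near t0, `|v t0 - v t| < e1 by have /cvgrPdist_lt := cv _ t0b; exact.
pose K := 2 * V * (2 / (c0 * d) ^+ 2 * C1) * (b2 - - b2).
have C10 : 0 <= C1 := le_trans (normr_ge0 _) (udphi (itv_b1 t0b)).
have cd : 0 < c0 * d by rewrite mulr_gt0.
have K0 : 0 <= K by rewrite !mulr_ge0 ?invr_ge0 ?sqr_ge0 ?(ltW c00).
have bound (k : nat) : `|\int[leb]_(t in `[- b2, b2]) ((v t - v t0) * (pker k.+1%:R (phi t) * `|dphi t|))| <=
    e1 * (2 * pi) + K * k.+1%:R^-1.
  apply: (@le_trans _ _ (\int[leb]_(t in `[- b2, b2]) (e1 * (pker k.+1%:R (phi t) * `|dphi t|) + 2 * V * (2 / (c0 * d) ^+ 2 / k.+1%:R * C1)))).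
    apply: le_itv => t ht.
    - by apply: continuousM; [apply: continuousB; [exact: cv|exact: cst_continuous]|exact: ck].
    - by apply: continuousD; [apply: continuousM; [exact: cst_continuous|exact: ck]|exact: cst_continuous].
    have pp : 0 <= pker k.+1%:R (phi t) * `|dphi t| by rewrite mulr_ge0 ?pker_ge0.
    have r0 : 0 <= 2 * V * (2 / (c0 * d) ^+ 2 / k.+1%:R * C1) by rewrite !mulr_ge0 ?invr_ge0 ?sqr_ge0 ?(ltW c00)// ltW.
    rewrite normrM [`|_ * `|_| |]ger0_norm//; have [td|td] := ltP `|t0 - t| d.
      by rewrite -[leLHS]addr0; apply: lerD => //; rewrite ler_wpM2r// ltW// distrC; exact: Hd.
    rewrite -[leLHS]add0r; apply: lerD; first by rewrite mulr_ge0 ?(ltW e10).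
    apply: ler_pM => //.
      by apply: le_trans (ler_normB _ _) _; rewrite mulr_natl mulr2n lerD ?vV.
    apply: ler_pM => //; [exact: pker_ge0| |exact: udphi (itv_b1 ht)].
    apply: pker_far => //; have := lin t t0 (itv_b1 ht) (itv_b1 t0b); rewrite phi0 subr0; apply: le_trans.
    by rewrite ler_wpM2l ?(ltW c00)// distrC.
  rewrite RintegralD//; last 2 first.
  - by apply: itv_integrable => t ht; apply: continuousM; [exact: cst_continuous|exact: ck].
  - by apply: itv_integrable => t _; exact: cst_continuous.
  have -> : \int[leb]_(t in `[- b2, b2]) (e1 * (pker k.+1%:R (phi t) * `|dphi t|)) = e1 * ka k.
    by rewrite RintegralZl//; apply: itv_integrable; exact: ck.
  apply: lerD; first by apply: ler_wpM2l (ltW e10) _ _ _; apply: mass_le.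
  have bb : - b2 <= b2 by rewrite (@le_trans _ _ 0) ?oppr_le0 ?(ltW b20).
  apply: le_trans (ler_norm _) (le_trans (le_itv_Rintegral bb (K := 2 * V * (2 / (c0 * d) ^+ 2 / k.+1%:R * C1)) _ _) _).
  - by move=> t _; exact: cst_continuous.
  - by move=> t _; rewrite ger0_norm// !mulr_ge0 ?invr_ge0 ?sqr_ge0 ?(ltW c00)// ltW.
  by rewrite /K le_eqVlt; apply/orP; left; apply/eqP; ring.
have Ke : 0 < e / 2 / (K + 1) by rewrite !divr_gt0// ltr_wpDl.
have [N _ HN] := (cvgr0Pnorm_le _).1 (@cvg_harmonic R) _ Ke; exists N => // k Nk /=.
apply: le_trans (bound k) _.
have := HN k Nk; rewrite /= ger0_norm ?invr_ge0// => hk.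
have h1 : K * k.+1%:R^-1 <= e / 2.
  apply: le_trans (ler_wpM2l K0 hk) _.
  by rewrite mulrA ler_pdivrMr ?ltr_wpDl// mulrC ler_wpM2l ?divr_ge0 ?(ltW e0)// lerDl.
have h2 : e1 * (2 * pi) <= e / 2.
  rewrite /e1 mulrAC ler_pdivrMr//.
  have -> : e / 2 * (2 * (2 * pi + 1)) = e * (2 * pi + 1) by move: (pi : R) => p; field.
  by apply: (ler_wpM2l (ltW e0)); rewrite lerDl.
by rewrite [leRHS](splitr e) lerD.
Unshelve. all: end_near. Qed.

End line.

End one_dim_limit.

Lemma measurable_funV_norm d (T : measurableType d) (R : realType) (f : T -> R) :
  measurable_fun setT f -> measurable_fun setT (fun x => `|f x|^-1).
Proof.
move=> mf; have mn : measurable_fun setT (fun x => `|f x|) by exact: measurableT_comp.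
have -> : (fun x => `|f x|^-1) = (fun x => `|f x| `^ (-1)).
  by apply/funext => x; rewrite powR_inv1.
exact: (measurableT_comp (measurable_powR (-1)) mn).
Qed.

(** * Surface integrals in one chart *)

Section surface_integral.
Variables (R : realType) (m : nat) (k : 'I_m.+1) (b1 C1 c0 : R) (rho : 'rV[R]_m.+1 -> R).
Hypotheses (b10 : 0 < b1) (srho : smooth_on (open_cube b1) rho) (c00 : 0 < c0) (C10 : 0 < C1).
Hypothesis brho : forall s x, (size s <= 2)%N -> open_cube b1 x -> `|partials s rho x| <= C1.
Hypothesis lrho : forall x, open_cube b1 x -> c0 <= `|partial k rho x|.
Hypothesis mrho : measurable_fun setT rho.
Implicit Types y : 'rV[R]_m.
Local Notation dom := (dom k b1 rho).
Local Notation gr := (gr k b1 rho).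

(** Values of [rho] outside the cube are arbitrary; cutting its derivatives to the cube makes
    [grad_norm] bounded and measurable on the whole space. *)
Definition Pcut (l : 'I_m.+1) : 'rV[R]_m.+1 -> R := partial l rho \_ (open_cube b1).
Definition grad_norm (x : 'rV[R]_m.+1) : R := Num.sqrt (\sum_l Pcut l x ^+ 2).
Definition gam y : 'rV[R]_m.+1 := ins k ((gr \_ dom) y, y).
(** This is the area density [(1 + |grad g|^2)^(1/2)] of the graph, by [dens_in]. Written through
    [rho], it exhibits the weight [|grad rho|] over the Jacobian [|d_k rho|] that arises in the
    limit of the Poisson kernel. *)
Definition dens y : R := \1_dom y * (grad_norm (gam y) / `|Pcut k (gam y)|).

Lemma domP : open dom. Proof. by move=> y; exact: (dom_open srho c00 C10 brho lrho). Qed.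

Lemma Pcut_in l x : open_cube b1 x -> Pcut l x = partial l rho x.
Proof. by move=> xb; rewrite /Pcut /patch mem_set. Qed.

Lemma Pcut_out l x : ~ open_cube b1 x -> Pcut l x = 0.
Proof. by move=> xb; rewrite /Pcut /patch memNset. Qed.

Lemma Pcut_bm l : bm (Pcut l).
Proof.
split.
  apply: measurable_patch; first exact: (open_measurable_rV (@open_cube_open R m.+1 b1)).
  apply: (cont_measurable_rV (@open_cube_open R m.+1 b1)) => x xb.
  by apply: smooth_cont xb; exact: (smooth_partials [:: l] srho).
exists C1 => x; have [xb|xb] := pselect (open_cube b1 x).
  by rewrite Pcut_in//; exact: (@brho [:: l]).
by rewrite Pcut_out// normr0 ltW.
Qed.

Lemma grad_norm_bm : bm grad_norm.
Proof.
have [mS [K SK]] : bm (fun x => \sum_l Pcut l x ^+ 2) by apply: bm_sum => l; exact: bmX (Pcut_bm l).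
split; last by exists (Num.sqrt K) => x; rewrite ger0_norm ?sqrtr_ge0// ler_wsqrtr// (le_trans (ler_norm _)).
by apply: measurableT_comp mS; apply: continuous_measurable_fun; exact: sqrt_continuous.
Qed.

Lemma comp_gr_cont s y : (size s <= 1)%N -> dom y ->
  {for y, continuous (fun y => partials s rho (ins k (gr y, y)))}.
Proof.
move=> s1 Dy P /nbhs_ballP[e /= e0 eP]; pose K := C1 * (C1 / c0 + 1).
have K0 : 0 < K by rewrite mulr_gt0// ltr_wpDl// divr_ge0 ?ltW.
have h1 : nbhs y dom := open_nbhs_nbhs (conj domP Dy).
have h2 := nbhs_sum y (divr_gt0 e0 K0).
apply: (@filterS _ (nbhs y) (nbhs_filter y) _ _ _ (@filterI _ (nbhs y) (nbhs_filter y) _ _ h1 h2)) => z [Dz zs]; apply: eP; rewrite /ball/=.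
have [gz _] := grP Dz; have [gy _] := grP Dy; have [zb _] := Dz; have [yb _] := Dy.
rewrite distrC; apply: le_lt_trans (lip srho brho s1 (proj2 (open_cube_ins k b1 _ _) (conj gz zb)) (proj2 (open_cube_ins k b1 _ _) (conj gy yb))) _.
rewrite sum_ins; move: zs; rewrite ltr_pdivlMr// mulrC; apply: le_lt_trans.
rewrite /K -mulrA ler_wpM2l ?(ltW C10)// mulrDl mul1r lerD2r.
have := gr_lip srho brho lrho Dy Dz; rewrite -ler_pdivlMl// => h; apply: (le_trans h).
by rewrite mulrA [C1 / c0]mulrC.
Qed.

Lemma gr_cont y : dom y -> {for y, continuous gr}.
Proof.
move=> Dy P /nbhs_ballP[e /= e0 eP].
have h1 : nbhs y dom := open_nbhs_nbhs (conj domP Dy).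
have h2 := nbhs_sum y (divr_gt0 (mulr_gt0 e0 c00) C10).
apply: (@filterS _ (nbhs y) (nbhs_filter y) _ _ _ (@filterI _ (nbhs y) (nbhs_filter y) _ _ h1 h2)) => z [Dz zs]; apply: eP; rewrite /ball/=.
rewrite distrC -(ltr_pM2l c00); apply: le_lt_trans (gr_lip srho brho lrho Dy Dz) _.
by move: zs; rewrite ltr_pdivlMr// mulrC [e * c0]mulrC.
Qed.

Lemma gr_C1 : Ck_on 1 dom gr.
Proof.
move=> [|l [|//]] y _ Dy; split=> //=.
- exact: gr_cont.
- by move=> _ l; exact: (gr_derive srho c00 C10 brho lrho l Dy).1.
have cs : {for y, continuous (slope k b1 rho l)}.
  apply: continuousN; apply: continuousM; first exact: (@comp_gr_cont [:: lift k l] y isT Dy).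
  apply: continuousV; last exact: (@comp_gr_cont [:: k] y isT Dy).
  have [gb _] := grP Dy; have [yb _] := Dy.
  by rewrite -normr_gt0 (lt_le_trans c00)//; apply: lrho; apply/open_cube_ins.
have E z : dom z -> partial l gr z = slope k b1 rho l z.
  by move=> Dz; exact: (gr_derive srho c00 C10 brho lrho l Dz).2.
move=> P hP; have h1 : nbhs y dom := open_nbhs_nbhs (conj domP Dy).
have hs : nbhs y [set z | P (slope k b1 rho l z)] := cs P (eq_rect _ (fun v => nbhs v P) hP _ (E y Dy)).
apply: (@filterS _ (nbhs y) (nbhs_filter y) _ _ _ (@filterI _ (nbhs y) (nbhs_filter y) _ _ h1 hs)) => z [Dz Pz].
by rewrite /= (E z Dz).
Qed.

Lemma gam_in y : dom y -> gam y = ins k (gr y, y).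
Proof. by move=> Dy; rewrite /gam /patch mem_set. Qed.

Lemma gam_meas : measurable_fun setT gam.
Proof.
apply: (measurableT_comp (measurable_ins k)); apply/measurable_fun_pairP; split=> /=; last exact: measurable_id.
apply: measurable_patch; first exact: (open_measurable_rV domP).
by apply: (cont_measurable_rV domP); exact: gr_cont.
Qed.

Lemma sqrt_ratio (p S : R) : p != 0 -> 0 <= S -> Num.sqrt (p ^+ 2 + S) / `|p| = Num.sqrt (1 + S / p ^+ 2).
Proof.
move=> p0 S0; have -> : 1 + S / p ^+ 2 = (p ^+ 2 + S) * (p^-1) ^+ 2 by field.
by rewrite sqrtrM ?addr_ge0 ?sqr_ge0// sqrtr_sqr normfV.
Qed.

Lemma dens_in y : dom y -> dens y = Num.sqrt (1 + \sum_l partial l gr y ^+ 2).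
Proof.
move=> Dy; have [gb _] := grP Dy; have [yb _] := Dy.
have xb : open_cube b1 (ins k (gr y, y)) by apply/open_cube_ins.
have pk : 0 < `|partial k rho (ins k (gr y, y))| := lt_le_trans c00 (lrho xb).
rewrite /dens indicE mem_set// mul1r gam_in// Pcut_in// /grad_norm.
under eq_bigr do rewrite Pcut_in//.
have p2 : partial k rho (ins k (gr y, y)) != 0 by rewrite -normr_gt0.
have -> : \sum_l partial l gr y ^+ 2 =
    (\sum_(l < m) partial (lift k l) rho (ins k (gr y, y)) ^+ 2) / partial k rho (ins k (gr y, y)) ^+ 2.
  rewrite mulr_suml; apply: eq_bigr => l _.
  by rewrite (gr_derive srho c00 C10 brho lrho l Dy).2 /slope sqrrN expr_div_n.
rewrite (bigD1_ord k)//= sqrt_ratio//.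
by apply: sumr_ge0 => l _; exact: sqr_ge0.
Qed.

Lemma dens_bm : bm dens.
Proof.
have bi : bm (\1_dom : 'rV[R]_m -> R).
  split; first by apply: measurable_indic; exact: (open_measurable_rV domP).
  by exists 1 => y; rewrite indicE; case: (_ \in _); rewrite ?normr1 ?normr0.
have [mG [KG GK]] := grad_norm_bm; have [mP _] := Pcut_bm k.
split.
  apply: measurable_funM; first by case: bi.
  apply: measurable_funM; first exact: (measurableT_comp mG gam_meas).
  have mV : measurable_fun setT (fun x => `|Pcut k x|^-1).
    exact: measurable_funV_norm.
  exact: (measurableT_comp mV gam_meas).
exists (KG / c0) => y; have KG0 : 0 <= KG := le_trans (normr_ge0 _) (GK 0).
have [Dy|Dy] := pselect (dom y); last first.
  by rewrite /dens indicE memNset// mul0r normr0 divr_ge0// ltW.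
have [gb _] := grP Dy; have [yb _] := Dy.
have xb : open_cube b1 (ins k (gr y, y)) by apply/open_cube_ins.
rewrite /dens indicE mem_set// mul1r normrM; apply: ler_pM => //.
rewrite normfV normr_id gam_in// Pcut_in// lef_pV2 ?posrE//; first exact: lrho.
exact: lt_le_trans c00 (lrho xb).
Qed.

Variable sigma : {measure set 'rV[R]_m.+1 -> \bar R}.
Local Notation M := (zero_locus (open_cube b1) rho).
Hypothesis Hs : is_surface_measure M sigma.

Lemma M_meas : measurable M.
Proof.
have -> : M = open_cube b1 `&` rho @^-1` [set 0] by apply/seteqP; split.
apply: measurableI; first exact: (open_measurable_rV (@open_cube_open R m.+1 b1)).
by rewrite -[X in measurable X]setTI; apply: mrho.
Qed.

Lemma graph_eq (A : set 'rV[R]_m.+1) :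
  graph_over k [set y | dom y /\ A (gam y)] gr = A `&` M.
Proof.
apply/seteqP; split=> [x [[Dy Ay] xk]|x [Ax [xb rx]]].
  have E : ins k (gr (col' k x), col' k x) = x by rewrite -xk ins_col'.
  move: Ay; rewrite gam_in// E => Ax; split=> //; have [gb rg] := grP Dy; have [yb _] := Dy.
  by split; rewrite -E//; apply/open_cube_ins.
have xE : ins k (x 0 k, col' k x) = x := ins_col' k x.
have [xkb yb] : `|x 0 k| < b1 /\ open_cube b1 (col' k x) :=
  proj1 (open_cube_ins k b1 _ _) (eq_ind_r (fun z => open_cube b1 z) xb xE).
have Dy : dom (col' k x) by split=> //; exists (x 0 k); rewrite ?xE.
have xg : x 0 k = gr (col' k x) by apply: (gr_uniq srho c00 lrho Dy); rewrite ?xE.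
by split; [split; [exact: Dy|rewrite (gam_in Dy) -xg xE]|exact: xg].
Qed.

(** The derivative along [k] vanishes nowhere on the cube, so all of [M] is one graph in direction
    [k] ([graph_eq]), and a single chart determines the measure. *)
Lemma sigmaE A : measurable A ->
  sigma (A `&` M) = (\int[cubeM m b1]_y ((\1_A (gam y) : R) * dens y))%:E.
Proof.
move=> mA; have mE : measurable [set y | dom y /\ A (gam y)].
  apply: measurableI; first exact: (open_measurable_rV domP).
  by have := gam_meas measurableT mA; rewrite setTI.
have gM : graph_over k dom gr `<=` M.
  have <- : setT `&` M = M by rewrite setTI.
  by rewrite -graph_eq; move=> x [h1 h2].
rewrite -graph_eq (Hs.2 k dom gr domP gr_C1 gM _ mE (fun y => @proj1 _ _)).
have bA : bm (\1_A : 'rV[R]_m.+1 -> R).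
  by split; [exact: measurable_indic|exists 1 => y; rewrite indicE; case: (_ \in _); rewrite ?normr1 ?normr0].
have bI : bm (fun y => (\1_A (gam y) : R) * dens y) by apply: bmM; [exact: bm_comp gam_meas bA|exact: dens_bm].
rewrite /cubeM mfrestr_Rintegral// /Rintegral fineK; last first.
  have [mI [K IK]] := bI; apply: integrable_fin_num; first exact: measurable_cube.
  apply: measurable_bounded_integrable; [exact: measurable_cube|exact: cube_fin|exact: measurable_funTS|].
  by exists K; split; rewrite ?num_real// => x xK t _; exact: le_trans (IK t) (ltW xK).
rewrite -[LHS]/(\int[lebesgue_rV R m]_(y in [set y | dom y /\ A (gam y)])
  (Num.sqrt (1 + \sum_(l < m) partial l gr y ^+ 2))%:E)%E.
rewrite [LHS]integral_mkcond [RHS]integral_mkcond; apply: eq_integral => y _.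
rewrite /patch; case: (boolP (y \in [set y | _])) => [|/negP]; rewrite inE => h.
  have [Dy Ay] := h; have [yb _] := Dy.
  by rewrite mem_set/=; [rewrite indicE mem_set// mul1r dens_in|move=> l; exact: ltW].
case: ifP => // _; have [Dy|Dy] := pselect (dom y); last by rewrite /dens [X in _ * (X * _)]indicE memNset// mul0r mulr0.
by rewrite indicE memNset ?mul0r// => Ay; apply: h.
Qed.

Lemma sigma_fin : (sigma M < +oo)%E.
Proof. by rewrite -[M]setTI sigmaE ?ltry. Qed.

Lemma surface_integral F : bm F -> \int[sigma]_(x in M) F x = \int[cubeM m b1]_y (F (gam y) * dens y).
Proof.
move=> bF; rewrite -(mfrestr_Rintegral M_meas sigma_fin bF).
apply: bm_density bF; [exact: gam_meas|exact: dens_bm|move=> A mA].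
have -> : \int[mfrestr M_meas sigma_fin]_x (\1_A x : R) = fine (sigma (A `&` M)).
  by rewrite /Rintegral integral_indic// setIT.
by rewrite sigmaE.
Qed.

End surface_integral.

Lemma bm_dominated (R : realType) d (T : measurableType d) (m : {finite_measure set T -> \bar R})
    (f_ : nat -> T -> R) (f : T -> R) (K : R) : (forall j, bm (f_ j)) -> bm f ->
  (forall j x, `|f_ j x| <= K) -> (forall x, f_ ^~ x @ \oo --> f x) ->
  \int[m]_x f_ j x @[j --> \oo] --> \int[m]_x f x.
Proof.
move=> bf_ bf fK cf; apply: fine_cvg; rewrite fineK; last first.
  by apply: integrable_fin_num => //; exact: bm_integrable.
have [] // := @dominated_convergence _ T R m setT measurableT (fun j x => (f_ j x)%:E) (fun x => (f x)%:E)
  (fun=> K%:E) _ _ _ _ _.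
- by move=> j; apply/measurable_EFinP; case: (bf_ j).
- by apply/measurable_EFinP; case: bf.
- by apply: aeW => x _; apply: cvg_EFin; [near=> j|exact: cf].
- exact: (bm_integrable m (bm_cst _ K)).
- by apply: aeW => x j _; rewrite /= lee_fin.
Unshelve. all: end_near. Qed.

(** * Passage from the Poisson kernel to the surface measure *)

Section limit.
Variables (R : realType) (m : nat) (k : 'I_m.+1) (b0 b1 b2 C1 c0 Kw : R) (N : nat).
Variables (lambda kappa : R) (Phi rho a : 'rV[R]_m.+1 -> R) (f : 'I_m.+1 -> R -> R).
Hypotheses (b00 : 0 < b0) (b02 : b0 < b2) (b21 : b2 < b1).
Hypotheses (sPhi : smooth_on (open_cube b1) Phi) (srho : smooth_on (open_cube b1) rho) (c00 : 0 < c0) (C10 : 0 < C1).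
Hypothesis brho : forall s x, (size s <= 2)%N -> open_cube b1 x -> `|partials s rho x| <= C1.
Hypothesis lrho : forall x, open_cube b1 x -> c0 <= `|partial k rho x|.
Hypotheses (mPhi : measurable_fun setT Phi) (mrho : measurable_fun setT rho).
Hypotheses (ba : bm a) (a0 : forall x, a x != 0 -> closed_cube b0 x).
Local Notation w := (fun x => a x * grad_norm b1 rho x).
Hypothesis gw : good_weight N b0 b1 Kw w.
Hypotheses (bf : forall l, bm (f l : measurableTypeR R -> R)) (cf : forall t, {for t, continuous (f k)}).

Definition Fsurf (x : 'rV[R]_m.+1) : R := \prod_l f l (x 0 l) * (a x * cos (lambda * Phi x + kappa)).
(** [Fsurf] with the extra weight [|grad rho|]: this one is integrated over the solid cube, [Fsurf]
    over the surface. *)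
Definition Wsurf (x : 'rV[R]_m.+1) : R := \prod_l f l (x 0 l) * (w x * cos (lambda * Phi x + kappa)).

Let b20 : 0 < b2. Proof. exact: lt_trans b00 b02. Qed.
Let b10 : 0 < b1. Proof. exact: lt_trans b20 b21. Qed.

Lemma cos_phase_bm : bm (fun x => cos (lambda * Phi x + kappa)).
Proof. by apply: bm_cos; apply: measurable_funD; [apply: measurable_funM => //; exact: measurable_cst|exact: measurable_cst]. Qed.

Lemma prod_bm : bm (fun x : 'rV[R]_m.+1 => \prod_l f l (x 0 l)).
Proof. by apply: bm_prod => l; exact: (bm_comp (measurable_coord l) (bf l)). Qed.

Lemma Fsurf_bm : bm Fsurf.
Proof. by apply: bmM; [exact: prod_bm|apply: bmM => //; exact: cos_phase_bm]. Qed.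

Lemma Wsurf_bm : bm Wsurf.
Proof.
apply: bmM; first exact: prod_bm.
by apply: bmM; [have [mw wK _ _] := gw; split => //; exists Kw|exact: cos_phase_bm].
Qed.

Lemma pker_bm M : 0 < M -> bm (fun x => pker M (rho x)).
Proof.
move=> M0; have cc (s : R) : {for s, continuous (fun s : R => pker M s)}.
  apply: continuousM; first exact: cst_continuous.
  apply: continuousV; first by rewrite gt_eqF// ltr_wpDr ?sqr_ge0.
  apply: continuousD; first exact: cst_continuous.
  have c1 : {for s, continuous (fun s : R => M * s)} by apply: continuousM => //; exact: cst_continuous.
  exact: (continuousM c1 c1).
split; first exact: (measurableT_comp (continuous_measurable_fun (cc : continuous _)) mrho).
exists (2 * M) => x; have h : 1 <= 1 + (M * rho x) ^+ 2 by rewrite lerDl sqr_ge0.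
rewrite ger0_norm ?pker_ge0 ?(ltW M0)// ler_pdivrMr ?(lt_le_trans ltr01 h)//.
by rewrite ler_peMr// mulr_ge0 ?(ltW M0).
Qed.

Lemma cube_ext n b (g h : 'rV[R]_n -> R) : bm g -> bm h -> (forall y, closed_cube b y -> g y = h y) ->
  \int[cubeM n b]_y g y = \int[cubeM n b]_y h y.
Proof.
move=> bg bh gh; rewrite /cubeM !mfrestr_Rintegral//.
by apply: eq_Rintegral => y; rewrite inE; exact: gh.
Qed.

Lemma cube_shrink n (g : 'rV[R]_n -> R) : bm g -> (forall y, g y != 0 -> closed_cube b2 y) ->
  \int[cubeM n b1]_y g y = \int[cubeM n b2]_y g y.
Proof.
move=> bg g0; rewrite /cubeM !mfrestr_Rintegral// Rintegral_mkcond [RHS]Rintegral_mkcond.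
apply: eq_Rintegral => y _; rewrite /patch; have [->|/g0 h] := eqVneq (g y) 0; first by do 2 case: ifP => //.
by rewrite !mem_set//= => l; apply: le_trans (h l) _; exact: ltW.
Qed.

Section fibre.
Variable y : 'rV[R]_m.
Implicit Types (t : R).
Hypothesis yb : closed_cube b2 y.

Let phi (t : R) : R := rho (ins k (t, y)).
Let dphi (t : R) : R := partial k rho (ins k (t, y)).
Let u (t : R) : R := Wsurf (ins k (t, y)).

Let yb1 : open_cube b1 y. Proof. by move=> l; exact: le_lt_trans (yb l) b21. Qed.

Let in1 t : `|t| < b1 -> open_cube b1 (ins k (t, y)).
Proof. by move=> tb; apply/open_cube_ins. Qed.

Lemma fib_der t : `|t| < b1 -> is_derive t 1 phi (dphi t).
Proof.
move=> tb; rewrite /phi /dphi; have E t' : ins k (t', y) = ins k (0, y) + t' *: unitv R k := ins_line k t' y.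
have -> : (fun t : R => rho (ins k (t, y))) = (fun t => rho (ins k (0, y) + t *: unitv R k)) by apply/funext => t'; rewrite E.
by rewrite E; apply: smooth_line srho _; rewrite -E; exact: in1.
Qed.

Lemma fib_cont g t : smooth_on (open_cube b1) g -> `|t| < b1 -> {for t, continuous (fun t : R => g (ins k (t, y)))}.
Proof.
move=> sg tb; have E t' : ins k (t', y) = ins k (0, y) + t' *: unitv R k := ins_line k t' y.
have -> : (fun t : R => g (ins k (t, y))) = (fun t => g (ins k (0, y) + t *: unitv R k)) by apply/funext => t'; rewrite E.
by apply: (is_derive_cont (smooth_line (i := k) sg _)); rewrite -E; exact: in1.
Qed.

Lemma fib_u t : `|t| < b1 -> {for t, continuous u}.
Proof.
move=> tb; have E : u = (fun t => (f k t * \prod_l f (lift k l) (y 0 l)) *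
    (w (ins k (0, y) + t *: unitv R k) * cos (lambda * Phi (ins k (t, y)) + kappa))).
  apply/funext => t'; rewrite /u /Wsurf (bigD1_ord k)//= ins_same -ins_line; congr (_ * _ * _).
  by apply: eq_bigr => l _; rewrite ins_lift.
rewrite E; apply: continuousM; first by apply: continuousM; [exact: cf|exact: cst_continuous].
apply: continuousM.
  by have [_ _ _ cw] := gw; apply: (Cb_cont (cw (ins k (0, y)) k)); rewrite /= -ins_line; exact: in1.
apply: (@continuous_comp _ _ _ (fun t : R => lambda * Phi (ins k (t, y)) + kappa) cos); last exact: continuous_cos.
by apply: continuousD; [apply: continuousM; [exact: cst_continuous|exact: fib_cont]|exact: cst_continuous].
Qed.

Lemma fib_ld t : `|t| < b1 -> c0 <= `|dphi t|. Proof. by move=> tb; apply: lrho; exact: in1. Qed.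
Lemma fib_ud t : `|t| < b1 -> `|dphi t| <= C1. Proof. by move=> tb; apply: (@brho [:: k]) => //; exact: in1. Qed.
Lemma fib_cd t : `|t| < b1 -> {for t, continuous dphi}.
Proof. by apply: fib_cont; exact: (smooth_partials [:: k] srho). Qed.

Lemma Wsurf_supp x : Wsurf x != 0 -> closed_cube b0 x.
Proof. by rewrite !mulf_eq0 !negb_or => /and3P[_ /andP[h _] _]; exact: a0. Qed.

Lemma fibre_bound U (M : R) : (forall x, `|Wsurf x| <= U) -> 0 < M ->
  `|\int[@lebesgue_measure R]_(t in `[- b2, b2]) (u t * pker M (phi t))| <= U / c0 * (2 * pi).
Proof. by move=> WU M0; exact: (pker_bound b20 b21 c00 fib_der fib_cd fib_ld fib_u (fun t => WU _) M0). Qed.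

(** On the line over [y] the limit is [2 pi u / |d_k rho|] at the zero, and [|grad rho| / |d_k rho|]
    is the density of the surface. Continuity of [f k] along the line is what [pker_limit] requires
    of [u]. *)
Lemma fibre_limit : \int[@lebesgue_measure R]_(t in `[- b2, b2]) (u t * pker j.+1%:R (phi t)) @[j --> \oo] -->
  2 * pi * (Fsurf (gam k b1 rho y) * dens k b1 rho y).
Proof.
have [_ [U WU]] := Wsurf_bm; have uU t : `|u t| <= U := WU _.
have bb : - b0 <= b0 by rewrite (@le_trans _ _ 0)// ?oppr_le0 ltW.
have [[z zb rz]|no] := pselect (exists2 z, `|z| <= b0 & phi z = 0).
  have zb1 : `|z| < b1 by apply: le_lt_trans zb _; exact: lt_trans b02 b21.
  have Dy : dom k b1 rho y by split=> //; exists z.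
  have zg : z = gr k b1 rho y := gr_uniq srho c00 lrho Dy zb1 rz.
  have xb := in1 zb1.
  have -> : Fsurf (gam k b1 rho y) * dens k b1 rho y = u z / `|dphi z|.
    rewrite /dens indicE mem_set// mul1r (gam_in Dy) -zg Pcut_in// /u /Wsurf /Fsurf /dphi.
    by move: (\prod_l _) (a _) (cos _) (grad_norm _ _ _) (`|_|^-1) => x1 x2 x3 x4 x5; ring.
  move: zb; rewrite ler_norml => /andP[z1 z2].
  have nb : `|- b2| < b1 by rewrite normrN gtr0_norm.
  have pb : `|b2| < b1 by rewrite gtr0_norm.
  have zlo : - b2 < z by apply: lt_le_trans z1; rewrite ltrN2.
  have zhi : z < b2 by apply: le_lt_trans b02.
  apply: (pker_limit b20 b21 c00 fib_der fib_cd fib_ld fib_ud fib_u uU (t0 := z) _ rz).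
  - by rewrite zlo zhi.
  - by move=> t t' tb tb'; exact: (zero_lin srho lrho tb tb' yb1).
  - exact: (zero_sign srho c00 lrho zlo zhi nb pb yb1 rz).
have -> : 2 * pi * (Fsurf (gam k b1 rho y) * dens k b1 rho y) = 0.
  have [Dy|Dy] := pselect (dom k b1 rho y); last by rewrite /dens indicE memNset// mul0r !mulr0.
  suff -> : Fsurf (gam k b1 rho y) = 0 by rewrite mul0r mulr0.
  rewrite (gam_in Dy) /Fsurf; have [->|/a0 h] := eqVneq (a (ins k (gr k b1 rho y, y))) 0; first by rewrite mul0r mulr0.
  by exfalso; apply: no; exists (gr k b1 rho y); [have := h k; rewrite ins_same|have [] := grP Dy].
have cn : {within `[- b0, b0], continuous (fun t => `|phi t|)}.
  apply: within_itv_continuous => t tb; apply: norm_cont; apply: fib_cont => //.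
  by apply: le_lt_trans (lt_trans b02 b21); rewrite ler_norml.
(* Without a zero on the compact interval that carries [u], [|phi|] has a positive minimum there and
   the kernel tends to 0 uniformly. *)
have [c] := EVT_min bb cn; rewrite in_itv/= -ler_norml => cb Hc.
have pc : 0 < `|phi c| by rewrite normr_gt0; apply/eqP => pc; apply: no; exists c.
apply: (pker_limit_none b20 b21 fib_der fib_u uU pc) => t _ ut.
by apply: Hc; rewrite in_itv/= -ler_norml; have := Wsurf_supp ut k; rewrite ins_same.
Qed.

End fibre.

(** [fibre_limit] for every [y], integrated over [y] by dominated convergence with the constant of
    [fibre_bound]. *)
Lemma Jint_limit : Jint b2 lambda kappa j.+1%:R Phi rho w f @[j --> \oo] -->
  2 * pi * \int[cubeM m b1]_y (Fsurf (gam k b1 rho y) * dens k b1 rho y).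
Proof.
have bG : bm (fun y => Fsurf (gam k b1 rho y) * dens k b1 rho y).
  by apply: bmM; [exact: bm_comp (gam_meas srho c00 C10 brho lrho) Fsurf_bm|exact: (dens_bm srho c00 C10 brho lrho)].
have G0 y : Fsurf (gam k b1 rho y) * dens k b1 rho y != 0 -> closed_cube b2 y.
  rewrite mulf_eq0 negb_or => /andP[h _] l; have : a (gam k b1 rho y) != 0.
    by apply: contra_neq h => h; rewrite /Fsurf h mul0r mulr0.
  by move=> /a0 /(_ (lift k l)); rewrite /gam ins_lift => h2; apply: le_trans h2 _; exact: ltW.
rewrite (cube_shrink bG G0) -(bm_RintegralZ _ _ bG).
have p0 (j : nat) : (0 : R) < j.+1%:R by rewrite ltr0n.
have bI (j : nat) : bm (fun x => Wsurf x * pker j.+1%:R (rho x)) := bmM Wsurf_bm (pker_bm (p0 j)).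
(* The indicator makes the bound and the limit hold for every [y], as [bm_dominated] asks; on the
   cube of half-side [b2], which carries the measure, nothing changes. *)
pose g_ (j : nat) y := (\1_(closed_cube b2) y : R) * \int[itvM b2]_t (Wsurf (ins k (t, y)) * pker j.+1%:R (rho (ins k (t, y)))).
have b1c : bm (\1_(closed_cube b2) : 'rV[R]_m -> R).
  split; first by apply: measurable_indic; exact: measurable_cube.
  by exists 1 => y; rewrite indicE; case: (_ \in _); rewrite ?normr1 ?normr0.
have bin (j : nat) : bm (fun y => \int[itvM b2]_t (Wsurf (ins k (t, y)) * pker j.+1%:R (rho (ins k (t, y))))).
  have ms : measurable_fun setT (fun p : 'rV[R]_m * measurableTypeR R => ins k (p.2, p.1)).
    apply: (measurableT_comp (measurable_ins k)).
    by apply/measurable_fun_pairP; split; [exact: measurable_snd|exact: measurable_fst].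
  exact: (bm_Rint (itvM b2) (bm_comp ms (bI j))).
have bg j : bm (g_ j) by exact: bmM.
have JE j : Jint b2 lambda kappa j.+1%:R Phi rho w f = \int[cubeM m b2]_y g_ j y.
  have -> : Jint b2 lambda kappa j.+1%:R Phi rho w f = \int[cubeM m.+1 b2]_x (Wsurf x * pker j.+1%:R (rho x)).
    by apply: eq_Rintegral => x _; rewrite /Wsurf /pker -!mulrA.
  rewrite (integral_ins k b2 (bI j)); apply: cube_ext => // y yb.
  by rewrite /g_ indicE mem_set// mul1r.
have [_ [U WU]] := Wsurf_bm; have U0 : 0 <= U := le_trans (normr_ge0 _) (WU 0).
have gE j y : closed_cube b2 y -> g_ j y = \int[@lebesgue_measure R]_(t in `[- b2, b2]) (Wsurf (ins k (t, y)) * pker j.+1%:R (rho (ins k (t, y)))).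
  move=> yb; rewrite /g_ indicE mem_set// mul1r Rintegral_itvM//.
  have ms : measurable_fun setT (fun t : measurableTypeR R => ins k (t, y)).
    exact: (measurableT_comp (measurable_ins k) (pair2_measurable y)).
  exact: (bm_comp ms (bI j)).
have gb j y : `|g_ j y| <= U / c0 * (2 * pi).
  have [yb|yb] := pselect (closed_cube b2 y); first by rewrite gE//; exact: fibre_bound.
  by rewrite /g_ indicE memNset// mul0r normr0 mulr_ge0 ?divr_ge0 ?mulr_ge0 ?pi_ge0// ltW.
have gl y : g_ ^~ y @ \oo --> 2 * pi * (Fsurf (gam k b1 rho y) * dens k b1 rho y).
  have [yb|yb] := pselect (closed_cube b2 y).
    by apply: cvg_trans (fibre_limit yb); apply: near_eq_cvg; near=> j; rewrite gE.
  have -> : Fsurf (gam k b1 rho y) * dens k b1 rho y = 0 by apply/eqP; apply: contrapT => /negP/G0.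
  rewrite mulr0; apply: cvg_trans (@cvg_cst _ (0 : R) _ \oo _); apply: near_eq_cvg; near=> j.
  by rewrite /g_ indicE memNset// mul0r.
have -> : (fun j : nat => Jint b2 lambda kappa j.+1%:R Phi rho w f) = (fun j => \int[cubeM m b2]_y g_ j y).
  by apply/funext => j; exact: JE.
have H := bm_dominated (m := cubeM m b2) bg (bmZ (2 * pi) bG) gb gl.

exact: H.
Unshelve. all: end_near. Qed.

End limit.

Lemma sqrt_add (R : realType) (x y : R) : 0 <= x -> 0 <= y -> Num.sqrt (x + y) <= Num.sqrt x + Num.sqrt y.
Proof.
move=> x0 y0; have h : 0 <= Num.sqrt x + Num.sqrt y by rewrite addr_ge0 ?sqrtr_ge0.
rewrite -(ger0_norm h) -sqrtr_sqr; apply: ler_wsqrtr; rewrite sqrrD !sqr_sqrtr//.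
by rewrite -addrA [_ *+ 2 + _]addrC addrA lerDl mulrn_wge0// mulr_ge0 ?sqrtr_ge0.
Qed.

(** Density of continuous functions in L^1. Clipping to [[- K, K]] does not increase the distance to
    [f], which lies there, and the bound [K] later converts L^1 closeness into closeness of the
    integrals of squares. *)
Lemma approx_cont (R : realType) (b K e : R) (f : R -> R) : bm (f : measurableTypeR R -> R) ->
  (forall t, `|f t| <= K) -> 0 < e ->
  exists2 h : R -> R, (forall t, {for t, continuous h}) /\ (forall t, `|h t| <= K) &
    \int[itvM b]_t `|f t - h t| <= e.
Proof.
move=> bf fK e0; have K0 : 0 <= K := le_trans (normr_ge0 _) (fK 0).
have itf : (@lebesgue_measure R).-integrable (mitv b) (EFin \o f).
  have [mf _] := bf; apply: measurable_bounded_integrable; [exact: measurable_mitv|exact: mitv_fin|exact: measurable_funTS|].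
  by exists K; split; rewrite ?num_real// => x xK t _; exact: le_trans (fK t) (ltW xK).
have [g [cg ig Lg]] := approximation_continuous_integrable (measurable_mitv b) (mitv_fin b) itf.
have Lf : (fine (\int[@lebesgue_measure R]_(z in mitv b) `|(f z - g n z)%:E|)%E) @[n --> \oo] --> (0 : R).
  by apply: fine_cvg; exact: Lg.
have /cvgr0Pnorm_le /(_ _ e0) [n _ Hn] := Lf.
pose h t := Num.max (- K) (Num.min K (g n t)).
have ch t : {for t, continuous h}.
  by apply: continuous_max; [exact: cst_continuous|apply: continuous_min; [exact: cst_continuous|exact: cg]].
have hK t : `|h t| <= K.
  rewrite /h ler_norml; apply/andP; split; first by rewrite le_max lexx.
  by rewrite ge_max ge_min lexx andbT; lra.
have fh t : `|f t - h t| <= `|f t - g n t|.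
  have := fK t; rewrite /h ler_norml => /andP[f1 f2].
  have [gK|gK] := leP (g n t) K.
    have [g2|g2] := leP (- K) (g n t) => //.
    have s1 : 0 <= f t - - K by lra.
    rewrite (ger0_norm s1); apply: le_trans (ler_norm _); lra.
  have kk : - K <= K by lra.
  have s1 : f t - K <= 0 by lra.
  rewrite (max_r kk) (ler0_norm s1) -normrN; apply: le_trans (ler_norm _); lra.
have bh : bm (h : measurableTypeR R -> R) by split; [exact: continuous_measurable_fun|exists K].
exists h => //; have bd : bm (fun t : measurableTypeR R => `|f t - h t|) by apply: bm_norm; exact: bmB.
rewrite /itvM mfrestr_Rintegral//.
apply: le_trans (_ : fine (\int[@lebesgue_measure R]_(z in mitv b) `|(f z - g n z)%:E|)%E <= _); last first.
  by apply: le_trans (ler_norm _) _; exact: (Hn n (leqnn n)).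
have ifg : (@lebesgue_measure R).-integrable (mitv b) (EFin \o (fun t => f t - g n t)).
  by have := integrableB (measurable_mitv b) itf (ig n); apply: eq_integrable => //; exact: measurable_mitv.
apply: (@le_Rintegral _ _ _ (@lebesgue_measure R) (mitv b) (fun t => `|f t - h t|) (fun t => `|f t - g n t|)) => //.
- exact: measurable_mitv.
- have [md [Kd dK]] := bd; apply: measurable_bounded_integrable; [exact: measurable_mitv|exact: mitv_fin|exact: measurable_funTS|].
  by exists Kd; split; rewrite ?num_real// => x xK t _; exact: le_trans (dK t) (ltW xK).
- exact: (integrable_norm ifg).
Qed.

(** * The surface estimate for bounded real functions *)

Section estimate.
Variables (R : realType) (m : nat) (b0 b1 b2 C1 c0 Kw A : R) (N : nat).
Variables (lambda kappa : R) (Phi rho a : 'rV[R]_m.+2 -> R).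
Hypotheses (b00 : 0 < b0) (b02 : b0 < b2) (b21 : b2 < b1) (A0 : 0 <= A).
Hypotheses (sPhi : smooth_on (open_cube b1) Phi) (srho : smooth_on (open_cube b1) rho) (c00 : 0 < c0) (C10 : 0 < C1).
Hypothesis brho : forall s x, (size s <= 2)%N -> open_cube b1 x -> `|partials s rho x| <= C1.
Hypothesis lrho : forall k x, open_cube b1 x -> c0 <= `|partial k rho x|.
Hypotheses (mPhi : measurable_fun setT Phi) (mrho : measurable_fun setT rho).
Hypotheses (ba : bm a) (a0 : forall x, a x != 0 -> closed_cube b0 x).
Hypothesis gw : good_weight N b0 b1 Kw (fun x => a x * grad_norm b1 rho x).
Variable sigma : {measure set 'rV[R]_m.+2 -> \bar R}.
Local Notation M := (zero_locus (open_cube b1) rho).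
Hypothesis Hs : is_surface_measure M sigma.
Hypothesis HJ : forall f : 'I_m.+2 -> R -> R, (forall k, bm (f k : measurableTypeR R -> R)) ->
  exists E, forall T, `|lambda| <= T ->
  `|Jint b2 lambda kappa T Phi rho (fun x => a x * grad_norm b1 rho x) f| <=
     A * Num.sqrt (\prod_k \int[itvM b2]_t (f k t ^+ 2)) + E / T.

Local Notation F f := (Fsurf lambda kappa Phi a f).

(** [HJ] is taken along [T = j.+1] to infinity: the error [E / T] disappears, although [E] depends
    on [f], and [Jint] tends to [2 pi] times the surface integral. *)
Lemma surface_estimate_cont (k : 'I_m.+2) f : (forall l, bm (f l : measurableTypeR R -> R)) ->
  (forall t, {for t, continuous (f k)}) ->
  `|\int[sigma]_(x in M) F f x| <= A / (2 * pi) * Num.sqrt (\prod_k \int[itvM b2]_t (f k t ^+ 2)).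
Proof.
move=> bf cf; have p0 : 0 < 2 * pi :> R by rewrite mulr_gt0// pi_gt0.
rewrite (surface_integral srho c00 C10 brho (lrho k) mrho Hs (Fsurf_bm lambda kappa mPhi ba bf)).
set I := \int[_]_y _; set P := Num.sqrt _.
have L : Jint b2 lambda kappa j.+1%:R Phi rho (fun x => a x * grad_norm b1 rho x) f @[j --> \oo] --> 2 * pi * I.
  exact: (Jint_limit b00 b02 b21 sPhi srho c00 C10 brho (lrho k) mPhi mrho ba a0 gw bf cf).
have [E HE] := HJ bf.
suff h : `|2 * pi * I| <= A * P.
  by rewrite [A / _ * _]mulrAC ler_pdivlMr// mulrC -[X in X * _](gtr0_norm p0) -normrM.
have L2 : (A * P + E * j.+1%:R^-1) @[j --> \oo] --> A * P + E * 0.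
  by apply: cvgD; [exact: cvg_cst|apply: cvgM; [exact: cvg_cst|exact: cvg_harmonic]].
rewrite -[leRHS]addr0 -[X in _ + X](mulr0 E).
apply: ler_cvg_to (cvg_norm L) L2 _; exists (Num.truncn `|lambda|) => // j /= hj.
by apply: HE; apply: ltW; apply: lt_le_trans (truncnS_gt _) _; rewrite ler_nat ltnS.
Qed.

(** Only one function has to be continuous, so only [f k] is replaced by a continuous [h]. The
    surface integral is stable under L^1 changes of [f k] by [L1], and the right side under bounded
    ones by [Sh]. *)
Lemma surface_estimate f : (forall l, bm (f l : measurableTypeR R -> R)) ->
  `|\int[sigma]_(x in M) F f x| <= A / (2 * pi) * Num.sqrt (\prod_k \int[itvM b2]_t (f k t ^+ 2)).
Proof.
(* Coordinate 1 is a free variable of the chart that solves for coordinate 0. There [f k] is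
   evaluated at a coordinate of [y] and not on the graph, so an L^1 bound controls the integral. *)
move=> bf; pose k : 'I_m.+2 := lift ord0 ord0.
have p0 : 0 < 2 * pi :> R by rewrite mulr_gt0// pi_gt0.
have [_ [K fK]] := bf k; have K0 : 0 <= K := le_trans (normr_ge0 _) (fK 0).
pose up h (l : 'I_m.+2) : R -> R := if l == k then h else f l.
have bup h : bm (h : measurableTypeR R -> R) -> forall l, bm (up h l : measurableTypeR R -> R).
  by move=> bh l; rewrite /up; case: eqP.
pose P' := \prod_(l | l != k) \int[itvM b2]_t (f l t ^+ 2).
have P'0 : 0 <= P' by apply: prodr_ge0 => l _; apply: Rintegral_ge0 => t _; exact: sqr_ge0.
have Pup h : \prod_l \int[itvM b2]_t (up h l t ^+ 2) = (\int[itvM b2]_t (h t ^+ 2)) * P'.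
  rewrite (bigD1 k)//= /up eqxx; congr (_ * _); apply: eq_bigr => l /negbTE lk.
  by rewrite lk.
pose rest (x : 'rV[R]_m.+2) := \prod_(l | l != k) f l (x 0 l) * (a x * cos (lambda * Phi x + kappa)).
have Fup h x : F (up h) x = h (x 0 k) * rest x.
  rewrite /Fsurf /rest (bigD1 k)//= /up eqxx -mulrA; congr (_ * (_ * _)).
  by apply: eq_bigr => l /negbTE ->.
have fE : F f = F (up (f k)) by apply/funext => x; rewrite Fup /Fsurf /rest (bigD1 k)//= -mulrA.
have b1p : 0 < b1 by apply: lt_trans b21; exact: lt_trans b00 b02.
have b2p : 0 <= b2 by apply: ltW; exact: lt_trans b00 b02.
have brest : bm rest.
  apply: bmM; last by apply: bmM => //; exact: cos_phase_bm.
  have -> : (fun x : 'rV[R]_m.+2 => \prod_(l | l != k) f l (x 0 l)) =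
      (fun x => \prod_l (if l != k then f l (x 0 l) else 1)) by apply/funext => x; rewrite big_mkcond.
  apply: bm_prod => l; case: (l != k); last exact: bm_cst.
  exact: (bm_comp (measurable_coord l) (bf l)).
pose ga := gam ord0 b1 rho; pose Q y := rest (ga y) * dens ord0 b1 rho y.
have mga := gam_meas srho c00 C10 brho (lrho ord0).
have bQ : bm Q by apply: bmM; [exact: bm_comp mga brest|exact: (dens_bm srho c00 C10 brho (lrho ord0))].
have Q0 y : Q y != 0 -> closed_cube b2 y.
  rewrite mulf_eq0 negb_or => /andP[h _] l; have : a (ga y) != 0.
    by apply: contra_neq h => h; rewrite /rest h mul0r mulr0.
  by move=> /a0 /(_ (lift ord0 l)); rewrite /ga /gam ins_lift => h2; apply: le_trans h2 _; exact: ltW.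
have byl h : bm (h : measurableTypeR R -> R) -> bm (fun y : 'rV[R]_m.+1 => h (y 0 ord0)).
  by move=> bh; exact: (bm_comp (measurable_coord ord0) bh).
have TE h : bm (h : measurableTypeR R -> R) ->
    \int[sigma]_(x in M) F (up h) x = \int[cubeM m.+1 b2]_y (h (y 0 ord0) * Q y).
  move=> bh; rewrite (surface_integral srho c00 C10 brho (lrho ord0) mrho Hs (Fsurf_bm lambda kappa mPhi ba (bup h bh))).
  have cs : \int[cubeM m.+1 b1]_y (h (y 0 ord0) * Q y) = \int[cubeM m.+1 b2]_y (h (y 0 ord0) * Q y).
    have bhQ : bm (fun y : 'rV[R]_m.+1 => h (y 0 ord0) * Q y) by apply: bmM => //; exact: byl.
    have hQ0 (y : 'rV[R]_m.+1) : h (y 0 ord0) * Q y != 0 -> closed_cube b2 y by rewrite mulf_eq0 negb_or => /andP[_ /Q0].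
    first [apply: cube_shrink bhQ hQ0|symmetry; apply: cube_shrink bhQ hQ0]; try exact: b00; try exact: b02; try exact: b21.
  rewrite -cs.
  by apply: eq_Rintegral => y _; rewrite Fup /Q -mulrA /ga /gam ins_lift.
have [_ [KQ QK]] := bQ; have KQ0 : 0 <= KQ := le_trans (normr_ge0 _) (QK 0).
have L1 h : bm (h : measurableTypeR R -> R) ->
    `|\int[cubeM m.+1 b2]_y (h (y 0 ord0) * Q y)| <= KQ * (2 * b2) ^+ m * \int[itvM b2]_t `|h t|.
  move=> bh; have bhQ : bm (fun y : 'rV[R]_m.+1 => h (y 0 ord0) * Q y) by apply: bmM => //; exact: byl.
  have bnh : bm (fun t : measurableTypeR R => `|h t|) by exact: bm_norm.
  apply: le_trans (bm_le_norm _ bhQ) _.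
  apply: le_trans (le_bm_Rintegral (cubeM m.+1 b2) (bm_norm bhQ) (bmZ KQ (byl _ bnh)) _) _.
    by move=> y; rewrite normrM mulrC ler_wpM2r.
  rewrite (bm_RintegralZ _ _ (byl _ bnh)) -mulrA; apply: ler_wpM2l => //.
  pose v (i : 'I_m.+1) (t : R) : R := if i == ord0 then `|h t| else 1.
  have bv i : bm (v i : measurableTypeR R -> R) by rewrite /v; case: eqP => // _; exact: bm_cst.
  have -> : \int[cubeM m.+1 b2]_y `|h (y 0 ord0)| = \int[cubeM m.+1 b2]_y \prod_i v i (y 0 i).
    apply: eq_Rintegral => y _; rewrite (bigD1 ord0)//= big1 ?mulr1; first by rewrite /v eqxx.
    by move=> i /negbTE i0; rewrite /v i0.
  rewrite (cubeM_prod _ bv) (bigD1_ord ord0)//= mulrC; apply: ler_wpM2r.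
    by apply: Rintegral_ge0 => t _; rewrite /v eqxx.
  rewrite [X in X <= _](_ : _ = \prod_(i < m) (2 * b2)); first by rewrite prodr_const card_ord.
  apply: eq_bigr => i _; rewrite /v/= Rintegral_cst// mul1r.
  by rewrite -(ell_setT b2p).
pose S := \int[itvM b2]_t (f k t ^+ 2); have S0 : 0 <= S by apply: Rintegral_ge0 => t _; exact: sqr_ge0.
pose Z := A / (2 * pi) * Num.sqrt (2 * K * P') + KQ * (2 * b2) ^+ m.
have Ap0 : 0 <= A / (2 * pi) by rewrite divr_ge0// ltW.
have Z0 : 0 <= Z by rewrite addr_ge0// mulr_ge0 ?sqrtr_ge0// exprn_ge0// mulr_ge0.
have PE : \prod_l \int[itvM b2]_t (f l t ^+ 2) = S * P' by rewrite (bigD1 k).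
rewrite PE; apply/ler_addgt0Pr => e e0.
(* The total error is at most [Z * eta]. The L^1 error is taken as [eta ^+ 2] because it passes
   through a square root in the first summand of [Z]; in the second, [eta ^+ 2 <= eta]. *)
pose eta := Num.min 1 (e / (Z + 1)); have Zp : 0 < Z + 1 by rewrite ltr_wpDl.
have eta0 : 0 < eta by rewrite lt_min ltr01 divr_gt0.
have eta1 : eta <= 1 by rewrite ge_min lexx.
have etae : eta * Z <= e.
  apply: (@le_trans _ _ (e / (Z + 1) * Z)); first by rewrite ler_wpM2r// ge_min lexx orbT.
  by rewrite mulrAC ler_pdivrMr// ler_wpM2l ?(ltW e0)// lerDl.
have [h [ch hK] hf] := @approx_cont R b2 K (eta ^+ 2) (f k) (bf k) fK (exprn_gt0 2 eta0).
have bh : bm (h : measurableTypeR R -> R) by split; [exact: continuous_measurable_fun|exists K].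
have bfh : bm (fun t : measurableTypeR R => f k t - h t) by exact: bmB.
have split : \int[sigma]_(x in M) F f x = \int[sigma]_(x in M) F (up h) x +
    \int[cubeM m.+1 b2]_y ((f k (y 0 ord0) - h (y 0 ord0)) * Q y).
  rewrite fE !TE// -bm_RintegralD.
  - by apply: eq_Rintegral => y _; rewrite -mulrDl addrC subrK.
  - by apply: bmM => //; exact: byl.
  - by apply: bmM => //; exact: (byl (fun t => f k t - h t)).
have Sh : \int[itvM b2]_t (h t ^+ 2) <= S + 2 * K * eta ^+ 2.
  apply: (@le_trans _ _ (S + 2 * K * \int[itvM b2]_t `|f k t - h t|)); last first.
    by rewrite lerD2l ler_wpM2l// mulr_ge0.
  have bn := bm_norm bfh.
  rewrite -(bm_RintegralZ _ _ bn) -(bm_RintegralD _ (bmX 2 (bf k)) (bmZ (2 * K) bn)).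
  apply: (le_bm_Rintegral (itvM b2) (bmX 2 bh) (bmD (bmX 2 (bf k)) (bmZ (2 * K) bn))) => t.
  rewrite -lerBlDl subr_sqr distrC.
  apply: le_trans (ler_norm _) _; rewrite normrM mulrC distrC; apply: ler_wpM2r => //.
  by apply: le_trans (ler_normD _ _) _; rewrite mulr_natl mulr2n lerD.
have h1 := surface_estimate_cont (k := k) (bup h bh) _; rewrite Pup in h1.
rewrite split; apply: le_trans (ler_normD _ _) _.
have h2 := le_trans (L1 _ bfh) (ler_wpM2l (mulr_ge0 KQ0 (exprn_ge0 m (mulr_ge0 (ler0n R 2) b2p))) hf).
apply: (@le_trans _ _ ((A / (2 * pi) * Num.sqrt (S * P') + A / (2 * pi) * Num.sqrt (2 * K * P') * eta) +
    KQ * (2 * b2) ^+ m * eta)).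
  apply: lerD; last first.
    apply: le_trans h2 _; apply: ler_wpM2l; first by rewrite mulr_ge0// exprn_ge0// mulr_ge0.
    by rewrite expr2 ler_piMr// ltW.
  apply: le_trans (h1 _) _; first by move=> t; rewrite /up eqxx; exact: ch.
  rewrite -[A / _ * Num.sqrt (2 * K * P') * eta]mulrA -mulrDr; apply: ler_wpM2l => //.
  apply: (@le_trans _ _ (Num.sqrt (S * P' + 2 * K * P' * eta ^+ 2))).
    apply: ler_wsqrtr; apply: le_trans (ler_wpM2r P'0 Sh) _.
    by rewrite le_eqVlt; apply/orP; left; apply/eqP; ring.
  have h5 : 0 <= S * P' := mulr_ge0 S0 P'0.
  have h6 : 0 <= 2 * K * P' := mulr_ge0 (mulr_ge0 (ler0n R 2) K0) P'0.
  apply: le_trans (sqrt_add h5 (mulr_ge0 h6 (sqr_ge0 eta))) _.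
  by rewrite lerD2l sqrtrM// sqrtr_sqr gtr0_norm.
by rewrite -addrA lerD2l -mulrDl [_ * eta]mulrC; exact: etae.
Qed.

End estimate.

Lemma Cb_sum (R : realType) l k (K : R) D n (F : 'I_n -> R -> R) : 0 < l -> 0 <= K ->
  (forall i, Cb l k K D (F i)) -> Cb l k (n%:R * K) D (fun t => \sum_i F i t).
Proof.
move=> l0 K0; elim: n F => [|n IH] F cF.
  have -> : (fun t => \sum_(i < 0) F i t) = (fun=> 0) by apply/funext => t; rewrite big_ord0.
  by apply: Cb_cst => //; rewrite normr0 mul0r.
have -> : (fun t => \sum_(i < n.+1) F i t) = (fun t => \sum_(i < n) F (widen_ord (leqnSn n) i) t + F ord_max t).
  by apply/funext => t; rewrite big_ord_recr.
by rewrite -natr1 mulrDl mul1r; apply: CbD; [exact: IH|exact: cF].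
Qed.

(** The sum of the squares of the first derivatives is at least [c0 ^+ 2], so its square root is
    covered by [Cb_sqrt]. The gradient uses one derivative of [rho] more than the order [N] of the
    weight. *)
Lemma weight_const (R : realType) (n N : nat) (C1 c0 Ca : R) : 0 < C1 -> 0 < c0 -> 0 <= Ca ->
  exists Kw : R, forall (b0 b1 : R) (rho a : 'rV[R]_n.+1 -> R), 0 < b1 -> b0 < b1 ->
  smooth_on (open_cube b1) rho -> smooth_on setT a ->
  (forall s x, (size s <= N.+1)%N -> open_cube b1 x -> `|partials s rho x| <= C1) ->
  (forall s x, (size s <= N)%N -> `|partials s a x| <= Ca) ->
  (forall x, open_cube b1 x -> c0 <= `|partial ord0 rho x|) ->
  (forall x, a x != 0 -> closed_cube b0 x) -> measurable_fun setT (grad_norm b1 rho) ->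
  good_weight N b0 b1 Kw (fun x => a x * grad_norm b1 rho x).
Proof.
move=> C10 c00 Ca0; pose K2 := (2 ^+ N * C1) ^+ 2.
have c2 : 0 < c0 ^+ 2 by rewrite exprn_gt0.
have [K' HK] := @Cb_sqrt R N (n.+1%:R * K2) (c0 ^+ 2) c2.
exists (2 ^+ N * Ca * K') => b0 b1 rho a b10 b01 srho sa brho ba lrho a0 mg.
have cw x k : Cb 1 N (2 ^+ N * Ca * K') [set t | open_cube b1 (x + t *: unitv R k)]
    (fun t => a (x + t *: unitv R k) * grad_norm b1 rho (x + t *: unitv R k)).
  have oD : open [set t : R | open_cube b1 (x + t *: unitv R k)].
    apply: (@open_comp _ _ (fun t : R => x + t *: unitv R k)); last exact: open_cube_open.
    move=> t _; have c : {for t, continuous (fun t : R => x + t *: unitv R k)}.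
      by apply: continuousD; [exact: cst_continuous|exact: scalel_continuous].
    exact: c.
  apply: CbM => //.
    have := @Cb_line R n.+1 setT a x k [::] N Ca sa; rewrite addn0 => /(_ (fun s y h _ => ba s y h)).
    by apply: Cb_sub.
  apply: HK => //.
    apply: (@Cb_ext _ _ _ _ _ (fun t => \sum_l (partial l rho (x + t *: unitv R k)) ^+ 2)) => //.
      by move=> t xt; apply: eq_bigr => l _; rewrite Pcut_in.
    apply: Cb_sum => //; first exact: sqr_ge0.
    move=> l; apply: CbX => //; have := @Cb_line R n.+1 (open_cube b1) rho x k [:: l] N C1 srho; apply.
    by move=> s y h; apply: brho; move: h; rewrite addn1.
  move=> t xt; rewrite (bigD1 ord0)//= Pcut_in// -[leLHS]addr0; apply: lerD.
    by rewrite -[leRHS]real_normK ?num_real// lerXn2r ?nnegrE ?(ltW c00)// lrho.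
  by apply: sumr_ge0 => l _; exact: sqr_ge0.
split => //.
- apply: measurable_funM => //; apply: (cont_measurable_rV openT) => x _.
  exact: smooth_cont sa I.
- move=> x; have [a0x|ax] := eqVneq (a x) 0.
    rewrite a0x mul0r normr0; apply: le_trans (Cb_bound (cw 0 ord0) (_ : [set t | open_cube b1 (0 + t *: unitv R ord0)] 0)); first exact: normr_ge0.
    by rewrite /= scale0r addr0 => l; rewrite mxE normr0.
  have xb : open_cube b1 x by move=> l; apply: le_lt_trans (a0 x ax l) b01.
  have := Cb_bound (cw x ord0) (_ : [set t | open_cube b1 (x + t *: unitv R ord0)] 0).
  by rewrite /= scale0r addr0; apply.
- by move=> x; rewrite mulf_eq0 negb_or => /andP[/a0].
Qed.

Local Open Scope complex_scope.

(** * Reduction of the complex form to real ones *)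

Section complex_forms.
Variable R : realType.

Lemma unit_coef (I : Type) (s : seq I) (phi : I -> bool) : exists p q : R, [/\ `|p| <= 1, `|q| <= 1 &
  \prod_(j <- s) (if phi j then 'i%C else 1 : R[i]) = p +i* q].
Proof.
elim: s => [|j s [p [q [hp hq E]]]]; first by exists 1, 0; rewrite big_nil normr1 normr0.
rewrite big_cons E; case: (phi j); last by exists p, q; rewrite mul1r.
exists (- q), p; rewrite normrN; split=> //.
by apply/eqP; rewrite eq_complex /= !(mul0r, mul1r, add0r, addr0, sub0r) !eqxx.
Qed.

Definition reim (b : bool) (z : R[i]) : R := if b then complex.Im z else complex.Re z.

Lemma ReD (x y : R[i]) : complex.Re (x + y) = complex.Re x + complex.Re y.
Proof. by case: x; case: y. Qed.
Lemma ImD (x y : R[i]) : complex.Im (x + y) = complex.Im x + complex.Im y.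
Proof. by case: x; case: y. Qed.

(** Every factor is its real part plus ['i] times its imaginary part; [phi] records which of the two
    is taken in each coordinate. *)
Lemma prod_expand (n : nat) (z : 'I_n -> R[i]) : \prod_j z j =
  \sum_(phi : {ffun 'I_n -> bool}) (\prod_j (if phi j then 'i%C else 1)) * (\prod_j reim (phi j) (z j))%:C.
Proof.
have E j : z j = \sum_(b : bool) (if b then 'i%C else 1) * (reim b (z j))%:C.
  rewrite big_bool/=; case: (z j) => x y; rewrite /reim/=.
  by apply/eqP; rewrite eq_complex /= !(mul0r, mul1r, mulr0, mulr1, add0r, addr0, subr0, sub0r, oppr0) !eqxx.
under eq_bigr do rewrite E.
rewrite bigA_distr_bigA/=; apply: eq_bigr => phi _.
by rewrite big_split/= rmorph_prod.
Qed.

(** Besides [phi], [v] chooses the real or imaginary part of [a], and [u] the cosine or the sine of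
    the phase, the sine being a cosine shifted by [- pi / 2]. These shifts are the values of [kappa]
    in the real estimates. *)
Lemma form_expand (n : nat) (b : bool) : exists k : {ffun 'I_n -> bool} -> bool -> bool -> R,
  (forall phi u v, `|k phi u v| <= 1) /\ forall (th : R) (z : 'I_n -> R[i]) (a : R[i]),
  reim b (expi th * (\prod_j z j) * a) =
  \sum_phi \sum_(u : bool) \sum_(v : bool) k phi u v * (\prod_j reim (phi j) (z j) *
     (reim v a * cos (th + (if u then - (pi / 2) else 0)))).
Proof.
have /choice[p /choice[q pq]] : forall phi : {ffun 'I_n -> bool}, exists p q : R, [/\ `|p| <= 1, `|q| <= 1 &
    \prod_j (if phi j then 'i%C else 1 : R[i]) = p +i* q] by move=> phi; exact: unit_coef.
pose k (b : bool) (phi : {ffun 'I_n -> bool}) (u v : bool) : R :=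
  if b then (if u then (if v then - q phi else p phi) else (if v then p phi else q phi))
  else (if u then (if v then - p phi else - q phi) else (if v then - q phi else p phi)).
exists (k b); split.
  by move=> phi u v; have [h1 h2 _] := pq phi; rewrite /k; case: b; case: u; case: v; rewrite ?normrN.
move=> th z a.
have sinE : sin th = cos (th + - (pi / 2)) by rewrite cosB cos_pihalf sin_pihalf mulr0 add0r mulr1.
have term (b' : bool) phi (c G x y : R) (s : R) : reim b' (((p phi +i* q phi) * G%:C) * ((c +i* s) * (x +i* y))) =
   (if b' then p phi * (s * x + c * y) + q phi * (c * x - s * y) else p phi * (c * x - s * y) - q phi * (s * x + c * y)) * G.
  by rewrite /reim; case: b'; rewrite /= !(mulr0, subr0, addr0); ring.
have -> : expi th * (\prod_j z j) * a = (\prod_j z j) * (expi th * a) by rewrite mulrA [_ * expi th]mulrC.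
rewrite prod_expand mulr_suml.
have -> : reim b (\sum_(phi : {ffun 'I_n -> bool}) (\prod_j (if phi j then 'i%C else 1)) * (\prod_j reim (phi j) (z j))%:C * (expi th * a)) =
  \sum_(phi : {ffun 'I_n -> bool}) reim b ((\prod_j (if phi j then 'i%C else 1)) * (\prod_j reim (phi j) (z j))%:C * (expi th * a)).
  by rewrite /reim; case: b; [apply: (big_morph _ ImD)|apply: (big_morph _ ReD)].
apply: eq_bigr => phi _; have [_ _ E] := pq phi.
rewrite E; case: a => x y; rewrite /expi term !big_bool/= -sinE addr0 /k /reim/=.
by move: (\prod_j _) (p phi) (q phi) (sin th) (cos th) => G p1 q1 s c; case: b; ring.
Qed.

End complex_forms.

(** The extended integral is the difference of the integrals of the positive and negative parts. If
    one of these is infinite the difference is infinite too, and [fine] sends it to 0. *)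
Lemma Rintegral_nonintegrable (R : realType) d (T : measurableType d) (m : {measure set T -> \bar R}) (D : set T)
    (f : T -> R) : measurable D -> measurable_fun D f -> ~ m.-integrable D (EFin \o f) -> \int[m]_(x in D) f x = 0.
Proof.
move=> mD mf nf; rewrite /Rintegral integralE.
have mEf : measurable_fun D (EFin \o f) by exact/measurable_EFinP.
have p0 : (0 <= \int[m]_(x in D) ((EFin \o f)^\+ x))%E by apply: integral_ge0 => x _; exact: funepos_ge0.
have n0 : (0 <= \int[m]_(x in D) ((EFin \o f)^\- x))%E by apply: integral_ge0 => x _; exact: funeneg_ge0.
have key : ~ ((\int[m]_(x in D) ((EFin \o f)^\+ x) < +oo)%E /\ (\int[m]_(x in D) ((EFin \o f)^\- x) < +oo)%E).
  move=> [h1 h2]; apply: nf; rewrite (funeposneg (EFin \o f)).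
  apply: integrableB => //; apply/integrableP; split.
  - exact: measurable_funepos.
  - by under eq_integral do rewrite (gee0_abs (funepos_ge0 _ _)).
  - exact: measurable_funeneg.
  - by under eq_integral do rewrite (gee0_abs (funeneg_ge0 _ _)).
move: p0 n0 key; move: (\int[m]_(x in D) _)%E (\int[m]_(x in D) _)%E => [x||] [y||] //= _ _ h.
by exfalso; apply: h; rewrite !ltry.
Qed.


(** Along a line through the centre [rho] changes at rate at least [c0] while staying within [C] of
    0, which bounds the length of the line. This keeps the size of the cube out of the final
    constant. *)
Lemma cube_size (R : realType) m (b1 c0 C : R) (rho : 'rV[R]_m.+1 -> R) : 0 < b1 -> 0 < c0 ->
  smooth_on (open_cube b1) rho -> (forall x, open_cube b1 x -> `|rho x| <= C) ->
  (forall x, open_cube b1 x -> c0 <= `|partial ord0 rho x|) -> b1 <= C / c0.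
Proof.
move=> b10 c00 sr rC lr; rewrite leNgt; apply/negP => h.
have C0 : 0 <= C.
  by apply: le_trans (normr_ge0 (rho 0)) (rC 0 _) => i; rewrite mxE normr0.
set t := (b1 + C / c0) / 2.
have q0 : 0 <= C / c0 by rewrite divr_ge0// ltW.
have t0 : 0 <= t by rewrite /t; lra.
have tb : `|t| < b1 by rewrite ger0_norm// /t; lra.
have tb' : `|- t| < b1 by rewrite normrN.
have y0 : open_cube b1 (0 : 'rV[R]_m) by move=> i; rewrite mxE normr0.
have i1 s : `|s| < b1 -> `|rho (ins ord0 (s, 0))| <= C by move=> hs; apply: rC; apply/open_cube_ins.
have h1 := zero_lin sr lr tb tb' y0.
have h2 := ler_normB (rho (ins ord0 (t, 0))) (rho (ins ord0 (- t, 0))).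
have h3 := i1 _ tb; have h4 := i1 _ tb'.
have ct : c0 * t = (c0 * b1 + C) / 2 by rewrite /t; field; rewrite gt_eqF.
have cb : C < c0 * b1 by rewrite mulrC -ltr_pdivrMr.
have tt : `|t - - t| = t + t by rewrite opprK ger0_norm// addr_ge0.
move: h1; rewrite tt mulrDr => h1.
suff : C < C by rewrite ltxx.
lra.
Qed.

Lemma L2norm_sqr (R : realType) (f : R -> R[i]) : in_L2 f -> 0 <= fine (L2norm f) /\
  (\int[@lebesgue_measure R]_t (complex.Re (f t) ^+ 2 + complex.Im (f t) ^+ 2)%:E = (fine (L2norm f) ^+ 2)%:E)%E.
Proof.
move=> [_ _]; rewrite /L2norm unlock/=.
have E t : `|Normc.normc (f t)| `^ 2 = complex.Re (f t) ^+ 2 + complex.Im (f t) ^+ 2.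
  by rewrite powR_mulrn ?normr_ge0// real_normK ?num_real//; case: (f t) => x y; rewrite /Normc.normc sqr_sqrtr ?addr_ge0 ?sqr_ge0.
under eq_integral do rewrite E.
have : (0 <= \int[@lebesgue_measure R]_t (complex.Re (f t) ^+ 2 + complex.Im (f t) ^+ 2)%:E)%E.
  by apply: integral_ge0 => t _; rewrite lee_fin addr_ge0 ?sqr_ge0.
case: (\int[_]_t _)%E => [r| |]//.
  by rewrite lee_fin => r0 _; rewrite poweR_EFin/= powR12_sqrt// sqrtr_ge0 sqr_sqrtr.
by rewrite /= invr_eq0 pnatr_eq0/= ltxx.
Qed.

Lemma itv_L2_le (R : realType) (b : R) (f : R -> R[i]) (g : R -> R) : in_L2 f -> bm (g : measurableTypeR R -> R) ->
  (forall t, g t ^+ 2 <= complex.Re (f t) ^+ 2 + complex.Im (f t) ^+ 2) ->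
  \int[itvM b]_t (g t ^+ 2) <= fine (L2norm f) ^+ 2.
Proof.
move=> f2 bg gf; have [_ I] := L2norm_sqr f2; have [mRe mIm _] := f2.
rewrite mfrestr_Rintegral; last exact: bmX.
have mF : measurable_fun setT (fun t => (complex.Re (f t) ^+ 2 + complex.Im (f t) ^+ 2)%:E).
  by apply/measurable_EFinP; apply: measurable_funD; exact: measurable_funX.
have mG : measurable_fun setT (fun t : measurableTypeR R => (g t ^+ 2)%:E).
  by apply/measurable_EFinP; apply: measurable_funX; case: bg.
have h : (\int[@lebesgue_measure R]_(t in mitv b) (g t ^+ 2)%:E <= (fine (L2norm f) ^+ 2)%:E)%E.
  rewrite -I; apply: (@le_trans _ _ (\int[@lebesgue_measure R]_t (g t ^+ 2)%:E)%E).
    by apply: ge0_subset_integral => //; [exact: measurable_mitv|move=> t _; rewrite lee_fin sqr_ge0].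
  apply: ge0_le_integral => //.
  - by move=> t _; rewrite lee_fin sqr_ge0.
  - by move=> t _; rewrite lee_fin.
rewrite /Rintegral -[leRHS]/(fine (fine (L2norm f) ^+ 2)%:E); apply: fine_le => //.
rewrite ge0_fin_numE; last by apply: integral_ge0 => t _; rewrite lee_fin sqr_ge0.
exact: le_lt_trans h (ltry _).
Qed.

(** * From bounded to square-integrable functions *)

Section bounded.
Variables (R : realType) (m : nat) (lambda : R) (Phi : 'rV[R]_m.+1 -> R) (a : 'rV[R]_m.+1 -> R[i]).
Hypotheses (mPhi : measurable_fun setT Phi) (ba : forall v, bm (fun x => reim v (a x))).

Lemma form_expand2 (n : nat) (b : bool) : exists k : {ffun 'I_n -> bool} * (bool * bool) -> R,
  (forall p, `|k p| <= 1) /\ forall (th : R) (z : 'I_n -> R[i]) (w : R[i]),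
  reim b (expi th * (\prod_j z j) * w) =
  \sum_p k p * (\prod_j reim (p.1 j) (z j) *
     (reim p.2.2 w * cos (th + (if p.2.1 then - (pi / 2) else 0)))).
Proof.
have [k [k1 E]] := form_expand R n b; exists (fun p => k p.1 p.2.1 p.2.2); split=> // th z w.
rewrite E; under eq_bigr do rewrite pair_bigA.
by rewrite pair_bigA.
Qed.

Definition cform (f : 'I_m.+1 -> R -> R[i]) x : R[i] := expi (lambda * Phi x) * (\prod_j f j (x 0 j)) * a x.

Lemma measurable_form b (f : 'I_m.+1 -> R -> R[i]) :
  (forall j c, measurable_fun setT (fun t : measurableTypeR R => reim c (f j t))) ->
  measurable_fun setT (fun x => reim b (cform f x)).
Proof.
move=> mf; have [k [_ E]] := form_expand2 m.+1 b.
have -> : (fun x => reim b (cform f x)) = (fun x => \sum_p k p * (\prod_j reim (p.1 j) (f j (x 0 j)) *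
     (reim p.2.2 (a x) * cos (lambda * Phi x + (if p.2.1 then - (pi / 2) else 0))))) by apply/funext => x; exact: E.
elim: (index_enum _) => [|p s IH].
  by under eq_fun do rewrite big_nil; exact: measurable_cst.
under eq_fun do rewrite big_cons; apply: measurable_funD => //.
apply: measurable_funM; first exact: measurable_cst.
apply: measurable_funM; last first.
  by apply: measurable_funM; [case: (ba p.2.2)|have [] := cos_phase_bm lambda (if p.2.1 then - (pi / 2) else 0) mPhi].
elim: (index_enum _) => [|j s' IH'].
  by under eq_fun do rewrite big_nil; exact: measurable_cst.
under eq_fun do rewrite big_cons; apply: measurable_funM => //.
exact: (measurableT_comp (mf j (p.1 j)) (measurable_coord j)).
Qed.

Variables (sigma : {measure set 'rV[R]_m.+1 -> \bar R}) (M : set 'rV[R]_m.+1) (mM : measurable M)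
  (fM : (sigma M < +oo)%E) (b2 B : R) (B0 : 0 <= B).
Hypothesis HB : forall kappa v g, (forall l, bm (g l : measurableTypeR R -> R)) ->
  `|\int[sigma]_(x in M) Fsurf lambda kappa Phi (fun x => reim v (a x)) g x| <=
   B * Num.sqrt (\prod_k \int[itvM b2]_t (g k t ^+ 2)).

Definition nterms : R := #|{: {ffun 'I_m.+1 -> bool} * (bool * bool)}|%:R.

(** The real estimate is applied to each of the [nterms] terms of the expansion, whose coefficients
    are at most 1; [Nf j] bounds the real and the imaginary part of [f j] alike. *)
Lemma bounded_form b (f : 'I_m.+1 -> R -> R[i]) (Nf : 'I_m.+1 -> R) :
  (forall j c, bm (fun t : measurableTypeR R => reim c (f j t))) -> (forall j, 0 <= Nf j) ->
  (forall j c, \int[itvM b2]_t (reim c (f j t) ^+ 2) <= Nf j ^+ 2) ->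
  `|\int[sigma]_(x in M) reim b (cform f x)| <= nterms * (B * \prod_j Nf j).
Proof.
move=> bf N0 fN; have [k [k1 E]] := form_expand2 m.+1 b.
pose g (p : {ffun 'I_m.+1 -> bool} * (bool * bool)) := Fsurf lambda (if p.2.1 then - (pi / 2) else 0) Phi
  (fun x => reim p.2.2 (a x)) (fun j t => reim (p.1 j) (f j t)).
have bg p : bm (g p) by apply: Fsurf_bm.
have -> : \int[sigma]_(x in M) reim b (cform f x) = \sum_p k p * \int[sigma]_(x in M) g p x.
  have bkg p : bm (fun x => k p * g p x) by exact: bmZ.
  have bS : bm (fun x => \sum_p k p * g p x).
    elim: (index_enum _) => [|p s IH]; first by under eq_fun do rewrite big_nil; exact: bm_cst.
    by under eq_fun do rewrite big_cons; apply: bmD.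
  transitivity (\int[sigma]_(x in M) \sum_p k p * g p x).
    by apply: eq_Rintegral => x _; rewrite /cform E.
  rewrite -(mfrestr_Rintegral mM fM bS) (bm_Rintegral_sum _ _ bkg); apply: eq_bigr => p _.
  by rewrite (bm_RintegralZ _ _ (bg p)) (mfrestr_Rintegral mM fM (bg p)).
apply: le_trans (ler_norm_sum _ _ _) _.
rewrite /nterms -sum1_card natr_sum mulr_suml; apply: ler_sum => p _; rewrite mul1r normrM.
apply: (@le_trans _ _ (`|\int[sigma]_(x in M) g p x|)); first by rewrite ler_piMl.
apply: le_trans (HB _ _ _) _ => //; apply: ler_wpM2l => //.
have P0 : 0 <= \prod_j Nf j by apply: prodr_ge0.
rewrite -[leRHS](ger0_norm P0) -sqrtr_sqr; apply: ler_wsqrtr; rewrite -prodrXl.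
apply: ler_prod => j _; rewrite fN andbT; apply: Rintegral_ge0 => t _; exact: sqr_ge0.
Qed.

End bounded.

(** Dominated convergence if [G] is integrable; otherwise the integral is 0 by convention and the
    bound holds trivially. Integrability of the form on the surface thus never has to be shown. *)
Lemma Rintegral_truncation_le (R : realType) d (T : measurableType d) (mu : {measure set T -> \bar R}) (D : set T)
    (G : T -> R) (Gn : nat -> T -> R) (B : R) : measurable D -> measurable_fun setT G ->
  (forall n, measurable_fun setT (Gn n)) -> 0 <= B -> (forall n x, `|Gn n x| <= `|G x|) ->
  (forall x, \forall n \near \oo, Gn n x = G x) -> (forall n, `|\int[mu]_(x in D) Gn n x| <= B) ->
  `|\int[mu]_(x in D) G x| <= B.
Proof.
move=> mD mG mGn B0 GnG GnE GB.
have [iG|nG] := pselect (mu.-integrable D (EFin \o G)); last first.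
  by rewrite Rintegral_nonintegrable ?normr0//; exact: measurable_funTS.
have [_ _ c] : [/\ mu.-integrable D (EFin \o G),
   [sequence \int[mu]_(x in D) (`|(EFin \o Gn n) x - (EFin \o G) x|)]_n @ \oo --> 0%E
   & [sequence \int[mu]_(x in D) ((EFin \o Gn n) x)]_n @ \oo --> \int[mu]_(x in D) ((EFin \o G) x)]%E.
  apply: (@dominated_convergence _ _ _ mu D mD (fun n => EFin \o Gn n) (EFin \o G) (fun x => (`|G x|)%:E)).
  - by move=> n; apply/measurable_EFinP; exact: measurable_funTS.
  - by apply/measurable_EFinP; exact: measurable_funTS.
  - apply/aeW => x _; apply: cvg_near_cst; near=> n; congr EFin; near: n; exact: GnE.
  - have := integrable_abse iG; apply: eq_integrable => //.
  - by apply/aeW => x n _; rewrite /= lee_fin.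
have c2 : \int[mu]_(x in D) Gn n x @[n --> \oo] --> \int[mu]_(x in D) G x.
  apply: fine_cvg; rewrite fineK; first exact: c.
  exact: integrable_fin_num.
apply: (ler_cvg_to (cvg_norm c2) (cvg_cst B)); near=> n; exact: GB.
Unshelve. all: end_near. Qed.


Section truncation.
Variable R : realType.
Implicit Types (f : R -> R[i]) (z : R[i]).

Definition sqn z : R := complex.Re z ^+ 2 + complex.Im z ^+ 2.
(** Large values are set to 0 and not clipped: the truncated form is then at every point either the
    form itself or 0, hence dominated by it, and finally equal to it. *)
Definition trunc (n : nat) f t : R[i] := if sqn (f t) <= n%:R then f t else 0.

Lemma sqn_ge0 z : 0 <= sqn z. Proof. by rewrite addr_ge0 ?sqr_ge0. Qed.

Lemma reim_sqn c z : reim c z ^+ 2 <= sqn z.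
Proof. by rewrite /sqn /reim; case: c; rewrite ?lerDl ?lerDr sqr_ge0. Qed.

Lemma trunc_sqn n f t : sqn (trunc n f t) <= sqn (f t).
Proof. by rewrite /trunc; case: ifP => // _; rewrite /sqn /= expr0n/= addr0 sqn_ge0. Qed.

Lemma measurable_reim f c : in_L2 f -> measurable_fun setT (fun t : measurableTypeR R => reim c (f t)).
Proof. by move=> [mr mi _]; case: c. Qed.

Lemma trunc_bm n f c : in_L2 f -> bm (fun t : measurableTypeR R => reim c (trunc n f t)).
Proof.
move=> f2; pose G (t : measurableTypeR R) : R := sqn (f t); have [mr mi _] := f2.
have mG : measurable_fun setT G by apply: measurable_funD; exact: measurable_funX.
have mS : measurable (G @^-1` `]-oo, n%:R]%classic).
  by rewrite -[X in measurable X]setTI; exact: mG.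
split.
  have -> : (fun t => reim c (trunc n f t)) = (fun t => reim c (f t) * \1_(G @^-1` `]-oo, n%:R]%classic) t).
    apply/funext => t; rewrite indicE /trunc -/(G t).
    have [h|h] := boolP (G t <= n%:R).
      by rewrite mem_set ?mulr1//= in_itv.
    by rewrite memNset ?mulr0; [case: c|rewrite /= in_itv/=; exact/negP].
  by apply: measurable_funM; [exact: measurable_reim|exact: measurable_indic].
exists (1 + n%:R) => t; rewrite /trunc; case: ifP => h; last first.
  by rewrite (_ : reim c 0 = 0) ?normr0 ?addr_ge0//; case: c.
have n0 : 0 <= n%:R :> R by [].
have q := le_trans (reim_sqn c (f t)) h; rewrite -[_ ^+ 2]real_normK ?num_real// in q.
rewrite leNgt; apply/negP => k; suff : n%:R < n%:R :> R by rewrite ltxx.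
by apply: lt_le_trans q; nra.
Qed.

Variables (m : nat) (lambda : R) (Phi : 'rV[R]_m.+1 -> R) (a : 'rV[R]_m.+1 -> R[i]) (f : 'I_m.+1 -> R -> R[i]).
Local Notation form := (cform lambda Phi a).

Lemma form_trunc_le n b x : `|reim b (form (fun j => trunc n (f j)) x)| <= `|reim b (form f x)|.
Proof.
have [/forallP h|] := boolP [forall j, sqn (f j (x 0 j)) <= n%:R].
  suff -> : form (fun j => trunc n (f j)) x = form f x by [].
  by rewrite /cform; congr (_ * _ * _); apply: eq_bigr => j _; rewrite /trunc h.
rewrite negb_forall => /existsP[j hj].
have -> : form (fun j => trunc n (f j)) x = 0.
  by rewrite /cform (bigD1 j)//= {1}/trunc (negbTE hj) mul0r mulr0 mul0r.
by rewrite (_ : reim b 0 = 0) ?normr0//; case: b.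
Qed.

Lemma form_trunc_eq x : \forall n \near \oo, form (fun j => trunc n (f j)) x = form f x.
Proof.
pose K : R := \sum_j sqn (f j (x 0 j)).
exists (Num.truncn K).+1 => // n /= hn; rewrite /cform; congr (_ * _ * _); apply: eq_bigr => j _.
rewrite /trunc ifT//; apply: (@le_trans _ _ K).
  by rewrite /K (bigD1 j)//= lerDl; apply: sumr_ge0 => l _; exact: sqn_ge0.
by apply: (le_trans (ltW (truncnS_gt K))); rewrite ler_nat.
Qed.

End truncation.

(** * Extension by zero outside the cube *)

Section patching.
Variables (R : realType) (n : nat).
Implicit Types (U : set 'rV[R]_n) (f g : 'rV[R]_n -> R).

Lemma smooth_on_ext U f g : open U -> (forall y, U y -> f y = g y) -> smooth_on U f -> smooth_on U g.
Proof.
move=> oU fg sf k s x sk Ux; have [cf df] := sf k s x sk Ux.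
have E : \forall y \near x, partials s f y = partials s g y.
  by near=> y; apply: (partials_ext s oU fg); near: y; exact: open_nbhs_nbhs.
split.
  rewrite /prop_for /continuous_at -(partials_ext s oU fg Ux).
  have E2 : \forall y \near x, partials s g y = partials s f y.
    by near=> y; rewrite (near E y).
  have cf' : partials s f @ x --> partials s f x := cf.
  by first [exact: cvg_trans (near_eq_cvg E) cf'|exact: cvg_trans (near_eq_cvg E2) cf'].
move=> sk' i; have /derivableP h := df sk' i.
suff : is_derive x (unitv R i) (partials s g) ('D_(unitv R i) (partials s f) x) by move=> [].
by move: h; apply: near_eq_is_derive; near=> y; rewrite (near E y).
Unshelve. all: end_near. Qed.

Lemma mpartial_partials (alpha : 'I_n -> nat) : exists s, forall f, mpartial alpha f = partials s f.
Proof.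
rewrite /mpartial; elim: (enum 'I_n) => [|i l [s E]]; first by exists [::].
exists (nseq (alpha i) i ++ s) => f /=; rewrite E -partials_cat.
by elim: (alpha i) => //= k ->.
Qed.

Lemma partials_0 s (x : 'rV[R]_n) : partials s (fun _ => 0 : R) x = 0.
Proof.
have -> : partials s (fun _ : 'rV[R]_n => 0 : R) = (fun _ => 0); last by [].
elim: s => //= i s ->; apply/funext => y; rewrite /partial.
exact: (@derive_cst R _ _ (0 : R)).
Qed.

Lemma patch_measurable U f : open U -> smooth_on U f -> measurable_fun setT (f \_ U).
Proof.
move=> oU sf; apply/(measurable_restrictT _ (open_measurable_rV oU)).
by apply: cont_measurable_rV => // x Ux; exact: smooth_cont sf Ux.
Qed.

(** Off the closed cube every derivative of [a] vanishes, because the complement of the support is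
    open; this carries the bound from the cube to the whole space. *)
Lemma reimD_bound k (b0 C : R) (a : 'rV[R]_n -> R[i]) c : smooth_onC setT a -> supp a `<=` closed_cube b0 ->
  0 <= C -> derivs_bounded_onC k (closed_cube b0) a C ->
  forall s x, (size s <= k)%N -> `|partials s (fun x => reim c (a x)) x| <= C.
Proof.
move=> [sr si] sa C0 ba s x sk.
apply: (@partials_bound R n k setT) => //; first exact: openT; first by case: c.
move=> alpha y ak _; have [yb|yb] := pselect (closed_cube b0 y).
  apply: le_trans (ba alpha y ak yb); rewrite /Normc.normc -sqrtr_sqr; apply: ler_wsqrtr.
  by case: c; rewrite ?lerDl ?lerDr sqr_ge0.
have [s' E] := mpartial_partials alpha; rewrite E.
have oS : open (~` supp a) by rewrite openC; exact: closed_closure.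
have z w : (~` supp a) w -> reim c (a w) = (fun _ => 0) w.
  move=> hw; have [->|aw] := eqVneq (a w) 0; first by case: c.
  by exfalso; apply: hw; exact: subset_closure.
by rewrite (partials_ext s' oS z) ?partials_0 ?normr0// => /sa.
Qed.

End patching.

(** The equation [E] names the dimension as [m.+2], so that coordinates can be removed without
    casts. [K] is fixed before the cube, the phase, the surface and the functions. *)
Lemma form_estimate (R : realType) (m d : nat) (hd : (0 < d)%N) (E : (2 * d.+1)%N = m.+2) (C1 c0 Ca c : R) :
  0 < C1 -> 0 < c0 -> 0 <= Ca -> 0 < c -> exists2 K : R, 0 <= K &
  forall (b0 b1 lambda : R) (Phi rho : 'rV[R]_m.+2 -> R) (a : 'rV[R]_m.+2 -> R[i])
    (sigma : {measure set 'rV[R]_m.+2 -> \bar R}),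
  0 < b0 -> b0 < b1 -> measurable_fun setT Phi -> measurable_fun setT rho ->
  smooth_on (open_cube b1) Phi -> smooth_on (open_cube b1) rho -> smooth_onC setT a ->
  (forall s x, (size s <= m.+4)%N -> open_cube b1 x -> `|partials s Phi x| <= C1) ->
  (forall s x, (size s <= m.+4)%N -> open_cube b1 x -> `|partials s rho x| <= C1) ->
  (forall v s x, (size s <= m.+4)%N -> `|partials s (fun x => reim v (a x)) x| <= Ca) ->
  (forall x, a x != 0 -> closed_cube b0 x) ->
  (forall k x, open_cube b1 x -> c0 <= `|partial k rho x|) -> lambda != 0 ->
  (forall x, open_cube b1 x -> forall ttau tau : R, ttau ^+ 2 + tau ^+ 2 = 1 ->
    exists i j : 'I_d.+1 -> 'I_m.+2, is_bipartition i j /\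
      c <= `|\det (bordered_hessian rho (fun y => ttau * Phi y + tau * rho y) i j x)|) ->
  is_surface_measure (zero_locus (open_cube b1) rho) sigma ->
  forall f : 'I_m.+2 -> R -> R[i], (forall j, in_L2 (f j)) -> forall v,
  `|\int[sigma]_(x in zero_locus (open_cube b1) rho) reim v (cform lambda Phi a f x)| <=
    K * Num.sqrt (`|lambda| ^- d) * \prod_j fine (L2norm (f j)).
Proof.
move=> C10 c00 Ca0 cc0.
have Bm0 : 0 < C1 / c0 by rewrite divr_gt0.
have [Kw HW] := weight_const m.+1 (2 * d.+1) C10 c00 Ca0.
have [A A0 HJ] := Jint_estimate m.+2 Kw hd C10 cc0 Bm0.
have p0 : 0 < 2 * pi :> R by rewrite mulr_gt0// pi_gt0.
have T0 : 0 <= nterms R m.+1 by rewrite /nterms.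
exists (nterms R m.+1 * (A / (2 * pi))); first by rewrite mulr_ge0// divr_ge0// ltW.
move=> b0 b1 lambda Phi rho a sigma b00 b01 mPhi mrho sPhi srho sa bPhi brho ba a0 lrho lam0 hdet Hs f f2 v.
(* Any number strictly between would do: no constant depends on the margins [b2 - b0] and
   [b1 - b2]. *)
pose b2 := (b0 + b1) / 2.
have b02 : b0 < b2 by rewrite /b2; lra.
have b21 : b2 < b1 by rewrite /b2; lra.
have b10 : 0 < b1 := lt_trans b00 b01.
have brho2 s x : (size s <= 2)%N -> open_cube b1 x -> `|partials s rho x| <= C1.
  by move=> hs; apply: brho; apply: leq_trans hs _.
have mM : measurable (zero_locus (open_cube b1) rho) := M_meas b1 mrho.
have fM := sigma_fin srho c00 C10 brho2 (lrho ord0) Hs.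
have b1B : b1 <= C1 / c0.
  apply: (cube_size b10 c00 srho _ (lrho ord0)) => x Ux; exact: (brho [::]).
have sav u : smooth_on setT (fun x => reim u (a x)) by case: sa; case: u.
have bav u : bm (fun x => reim u (a x)).
  split; last by exists Ca => x; exact: (ba u [::]).
  by apply: cont_measurable_rV; [exact: openT|move=> x _; exact: (smooth_cont (sav u) I)].
have a0v u x : reim u (a x) != 0 -> closed_cube b0 x.
  by move=> h; apply: a0; apply: contra_neq h => ->; case: u.
have gw u : good_weight (2 * d.+1) b0 b1 Kw (fun x => reim u (a x) * grad_norm b1 rho x).
  apply: HW => //.
  - by move=> s x hs; apply: brho; apply: leq_trans hs _; rewrite E.
  - by move=> s x hs; apply: ba; apply: leq_trans hs _; rewrite E; do 2 apply: leqW.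
  - exact: lrho.
  - exact: (a0v u).
  - by have [] := grad_norm_bm srho C10 brho2.
pose S := Num.sqrt (`|lambda| ^- d); have S0 : 0 <= S := sqrtr_ge0 _.
have HB kappa u g : (forall l, bm (g l : measurableTypeR R -> R)) ->
  `|\int[sigma]_(x in zero_locus (open_cube b1) rho) Fsurf lambda kappa Phi (fun x => reim u (a x)) g x| <=
   A * S / (2 * pi) * Num.sqrt (\prod_k \int[itvM b2]_t (g k t ^+ 2)).
  move=> bg; apply: (surface_estimate b00 b02 b21 (mulr_ge0 A0 S0) sPhi srho c00 C10 brho2 lrho mPhi mrho (bav u) (a0v u) (gw u) Hs _ bg).
  apply: (HJ b0 b1 b2 lambda kappa Phi rho _ b00 b02 b21 b1B mPhi mrho sPhi srho _ _ (gw u) lam0 hdet).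
  - by move=> s x hs; apply: bPhi; apply: leq_trans hs _; rewrite E.
  - by move=> s x hs; apply: brho; apply: leq_trans hs _; rewrite E.
have N0 j : 0 <= fine (L2norm (f j)) by have [] := L2norm_sqr (f2 j).
have B0 : 0 <= A * S / (2 * pi) := divr_ge0 (mulr_ge0 A0 S0) (ltW p0).
have -> : nterms R m.+1 * (A / (2 * pi)) * S * \prod_j fine (L2norm (f j)) =
   nterms R m.+1 * (A * S / (2 * pi) * \prod_j fine (L2norm (f j))) by ring.
apply: (@Rintegral_truncation_le R _ _ sigma _ _ (fun n x => reim v (cform lambda Phi a (fun j => trunc n (f j)) x))) => //.
- by apply: measurable_form => // j u; exact: measurable_reim.
- by move=> n; apply: measurable_form => // j u; have [] := trunc_bm n u (f2 j).
- by apply: (mulr_ge0 T0 (mulr_ge0 B0 _)); apply: prodr_ge0 => j _; exact: N0.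
- by move=> n x; exact: form_trunc_le.
- move=> x; near=> n; congr (reim v _); near: n; exact: form_trunc_eq.
- move=> n; apply: (bounded_form mPhi bav mM fM B0 HB) => // j u; first exact: trunc_bm.
  apply: (itv_L2_le b2 (f2 j) (trunc_bm n u (f2 j))) => t.
  by apply: le_trans (reim_sqn u _) (trunc_sqn n (f j) t).
Unshelve. all: end_near. Qed.

Lemma sqrt_pow_powR (R : realType) (x : R) d : 0 < x -> Num.sqrt (x ^- d) = x `^ (- ((d.+1%:R - 1) / 2)).
Proof.
move=> x0; rewrite -powR12_sqrt; last by rewrite invr_ge0 exprn_ge0// ltW.
rewrite -powR_mulrn ?(ltW x0)// -powRN -powRrM; congr (_ `^ _).
by rewrite -[d.+1%:R]natr1 addrK mulNr.
Qed.

Local Close Scope complex_scope.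
Unset Implicit Arguments.

Theorem theorem1 (R : realType) (d : nat) (hd : (2 <= d)%N)
    (C_rho C_rho' C_Phi C_a c : R)
    (hC_rho : 0 < C_rho) (hC_rho' : 0 < C_rho') (hC_Phi : 0 < C_Phi)
    (hC_a : 0 < C_a) (hc : 0 < c) :
  exists C : R,
  forall (b0 b1 : R) (Phi rho : 'rV[R]_(2 * d) -> R)
    (a : 'rV[R]_(2 * d) -> R[i]) (lambda : R)
    (sigma : {measure set 'rV[R]_(2 * d) -> \bar R}),
  let B1 := open_cube b1 in
  let B0 := closed_cube b0 in
  let M := zero_locus B1 rho in
  0 < b0 -> b0 < b1 ->
  smooth_on B1 Phi -> smooth_on B1 rho ->
  smooth_onC setT a -> compact (supp a) -> supp a `<=` B0 ->
  derivs_bounded_on (2 * d + 3) B1 rho C_rho ->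
  derivs_bounded_on (2 * d + 2) B1 Phi C_Phi ->
  derivs_bounded_onC (2 * d + 2) B0 a C_a ->
  (forall (i : 'I_(2 * d)) x, B1 x -> C_rho'^-1 <= `|partial i rho x|) ->
  lambda != 0 -> `|lambda| `^ (- 2^-1) <= Num.min (b1 - b0) 1 ->
  (forall x, B1 x -> forall ttau tau : R, ttau ^+ 2 + tau ^+ 2 = 1 ->
    exists i j : 'I_d -> 'I_(2 * d), is_bipartition i j /\
      c <= `|\det (bordered_hessian rho
                     (fun y => ttau * Phi y + tau * rho y) i j x)|) ->
  is_surface_measure M sigma ->
  forall f : 'I_(2 * d) -> R -> R[i], (forall j, in_L2 (f j)) ->
    Normc.normc (multilinear_form sigma M lambda Phi a f)
    <= C * `|lambda| `^ (- ((d%:R - 1) / 2)) *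
       \prod_(j < 2 * d) fine (L2norm (f j)).
Proof.
(* From here on [d.+1] is the [d] of the statement, so the exponent [(d - 1) / 2] becomes
   [d / 2]. *)
case: d hd => [//|d] hd.
(* The dimension is generalized to [n] with an equation, so that it can be exposed as [m.+2]: one
   coordinate is solved for in a chart, and a second one must remain free. *)
have [K K0 HK] : exists2 K : R, 0 <= K & forall (n : nat), (2 * d.+1)%N = n ->
  forall (b0 b1 : R) (Phi rho : 'rV[R]_n -> R) (a : 'rV[R]_n -> R[i]) (lambda : R)
    (sigma : {measure set 'rV[R]_n -> \bar R}), 0 < b0 -> b0 < b1 ->
  smooth_on (open_cube b1) Phi -> smooth_on (open_cube b1) rho ->
  smooth_onC setT a -> supp a `<=` closed_cube b0 ->
  derivs_bounded_on (n + 3) (open_cube b1) rho C_rho ->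
  derivs_bounded_on (n + 2) (open_cube b1) Phi C_Phi ->
  derivs_bounded_onC (n + 2) (closed_cube b0) a C_a ->
  (forall (i : 'I_n) x, open_cube b1 x -> C_rho'^-1 <= `|partial i rho x|) ->
  lambda != 0 ->
  (forall x, open_cube b1 x -> forall ttau tau : R, ttau ^+ 2 + tau ^+ 2 = 1 ->
    exists i j : 'I_d.+1 -> 'I_n, is_bipartition i j /\
      c <= `|\det (bordered_hessian rho (fun y => ttau * Phi y + tau * rho y) i j x)|) ->
  is_surface_measure (zero_locus (open_cube b1) rho) sigma ->
  forall f : 'I_n -> R -> R[i], (forall j, in_L2 (f j)) -> forall v,
  `|\int[sigma]_(x in zero_locus (open_cube b1) rho) reim v (expi (lambda * Phi x) * (\prod_j f j (x 0 j)) * a x)| <=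
    K * Num.sqrt (`|lambda| ^- d) * \prod_j fine (L2norm (f j)).
  have c00 : 0 < C_rho'^-1 by rewrite invr_gt0.
  have C10 : 0 < C_rho + C_Phi by rewrite addr_gt0.
  move En : (2 * d.+1)%N => n0; case: n0 En => [|[|m]] En; [by have := leq_mul (leqnn 2) hd; rewrite En|by have := leq_mul (leqnn 2) hd; rewrite En|].
  have [K K0 HK] := form_estimate hd En C10 c00 (ltW hC_a) hc; exists K => //.
  move=> n <- {n} b0 b1 Phi rho a lambda sigma b00 b01 sPhi srho sa supa brho bPhi ba lrho lam0 hdet Hs f f2 v.
  have oU : open (open_cube b1 : set 'rV[R]_m.+2) by exact: open_cube_open.
  pose U : set 'rV[R]_m.+2 := open_cube b1.
  (* [Phi] and [rho] are arbitrary outside the cube, possibly not measurable. They are replaced by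
     their extensions by zero, which have the same derivatives, determinants and zero locus inside
     the open cube. *)
  have pe (g : 'rV[R]_m.+2 -> R) y : U y -> g y = (g \_ U) y by move=> Uy; rewrite patchE mem_set.
  have ZE : zero_locus U (rho \_ U) = zero_locus U rho.
    by apply/seteqP; split=> x [Ux r0]; split=> //; move: r0; rewrite -(pe rho _ Ux).
  have brho' s x : (size s <= m.+4)%N -> U x -> `|partials s (rho \_ U) x| <= C_rho + C_Phi.
    move=> hs Ux; rewrite -(partials_ext s oU (pe rho) Ux).
    apply: (@le_trans _ _ C_rho); last by rewrite lerDl ltW.
    by apply: (partials_bound oU srho brho) => //; apply: leq_trans hs _; rewrite !addnS addn0 leqnSn.
  have bPhi' s x : (size s <= m.+4)%N -> U x -> `|partials s (Phi \_ U) x| <= C_rho + C_Phi.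
    move=> hs Ux; rewrite -(partials_ext s oU (pe Phi) Ux).
    apply: (@le_trans _ _ C_Phi); last by rewrite lerDr ltW.
    by apply: (partials_bound oU sPhi bPhi) => //; apply: leq_trans hs _; rewrite !addnS addn0.
  have := HK b0 b1 lambda (Phi \_ U) (rho \_ U) a sigma b00 b01 (patch_measurable oU sPhi) (patch_measurable oU srho)
    (smooth_on_ext oU (pe Phi) sPhi) (smooth_on_ext oU (pe rho) srho) sa bPhi' brho'.
  rewrite ZE => HK1; have {HK1} HK2 := HK1 _ _ _ lam0 _ Hs f f2 v.
  rewrite (_ : \int[sigma]_(x in _) _ = \int[sigma]_(x in zero_locus U rho) reim v (cform lambda (Phi \_ U) a f x)); last first.
    by apply: eq_Rintegral => x; rewrite inE => -[Ux _]; rewrite /cform -(pe Phi _ Ux).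
  apply: HK2.
  - move=> u s x hs; apply: (reimD_bound (k := m.+2 + 2) u sa supa (ltW hC_a) ba).
    by apply: leq_trans hs _; rewrite !addnS addn0.
  - by move=> x ax; apply: supa; exact: subset_closure.
  - by move=> k x Ux; rewrite -(partial_ext k oU (pe rho) Ux); exact: lrho.
  - move=> x Ux tt ta h; have [i [j [bij hij]]] := hdet x Ux tt ta h; exists i, j; split => //.
    suff -> : bordered_hessian (rho \_ U) (fun y => tt * (Phi \_ U) y + ta * (rho \_ U) y) i j x =
      bordered_hessian rho (fun y => tt * Phi y + ta * rho y) i j x by [].
    have pp k l : partial k (partial l (fun y => tt * Phi y + ta * rho y)) x =
        partial k (partial l (fun y => tt * (Phi \_ U) y + ta * (rho \_ U) y)) x.
      apply: (@partials_ext R _ U _ _ [:: k; l] x oU _ Ux) => y Uy.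
      by rewrite -(pe Phi _ Uy) -(pe rho _ Uy).
    have pr k : partial k (rho \_ U) x = partial k rho x := esym (partial_ext k oU (pe rho) Ux).
    apply/matrixP => r s; rewrite !mxE.
    by case: (unlift ord_max r) => [r'|]; case: (unlift ord0 s) => [s'|] //=; rewrite ?pp ?pr.
(* The modulus is at most the sum of the absolute values of the real and imaginary parts, each
   bounded by [K]. *)
exists (2 * K) => b0 b1 Phi rho a lambda sigma B1 B0 M b00 b01 sPhi srho sa _ supa brho bPhi ba lrho lam0 _ hdet Hs f f2.
have H v := HK _ erefl b0 b1 Phi rho a lambda sigma b00 b01 sPhi srho sa supa brho bPhi ba lrho lam0 hdet Hs f f2 v.
rewrite -sqrt_pow_powR ?normr_gt0// /multilinear_form /Cintegral /Normc.normc.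
apply: le_trans (sqrt_add (sqr_ge0 _) (sqr_ge0 _)) _; rewrite !sqrtr_sqr.
apply: le_trans (lerD (H false) (H true)) _.
by rewrite le_eqVlt; apply/orP; left; apply/eqP; ring.
Qed.
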